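(* Let $n\ge 2$, let $\Omega\subset\mathbb{R}^n$ be open and bounded, $T>0$, $\Omega_T=\Omega\times(0,T)$. Let $2\le p\le q$, $\mu\in[0,1]$, $\alpha,\beta>1$ satisfy $$p\le q<p\,\frac{\alpha}{\alpha+1}\,\frac{\beta-1}{\beta}+\frac{2}{n+2}.$$ Let $a,b:\Omega_T\to[0,\infty)$ be functions with $a^{-1}\in L^\alpha(\Omega_T)$ and $b\in L^\beta(\Omega_T)$, and let $\mathcal{A}:\Omega_T\times\mathbb{R}^n\to\mathbb{R}^n$ be a Carathéodory function such that for almost every $(x,t)\in\Omega_T$ and all $\xi\in\mathbb{R}^n$ $$|\mathcal{A}(x,t,\xi)|\le b(x,t)(\mu^2+|\xi|^2)^{\frac{q-1}{2}},\qquad \langle\mathcal{A}(x,t,\xi),\xi\rangle\ge a(x,t)(\mu^2+|\xi|^2)^{\frac{p-2}{2}}|\xi|^2 .$$ Put $p_\alpha:=\frac{p\alpha}{\alpha+1}$, $q_\beta:=\frac{q\beta}{\beta-1}$ and $m:=\frac{p_\alpha(n+2)}{n}$. Assume that $u\in L^{q_\beta}(0,T;W^{1,q_\beta}(\Omega))$ is a weak subsolution of $$\partial_t u-\operatorname{div}\mathcal{A}(x,t,Du)=0\quad\text{in }\Omega_T .$$ Then for every cylinder $Q:=Q_{2\rho,2\sigma}(z_o)\subset\Omega_T$ with $\operatorname{dist}(Q,\partial_{\mathrm{par}}\Omega_T)>0$ for parameters $\rho,\sigma>0$, we have the following estimate on the smaller cylinder $\tfrac12Q:=Q_{\rho,\sigma}(z_o)$: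 $$\operatorname*{ess\,sup}_{\frac12Q}u\le \mathrm{C}_{a,b}\max\left\{\Big(\frac{\sigma}{\rho^{\frac{p}{p+1-q}}}\Big)^{\vartheta_1}\frac{1}{\rho^{(q-p)\vartheta_2}}\Big(\frac{1}{|Q|}\int_Q u_+^m\,\mathrm{d}z\Big)^{\vartheta_3},\ \Big(\frac{1}{|Q|}\int_Q u_+^m\,\mathrm{d}z\Big)^{\frac1m},\ \Big(\frac{\rho^{\frac{p}{p+1-q}}}{\sigma}\Big)^{\frac{p+1-q}{p-2+2(q-p)}},\ \rho\right\}.$$ Here the constants $\vartheta_1,\vartheta_2,\vartheta_3>0$ depend at most on $n,p,q,\alpha,\beta$, and the constant $\mathrm{C}_{a,b}$ depends additionally on the quantities $\frac{1}{|Q|}\int_Q a^{-\alpha}\,\mathrm{d}x\,\mathrm{d}t$ and $\frac{1}{|Q|}\int_Q b^{\beta}\,\mathrm{d}x\,\mathrm{d}t$.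
   Context: Weak subsolution: a function $u\in L^{q_\beta}(0,T;W^{1,q_\beta}(\Omega))\cap C_w([0,T];L^2(\Omega))$ is a weak subsolution of $\partial_tu-\operatorname{div}\mathcal{A}(x,t,Du)=0$ in $\Omega_T$ if $$\int_{\Omega_T}\big(-u\,\partial_t\varphi+\langle\mathcal{A}(x,t,Du),D\varphi\rangle\big)\,\mathrm{d}x\,\mathrm{d}t\le 0$$ for every nonnegative $\varphi\in C_0^\infty(\Omega_T)$. $C_w([0,T];L^2(\Omega))$ is the space of maps $u\in L^\infty(0,T;L^2(\Omega))$ that are continuous in time with respect to the weak topology of $L^2(\Omega)$. Notation: $Du$ is the spatial gradient; $z=(x,t)$; for $z_o=(x_o,t_o)$, $Q_{\rho,\sigma}(z_o):=B_\rho(x_o)\times(t_o-\sigma,t_o)$, where $B_\rho(x_o)$ is the open ball in $\mathbb{R}^n$; $\partial_{\mathrm{par}}\Omega_T:=(\overline\Omega\times\{0\})\cup(\partial\Omega\times(0,T])$; $\operatorname{dist}$ is the distance between sets in $\mathbb{R}^{n+1}$; $u_+=\max\{u,0\}$; $|Q|$ is the Lebesgue measure of $Q$. *)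

(* Defs.v *)
From HB Require Import structures.
From mathcomp Require Import all_boot all_order all_algebra.
From mathcomp Require Import all_classical all_reals all_analysis.
From mathcomp Require Import measurable_realfun ess_sup_inf.

Set Implicit Arguments.
Unset Strict Implicit.
Unset Printing Implicit Defensive.

Import Order.TTheory GRing.Theory Num.Theory.
Import numFieldNormedType.Exports.

Local Open Scope classical_set_scope.
Local Open Scope ring_scope.

Definition enorm (R : realType) (n : nat) (x : 'rV[R]_n) : R :=
  Num.sqrt (\sum_(i < n) x 0 i ^+ 2).

Definition dotp (R : realType) (n : nat) (x y : 'rV[R]_n) : R :=
  \sum_(i < n) x 0 i * y 0 i.

(* The sigma-algebra on R^n generated by the coordinates, i.e. the Borel
   sigma-algebra. *)
Section measurable_rV.
Context (R : realType) (n : nat).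

Definition rV_coord (i : 'I_n) (v : 'rV[R]_n) : measurableTypeR R := v 0 i.

Let rV_set0 : g_sigma_preimage rV_coord set0.
Proof. exact: sigma_algebra0. Qed.

Let rV_setC A : g_sigma_preimage rV_coord A -> g_sigma_preimage rV_coord (~` A).
Proof. exact: sigma_algebraC. Qed.

Let rV_bigcup (F : _^nat) : (forall i, g_sigma_preimage rV_coord (F i)) ->
  g_sigma_preimage rV_coord (\bigcup_i (F i)).
Proof. exact: sigma_algebra_bigcup. Qed.

HB.instance Definition _ := @isMeasurable.Build default_measure_display
  'rV[R]_n (g_sigma_preimage rV_coord) rV_set0 rV_setC rV_bigcup.

End measurable_rV.

Lemma measurable_rV_coord (R : realType) (n : nat) (i : 'I_n) :
  measurable_fun [set: 'rV[R]_n] (@rV_coord R n i).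
Proof.
move=> _ Y mY; rewrite setTI; apply: sub_sigma_algebra => /=.
rewrite -bigcup_seq/=; exists i => /=; first by rewrite mem_index_enum.
by exists Y => //; rewrite setTI.
Qed.

Lemma measurable_fun_rVP (R : realType) (n : nat) d (T : measurableType d)
    (f : T -> 'rV[R]_n) :
  (forall i, measurable_fun [set: T] (rV_coord i \o f)) ->
  measurable_fun [set: T] f.
Proof.
move=> mf _ A mA; rewrite setTI; move: A mA.
pose F := image_set_system setT f (@measurable _ T).
suff : g_sigma_preimage (@rV_coord R n) `<=` F.
  by move=> + A mA => /(_ _ mA); rewrite /F /image_set_system /= setTI.
apply: smallest_sub; first exact/sigma_algebra_image/sigma_algebra_measurable.
rewrite -bigcup_seq; apply: bigcup_sub => i _ _ [B mB <-].
rewrite /F /image_set_system /= !setTI.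
by have := mf i measurableT B mB; rewrite setTI.
Qed.

Definition rV_cons (R : realType) (n : nat) (w : measurableTypeR R * 'rV[R]_n) :
    'rV[R]_n.+1 :=
  \row_(i < n.+1) (if unlift ord0 i is Some j then w.2 0 j else w.1).

Lemma measurable_rV_cons (R : realType) (n : nat) :
  measurable_fun [set: measurableTypeR R * 'rV[R]_n] (@rV_cons R n).
Proof.
apply: measurable_fun_rVP => i; case: (unliftP ord0 i) => [j|] ->.
- rewrite (_ : _ \o _ = rV_coord j \o snd).
    exact: measurableT_comp (measurable_rV_coord _) measurable_snd.
  by apply/funext => w; rewrite /= /rV_coord mxE liftK.
- rewrite (_ : _ \o _ = fst); first exact: measurable_fst.
  by apply/funext => w; rewrite /= /rV_coord mxE unlift_none.
Qed.

(* The product of one-dimensional Lebesgue measure and m, transported to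
   R^(n+1). *)
Section lebesgue_rV_step.
Context (R : realType) (n : nat)
  (m : {sigma_finite_measure set 'rV[R]_n -> \bar R}).

Definition lebesgue_rV_step : set 'rV[R]_n.+1 -> \bar R :=
  pushforward (lebesgue_measure \x m)%E (@rV_cons R n).

Let step0 : lebesgue_rV_step set0 = 0%E.
Proof. by rewrite /lebesgue_rV_step /pushforward preimage_set0 measure0. Qed.

Let step_ge0 A : (0 <= lebesgue_rV_step A)%E.
Proof. by rewrite /lebesgue_rV_step /pushforward measure_ge0. Qed.

Let step_sigma : semi_sigma_additive lebesgue_rV_step.
Proof.
have mc A : measurable A -> measurable (@rV_cons R n @^-1` A).
  by move=> mA; rewrite -[X in measurable X]setTI; exact: measurable_rV_cons.
move=> F mF tF mUF; rewrite /lebesgue_rV_step /pushforward preimage_bigcup.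
apply: measure_semi_sigma_additive.
- by move=> k; exact: mc.
- apply/trivIsetP => /= i j _ _ ij; rewrite -preimage_setI.
  by move/trivIsetP : tF => /(_ _ _ _ _ ij) ->//; rewrite preimage_set0.
- by rewrite -preimage_bigcup; exact: mc.
Qed.

HB.instance Definition _ := isMeasure.Build _ _ _ lebesgue_rV_step
  step0 step_ge0 step_sigma.

Let uncons (v : 'rV[R]_n.+1) : measurableTypeR R * 'rV[R]_n :=
  (v 0 ord0, \row_j v 0 (lift ord0 j)).

Let consK : cancel (@rV_cons R n) uncons.
Proof.
move=> [x v]; rewrite /uncons /rV_cons; congr pair; first by rewrite mxE unlift_none.
by apply/rowP => j; rewrite !mxE liftK.
Qed.

Let muncons : measurable_fun setT uncons.
Proof.
apply/measurable_fun_pairP; split.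
  exact: (measurable_rV_coord ord0).
apply: measurable_fun_rVP => j.
rewrite (_ : _ \o _ = rV_coord (lift ord0 j)); first exact: measurable_rV_coord.
by apply/funext => v; rewrite /= /rV_coord mxE.
Qed.

Let step_sigma_finite : sigma_finite setT lebesgue_rV_step.
Proof.
have /sigma_finiteP[F [TF ndF Foo]] := sigma_finiteT (@lebesgue_measure R).
have /sigma_finiteP[G [TG ndG Goo]] := sigma_finiteT m.
exists (fun k => uncons @^-1` (F k `*` G k)).
  rewrite -preimage_bigcup (_ : \bigcup_k _ = setT) ?preimage_setT//.
  rewrite -subTset => -[x y] _.
  have : (\bigcup_k F k) x by rewrite -TF.
  have : (\bigcup_k G k) y by rewrite -TG.
  move=> [k _ Gky] [l _ Flx]; exists (maxn k l) => //; split => /=.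
  - by move: x Flx; exact/subsetPset/ndF/leq_maxr.
  - by move: y Gky; exact/subsetPset/ndG/leq_maxl.
move=> k; have [mF Fk] := Foo k; have [mG Gk] := Goo k; split.
  rewrite -[X in measurable X]setTI; apply: muncons => //.
  exact: measurableX.
rewrite /lebesgue_rV_step /pushforward.
rewrite -comp_preimage (_ : uncons \o _ = id); last exact/funext/consK.
rewrite preimage_id.
by rewrite product_measure1E// lte_mul_pinfty// ge0_fin_numE.
Qed.

HB.instance Definition _ := Measure_isSigmaFinite.Build _ _ _ lebesgue_rV_step
  step_sigma_finite.

End lebesgue_rV_step.

Fixpoint lebesgue_rV (R : realType) (n : nat) :
    {sigma_finite_measure set 'rV[R]_n -> \bar R} :=
  match n with
  | 0 => \d_(0 : 'rV[R]_0)
  | k.+1 => lebesgue_rV_step (lebesgue_rV R k)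
  end.

Lemma lebesgue_rV_box (R : realType) (n : nat)
    (A : 'I_n -> set (measurableTypeR R)) : (forall i, measurable (A i)) ->
  (lebesgue_rV R n [set v : 'rV[R]_n | forall i, A i (v 0%R i)] =
   \prod_(i < n) lebesgue_measure (A i))%E.
Proof.
elim: n => [|n IH] in A * => mA.
  by rewrite big_ord0 /= diracE mem_set//= => -[].
rewrite big_ord_recl -IH; last by move=> i; exact: mA.
have mB : measurable [set v : 'rV[R]_n | forall i, A (lift ord0 i) (v 0%R i)].
  rewrite (_ : mkset _ =
      \bigcap_(i in setT) (rV_coord i @^-1` A (lift ord0 i))).
    apply: fin_bigcap_measurable => [|i _]; first exact: finite_finset.
    by rewrite -[X in measurable X]setTI; exact: measurable_rV_coord.
  by apply/seteqP; split => v /= vA i; [move=> _|]; exact: vA.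
rewrite -(product_measure1E _ _ (mA ord0) mB) /= /lebesgue_rV_step /pushforward.
congr (product_measure1 _ _ _); apply/seteqP; split => -[x v] /=.
- move=> h; split; first by have := h ord0; rewrite mxE unlift_none.
  by move=> i; have := h (lift ord0 i); rewrite mxE liftK.
- move=> [Ax Av] i; case: (unliftP ord0 i) => [j|] ->.
    by rewrite mxE liftK; exact: Av.
  by rewrite mxE unlift_none.
Qed.

(* Space-time R^n x R; points are z = (x, t). *)
Notation spacetime R n := ('rV[R]_n * measurableTypeR R)%type.

Definition lebesgue_st (R : realType) (n : nat) :
    {measure set (spacetime R n) -> \bar R} :=
  (lebesgue_rV R n \x lebesgue_measure)%E.

(* Measurability for the completion of mu: with mu = Lebesgue measure on the
   Borel sets this is Lebesgue measurability. *)
Definition ae_measurable d d' (X : measurableType d) (Y : measurableType d')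
    (R : realType) (mu : {measure set X -> \bar R}) (D : set X) (f : X -> Y) :=
  exists g : X -> Y, measurable_fun D g /\
    {ae mu, forall x, D x -> f x = g x}.

(* f belongs to L^r(D), r in [1, +oo]; f may take infinite values. *)
Definition in_Lp d (X : measurableType d) (R : realType)
    (mu : {measure set X -> \bar R}) (D : set X) (r : \bar R)
    (f : X -> \bar R) :=
  ae_measurable mu D f /\ (Lnorm mu r (f \_ D) < +oo)%E.

Section test_functions.
Context (R : realType) (V : normedModType R).

Fixpoint Ck (k : nat) (f : V -> R) : Prop :=
  match k with
  | 0 => continuous f
  | j.+1 => continuous f /\
      forall v, (forall x, derivable f x v) /\ Ck j (fun x => 'D_v f x)
  end.

(* C_0^oo(D). *)
Definition test_fun (D : set V) (phi : V -> R) :=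
  (forall k, Ck k phi) /\
  compact (closure [set x | phi x != 0]) /\
  closure [set x | phi x != 0] `<=` D.

End test_functions.

(* L^r(0,T;X), where the Banach space X is given by the representatives in V
   that satisfy the predicate X, with norm N; elements at distance 0 are
   identified. *)
Section bochner.
Context (R : realType) (V : zmodType) (X : set V) (N : V -> \bar R).

Definition simple_map (s : R -> V) :=
  finite_set (range s) /\
  (forall v, measurable (s @^-1` [set v] : set (measurableTypeR R))) /\
  (forall t, X (s t)).

Definition strongly_measurable (T : R) (U : R -> V) :=
  exists s : nat -> R -> V, (forall k, simple_map (s k)) /\
    {ae (@lebesgue_measure R), forall t, t \in `]0, T[ ->
      N (U t - s k t) @[k --> \oo] --> 0%E}.

Definition bochner (T : R) (r : \bar R) (U : R -> V) :=
  strongly_measurable T U /\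
  {ae (@lebesgue_measure R), forall t, t \in `]0, T[ -> X (U t)} /\
  (Lnorm (@lebesgue_measure R) r
     ((fun t => N (U t)) \_ (`]0%R, T[ : set R)) < +oo)%E.

End bochner.

Section function_spaces.
Context (R : realType) (n : nat).
Implicit Types (Om : set 'rV[R]_n) (v : 'rV[R]_n -> R).

Definition L2norm Om v : \bar R :=
  Lnorm (lebesgue_rV R n) 2%:E ((EFin \o v) \_ Om).

Definition L2 Om : set ('rV[R]_n -> R) :=
  [set v | in_Lp (lebesgue_rV R n) Om 2%:E (EFin \o v)].

Definition weak_gradient Om v (g : 'rV[R]_n -> 'rV[R]_n) :=
  forall phi : 'rV[R]_n -> R, test_fun Om phi -> forall i : 'I_n,
    (\int[lebesgue_rV R n]_(x in Om) (v x * 'D_(delta_mx 0 i) phi x)%:E =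
     - \int[lebesgue_rV R n]_(x in Om) (g x 0 i * phi x)%:E)%E.

(* An element of W^{1,r} is carried together with its weak gradient. *)
Definition W1 Om (r : R) (w : ('rV[R]_n -> R) * ('rV[R]_n -> 'rV[R]_n)) :=
  in_Lp (lebesgue_rV R n) Om r%:E (EFin \o w.1) /\
  (forall i, in_Lp (lebesgue_rV R n) Om r%:E (fun x => (w.2 x 0 i)%:E)) /\
  weak_gradient Om w.1 w.2.

Definition W1norm Om (r : R)
    (w : ('rV[R]_n -> R) * ('rV[R]_n -> 'rV[R]_n)) : \bar R :=
  (Lnorm (lebesgue_rV R n) r%:E ((EFin \o w.1) \_ Om) +
   Lnorm (lebesgue_rV R n) r%:E ((fun x => (enorm (w.2 x))%:E) \_ Om))%E.

Definition cylT Om (T : R) : set (spacetime R n) :=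
  Om `*` (`]0, T[ : set R).

(* u is in L^r(0,T;W^{1,r}(Om)), with spatial gradient Du. A map with values
   in W^{1,r} is represented by functions of (x, t); the joint measurability
   says that these are representatives for which integrals over Om x (0,T)
   make sense. *)
Definition parabolic_W1 Om (T r : R) (u : spacetime R n -> R)
    (Du : spacetime R n -> 'rV[R]_n) :=
  ae_measurable (lebesgue_st R n) (cylT Om T) u /\
  ae_measurable (lebesgue_st R n) (cylT Om T) Du /\
  bochner (W1 Om r) (W1norm Om r) T r%:E
    (fun t => (fun x => u (x, t), fun x => Du (x, t))).

(* u is in C_w([0,T];L^2(Om)). *)
Definition Cw_L2 Om (T : R) (u : spacetime R n -> R) :=
  bochner (L2 Om) (L2norm Om) T +oo%E (fun t x => u (x, t)) /\
  (forall t, t \in `[0, T] -> L2 Om (fun x => u (x, t))) /\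
  (forall v, L2 Om v ->
    {within `[0, T], continuous (fun t : R =>
       \int[lebesgue_rV R n]_(x in Om) (u (x, t) * v x))%R}).

End function_spaces.

Section parabolic.
Context (R : realType) (n : nat).
Implicit Types (Om : set 'rV[R]_n) (A : spacetime R n -> 'rV[R]_n -> 'rV[R]_n).

Definition dt (phi : 'rV[R]_n * R -> R) (z : 'rV[R]_n * R) : R :=
  'D_((0 : 'rV[R]_n, 1 : R)) phi z.

Definition dx (phi : 'rV[R]_n * R -> R) (z : 'rV[R]_n * R) : 'rV[R]_n :=
  \row_(i < n) 'D_((delta_mx 0 i : 'rV[R]_n, 0 : R)) phi z.

Definition caratheodory Om (T : R) A :=
  (forall xi, ae_measurable (lebesgue_st R n) (cylT Om T) (A ^~ xi)) /\
  {ae (lebesgue_st R n), forall z, cylT Om T z -> continuous (A z)}.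

(* Weak subsolution of u_t - div A(x,t,Du) = 0, r = q_beta. *)
Definition weak_subsolution Om (T r : R) A (u : spacetime R n -> R) :=
  exists Du : spacetime R n -> 'rV[R]_n,
    parabolic_W1 Om T r u Du /\ Cw_L2 Om T u /\
    forall phi : 'rV[R]_n * R -> R,
      test_fun (cylT Om T) phi -> (forall z, 0 <= phi z) ->
      (\int[lebesgue_st R n]_(z in cylT Om T)
         (- (u z * dt phi z) + dotp (A z (Du z)) (dx phi z))%:E <= 0)%E.

Definition cylinder (z0 : spacetime R n) (rho sigma : R) :
    set (spacetime R n) :=
  [set z | enorm (z.1 - z0.1) < rho /\ z0.2 - sigma < z.2 < z0.2].

Definition par_boundary Om (T : R) : set (spacetime R n) :=
  (closure Om `*` [set 0]) `|`
  ((closure Om `\` interior Om) `*` (`]0, T] : set R)).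

(* Euclidean distance of R^(n+1) between sets. *)
Definition st_dist (D E : set (spacetime R n)) : \bar R :=
  ereal_inf [set d | exists z w, D z /\ E w /\
    d = (Num.sqrt (enorm (z.1 - w.1) ^+ 2 + (z.2 - w.2) ^+ 2))%:E].

Definition mean (D : set (spacetime R n)) (f : spacetime R n -> \bar R) :
    \bar R :=
  ((\int[lebesgue_st R n]_(z in D) f z) / lebesgue_st R n D)%E.

Definition ess_sup_on (D : set (spacetime R n)) (f : spacetime R n -> R) :
    \bar R :=
  ess_sup (lebesgue_st R n) (fun z => if z \in D then (f z)%:E else -oo%E).

End parabolic.

(* x^(c/d) for x > 0, c > 0, d >= 0, where c/0 = +oo and x^(+oo) is
   the limit of x^s as s tends to +oo. *)
Definition pow_quot (R : realType) (x c d : R) : \bar R :=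
  if d == 0 then if x < 1 then 0%E else if x == 1 then 1%E else +oo%E
  else (x `^ (c / d))%:E.

(* Main.v *)
(* De Giorgi iteration with unbounded, degenerate coefficients. Mollifying in
   space-time turns the subsolution inequality and the weak gradient into
   pointwise relations, valid away from the boundary for small radii. Testing
   them with g(u) eta, where g is a convex C^1 truncation at a level k, and
   letting the radius tend to 0 bounds both the supremum over t of the L^2 mass
   of (u - k)_+ eta and the integral of <A, Du> eta. The term <A, D eta> is
   controlled by |A| <= b (1 + (a^-1 <A, Du>)^((q-1)/p)): Young's inequality
   absorbs <A, Du>, and Hoelder's inequality separates a^-1 in L^alpha, b in
   L^beta and a power of the excess. On the other side a^-1 in L^alpha bounds
   Du in L^(p_alpha), and the parabolic Sobolev inequality then bounds the
   excess in L^m. The condition on q - p makes the resulting recursion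
   superlinear, so the excess over the levels K (1 - 2^-j) on shrinking
   cylinders decays geometrically once K exceeds the right-hand side of the
   estimate. *)
From HB Require Import structures.
Require Import Defs.
From mathcomp Require Import all_boot all_order all_algebra.
From mathcomp Require Import all_classical all_reals all_analysis.
From mathcomp Require Import measurable_realfun ess_sup_inf.
From mathcomp Require Import lra.
Import Order.TTheory GRing.Theory Num.Theory.
Import numFieldNormedType.Exports.
Local Open Scope classical_set_scope.
Local Open Scope ring_scope.

Set Implicit Arguments.
Unset Strict Implicit.
Unset Printing Implicit Defensive.

(** The function [g (u) * eta] is not an admissible test function and [u] has no time derivative;
    mollifying first makes all product rules classical and leaves only limits to justify. The
    integrands are controlled by [|u|^s + |Du|^s + |A|^s'] with [s = q_beta] and [s'] its conjugate;
    by Jensen the mollified integrands are controlled by the mollification of that sum, which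
    converges in L^1, so Pratt's theorem applies. Each term of the maximum answers one demand on the
    final level [K]. [K >= rho] gives [K / rho >= 1], so lower powers of this ratio are absorbed in
    [(K / rho)^lam] with [lam = p / (p + 1 - q)]. The term in [tau / sigma] gives
    [K^2 / sigma <= (K / rho)^lam]: the time derivative of the cutoff costs no more than its
    gradient. [M^(1/m) <= K] allows a first normalised excess of at most 1, so the smallest exponent
    of the excess governs all terms. The first term makes this excess small enough for the decay to
    start; [theta1], [theta2], [theta3] come from solving that smallness condition for [K]. *)

Lemma invf_itv01 (R : realFieldType) (x : R) : 1 < x -> 0 < x^-1 < 1.
Proof. by move=> x1; rewrite invr_gt0 invf_lt1 ?x1 (lt_trans ltr01). Qed.

Lemma le_poweR (R : realType) (r : R) (x y : \bar R) : (0 <= r)%R ->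
  (0 <= x -> x <= y -> x `^ r <= y `^ r)%E.
Proof.
move=> r0 x0 xy; apply: gt0_ler_poweR => //; rewrite in_itv/= leey andbT//.
exact: le_trans xy.
Qed.

(** * Monotonicity of integrals and Hoelder's inequality with values in [[0, +oo]] *)

Section measure_prelim.
Context d (T : measurableType d) (R : realType) (mu : {measure set T -> \bar R}).
Local Open Scope ereal_scope.
Import HBNNSimple.

(** No measurability is assumed: the integral of a nonnegative function is the supremum over the
    simple functions below it, and each of these can be set to 0 on the exceptional null set without
    changing its integral. Integrands that merely equal measurable ones almost everywhere are
    handled this way. *)
Lemma ae_le_integral (D : set T) (f g : T -> \bar R) :
  (forall x, D x -> 0 <= f x) -> (forall x, D x -> 0 <= g x) ->
  {ae mu, forall x, D x -> f x <= g x} ->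
  \int[mu]_(x in D) f x <= \int[mu]_(x in D) g x.
Proof.
move=> f0 g0 [N [mN N0 fgN]]; rewrite !ge0_integralE//.
apply: ge_ereal_sup => _ [h /= hf] <-.
have mNC : measurable (~` N) by exact: measurableC.
pose h' : {nnsfun T >-> R} := mul_nnsfun h (indic_nnsfun R mNC).
have -> : sintegral mu h = sintegral mu h'.
  rewrite -!integralT_nnsfun; apply: ge0_ae_eq_integral => //=.
  - by apply/measurable_EFinP.
  - by apply/measurable_EFinP; apply: measurable_funM.
  - by move=> x _; rewrite lee_fin.
  - by move=> x _; rewrite lee_fin mulr_ge0.
  - exists N; split => // x /= hx; apply: contrapT => Nx; apply: hx => _.
    by rewrite /= mindicE mem_set//= mulr1.
apply: ereal_sup_ubound; exists h' => //= x.
have [Nx|Nx] := pselect (N x).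
  rewrite /= mindicE (memNset (_ : ~ (~` N) x))/= ?mulr0//.
  by rewrite /patch; case: ifPn => // /set_mem; exact: g0.
rewrite /= mindicE mem_set//= mulr1; apply: (le_trans (hf x)).
rewrite /patch; case: ifPn => // /set_mem Dx.
by apply: contrapT => h0; apply: Nx; apply: fgN => /= /(_ Dx).
Qed.

Lemma ae_eq_integral_nm (D : set T) (f g : T -> \bar R) :
  {ae mu, forall x, D x -> f x = g x} ->
  \int[mu]_(x in D) f x = \int[mu]_(x in D) g x.
Proof.
move=> fg; rewrite integralE [RHS]integralE; congr (_ - _);
  apply/eqP; rewrite eq_le; apply/andP; split; apply: ae_le_integral => //;
  by apply: filterS fg => x fgx Dx; rewrite /= ?funeposE ?funenegE fgx.
Qed.

(** The real-valued inequality applies when both integrals are finite. Otherwise either one integral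
    vanishes, and with it the product almost everywhere, or both are positive, one is infinite, and
    so is the right-hand side. *)
Lemma hoelder_pow (F G : T -> \bar R) (t : R) : (0 < t < 1)%R ->
  measurable_fun setT F -> measurable_fun setT G ->
  (forall x, 0 <= F x) -> (forall x, 0 <= G x) ->
  \int[mu]_x (F x `^ t * G x `^ (1 - t)) <=
    (\int[mu]_x F x) `^ t * (\int[mu]_x G x) `^ (1 - t).
Proof.
move=> /andP[t0 t1] mF mG F0 G0.
have t1' : (0 < 1 - t)%R by lra.
have zero (H K : T -> \bar R) (s : R) : (0 < s)%R -> measurable_fun setT H ->
    (forall x, 0 <= H x) -> \int[mu]_x H x = 0 ->
    {ae mu, forall x, setT x -> H x `^ s * K x = 0}.
  move=> s0 mH H0 iH.
  have /ae_eq_integral_abs : \int[mu]_x `|H x| = 0.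
    by rewrite -iH; apply: eq_integral => x _; rewrite gee0_abs.
  move=> /(_ measurableT mH); apply: filterS => x /(_ I) -> _.
  by rewrite /cst poweR0r ?mul0e// gt_eqF.
have [iF|iF] := eqVneq (\int[mu]_x F x) 0.
  rewrite (ae_eq_integral_nm (zero F _ t t0 mF F0 iF)) integral0.
  by rewrite mule_ge0// poweR_ge0.
have [iG|iG] := eqVneq (\int[mu]_x G x) 0.
  under eq_integral do rewrite muleC.
  rewrite (ae_eq_integral_nm (zero G _ _ t1' mG G0 iG)) integral0.
  by rewrite mule_ge0// poweR_ge0.
have pF : 0 < \int[mu]_x F x by rewrite lt0e iF integral_ge0.
have pG : 0 < \int[mu]_x G x by rewrite lt0e iG integral_ge0.
have [iFy|iFy] := eqVneq (\int[mu]_x F x) +oo.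
  by rewrite iFy poweRyr ?gt_eqF// gt0_mulye ?leey// poweR_gt0.
have [iGy|iGy] := eqVneq (\int[mu]_x G x) +oo.
  by rewrite iGy poweRyr ?gt_eqF// gt0_muley ?leey// poweR_gt0.
have intF : mu.-integrable setT F.
  apply/integrableP; split => //; under eq_integral do rewrite gee0_abs//.
  by rewrite ltey.
have intG : mu.-integrable setT G.
  apply/integrableP; split => //; under eq_integral do rewrite gee0_abs//.
  by rewrite ltey.
pose f x := (fine (F x) `^ t)%R; pose g x := (fine (G x) `^ (1 - t))%R.
have mf : measurable_fun setT f.
  apply: (measurableT_comp (measurable_powR t)).
  exact: measurableT_comp.
have mg : measurable_fun setT g.
  apply: (measurableT_comp (measurable_powR _)).
  exact: measurableT_comp.
have := @hoelder _ _ _ mu f g t^-1 (1 - t)^-1 mf mg.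
rewrite !invr_gt0 !invrK => /(_ t0 t1'); rewrite addrC subrK => /(_ erefl).
rewrite Lnorm1 unlock /= !invrK => H.
have -> : \int[mu]_x (F x `^ t * G x `^ (1 - t)) = \int[mu]_x `|((f \* g)%R x)%:E|.
  apply: ae_eq_integral_nm.
  have := integrable_ae measurableT intF; have := integrable_ae measurableT intG.
  apply: filterS2 => x /(_ I) gx /(_ I) fx _.
  rewrite gee0_abs ?lee_fin ?mulr_ge0 ?powR_ge0// EFinM -!poweR_EFin.
  by rewrite !fineK.
have iE (K : T -> \bar R) (s : R) : (0 < s)%R -> (forall x, 0 <= K x) ->
    mu.-integrable setT K ->
    \int[mu]_x (`|fine (K x) `^ s|%R `^ s^-1)%:E <= \int[mu]_x K x.
  move=> s0 K0 iK; apply: ae_le_integral => //.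
  have := integrable_ae measurableT iK.
  apply: filterS => x /(_ I) fx _; rewrite /= ger0_norm ?powR_ge0//.
  by rewrite -powRrM mulfV ?gt_eqF// powRr1 ?fine_ge0// fineK.
apply: (le_trans H); apply: lee_pmul; rewrite ?poweR_ge0//.
- apply: le_poweR; [exact: ltW| |exact: iE].
  by apply: integral_ge0 => x _; rewrite lee_fin powR_ge0.
- apply: le_poweR; [exact: ltW| |exact: iE].
  by apply: integral_ge0 => x _; rewrite lee_fin powR_ge0.
Qed.

End measure_prelim.

(** * Integration on space-time *)

Section translation.
Context (R : realType).
Local Notation mu1 := (@lebesgue_measure R).

Local Notation V n := (spacetime R n).

Lemma measurable_integral2 d1 d2 (T1 : measurableType d1) (T2 : measurableType d2)
  (m2 : {sigma_finite_measure set T2 -> \bar R}) (f : T1 * T2 -> \bar R) :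
  measurable_fun setT f -> (forall x, 0 <= f x)%E ->
  measurable_fun setT (fun x => \int[m2]_y f (x, y))%E.
Proof. by move=> mf f0; exact: measurable_fun_fubini_tonelli_F. Qed.

Lemma measurable_integral1 d1 d2 (T1 : measurableType d1) (T2 : measurableType d2)
  (m1 : {sigma_finite_measure set T1 -> \bar R}) (f : T1 * T2 -> \bar R) :
  measurable_fun setT f -> (forall x, 0 <= f x)%E ->
  measurable_fun setT (fun y => \int[m1]_x f (x, y))%E.
Proof. by move=> mf f0; exact: measurable_fun_fubini_tonelli_G. Qed.

Lemma measurable_fun_rV_shift n (a : 'rV[R]_n) :
  measurable_fun [set: 'rV[R]_n] (fun v => v + a).
Proof.
apply: measurable_fun_rVP => i.
rewrite (_ : _ \o _ = fun v => rV_coord i v + a 0 i).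
  by apply: measurable_funD => //; exact: measurable_rV_coord.
by apply/funext => v; rewrite /= /rV_coord mxE.
Qed.

(** The image of Lebesgue measure under the shift has the right value on half-open intervals, and
    these values determine the measure. *)
Lemma ge0_integral_shift (a : R) (f : R -> \bar R) : measurable_fun setT f ->
  (forall x, 0 <= f x)%E -> (\int[mu1]_x f (x + a)%R = \int[mu1]_x f x)%E.
Proof.
move=> mf f0; pose g (x : measurableTypeR R) : measurableTypeR R := (x : R) + a.
have mg : measurable_fun setT g by exact: measurable_funD.
pose h : {mfun measurableTypeR R >-> measurableTypeR R} :=
  HB.pack g (isMeasurableFun.Build _ _ _ _ _ mg).
rewrite -[LHS](@ge0_integral_pushforward _ _ _ _ _ g mg mu1 setT f)//.
apply: eq_measure_integral => A mA _; apply/esym.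
apply: (@lebesgue_measure_unique R (pushforward mu1 h)) => //.
move=> _ [[b c]] _ <-.
transitivity (mu1 `]b - a, c - a]%classic).
  rewrite /= !lebesgue_measure_itv/= !lte_fin ltrD2r; case: ifPn => // _.
  by rewrite -!EFinB; congr (_%:E); lra.
rewrite /pushforward; congr (mu1 _).
by apply/seteqP; split => x /=; rewrite !in_itv/= /g => /andP[? ?]; apply/andP; split; lra.
Qed.

Lemma ge0_integral_rVS n (f : 'rV[R]_n.+1 -> \bar R) : measurable_fun setT f ->
  (forall x, 0 <= f x)%E ->
  (\int[lebesgue_rV R n.+1]_x f x =
   \int[mu1]_s \int[lebesgue_rV R n]_y f (rV_cons (s, y)))%E.
Proof.
move=> mf f0.
rewrite [LHS](@ge0_integral_pushforward _ _ _ _ _ _ (@measurable_rV_cons R n) (mu1 \x lebesgue_rV R n)%E setT f)//.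
rewrite preimage_setT fubini_tonelli1//.
  exact: (measurableT_comp mf (@measurable_rV_cons R n)).
by move=> x; exact: f0.
Qed.

Lemma rV_consD n (s a : R) (y b : 'rV[R]_n) :
  rV_cons (s, y) + rV_cons (a, b) = rV_cons (s + a, y + b).
Proof. by apply/rowP => i; rewrite !mxE/=; case: unlift => [j|//]; rewrite mxE. Qed.

Lemma rV_cons_surj n (v : 'rV[R]_n.+1) :
  exists s y, v = rV_cons (s, y).
Proof.
exists (v 0 ord0), (\row_j v 0 (lift ord0 j)).
by apply/rowP => i; rewrite mxE; case: unliftP => [j|] -> //=; rewrite mxE.
Qed.

Lemma measurable_rV_cons_r n (s : R) :
  measurable_fun [set: 'rV[R]_n] (fun y => rV_cons (s : measurableTypeR R, y)).
Proof. exact: (measurableT_comp (@measurable_rV_cons R n) (measurable_pair1 _)). Qed.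

Lemma ge0_integral_rV_shift n (a : 'rV[R]_n) (f : 'rV[R]_n -> \bar R) :
  measurable_fun setT f -> (forall x, 0 <= f x)%E ->
  (\int[lebesgue_rV R n]_x f (x + a)%R = \int[lebesgue_rV R n]_x f x)%E.
Proof.
elim: n => [|n IH] in a f *; move=> mf f0.
  by apply: eq_integral => x _; congr f; apply/rowP => -[].
have [s [y ->]] := rV_cons_surj a.
have mfs : measurable_fun [set: 'rV[R]_n.+1] (fun x => f (x + rV_cons (s, y))).
  exact: (measurableT_comp mf (measurable_fun_rV_shift _)).
apply: (etrans (ge0_integral_rVS mfs (fun=> f0 _))).
apply: (etrans _ (esym (ge0_integral_rVS mf f0))).
rewrite -[RHS](@ge0_integral_shift s); last first.
- by move=> x; exact: integral_ge0.
- exact: (measurable_integral2 (lebesgue_rV R n) (measurableT_comp mf (@measurable_rV_cons R n)) (fun x => f0 _)).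
apply: eq_integral => t _; under eq_integral do rewrite rV_consD.
rewrite (IH y (fun v => f (rV_cons (t + s, v))))//.
exact: (measurableT_comp mf (measurable_rV_cons_r _)).
Qed.

Lemma ge0_integral_st n (f : V n -> \bar R) : measurable_fun setT f ->
  (forall x, 0 <= f x)%E ->
  (\int[lebesgue_st R n]_z f z =
    \int[lebesgue_rV R n]_x \int[mu1]_t f (x, t))%E.
Proof. by move=> mf f0; rewrite fubini_tonelli1. Qed.

Lemma ge0_integral_st_sym n (f : V n -> \bar R) : measurable_fun setT f ->
  (forall x, 0 <= f x)%E ->
  (\int[lebesgue_st R n]_z f z =
    \int[mu1]_t \int[lebesgue_rV R n]_x f (x, t))%E.
Proof. by move=> mf f0; rewrite fubini_tonelli2. Qed.

Lemma measurable_st_shift n (w : V n) : measurable_fun setT (fun z : V n => z + w).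
Proof.
apply/measurable_fun_pairP; split.
  exact: (measurableT_comp (measurable_fun_rV_shift w.1) measurable_fst).
by apply: measurable_funD => //; exact: measurable_snd.
Qed.

Lemma ge0_integral_st_shift n (w : V n) (f : V n -> \bar R) :
  measurable_fun setT f -> (forall x, 0 <= f x)%E ->
  (\int[lebesgue_st R n]_z f (z + w)%R = \int[lebesgue_st R n]_z f z)%E.
Proof.
move=> mf f0; have mfs := measurableT_comp mf (measurable_st_shift w).
apply: (etrans (ge0_integral_st mfs (fun=> f0 _))).
apply: (etrans _ (esym (ge0_integral_st mf f0))).
rewrite -[RHS](@ge0_integral_rV_shift n w.1); last first.
- by move=> x; exact: integral_ge0.
- exact: (measurable_integral2 mu1 mf).
apply: eq_integral => x _.
rewrite -[RHS](@ge0_integral_shift w.2)//.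
exact: (measurableT_comp mf (measurable_pair1 _)).
Qed.

End translation.
Lemma indic1 (T : Type) (R : pzRingType) (A : set T) z : A z -> \1_A z = 1 :> R.
Proof. by move=> Az; rewrite indicE mem_set. Qed.

Lemma indic0 (T : Type) (R : pzRingType) (A : set T) z : ~ A z -> \1_A z = 0 :> R.
Proof. by move=> Az; rewrite indicE memNset. Qed.

Lemma cvge_exists_gt (R : realType) (u : nat -> \bar R) (l c : \bar R) :
  u k @[k --> \oo] --> l -> (c < l)%E -> exists k, (c < u k)%E.
Proof.
move=> ul cl; apply: contrapT => /forallNP h.
suff : (l <= c)%E by rewrite leNgt cl.
apply: (@cvge_to_le _ _ _ _ u _ _ ul).
by apply: nearW => k; rewrite leNgt; apply/negP; exact: h.
Qed.

Lemma cvge_exists_lt (R : realType) (u : nat -> \bar R) (l c : \bar R) :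
  u k @[k --> \oo] --> l -> (l < c)%E -> exists k, (u k < c)%E.
Proof.
move=> ul cl; apply: contrapT => /forallNP h.
suff : (c <= l)%E by rewrite leNgt cl.
apply: (@cvge_to_ge _ _ _ _ u _ _ ul).
by apply: nearW => k; rewrite leNgt; apply/negP; exact: h.
Qed.

(** * Continuity of translations in L^1 *)

Section shift_continuity.
Context d (T : measurableType d) (R : realType) (mu : {measure set T -> \bar R})
  (W : Type) (sh : W -> T -> T) (N : R -> W -> Prop).
Local Open Scope ereal_scope.

(** The shifts [sh w] and their size [N e w] are abstract, so that a product of two such spaces is
    again an instance and space-time is reached one coordinate at a time. *)
Definition shift_cont (f : T -> R) := forall de : R, (0 < de)%R ->
  exists2 ep : R, (0 < ep)%R & forall w, N ep w ->
    \int[mu]_z (`|f (sh w z) - f z|%R)%:E <= de%:E.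

(** Continuity is asked only for indicators of sets of finite measure; simple functions and limits
    in L^1 extend it to every integrable function, in [shift_cont_integrable]. *)
Record shift_space : Prop := ShiftSpace {
  shift_meas : forall w, measurable_fun setT (sh w) ;
  shift_int : forall w (f : T -> \bar R), measurable_fun setT f ->
    (forall z, 0 <= f z) -> \int[mu]_z f (sh w z) = \int[mu]_z f z ;
  shift_mono : forall e e' w, (e <= e')%R -> N e w -> N e' w ;
  shift_set : forall A, measurable A -> mu A < +oo -> shift_cont \1_A }.

Hypothesis msh : forall w, measurable_fun setT (sh w).
Hypothesis ish : forall w (f : T -> \bar R), measurable_fun setT f ->
    (forall z, 0 <= f z) -> \int[mu]_z f (sh w z) = \int[mu]_z f z.
Hypothesis mono : forall e e' w, (e <= e')%R -> N e w -> N e' w.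

Lemma measurable_shift_diff (f : T -> R) w : measurable_fun setT f ->
  measurable_fun setT (fun z => (`|f (sh w z) - f z|%R)%:E).
Proof.
move=> mf; apply/measurable_EFinP; apply: measurableT_comp => //.
by apply: measurable_funB => //; exact: measurableT_comp.
Qed.

Lemma shift_contD (f g : T -> R) : measurable_fun setT f ->
  measurable_fun setT g -> shift_cont f -> shift_cont g ->
  shift_cont (fun z => f z + g z)%R.
Proof.
move=> mf mg cf cg de de0; have de2 : (0 < de / 2)%R by rewrite divr_gt0.
have [e1 e10 h1] := cf _ de2; have [e2 e20 h2] := cg _ de2.
exists (Num.min e1 e2); first by rewrite lt_min e10.
move=> w Nw.
have N1 : N e1 w by apply: mono Nw; rewrite ge_min lexx.
have N2 : N e2 w by apply: mono Nw; rewrite ge_min lexx orbT.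
rewrite [in leRHS](splitr de) EFinD.
apply: (le_trans _ (leeD (h1 _ N1) (h2 _ N2))).
rewrite -ge0_integralD//; [|exact: measurable_shift_diff..].
apply: ae_le_integral => //= [x _|]; first by rewrite adde_ge0.
apply: aeW => z _; rewrite -EFinD lee_fin.
by rewrite (le_trans _ (ler_normD _ _))// addrACA opprD lexx.
Qed.

Lemma shift_contZ (k : R) (f : T -> R) : measurable_fun setT f ->
  shift_cont f -> shift_cont (fun z => k * f z)%R.
Proof.
move=> mf cf de de0.
have k1 : (0 < `|k| + 1)%R by rewrite ltr_wpDl.
have [e e0 he] := cf (de / (`|k| + 1))%R (divr_gt0 de0 k1); exists e => // w Nw.
under eq_integral do rewrite -mulrBr normrM EFinM.
rewrite ge0_integralZl//; last first.
  exact: measurable_shift_diff.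
apply: (le_trans (lee_pmul _ _ (_ : _ <= (`|k| + 1)%:E) (he _ Nw))) => //.
- by apply: integral_ge0 => *; rewrite lee_fin.
- by rewrite lee_fin lerDl.
- by rewrite -EFinM mulrC mulrVK// unitfE gt_eqF.
Qed.

(** A three-epsilon argument: by invariance the shifted error [f - g k] has the same integral as the
    unshifted one. *)
Lemma shift_cont_lim (f : T -> R) (g : nat -> T -> R) : measurable_fun setT f ->
  (forall k, measurable_fun setT (g k)) -> (forall k, shift_cont (g k)) ->
  (forall de : R, (0 < de)%R -> exists k,
    \int[mu]_z (`|f z - g k z|%R)%:E <= de%:E) -> shift_cont f.
Proof.
move=> mf mg cg fg de de0.
have de3 : (0 < de / 3)%R by rewrite divr_gt0.
have [k hk] := fg _ de3; have [e e0 he] := cg k _ de3; exists e => // w Nw.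
have m1 : measurable_fun setT (fun z => (`|f z - g k z|%R)%:E).
  by apply/measurable_EFinP; apply: measurableT_comp => //; exact: measurable_funB.
have m1' := measurableT_comp m1 (msh w).
have -> : (de = de / 3 + de / 3 + de / 3)%R by lra.
rewrite !EFinD.
have hk' : \int[mu]_z (`|f (sh w z) - g k (sh w z)|%R)%:E <= (de / 3)%:E.
  by rewrite (ish w m1).
apply: (le_trans _ (leeD (leeD hk hk') (he _ Nw))).
rewrite -ge0_integralD// -?ge0_integralD//.
- apply: ae_le_integral => //= [x _|]; first by rewrite !adde_ge0.
  apply: aeW => z _; rewrite -!EFinD lee_fin.
  rewrite -(distrC _ (f z)) -addrA addrC -addrA.
  rewrite (_ : f (sh w z) - f z = (f (sh w z) - g k (sh w z)) +
    ((g k (sh w z) - g k z) + (g k z - f z)))%R; last by lra.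
  by rewrite (le_trans (ler_normD _ _))// lerD2l ler_normD.
- by move=> z _; rewrite adde_ge0.
- exact: emeasurable_funD.
- exact: measurable_shift_diff.
Qed.

Lemma shift_cont_bigcup (F : nat -> set T) : (forall k, measurable (F k)) ->
  nondecreasing_seq F -> mu (\bigcup_k F k) < +oo ->
  (forall k, shift_cont \1_(F k)) -> shift_cont \1_(\bigcup_k F k).
Proof.
move=> mF ndF Foo cF.
have mU : measurable (\bigcup_k F k) by exact: bigcup_measurable.
apply: (@shift_cont_lim _ (fun k => \1_(F k))) => //.
move=> de de0.
have Fk : mu (F k) @[k --> \oo] --> mu (\bigcup_k F k).
  exact: nondecreasing_cvg_mu.
have fU : mu (\bigcup_k F k) \is a fin_num by rewrite ge0_fin_numE.
have lt : mu (\bigcup_k F k) - de%:E < mu (\bigcup_k F k).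
  by rewrite lteBlDr// lteDl// lte_fin.
have [k hk] := cvge_exists_gt Fk lt.
exists k.
have FkU : F k `<=` \bigcup_k F k by move=> x Fx; exists k.
have -> : \int[mu]_z (`|\1_(\bigcup_k F k) z - \1_(F k) z|%R)%:E =
    \int[mu]_z (\1_((\bigcup_k F k) `\` F k) z)%:E.
  apply: eq_integral => z _; congr (_%:E).
  have [zF|zF] := pselect (F k z).
    by rewrite (indic1 _ zF) (indic1 _ (FkU _ zF)) indic0 ?subrr ?normr0// => -[].
  rewrite (indic0 _ zF) subr0 ger0_norm//.
  have [zU|zU] := pselect ((\bigcup_k F k) z); first by rewrite !indic1.
  by rewrite !indic0// => -[].
rewrite integral_indic ?setIT//; last exact: measurableD.
rewrite measureD// setIidr//.
rewrite leeBlDl; last first.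
  rewrite ge0_fin_numE//; apply: le_lt_trans Foo; apply: le_measure; rewrite ?inE//.
by rewrite -leeBlDr// ltW.
Qed.

(** For fixed [k] the sets whose trace on [K k] is continuous under shifts form a lambda-system; it
    contains the generating family, hence every measurable set. The traces on the increasing [K k]
    then exhaust a set of finite measure. *)
Lemma shift_cont_generate (G : set (set T)) (K : nat -> set T) :
  setI_closed G -> @measurable _ T = <<s G >> ->
  (forall k, measurable (K k)) -> (forall k, mu (K k) < +oo) ->
  nondecreasing_seq K -> \bigcup_k K k = setT ->
  (forall k, shift_cont \1_(K k)) ->
  (forall A k, G A -> shift_cont \1_(A `&` K k)) ->
  shift_space.
Proof.
move=> GI GE mK Koo ndK KT cK cG; split => // A mA Aoo.
pose H k := [set A | measurable A /\ shift_cont \1_(A `&` K k)].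
have all k : measurable `<=` H k.
  rewrite GE; apply: lambda_system_subset => //; last first.
    move=> B GB; split; last exact: cG.
    by rewrite GE; exact: sub_sigma_algebra.
  split => //.
  - by split => //; rewrite setTI; exact: cK.
  - move=> B C CB [mB cB] [mC cC]; split; first exact: measurableD.
    rewrite (_ : \1_ _ = (fun z => \1_(B `&` K k) z + -1 * \1_(C `&` K k) z)%R).
      apply: shift_contD => //.
      + exact/measurable_indic/measurableI.
      + by apply: measurable_funM => //; exact/measurable_indic/measurableI.
      + by apply: shift_contZ => //; exact/measurable_indic/measurableI.
    apply/funext => z; have [Cz|Cz] := pselect (C z); last first.
      rewrite (indic0 _ (_ : ~ (C `&` K k) z)); last by case.
      rewrite mulr0 addr0; have [BK|BK] := pselect ((B `&` K k) z).
        by rewrite !indic1//; case: BK.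
      by rewrite !indic0// => -[[? ?] ?]; apply: BK.
    rewrite indic0; last by case=> -[].
    have [Kz|Kz] := pselect (K k z).
      by rewrite !indic1 ?mulr1 ?subrr//; split => //; exact: CB.
    by rewrite !indic0 ?mulr0 ?addr0//; case.
  - move=> F ndF HF; split.
      by apply: bigcup_measurable => i _; have [] := HF i.
    rewrite setI_bigcupl; apply: shift_cont_bigcup.
    + by move=> i; apply: measurableI => //; have [] := HF i.
    + by move=> i j ij; apply/subsetPset; apply: setSI; apply/subsetPset/ndF.
    + apply: le_lt_trans (Koo k); apply: le_measure; rewrite ?inE//.
        apply: bigcup_measurable => i _; apply: measurableI => //.
        by have [] := HF i.
      by move=> x [i _ []].
    + by move=> i; have [] := HF i.
rewrite -(setIT A) -KT setI_bigcupr; apply: shift_cont_bigcup.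
- by move=> k; exact: measurableI.
- by move=> i j ij; apply/subsetPset; apply: setIS; apply/subsetPset/ndK.
- by rewrite -setI_bigcupr KT setIT.
- by move=> k; have [] := all k _ mA.
Qed.

End shift_continuity.

Import HBSimple.

Lemma shift_cont_integrable d (T : measurableType d) (R : realType)
    (mu : {measure set T -> \bar R}) (W : Type) (sh : W -> T -> T)
    (N : R -> W -> Prop) (f : T -> R) :
  (exists w, N 1%R w) -> shift_space mu sh N -> mu.-integrable setT (EFin \o f) ->
  shift_cont mu sh N f.
Proof.
move=> Nw [msh ish mono cA] fi.
have mf : measurable_fun setT f by move/measurable_int : fi => /measurable_EFinP.
have [g [gi _ fg]] := approximation_sfun_integrable measurableT fi.
apply: (@shift_cont_lim _ _ _ mu _ sh N msh ish f (fun k => g k)) => // [k|de de0].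
  have gE : (g k : T -> R) = (fun z => \sum_(y <- finmap.enum_fset (fset_set (range (g k))))
      y * \1_(g k @^-1` [set y]) z)%R.
    by apply/funext => z; rewrite [LHS]fimfunE fsbig_finite.
  rewrite gE; elim: (finmap.enum_fset _) => [|y s IH].
    move=> de de0; exists 1%R => // w _; under eq_integral do rewrite !big_nil subrr normr0.
    by rewrite integral0 lee_fin ltW.
  have mt : measurable_fun setT (fun z => (y * \1_(g k @^-1` [set y]) z)%R).
    exact: measurable_funM.
  rewrite (_ : (fun z => _) = (fun z => y * \1_(g k @^-1` [set y]) z +
      \sum_(y <- s) y * \1_(g k @^-1` [set y]) z)%R); last first.
    by apply/funext => z; rewrite big_cons.
  apply: shift_contD => //.
    by apply: measurable_sum => t; exact: measurable_funM.
  have [->|y0] := eqVneq y 0%R.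
    move=> de de0; exists 1%R => // w _; under eq_integral do rewrite !mul0r subrr normr0.
    by rewrite integral0 lee_fin ltW.
  apply: shift_contZ => //; apply: cA => //.
  (* A level set of a nonzero value has finite measure, for otherwise [|g k|] would not be
     integrable. *)
  have := gi k => /integrableP[_].
  rewrite !ltNge; apply: contra; rewrite leye_eq => /eqP hoo.
  have : (\int[mu]_z (`|y| * \1_(g k @^-1` [set y]) z)%:E <= \int[mu]_x `|(EFin \o g k) x|)%E.
    apply: ae_le_integral => //=.
    apply: aeW => x _; rewrite lee_fin; have [xy|xy] := pselect ((g k @^-1` [set y]) x).
      by rewrite (indic1 _ xy) mulr1 -[g k x]/(g k x) xy.
    by rewrite (indic0 _ xy) mulr0.
  under eq_integral do rewrite EFinM.
  rewrite ge0_integralZl//; last exact/measurable_EFinP.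
  by rewrite integral_indic// setIT hoo gt0_muley// lte_fin normr_gt0.
have [k hk] : exists k, (\int[mu]_z `|(EFin \o f) z - (g k z)%:E| < de%:E)%E.
  by apply: cvge_exists_lt fg _; rewrite lte_fin.
by exists k; exact: ltW.
Qed.

Section shift_product.
Context d1 d2 (T1 : measurableType d1) (T2 : measurableType d2) (R : realType)
  (m1 : {sigma_finite_measure set T1 -> \bar R})
  (m2 : {sigma_finite_measure set T2 -> \bar R})
  (W1 W2 : Type) (sh1 : W1 -> T1 -> T1) (sh2 : W2 -> T2 -> T2)
  (N1 : R -> W1 -> Prop) (N2 : R -> W2 -> Prop).
Local Open Scope ereal_scope.

(** For a rectangle the difference of indicators is split into [F1 + F2], in each of which only one
    factor changes; Tonelli reduces both to the factors. Rectangles are stable under intersection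
    and generate the product sigma-algebra. *)
Lemma shift_space_prod : shift_space m1 sh1 N1 -> shift_space m2 sh2 N2 ->
  shift_space (m1 \x m2) (fun w z => (sh1 w.1 z.1, sh2 w.2 z.2))
    (fun e w => N1 e w.1 /\ N2 e w.2).
Proof.
move=> [ms1 is1 mono1 c1] [ms2 is2 mono2 c2].
have ms w : measurable_fun setT (fun z : T1 * T2 => (sh1 w.1 z.1, sh2 w.2 z.2)).
  apply/measurable_fun_pairP; split.
    exact: (measurableT_comp (ms1 _) measurable_fst).
  exact: (measurableT_comp (ms2 _) measurable_snd).
have is' w (f : T1 * T2 -> \bar R) : measurable_fun setT f ->
    (forall z, 0 <= f z) ->
    \int[m1 \x m2]_z f (sh1 w.1 z.1, sh2 w.2 z.2) = \int[m1 \x m2]_z f z.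
  move=> mf f0.
  rewrite (fubini_tonelli1 (fun z => f (sh1 w.1 z.1, sh2 w.2 z.2)) (measurableT_comp mf (ms w)))//.
  rewrite (fubini_tonelli1 f)// /fubini_F.
  rewrite -[RHS](is1 w.1); last first.
  - by move=> x; exact: integral_ge0.
  - exact: (measurable_integral2 m2 mf f0).
  apply: eq_integral => x _; rewrite -[RHS](is2 w.2)//.
  exact: (measurableT_comp mf (measurable_pair1 _)).
have mono e e' w : (e <= e')%R -> N1 e w.1 /\ N2 e w.2 -> N1 e' w.1 /\ N2 e' w.2.
  by move=> ee' [? ?]; split; [exact: mono1 ee' _|exact: mono2 ee' _].
have rect A B : measurable A -> measurable B -> m1 A < +oo -> m2 B < +oo ->
    shift_cont (m1 \x m2) (fun w z => (sh1 w.1 z.1, sh2 w.2 z.2))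
    (fun e w => N1 e w.1 /\ N2 e w.2) \1_(A `*` B).
  move=> mA mB Aoo Boo de de0.
  have fA : m1 A \is a fin_num by rewrite ge0_fin_numE.
  have fB : m2 B \is a fin_num by rewrite ge0_fin_numE.
  pose a := fine (m1 A); pose b := fine (m2 B).
  have a0 : (0 <= a)%R by rewrite fine_ge0.
  have b0 : (0 <= b)%R by rewrite fine_ge0.
  (* The error of each factor is multiplied by the measure of the other side; [b + 1] keeps the
     division safe when that measure is 0. *)
  have [|e1 e10 h1] := c1 A mA Aoo (de / 2 / (b + 1))%R.
    by rewrite !divr_gt0// ltr_wpDl.
  have [|e2 e20 h2] := c2 B mB Boo (de / 2 / (a + 1))%R.
    by rewrite !divr_gt0// ltr_wpDl.
  exists (Num.min e1 e2); first by rewrite lt_min e10.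
  move=> [w1 w2] /= [Nw1 Nw2].
  have {}h1 := h1 w1 (mono1 _ _ _ _ Nw1); have {}h2 := h2 w2 (mono2 _ _ _ _ Nw2).
  rewrite !ge_min !lexx ?orbT in h1 h2; move: (h1 isT) (h2 isT) => {}h1 {}h2.
  have mI1 : measurable_fun setT (fun x => (`|\1_A (sh1 w1 x) - \1_A x : R|%R)%:E).
    exact: measurable_shift_diff.
  have mI2 : measurable_fun setT (fun x => (`|\1_B (sh2 w2 x) - \1_B x : R|%R)%:E).
    exact: measurable_shift_diff.
  pose F1 (z : T1 * T2) : \bar R := (`|\1_A (sh1 w1 z.1) - \1_A z.1|%R)%:E * (\1_B (sh2 w2 z.2))%:E.
  pose F2 (z : T1 * T2) : \bar R := (\1_A z.1)%:E * (`|\1_B (sh2 w2 z.2) - \1_B z.2|%R)%:E.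
  have mA1 : measurable_fun setT (\1_A : T1 -> R) by exact: measurable_indic.
  have mB1 : measurable_fun setT (\1_B : T2 -> R) by exact: measurable_indic.
  have mF1 : measurable_fun setT F1.
    apply: emeasurable_funM; first exact: (measurableT_comp mI1 measurable_fst).
    by apply/measurable_EFinP; exact: (measurableT_comp mB1 (measurableT_comp (ms2 w2) measurable_snd)).
  have mF2 : measurable_fun setT F2.
    apply: emeasurable_funM; last exact: (measurableT_comp mI2 measurable_snd).
    by apply/measurable_EFinP; exact: (measurableT_comp mA1 measurable_fst).
  have F10 z : 0 <= F1 z by rewrite mule_ge0// lee_fin.
  have F20 z : 0 <= F2 z by rewrite mule_ge0// lee_fin.
  apply: (@le_trans _ _ (\int[m1 \x m2]_z (F1 z + F2 z))).
    apply: ae_le_integral => [z _|z _|]; rewrite ?adde_ge0//.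
    apply: aeW => -[x y] _; rewrite /F1 /F2 -!EFinM -EFinD lee_fin /=.
    rewrite !indicE !in_setX/=.
    case: (sh1 w1 x \in A); case: (x \in A); case: (sh2 w2 y \in B); case: (y \in B);
      rewrite /= ?(subr0, sub0r, subrr, normr0, normrN, normr1, mulr0, mul0r, mulr1, addr0, add0r)//.
  rewrite ge0_integralD// fubini_tonelli1// fubini_tonelli1//.
  rewrite (_ : \int[m1]_x fubini_F m2 F1 x = \int[m1]_x ((`|\1_A (sh1 w1 x) - \1_A x : R|%R)%:E * m2 B)); last first.
    apply: eq_integral => x _; rewrite /fubini_F /F1 /= ge0_integralZl//; last first.
      by apply/measurable_EFinP; exact: (measurableT_comp mB1 (ms2 w2)).
    have mEB : measurable_fun setT (EFin \o (\1_B : T2 -> R)) by exact/measurable_EFinP.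
    have EB0 z : 0 <= (EFin \o (\1_B : T2 -> R)) z by rewrite lee_fin.
    by congr (_ * _); rewrite (is2 w2 _ mEB EB0) /= integral_indic// setIT.
  rewrite (_ : \int[m1]_x fubini_F m2 F2 x = \int[m1]_x ((\1_A x)%:E * \int[m2]_y (`|\1_B (sh2 w2 y) - \1_B y : R|%R)%:E)); last first.
    apply: eq_integral => x _; rewrite /fubini_F /F2 /= ge0_integralZl//.
  rewrite ge0_integralZr// ge0_integralZr//; last 2 first.
  - by apply/measurable_EFinP; exact: measurable_indic.
  - by apply: integral_ge0.
  have iA : \int[m1]_x (\1_A x : R)%:E = a%:E by rewrite integral_indic// setIT fineK.
  have mB' : m2 B = b%:E by rewrite fineK.
  rewrite iA mB'.
  apply: (@le_trans _ _ ((de / 2 / (b + 1))%:E * b%:E + a%:E * (de / 2 / (a + 1))%:E)).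
    by apply: leeD; [apply: lee_wpmul2r|apply: lee_wpmul2l].
  have le_div (c x : R) : (0 <= c)%R -> (0 <= x)%R -> (c / (x + 1) * x <= c)%R.
    move=> c0 x0; rewrite -mulrA ler_piMr// mulrC ler_pdivrMr ?mul1r ?lerDl//.
    by rewrite ltr_wpDl.
  rewrite -!EFinM -EFinD lee_fin [leRHS](splitr de) lerD//.
    by rewrite le_div// divr_ge0// ltW.
  by rewrite mulrC le_div// divr_ge0// ltW.
have /sigma_finiteP[F [TF ndF Foo]] := sigma_finiteT m1.
have /sigma_finiteP[G [TG ndG Goo]] := sigma_finiteT m2.
have mF k := (Foo k).1; have mG k := (Goo k).1.
apply: (@shift_cont_generate _ _ _ _ _ _ _ ms is' mono
  [set A `*` B | A in measurable & B in measurable] (fun k => F k `*` G k)).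
- move=> X Y [X1 mX1 [X2 mX2 <-{X}]] [Y1 mY1 [Y2 mY2 <-{Y}]].
  exists (X1 `&` Y1); first exact: measurableI.
  by exists (X2 `&` Y2); [exact: measurableI|rewrite setXI].
- by rewrite measurable_prod_measurableType.
- by move=> k; exact: measurableX.
- move=> k; have : (m1 \x m2) (F k `*` G k) < +oo.
    rewrite product_measure1E// lte_mul_pinfty// ?(Foo k).2 ?(Goo k).2//.
    by rewrite ge0_fin_numE// (Foo k).2.
  exact.
- move=> i j ij; apply/subsetPset => -[x y] [/= Fx Gy]; split => /=.
    by move: x Fx; apply/subsetPset/ndF.
  by move: y Gy; apply/subsetPset/ndG.
- rewrite -subTset => -[x y] _.
  have : (\bigcup_k F k) x by rewrite -TF.
  have : (\bigcup_k G k) y by rewrite -TG.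
  move=> [k _ Gky] [l _ Flx]; exists (maxn k l) => //; split => /=.
  - by move: x Flx; exact/subsetPset/ndF/leq_maxr.
  - by move: y Gky; exact/subsetPset/ndG/leq_maxl.
- by move=> k; apply: rect; rewrite ?(Foo k).2 ?(Goo k).2.
- move=> _ k [A mA [B mB <-]]; rewrite -setXI; apply: rect.
  + exact: measurableI.
  + exact: measurableI.
  + by apply: le_lt_trans (Foo k).2; apply: le_measure; rewrite ?inE//; exact: measurableI.
  + by apply: le_lt_trans (Goo k).2; apply: le_measure; rewrite ?inE//; exact: measurableI.
Qed.

End shift_product.
Section euclidean_shift.
Context (R : realType).
Local Notation mu1 := (@lebesgue_measure R).
Local Notation V n := (spacetime R n).

Lemma shift_space_R : shift_space mu1 (fun w z : measurableTypeR R => (z : R) + w : measurableTypeR R)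
  (fun e w => `|w : R| <= e).
Proof.
have ms (w : measurableTypeR R) : measurable_fun setT
    (fun z : measurableTypeR R => (z : R) + w : measurableTypeR R).
  exact: measurable_funD.
have int (w : measurableTypeR R) (f : R -> \bar R) := @ge0_integral_shift R w f.
have mono e e' (w : R) : e <= e' -> `|w| <= e -> `|w| <= e'.
  by move=> ee' /le_trans; exact.
have itv a b : shift_cont mu1 (fun w z : measurableTypeR R => (z : R) + w : measurableTypeR R)
  (fun e w => `|w : R| <= e) \1_(`]a, b] : set (measurableTypeR R)).
  (* A shift by at most [e] changes the indicator only within distance [e] of [a] or [b], on a set
     of measure at most [4 * e]. *)
  move=> de de0; exists (de / 4); first by rewrite divr_gt0.
  move=> w wde; set e := de / 4 in wde *.
  have e0 : 0 < e by rewrite divr_gt0.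
  apply: (@le_trans _ _ (\int[mu1]_z ((\1_(`[a - e, a + e]%classic : set R) z)%:E
      + (\1_(`[b - e, b + e]%classic : set R) z)%:E)))%E.
    apply: ae_le_integral => [z _|z _|]; rewrite ?adde_ge0 ?lee_fin//.
    apply: aeW => z _; rewrite -EFinD lee_fin.
    move: wde; rewrite ler_norml => /andP[w1 w2].
    have [za|za] := pselect (`[a - e, a + e]%classic z).
      rewrite (indic1 _ za) (@le_trans _ _ 1)// ?lerDl//.
      rewrite !indicE; case: (_ \in _); case: (_ \in _); by rewrite ?subrr ?normr0 ?subr0 ?sub0r ?normrN ?normr1.
    have [zb|zb] := pselect (`[b - e, b + e]%classic z).
      rewrite (indic1 _ zb) (@le_trans _ _ 1)// ?lerDr//.
      rewrite !indicE; case: (_ \in _); case: (_ \in _); by rewrite ?subrr ?normr0 ?subr0 ?sub0r ?normrN ?normr1.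
    rewrite (indic0 _ za) (indic0 _ zb) addr0.
    have [h|h] := pselect (`]a, b]%classic (z : R)).
      rewrite !indic1 ?subrr ?normr0//.
      move: h za zb; rewrite /= !in_itv/= => /andP[h1 h2] /negP; rewrite negb_and -!ltNge => h3 /negP; rewrite negb_and -!ltNge => h4.
      apply/andP; split; [case/orP: h3; lra|case/orP: h4; lra].
    rewrite !indic0 ?subrr ?normr0// => h'; apply: h; move: h' za zb.
    rewrite /= !in_itv/= => /andP[h1 h2] /negP; rewrite negb_and -!ltNge => h3 /negP; rewrite negb_and -!ltNge => h4.
    by apply/andP; split; [case/orP: h3; lra|case/orP: h4; lra].
  rewrite ge0_integralD//=; last 2 first.
  - by apply/measurable_EFinP; exact: measurable_indic.
  - by apply/measurable_EFinP; exact: measurable_indic.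
  have len (x : R) : (\int[mu1]_z (\1_(`[(x - e)%R, (x + e)%R]%classic : set R) z)%:E = (2 * e)%:E)%E.
    rewrite integral_indic// setIT.
    rewrite [LHS]lebesgue_measure_itv/= lte_fin ifT; last by lra.
    by rewrite -EFinB; congr (_%:E); lra.
  rewrite (len a) (len b).
  by rewrite -EFinD lee_fin /e; lra.
apply: (@shift_cont_generate _ _ _ _ _ _ _ ms int mono
  [set `]x.1, x.2]%classic | x in [set: R * R]] (fun k => `]- k%:R, k%:R]%classic)).
- move=> _ _ [[a b] _ <-] [[c d] _ <-] /=; exists (Num.max a c, Num.min b d) => //=.
  apply/seteqP; split => x /=; rewrite !in_itv/= gt_max le_min.
    by move=> /andP[/andP[-> ->] /andP[-> ->]].
  by move=> [/andP[-> ->] /andP[-> ->]].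
- by [].
- by move=> k.
- move=> k; have : (mu1 (`](- k%:R)%R, k%:R]%classic : set R) < +oo)%E.
    by rewrite lebesgue_measure_itv/=; case: ifPn => // _; rewrite -EFinB ltry.
  exact.
- move=> i j ij; apply/subsetPset => x /=; rewrite !in_itv/= => /andP[h1 h2].
  have : (i%:R <= j%:R :> R) by rewrite ler_nat.
  by move=> h; apply/andP; split; lra.
- rewrite -subTset => x _ /=; have := @archi_boundP R `|x : R| (normr_ge0 _).
  set k := Num.Def.archi_bound _ => xk; exists k => //=.
  by move: xk; rewrite in_itv/= ltr_norml => /andP[-> /ltW ->].
- by move=> k; exact: itv.
- move=> _ k [[a b] _ <-] /=; rewrite (_ : _ `&` _ = `]Num.max a (- k%:R), Num.min b k%:R]%classic).
    exact: itv.
  apply/seteqP; split => x /=; rewrite !in_itv/= gt_max le_min.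
    by move=> [/andP[-> ->] /andP[-> ->]].
  by move=> /andP[/andP[-> ->] /andP[-> ->]].
Qed.

Lemma shift_space_rV n : shift_space (lebesgue_rV R n) (fun w z : 'rV[R]_n => z + w)
  (fun e w => forall i, `|w 0 i| <= e).
Proof.
elim: n => [|n IH].
  split.
  - by move=> w; exact: measurable_fun_rV_shift.
  - by move=> w f mf f0; exact: ge0_integral_rV_shift.
  - by move=> e e' w ee' h i; exact: le_trans (h i) ee'.
  - move=> A mA Aoo de de0; exists 1 => // w _.
    rewrite integral0_eq ?lee_fin ?ltW// => x _.
    by rewrite (_ : x + w = x) ?subrr ?normr0//; apply/rowP => -[].
have [ms int mono set] := shift_space_prod shift_space_R IH.
split.
- by move=> w; exact: measurable_fun_rV_shift.
- by move=> w f mf f0; exact: ge0_integral_rV_shift.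
- by move=> e e' w ee' h i; exact: le_trans (h i) ee'.
move=> A mA Aoo de de0.
have mB : measurable (@rV_cons R n @^-1` A).
  by rewrite -[X in measurable X]setTI; exact: measurable_rV_cons.
have [e e0 he] := set _ mB Aoo de de0; exists e => // w hw.
have [s [y wE]] := rV_cons_surj w.
have hs : `|s : R| <= e by have := hw ord0; rewrite wE mxE unlift_none.
have hy i : `|y 0 i| <= e by have := hw (lift ord0 i); rewrite wE mxE liftK.
have := he (s, y) (conj hs hy).
congr (_ <= _)%E.
rewrite [RHS](@ge0_integral_pushforward _ _ _ _ _ _ (@measurable_rV_cons R n) (mu1 \x lebesgue_rV R n)%E setT)//.
  rewrite preimage_setT; apply: eq_integral => -[s' y'] _ /=.
  by rewrite wE rV_consD.
have mI : measurable_fun setT (\1_A : 'rV[R]_n.+1 -> R) by exact: measurable_indic.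
apply/measurable_EFinP; apply: measurableT_comp => //; apply: measurable_funB => //.
exact: (measurableT_comp mI (measurable_fun_rV_shift _)).
Qed.

Definition box_le n (e : R) (w : V n) := (forall i, `|w.1 0 i| <= e) /\ `|w.2 : R| <= e.

Lemma shift_space_st n : shift_space (lebesgue_st R n) (fun w z : V n => z + w)
  (@box_le n).
Proof. exact: (shift_space_prod (shift_space_rV n) shift_space_R). Qed.

End euclidean_shift.
(** * Loomis-Whitney inequality *)

Section sobolev_dual.
Context (R : realType).
Local Notation mu1 := (@lebesgue_measure R).
Local Open Scope ereal_scope.

Definition upd n (v : 'rV[R]_n) (i : 'I_n) (s : R) : 'rV[R]_n :=
  \row_j (if j == i then s else v 0%R j).

Lemma upd_cons0 n (s r : R) (y : 'rV[R]_n) :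
  upd (rV_cons (s, y)) ord0 r = rV_cons (r, y).
Proof.
by apply/rowP => j; rewrite !mxE; case: unliftP => [k|] -> //=; rewrite eqxx.
Qed.

Lemma upd_consS n (s r : R) (y : 'rV[R]_n) i :
  upd (rV_cons (s, y)) (lift ord0 i) r = rV_cons (s, upd y i r).
Proof.
apply/rowP => j; rewrite !mxE; case: (unliftP ord0 j) => [k|] -> /=.
  by rewrite mxE (inj_eq lift_inj).
by [].
Qed.

Lemma poweR_split (x : \bar R) (a b : R) : 0 <= x -> (0 < a)%R -> (0 < b)%R ->
  x `^ (a + b) = x `^ a * x `^ b.
Proof.
move=> x0 a0 b0; apply: poweRD; apply: add_neq0_poweRD_def.
by rewrite gt_eqF ?addr_gt0.
Qed.

(* Loomis-Whitney in dual form: it is multiplicative in the number of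
   coordinates, so that splitting off one coordinate and two applications of
   Hoelder's inequality give the induction step. *)
Lemma sobolev_dual n (f g h : 'rV[R]_n.+1 -> \bar R) :
  measurable_fun setT f -> measurable_fun setT g -> measurable_fun setT h ->
  (forall v, 0 <= f v) -> (forall v, 0 <= g v) -> (forall v, 0 <= h v) ->
  (forall i v, f v <= \int[mu1]_s g (upd v i s)) ->
  \int[lebesgue_rV R n.+1]_v (f v * h v `^ (n.+1%:R^-1)) <=
  \int[lebesgue_rV R n.+1]_v g v * (\int[lebesgue_rV R n.+1]_v h v) `^ (n.+1%:R^-1).
Proof.
elim: n f g h => [|n IH] f g h mf mg mh f0 g0 h0 fg.
  rewrite invr1 poweRe1; last by apply: integral_ge0.
  have fle v : f v <= \int[lebesgue_rV R 1]_v g v.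
    apply: (le_trans (fg ord0 v)); rewrite ge0_integral_rVS//.
    apply/eqP/eqP; rewrite le_eqVlt; apply/orP; left; apply/eqP.
    apply: eq_integral => s _; rewrite integral_dirac//; last first.
      exact: (measurableT_comp mg (measurable_rV_cons_r _)).
    rewrite diracT mul1e; congr g; have [r [y ->]] := rV_cons_surj v.
    by rewrite upd_cons0; congr rV_cons; congr pair; apply/rowP => -[].
  rewrite -ge0_integralZl//; last by apply: integral_ge0.
  apply: ae_le_integral => [v _|v _|]; rewrite ?mule_ge0 ?poweR_ge0 ?integral_ge0//.
  by apply: aeW => v _; rewrite poweRe1// lee_wpmul2r.
pose I := \int[lebesgue_rV R n.+2]_v g v.
(* With this [t] one has [1 - t = 1/(n+2)] and [t/(n+1) = 1/(n+2)]: Hoelder's inequality on a slice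
   produces the integral of the induction hypothesis to the power [t] and the integral of [f] to the
   power [1 - t]. *)
pose t : R := (n.+1%:R / n.+2%:R)%R.
have n20 : (0 < n.+2%:R :> R)%R by rewrite ltr0n.
have n10 : (0 < n.+1%:R :> R)%R by rewrite ltr0n.
have tE : (1 - t = n.+2%:R^-1)%R.
  rewrite /t -[X in (X - _)%R](mulfV (lt0r_neq0 n20)) -mulrBl.
  by rewrite -(natr1 n.+1) (addrC _ 1%R) addrK mul1r.
have t01 : (0 < t < 1)%R.
  by rewrite divr_gt0//= -subr_gt0 tE invr_gt0.
have t0 : (0 < t)%R by case/andP: t01.
have t1 : (0 < 1 - t)%R by rewrite tE invr_gt0.
have tn : (n.+1%:R^-1 * t = n.+2%:R^-1)%R by rewrite /t mulrA mulVf ?lt0r_neq0// mul1r.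
have mc (F : 'rV[R]_n.+2 -> \bar R) s : measurable_fun setT F ->
    measurable_fun setT (fun y => F (rV_cons (s, y))).
  by move=> mF; exact: (measurableT_comp mF (measurable_rV_cons_r _)).
have mi (F : 'rV[R]_n.+2 -> \bar R) : measurable_fun setT F -> (forall v, 0 <= F v) ->
    measurable_fun setT (fun s : measurableTypeR R => \int[lebesgue_rV R n.+1]_y F (rV_cons (s, y))).
  move=> mF F0.
  exact: (measurable_integral2 (lebesgue_rV R n.+1) (measurableT_comp mF (@measurable_rV_cons R n.+1)) (fun x => F0 _)).
have mpow (F : 'rV[R]_n.+2 -> \bar R) a : measurable_fun setT F ->
    measurable_fun setT (fun v => F v `^ a).
  by move=> mF; exact: (measurableT_comp (measurable_poweR a) mF).
pose G s := \int[lebesgue_rV R n.+1]_y g (rV_cons (s, y)).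
pose H s := \int[lebesgue_rV R n.+1]_y h (rV_cons (s, y)).
have G0 s : 0 <= G s by apply: integral_ge0.
have H0 s : 0 <= H s by apply: integral_ge0.
have I0 : 0 <= I by apply: integral_ge0.
have IE : I = \int[mu1]_s G s by rewrite /I ge0_integral_rVS.
(* The bound along the first coordinate controls each slice of [f] by the whole integral of [g]; the
   bounds along the others feed the induction hypothesis. *)
have FI s : \int[lebesgue_rV R n.+1]_y f (rV_cons (s, y)) <= I.
  have -> : I = \int[lebesgue_rV R n.+1]_y \int[mu1]_s g (rV_cons (s, y)).
    rewrite IE /G.
    exact: (fubini_tonelli (m1 := mu1) (m2 := lebesgue_rV R n.+1) _ (measurableT_comp mg (@measurable_rV_cons R n.+1)) (fun x => g0 _)).
  apply: ae_le_integral => // [y _|]; first exact: integral_ge0.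
  apply: aeW => y _; apply: (le_trans (fg ord0 _)).
  by under eq_integral do rewrite upd_cons0.
have step s : \int[lebesgue_rV R n.+1]_y
    (f (rV_cons (s, y)) * h (rV_cons (s, y)) `^ n.+2%:R^-1) <=
    (G s `^ t * H s `^ (1 - t)) * I `^ (1 - t).
  have -> : \int[lebesgue_rV R n.+1]_y
      (f (rV_cons (s, y)) * h (rV_cons (s, y)) `^ n.+2%:R^-1) =
    \int[lebesgue_rV R n.+1]_y
      ((f (rV_cons (s, y)) * h (rV_cons (s, y)) `^ n.+1%:R^-1) `^ t *
        f (rV_cons (s, y)) `^ (1 - t)).
    apply: eq_integral => y _.
    rewrite poweRM ?poweR_ge0// -poweRrM tn muleAC -poweR_split//.
    by rewrite addrC subrK poweRe1.
  apply: (le_trans (@hoelder_pow _ _ _ (lebesgue_rV R n.+1)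
    (fun y => f (rV_cons (s, y)) * h (rV_cons (s, y)) `^ n.+1%:R^-1)
    (fun y => f (rV_cons (s, y))) _ t01 _ _ _ _)).
  - apply: emeasurable_funM; first exact: mc.
    by apply: (mc (fun v => h v `^ _)); exact: mpow.
  - exact: mc.
  - by move=> y; rewrite mule_ge0 ?poweR_ge0.
  - by move=> y.
  apply: lee_pmul; rewrite ?poweR_ge0//; last first.
    by apply: le_poweR; [exact: ltW|exact: integral_ge0|exact: FI].
  rewrite (_ : H s `^ (1 - t) = (H s `^ n.+1%:R^-1) `^ t); last by rewrite -poweRrM tn tE.
  rewrite -poweRM ?poweR_ge0//.
  apply: le_poweR; first exact: ltW.
    by apply: integral_ge0 => y _; rewrite mule_ge0 ?poweR_ge0.
  apply: IH => //; try exact: mc.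
  move=> i y; apply: (le_trans (fg (lift ord0 i) _)).
  by under eq_integral do rewrite upd_consS.
rewrite ge0_integral_rVS; last 2 first.
- by apply: emeasurable_funM => //; exact: mpow.
- by move=> v; rewrite mule_ge0 ?poweR_ge0.
have mGH : measurable_fun setT (fun s : measurableTypeR R => G s `^ t * H s `^ (1 - t)).
  apply: emeasurable_funM; first exact: (measurableT_comp (measurable_poweR _) (mi _ mg g0)).
  exact: (measurableT_comp (measurable_poweR _) (mi _ mh h0)).
apply: (@le_trans _ _ (\int[mu1]_s ((G s `^ t * H s `^ (1 - t)) * I `^ (1 - t)))).
  apply: ae_le_integral => [s _|s _|].
  - by apply: integral_ge0 => y _; rewrite mule_ge0 ?poweR_ge0.
  - by rewrite !mule_ge0 ?poweR_ge0.
  - by apply: aeW => s _; exact: step.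
rewrite ge0_integralZr//; last 2 first.
- by move=> s _; rewrite mule_ge0 ?poweR_ge0.
- exact: poweR_ge0.
apply: (@le_trans _ _ ((I `^ t * (\int[mu1]_s H s) `^ (1 - t)) * I `^ (1 - t))).
  apply: lee_wpmul2r; first exact: poweR_ge0.
  rewrite IE; apply: (@hoelder_pow _ _ _ mu1 G H) => //; exact: mi.
rewrite muleAC -poweR_split// addrC subrK poweRe1// tE.
by rewrite [X in _ <= _ * X `^ _]ge0_integral_rVS.
Qed.

End sobolev_dual.
(** * Smooth bumps and mollification *)

Section one_variable.
Context (R : realType).
Implicit Types (s x : R).

Definition posp (a : R) s : R := (Num.max s 0) `^ a.

Lemma posp_ge0 a s : 0 <= posp a s. Proof. exact: powR_ge0. Qed.

Lemma posp_le0 a s : a != 0 -> s <= 0 -> posp a s = 0.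
Proof. by move=> a0 s0; rewrite /posp max_r// powR0. Qed.

Lemma posp_gt0 a s : 0 <= s -> posp a s = s `^ a.
Proof. by move=> s0; rewrite /posp max_l. Qed.

Lemma is_derive_cvg0 (f : R -> R) (df : R) x :
  (h^-1 * (f (h + x) - f x) @[h --> 0^'] --> df) -> is_derive x 1 f df.
Proof.
move=> h; have e : (fun h0 => h0^-1 *: ((f \o shift x) (h0 *: 1) - f x)) =
    (fun h => h^-1 * (f (h + x) - f x)) :> (R -> R).
  by apply/funext => k; rewrite /= [k *: 1]mulr1.
apply: DeriveDef; first by rewrite /derivable e; apply/cvg_ex; exists df.
by rewrite /derive e; exact/cvg_lim.
Qed.

(** The difference quotient at 0 is at most [C * |h|^a]. This settles the gluing point both of the
    powers [posp] and of [exp (-1/s)]. *)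
Lemma is_derive_flat0 (f : R -> R) (C a : R) : 0 < a -> 0 <= C -> f 0 = 0 ->
  (forall h, `|h| < 1 -> `|f h| <= C * `|h| * `|h| `^ a) -> is_derive (0 : R) 1 f 0.
Proof.
move=> a0 C0 f0 fh; apply: is_derive_cvg0.
apply/cvgr0Pnorm_le => e e0.
have C1 : 0 < C + 1 by rewrite ltr_wpDl.
pose d := Num.min 1 ((e / (C + 1)) `^ a^-1).
have d0 : 0 < d by rewrite lt_min ltr01 powR_gt0 ?divr_gt0.
exists d => // h /= hd h0; rewrite sub0r normrN in hd.
rewrite addr0 f0 subr0 normrM normfV.
have hpos : 0 < `|h| by rewrite normr_gt0.
have h1 : `|h| < 1 by apply: lt_le_trans hd _; rewrite ge_min lexx.
rewrite mulrC ler_pdivrMr//; apply: (le_trans (fh _ h1)).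
rewrite mulrAC ler_pM2r//.
have : `|h| `^ a <= e / (C + 1).
  have h2 : `|h| <= (e / (C + 1)) `^ a^-1.
    by apply: ltW; apply: lt_le_trans hd _; rewrite ge_min lexx orbT.
  have e1 : 0 <= e / (C + 1) by rewrite divr_ge0// ltW.
  apply: (le_trans (ge0_ler_powR (ltW a0) _ _ h2)); rewrite ?nnegrE ?powR_ge0//.
  by rewrite -powRrM mulVf ?gt_eqF// powRr1.
move=> h3; apply: (@le_trans _ _ ((C + 1) * (e / (C + 1)))).
  by apply: ler_pM => //; rewrite ?powR_ge0// lerDl.
by rewrite mulrC mulrVK// unitfE gt_eqF.
Qed.

Lemma is_derive_posp a s : 1 < a -> is_derive s 1 (posp a) (a * posp (a - 1) s).
Proof.
move=> a1; have a0 : a != 0 by rewrite gt_eqF// (lt_trans ltr01).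
have a10 : 0 < a - 1 by rewrite subr_gt0.
have [s0|s0|->] := ltgtP s 0.
- rewrite posp_le0 ?mulr0 ?(gt_eqF a10)// 1?ltW//.
  have d0 : is_derive s 1 (cst 0 : R -> R) (0 : R) by exact: is_derive_cst.
  apply: (@near_eq_is_derive _ _ _ _ _ _ _ _ _ d0).
  near=> y; rewrite posp_le0//; apply: ltW; near: y; exact: lt_nbhsl.
- rewrite posp_gt0 1?ltW//.
  apply: (@near_eq_is_derive _ _ _ (fun y => y `^ a)).
    near=> y; rewrite posp_gt0//; apply: ltW; near: y; exact: lt_nbhsr.
  apply: DeriveDef; first by apply: derivable_powR; rewrite in_itv/= s0.
  by rewrite -derive1E powR_derive1// in_itv/= s0.
- rewrite posp_le0 ?mulr0 ?(gt_eqF a10)//.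
  apply: (@is_derive_flat0 _ 1 (a - 1)) => //; first by rewrite posp_le0.
  move=> h _; rewrite mul1r mulr_powRB1 ?normr_ge0 ?(lt_trans ltr01)//.
  rewrite ger0_norm ?posp_ge0// /posp; apply: ge0_ler_powR; rewrite ?nnegrE ?le_max ?lexx ?orbT//.
    by rewrite ltW// (lt_trans ltr01).
  by rewrite ge_max ler_norm normr_ge0.
Unshelve. all: by end_near. Qed.

Lemma is_derive_continuous (f : R -> R) (df : R) x : is_derive x 1 f df ->
  {for x, continuous f}.
Proof. by move=> h; apply: differentiable_continuous; apply/derivable1_diffP; exact: ex_derive. Qed.

Lemma continuous_posp1 : continuous (posp 1).
Proof.
rewrite (_ : posp 1 = fun s => Num.max s 0).
  by move=> s; apply: (@continuous_max R R id (cst 0)); [exact: cvg_id|exact: cvg_cst].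
by apply/funext => s; rewrite /posp powRr1// le_max lexx orbT.
Qed.

(** Differentiation maps this family into its linear combinations, so all derivatives of a bump stay
    explicit. *)
Definition flat (k : nat) s : R := if 0 < s then s ^- k * expR (- s^-1) else 0.

Lemma flat_ge0 k s : 0 <= flat k s.
Proof.
by rewrite /flat; case: ifPn => // s0; rewrite mulr_ge0 ?expR_ge0// invr_ge0 exprn_ge0// ltW.
Qed.

Lemma flat_gt0 s : 0 < s -> 0 < flat 0 s.
Proof. by move=> s0; rewrite /flat s0 expr0 invr1 mul1r expR_gt0. Qed.

Lemma flat_le0 k s : s <= 0 -> flat k s = 0.
Proof. by move=> s0; rewrite /flat ltNge s0. Qed.

Lemma expR_ge_pow (m : nat) (y : R) : 0 <= y -> (y / m.+1%:R) ^+ m.+1 <= expR y.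
Proof.
move=> y0; have m0 : 0 < m.+1%:R :> R by rewrite ltr0n.
have -> : expR y = expR (y / m.+1%:R) ^+ m.+1.
  by rewrite -expRM_natl; congr expR; rewrite mulrC mulrVK// unitfE gt_eqF.
apply: lerXn2r; rewrite ?nnegrE ?divr_ge0 ?expR_ge0//.
by apply: le_trans (expR_ge1Dx (y / m.+1%:R)); rewrite lerDr.
Qed.

(** From [exp y >= (y / N)^N] with [y = 1/s] and [N = k + j + 1]: the exponential beats [s^(-k)] by
    any power of [s]. *)
Lemma flat_le k j s : 0 <= s -> flat k s <= ((k + j).+1%:R) ^+ (k + j).+1 * s ^+ j.+1.
Proof.
rewrite le_eqVlt => /predU1P[<-|s0].
  by rewrite flat_le0// expr0n mulr0.
rewrite /flat s0 expRN mulrC -ler_pdivlMr ?invr_gt0 ?exprn_gt0// invrK.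
have sV : 0 <= s^-1 by rewrite invr_ge0 ltW.
have := expR_ge_pow (k + j) sV.
have p0 : 0 < (s^-1 / (k + j).+1%:R) ^+ (k + j).+1.
  by rewrite exprn_gt0// divr_gt0 ?invr_gt0.
rewrite -(lef_pV2 (_ : expR s^-1 \in Num.pos) (_ : _ \in Num.pos)) ?posrE ?expR_gt0//.
move=> /le_trans; apply; rewrite expr_div_n invf_div exprVn -mulrA -exprD.
by rewrite invrK addSn addnC.
Qed.

Lemma flat_bounded k : exists2 C : R, 0 <= C & forall s, `|flat k s| <= C.
Proof.
exists (1 + k%:R ^+ k); first by rewrite addr_ge0// exprn_ge0.
move=> s; rewrite ger0_norm ?flat_ge0//.
have [s0|s0] := leP s 0; first by rewrite flat_le0// addr_ge0// exprn_ge0.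
rewrite /flat s0 expRN ler_pdivrMr ?expR_gt0//.
have sV : 0 <= s^-1 by rewrite invr_ge0 ltW.
case: k => [|k].
  rewrite expr0 invr1 expr0; apply: le_trans (_ : 1 <= expR s^-1) _.
    by apply: le_trans (expR_ge1Dx _); rewrite lerDl.
  by rewrite ler_peMl ?expR_ge0// lerDl.
apply: (@le_trans _ _ (k.+1%:R ^+ k.+1 * expR s^-1)).
  have := expR_ge_pow k sV; rewrite expr_div_n exprVn ler_pdivrMr ?exprn_gt0 ?ltr0n//.
  by rewrite mulrC.
by apply: ler_wpM2r; rewrite ?expR_ge0// lerDr.
Qed.

Lemma is_derive_flat k s :
  is_derive s 1 (flat k) (flat k.+2 s - k%:R * flat k.+1 s).
Proof.
have [s0|s0|->] := ltgtP s 0.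
- rewrite !(flat_le0 _ (ltW s0)) mulr0 subr0.
  have d0 : is_derive s 1 (cst 0 : R -> R) (0 : R) by exact: is_derive_cst.
  apply: (@near_eq_is_derive _ _ _ _ _ _ _ _ _ d0).
  near=> y; rewrite flat_le0//; apply: ltW; near: y; exact: lt_nbhsl.
- have sn0 : s != 0 by rewrite gt_eqF.
  have d1 : is_derive s 1 (fun y : R => (y ^+ k)^-1) (- (s ^+ k) ^- 2 *: ((k%:R * s ^+ k.-1) *: 1)).
    apply: is_deriveV; first by rewrite expf_neq0.
    have := @is_deriveX _ _ (@id R) k s 1 1 (is_derive_id _ _).
    by rewrite exprfctE.
  have d2 : is_derive s 1 (fun y : R => - y^-1) (- (- s ^- 2 *: 1)).
    by apply: is_deriveN; apply: is_deriveV.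
  have d3 : is_derive s 1 (expR \o (fun y : R => - y^-1)) (expR (- s^-1) * - (- s ^- 2 *: 1)).
    exact: is_derive1_comp.
  have d4 := is_deriveM d1 d3.
  apply: (@near_eq_is_derive _ _ _ _ _ _ _ _ _ (is_derive_eq d4 _)).
    near=> y; rewrite /flat ifT//; near: y; exact: lt_nbhsr.
  rewrite /flat s0 /= /GRing.scale/= !mulr1 opprK.
  case: k d1 d4 => [|k] _ _; first by rewrite !mul0r !mulr0 subr0 addr0 expr0 invr1 mul1r mulrC.
  have e1 : s ^- k.+1 / s ^+ 2 = s ^- k.+3 by rewrite -invfM -exprD addn2.
  have e2 : s ^+ k.+1 ^- 2 * s ^+ k = s ^- k.+2.
    rewrite -exprM (_ : k.+1 * 2 = k + k.+2)%N; last by rewrite muln2 -addnn addSnnS.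
    by rewrite exprD invfM mulrAC mulVf ?mul1r// expf_neq0.
  by rewrite -e1 -e2 /=; lra.
- rewrite !flat_le0// mulr0 subr0.
  apply: (@is_derive_flat0 _ ((k + 1).+1%:R ^+ (k + 1).+1) 1) => //.
  + by rewrite flat_le0.
  + move=> h _; rewrite powRr1// -mulrA -expr2 ger0_norm ?flat_ge0//.
    have [h0|h0] := leP h 0; first by rewrite flat_le0// mulr_ge0 ?exprn_ge0.
    by rewrite (ger0_norm (ltW h0)) flat_le// ltW.
Unshelve. all: by end_near. Qed.

End one_variable.

(** * Directional derivatives and smooth functions of affine coordinates *)

Section directional.
Context (R : realType) (V : normedModType R).
Implicit Types (f g : V -> R) (z v : V).

(** Every rule for directional derivatives below is imported from one variable through this
    equivalence. *)
Lemma is_derive_line f z v (df : R) :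
  is_derive z v f df <-> is_derive (0 : R) 1 (fun h : R => f (h *: v + z)) df.
Proof.
have e : (fun h : R => h^-1 *: ((f \o shift z) (h *: v) - f z)) =
    (fun h : R => h^-1 *: (((fun h : R => f (h *: v + z)) \o shift (0 : R)) (h *: 1) -
    (fun h : R => f (h *: v + z)) 0)).
  by apply/funext => h /=; rewrite addr0 scale0r add0r [h *: 1]mulr1.
split=> -[]; rewrite /derivable /derive.
  by rewrite e => h1 h2; apply: DeriveDef.
by rewrite -e => h1 h2; apply: DeriveDef.
Qed.

Lemma is_derive_along f z v (df : R) s : is_derive (s *: v + z) v f df ->
  is_derive s 1 (fun h : R => f (h *: v + z)) df.
Proof.
move=> /is_derive_line h.
have -> : (fun h : R => f (h *: v + z)) =
    (fun h : R => f (h *: v + (s *: v + z))) \o (fun h => h - s).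
  by apply/funext => r /=; rewrite addrA -scalerDl subrK.
rewrite -[df]mulr1; apply: is_derive1_comp; first by rewrite subrr.
apply: (is_derive_eq (is_deriveB (is_derive_id _ _) (is_derive_cst _ _ _))).
by rewrite subr0.
Qed.

Lemma is_derive_circ (G : R -> R) f z v (dG df : R) :
  is_derive (f z) 1 G dG -> is_derive z v f df ->
  is_derive z v (G \o f) (dG * df).
Proof.
move=> hG /is_derive_line hf; apply/is_derive_line.
apply: (@is_derive1_comp _ G (fun h : R => f (h *: v + z))) => //.
by rewrite scale0r add0r.
Qed.

Lemma is_derive_affine (l : V -> R) (l0 : R) z v :
  (forall h : R, l (h *: v + z) = l z + h * l0) -> is_derive z v l l0.
Proof.
move=> hl; apply/is_derive_line.
have -> : (fun h : R => l (h *: v + z)) = cst (l z) + (l0 *: (@id R)).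
  by apply/funext => h; rewrite hl; congr (_ + _); rewrite /= mulrC.
apply: (is_derive_eq (is_deriveD (is_derive_cst _ _ _) (is_deriveZ _ (is_derive_id _ _)))).
by rewrite add0r; exact: mulr1.
Qed.

Lemma Ck_continuous k f : Ck k f -> continuous f.
Proof. by case: k => [//|k] []. Qed.

Lemma CkW k f : Ck k.+1 f -> Ck k f.
Proof.
elim: k f => [|k IH] f [cf df] //; split => // v.
by have [dv Cf] := df v; split => //; exact: IH.
Qed.

Lemma Ck_cst k (c : R) : Ck k (fun _ : V => c).
Proof.
elim: k c => [|k IH] c; first by move=> x; exact: cvg_cst.
split; first by move=> x; exact: cvg_cst.
move=> v; split; first by move=> x; exact: derivable_cst.
have -> : (fun x => 'D_v (fun=> c) x) = (fun=> 0); last exact: IH.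
by apply/funext => x; exact: derive_cst.
Qed.

Lemma Ck_add k f g : Ck k f -> Ck k g -> Ck k (fun z => f z + g z).
Proof.
elim: k f g => [|k IH] f g; first by move=> cf cg x; apply: cvgD; [exact: cf|exact: cg].
move=> [cf df] [cg dg]; split; first by move=> x; apply: cvgD; [exact: cf|exact: cg].
move=> v; have [dfv Cf] := df v; have [dgv Cg] := dg v.
split; first by move=> x; exact: derivableD.
rewrite (_ : (fun x => _) = (fun x => 'D_v f x + 'D_v g x)); first exact: IH.
by apply/funext => x; exact: deriveD.
Qed.

Lemma Ck_mul k f g : Ck k f -> Ck k g -> Ck k (fun z => f z * g z).
Proof.
elim: k f g => [|k IH] f g; first by move=> cf cg x; apply: cvgM; [exact: cf|exact: cg].
move=> kf kg; have kf' := CkW kf; have kg' := CkW kg.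
move: kf kg => [cf df] [cg dg]; split; first by move=> x; apply: cvgM; [exact: cf|exact: cg].
move=> v; have [dfv Cf] := df v; have [dgv Cg] := dg v.
split; first by move=> x; exact: derivableM.
rewrite (_ : (fun x => _) = (fun x => f x * 'D_v g x + g x * 'D_v f x)).
  by apply: Ck_add; exact: IH.
by apply/funext => x; exact: deriveM.
Qed.

Lemma Ck_prod (I : Type) (r : seq I) k (F : I -> V -> R) : (forall i, Ck k (F i)) ->
  Ck k (fun z => \prod_(i <- r) F i z).
Proof.
move=> CF; elim: r => [|i r IH].
  by under eq_fun do rewrite big_nil; exact: Ck_cst.
by under eq_fun do rewrite big_cons; exact: Ck_mul.
Qed.

(** Here [l] is affine with linear part [l0]. A derivative of [flat m] composed with [l] is a
    combination of [flat m.+2] and [flat m.+1] times a constant, so the induction on [k] runs for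
    all [m] at once. *)
Lemma Ck_flat k m (l l0 : V -> R) : continuous l ->
  (forall z v h, l (h *: v + z) = l z + h * l0 v) -> Ck k (fun z => flat m (l z)).
Proof.
move=> cl hl; elim: k m => [|k IH] m.
  move=> z; apply: (@continuous_comp _ _ _ l (@flat R m)); first exact: cl.
  exact: is_derive_continuous (is_derive_flat m (l z)).
split; first exact: Ck_continuous (IH m).
move=> v.
have hd z : is_derive z v (fun z => flat m (l z))
    ((flat m.+2 (l z) - m%:R * flat m.+1 (l z)) * l0 v).
  by apply: is_derive_circ; [exact: is_derive_flat|exact: is_derive_affine].
split; first by move=> z; have [] := hd z.
rewrite (_ : (fun x => _) = (fun z => (flat m.+2 (l z) + - m%:R * flat m.+1 (l z)) * l0 v)).
  apply: Ck_mul; last exact: Ck_cst.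
  by apply: Ck_add => //; apply: Ck_mul => //; exact: Ck_cst.
by apply/funext => z; have [_ ->] := hd z; rewrite mulNr.
Qed.

End directional.

Section bumps.
Context (R : realType).
Implicit Types (e s : R).

(** Both factors are smooth on the whole line and one of them vanishes outside []-e, e[], so the end
    points need no separate study. [bump1] and [bump2] are the first two derivatives. *)
Definition bump e s : R := flat 0 (e - s) * flat 0 (e + s).

Definition bump1 e s : R :=
  flat 0 (e - s) * flat 2 (e + s) - flat 2 (e - s) * flat 0 (e + s).

Definition bump2 e s : R :=
  flat 0 (e - s) * (flat 4 (e + s) - 2 * flat 3 (e + s))
  - 2 * (flat 2 (e - s) * flat 2 (e + s))
  + (flat 4 (e - s) - 2 * flat 3 (e - s)) * flat 0 (e + s).

Lemma is_derive_flatD k e s :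
  is_derive s 1 (fun s => flat k (e + s)) (flat k.+2 (e + s) - k%:R * flat k.+1 (e + s)).
Proof.
have h : is_derive s 1 (fun s => e + s) 1.
  by apply: (@is_derive_affine _ _ (fun s => e + s)) => h; rewrite mulr1 /= [h *: _]mulr1; lra.
have := @is_derive1_comp _ (flat k) (fun s => e + s) s _ _ (is_derive_flat k (e + s)) h.
by rewrite mulr1.
Qed.

Lemma is_derive_flatB k e s :
  is_derive s 1 (fun s => flat k (e - s)) (- (flat k.+2 (e - s) - k%:R * flat k.+1 (e - s))).
Proof.
have h : is_derive s 1 (fun s => e - s) (-1).
  by apply: (@is_derive_affine _ _ (fun s => e - s)) => h; rewrite mulrN1 /= [h *: _]mulr1; lra.
have := @is_derive1_comp _ (flat k) (fun s => e - s) s _ _ (is_derive_flat k (e - s)) h.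
by rewrite mulrN1.
Qed.

Lemma is_derive_bump e s : is_derive s 1 (bump e) (bump1 e s).
Proof.
apply: (is_derive_eq (is_deriveM (is_derive_flatB 0 e s) (is_derive_flatD 0 e s))).
rewrite /bump1 /GRing.scale/= !mul0r !subr0; lra.
Qed.

Lemma is_derive_bump1 e s : is_derive s 1 (bump1 e) (bump2 e s).
Proof.
have h1 := is_deriveM (is_derive_flatB 0 e s) (is_derive_flatD 2 e s).
have h2 := is_deriveM (is_derive_flatB 2 e s) (is_derive_flatD 0 e s).
apply: (is_derive_eq (is_deriveB h1 h2)).
rewrite /bump2 /GRing.scale/= !mul0r !subr0; lra.
Qed.

Lemma bump_ge0 e s : 0 <= bump e s.
Proof. by rewrite mulr_ge0 ?flat_ge0. Qed.

Lemma bump_gt0 e s : `|s| < e -> 0 < bump e s.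
Proof. by rewrite ltr_norml => /andP[h1 h2]; rewrite mulr_gt0// flat_gt0//; lra. Qed.

Lemma bump_eq0 e s : e <= `|s| -> bump e s = 0 /\ bump1 e s = 0.
Proof.
rewrite /bump /bump1; have [s0|s0] := leP 0 s.
  rewrite ger0_norm// => h; have es : e - s <= 0 by lra.
  rewrite !(flat_le0 _ es).
  by rewrite !mul0r subrr.
rewrite ltr0_norm// => h; have es : e + s <= 0 by lra.
rewrite !(flat_le0 _ es).
by rewrite !mulr0 subrr.
Qed.

Definition bdd (f : R -> R) := exists C, forall s, `|f s| <= C.

Lemma bddM f g : bdd f -> bdd g -> bdd (fun s => f s * g s).
Proof. by move=> [C hC] [D hD]; exists (C * D) => s; rewrite normrM ler_pM. Qed.

Lemma bddD f g : bdd f -> bdd g -> bdd (fun s => f s + g s).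
Proof.
by move=> [C hC] [D hD]; exists (C + D) => s; rewrite (le_trans (ler_normD _ _))// lerD.
Qed.

Lemma bddN f : bdd f -> bdd (fun s => - f s).
Proof. by move=> [C hC]; exists C => s; rewrite normrN. Qed.

Lemma bddZ (c : R) f : bdd f -> bdd (fun s => c * f s).
Proof. by move=> [C hC]; exists (`|c| * C) => s; rewrite normrM ler_wpM2l. Qed.

Lemma bdd_flatD k e : bdd (fun s => flat k (e + s)).
Proof. by have [C _ hC] := flat_bounded R k; exists C => s. Qed.

Lemma bdd_flatB k e : bdd (fun s => flat k (e - s)).
Proof. by have [C _ hC] := flat_bounded R k; exists C => s. Qed.

Lemma bdd_bump e : bdd (bump e).
Proof. by apply: bddM; [exact: bdd_flatB|exact: bdd_flatD]. Qed.

Lemma bdd_bump1 e : bdd (bump1 e).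
Proof.
by apply: bddD; [|apply: bddN]; apply: bddM; try exact: bdd_flatB; exact: bdd_flatD.
Qed.

Lemma bdd_bump2 e : bdd (bump2 e).
Proof.
apply: bddD; first (apply: bddD; last apply: bddN).
- apply: bddM; first exact: bdd_flatB.
  by apply: bddD; [|apply/bddN/bddZ]; exact: bdd_flatD.
- by apply: bddZ; apply: bddM; [exact: bdd_flatB|exact: bdd_flatD].
- apply: bddM; last exact: bdd_flatD.
  by apply: bddD; [|apply/bddN/bddZ]; exact: bdd_flatB.
Qed.

End bumps.
Lemma measurable_integral_param d1 d2 (T1 : measurableType d1)
    (T2 : measurableType d2) (R : realType)
    (m2 : {sigma_finite_measure set T2 -> \bar R}) (f : T1 * T2 -> \bar R) :
  measurable_fun setT f -> measurable_fun setT (fun x => \int[m2]_y f (x, y))%E.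
Proof.
move=> mf.
rewrite (_ : (fun x => _) = (fun x => \int[m2]_y (f^\+)%E (x, y) -
    \int[m2]_y (f^\-)%E (x, y))%E); last first.
  apply/funext => x; rewrite integralE; congr (_ - _)%E;
  by apply: eq_integral => y _; rewrite ?funeposE ?funenegE.
apply: emeasurable_funB; apply: measurable_integral2 => //.
  exact: measurable_funepos.
exact: measurable_funeneg.
Qed.

Section product_kernels.
Context (R : realType) (n : nat).
Local Notation V := (spacetime R n).
Local Notation VN := ('rV[R]_n * R)%type.
Local Notation mu := (lebesgue_st R n).
Implicit Types (o : option 'I_n) (z w : V) (K f : V -> R).

(** Coordinates are indexed by [option 'I_n], with [None] for time, so that the same lemmas serve
    space and time derivatives. *)
Definition co o (z : V) : R := if o is Some i then z.1 0 i else z.2.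

Definition dir o : VN := if o is Some i then (delta_mx 0 i, 0) else (0, 1).

Lemma co_line o o' (h : R) (z : VN) :
  co o (h *: dir o' + z) = co o z + h * (o == o')%:R.
Proof.
case: o o' => [i|] [j|] /=; rewrite ?mxE /=.
- rewrite eq_sym addrC; case: (eqVneq j i) => [->|ij]; rewrite ?eqxx.
    by [].
  by rewrite (_ : (Some i == Some j) = false)//; apply/negbTE; apply: contra ij => /eqP[->].
- by rewrite mulr0 addrC.
- by rewrite [h *: 0]mulr0 mulr0 add0r addr0.
- by rewrite [h *: 1]mulr1 mulr1 addrC.
Qed.

Lemma coB o z w : co o (z - w) = co o z - co o w.
Proof. by case: o => [i|] //=; rewrite !mxE. Qed.

Lemma measurable_co o : measurable_fun setT (co o : V -> R).
Proof.
case: o => [i|] /=; last exact: measurable_snd.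
exact: (measurableT_comp (measurable_rV_coord i) measurable_fst).
Qed.

Lemma continuous_co o : continuous (co o : VN -> R).
Proof.
case: o => [i|] z /=; last exact: cvg_snd.
apply: (@continuous_comp _ _ _ fst (fun x : 'rV[R]_n => x 0 i)); first exact: cvg_fst.
exact: coord_continuous.
Qed.

Lemma st_box (x0 : 'rV[R]_n) (r a b : R) : 0 <= r -> a <= b ->
  mu [set z : V | (forall i, `|z.1 0 i - x0 0 i| < r) /\ a < z.2 < b] =
  ((2 * r) ^+ n * (b - a))%:E.
Proof.
move=> r0 ab.
pose B := [set v : 'rV[R]_n | forall i, (`]x0 0 i - r, x0 0 i + r[%classic : set (measurableTypeR R)) (v 0 i)].
have mB : measurable B.
  rewrite (_ : B = \bigcap_(i in setT) (rV_coord i @^-1` `]x0 0 i - r, x0 0 i + r[%classic)).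
    apply: fin_bigcap_measurable => [|i _]; first exact: finite_finset.
    by rewrite -[X in measurable X]setTI; exact: measurable_rV_coord.
  by apply/seteqP; split => v /= vA i; [move=> _|]; exact: vA.
have -> : [set z : V | (forall i, `|z.1 0 i - x0 0 i| < r) /\ a < z.2 < b] =
    B `*` (`]a, b[%classic : set (measurableTypeR R)).
  apply/seteqP; split => -[x t] /= [h1 h2]; split => //.
  - by move=> i; move: (h1 i); rewrite /= in_itv/= ltr_norml => /andP[? ?]; apply/andP; split; lra.
  - by move=> i; move: (h1 i); rewrite /= in_itv/= ltr_norml => /andP[? ?]; apply/andP; split; lra.
rewrite [LHS]product_measure1E//.
have itv (c d : R) : c <= d -> (@lebesgue_measure R (`]c, d[%classic : set R) = (d - c)%:E)%E.
  move=> cd; rewrite lebesgue_measure_itv/= lte_fin; case: ltP => h; first by rewrite -EFinB.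
  by congr (_%:E); lra.
have BE : lebesgue_rV R n B = ((2 * r) ^+ n)%:E.
  rewrite [LHS](@lebesgue_rV_box R n (fun i => `]x0 0 i - r, x0 0 i + r[%classic))//.
  rewrite (eq_bigr (fun=> (2 * r)%:E)) => [|i _].
    by rewrite prodEFin prodr_const card_ord.
  by apply: (etrans (itv _ _ _)); [lra|congr (_%:E); lra].
by rewrite EFinM; congr (_ * _)%E; [exact: BE|exact: itv].
Qed.

Definition box (e : R) : set V := [set z | forall o, `|co o z| < e].

Lemma lebesgue_st_box (e : R) : 0 <= e -> mu (box e) = ((2 * e) ^+ n * (e + e))%:E.
Proof.
move=> e0; have -> : (e + e = e - - e)%R by rewrite opprK.
rewrite -(@st_box 0 e (- e) e)//; last by rewrite ge0_cp.
congr (mu _); apply/seteqP; split => -[x t] /= h.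
  by split => [i|]; [rewrite mxE subr0; exact: (h (Some i))|rewrite -ltr_norml; exact: (h None)].
case: h => h1 h2 [i|] /=; first by have := h1 i; rewrite mxE subr0.
by rewrite ltr_norml.
Qed.

Lemma measurable_box (e : R) : measurable (box e).
Proof.
rewrite (_ : box e = \bigcap_(o in setT) (co o @^-1` `](- e), e[%classic)).
  apply: fin_bigcap_measurable => [|o _]; first exact: finite_finset.
  by rewrite -[X in measurable X]setTI; exact: measurable_co.
apply/seteqP; split => v /= h o; [move=> _|]; have := h o.
  by rewrite /= in_itv/= -ltr_norml.
by move=> /(_ I); rewrite /= in_itv/= -ltr_norml.
Qed.

Lemma lebesgue_st_sigma_finite : sigma_finite setT mu.
Proof.
exists (fun k => box k%:R) => [|k]; last first.
  by split; [exact: measurable_box|rewrite lebesgue_st_box// ltry].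
apply/esym; rewrite -subTset => z _ /=.
pose m := \sum_o `|co o z|.
have m0 : 0 <= m by apply: sumr_ge0.
exists (Num.Def.archi_bound m) => // o.
apply: le_lt_trans (archi_boundP m0).
by rewrite /m (bigD1 o)//= lerDl sumr_ge0.
Qed.

(** [lebesgue_st] is typed as a plain measure; this copy carries the sigma-finiteness that Tonelli
    on two copies of space-time asks for. *)
Definition lebesgue_st_fun : set V -> \bar R := mu.
HB.instance Definition _ := Measure.copy lebesgue_st_fun mu.
HB.instance Definition _ := Measure_isSigmaFinite.Build _ _ _ lebesgue_st_fun
  lebesgue_st_sigma_finite.
Definition lebesgue_st_sf : {sigma_finite_measure set V -> \bar R} :=
  lebesgue_st_fun.

Definition prodK (F : option 'I_n -> R -> R) (z : V) : R := \prod_o F o (co o z).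

Definition updK (F : option 'I_n -> R -> R) o (g : R -> R) o' :=
  if o' == o then g else F o'.

Lemma prodK_derive F o (g : R -> R) (z : VN) :
  (forall s : R, is_derive s 1 (F o) (g s)) ->
  is_derive z (dir o) (prodK F : VN -> R) (prodK (updK F o g) z).
Proof.
move=> Fg; apply/is_derive_line.
pose c := \prod_(o' | o' != o) F o' (co o' z).
have -> : (fun h : R => (prodK F : VN -> R) (h *: dir o + z)) =
    (F o \o (fun h => h + co o z)) * cst c.
  apply/funext => h; rewrite /prodK (bigD1 o)//= co_line eqxx mulr1 (addrC (co o z)).
  congr (_ * _); apply: eq_bigr => o' o'o; rewrite co_line (negbTE o'o) mulr0 addr0//.
have -> : prodK (updK F o g) z = g (co o z) * c.
  rewrite /prodK (bigD1 o)//= /updK eqxx; congr (_ * _).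
  by apply: eq_bigr => o' /negbTE ->.
have d1 : is_derive (0 : R) 1 (F o \o (fun h => h + co o z)) (g (co o z) * (1 + 0)).
  by apply: is_derive1_comp; rewrite add0r.
apply: (is_derive_eq (is_deriveM d1 (is_derive_cst _ _ _))).
by rewrite /GRing.scale/= mulr0 add0r addr0 mulr1 mulrC.
Qed.

Lemma prodK_bdd F : (forall o, bdd (F o)) -> exists C : R, forall z, `|prodK F z| <= C.
Proof.
move=> bF; rewrite /prodK; elim: (index_enum _) => [|o s [C hC]].
  by exists 1 => z; rewrite big_nil normr1.
have [D hD] := bF o; exists (D * C) => z; rewrite big_cons normrM.
by apply: ler_pM.
Qed.

Lemma measurable_prodK F : (forall o, measurable_fun setT (F o)) ->
  measurable_fun setT (prodK F).
Proof.
move=> mF; apply: measurable_prod => o _.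
exact: (measurableT_comp (mF o) (measurable_co o)).
Qed.

(** The kernel is [K (w - z)], not [K (z - w)]: the function [w |-> K (w - z)] is then itself the
    test function of the weak formulation, at the price of a minus sign in each derivative. *)
Definition conv (K : V -> R) (f : V -> R) z : R :=
  (\int[mu]_w (f w * K (w - z)))%R.

Lemma measurable_st_sub z : measurable_fun setT (fun w : V => w - z).
Proof. exact: measurable_st_shift. Qed.

Lemma conv_integrable K f z (C : R) : measurable_fun setT K -> (forall w, `|K w| <= C) ->
  mu.-integrable setT (EFin \o f) ->
  mu.-integrable setT (EFin \o (fun w => f w * K (w - z))).
Proof.
move=> mK bK fi.
have := integrableMl measurableT fi (measurableT_comp mK (measurable_st_sub z)).
apply; exists C; split; first exact: num_real.
by move=> M CM w _; apply: (le_trans (bK _)); exact: ltW.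
Qed.

Lemma conv_bdd K f z (C : R) : measurable_fun setT K -> (forall w, `|K w| <= C) ->
  mu.-integrable setT (EFin \o f) ->
  `|conv K f z| <= C * \int[mu]_w `|f w|.
Proof.
move=> mK bK fi; have Ki := conv_integrable z mK bK fi.
apply: (le_trans (le_normr_Rintegral measurableT Ki)).
rewrite -RintegralZl//; last exact: integrable_norm.
apply: le_Rintegral => //; first exact: integrable_norm.
  have := integrableZl measurableT C (integrable_norm fi); by [].
by move=> w _; rewrite normrM mulrC ler_wpM2r.
Qed.

(** Differentiation under the integral, with the integrable majorant [C' * |f|]. *)
Lemma conv_derive K (K' : V -> R) f (v z : VN) (C C' : R) :
  measurable_fun setT K -> measurable_fun setT K' -> (forall w, `|K w| <= C) -> (forall w, `|K' w| <= C') ->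
  (forall z : VN, is_derive z v (K : VN -> R) (K' z)) ->
  mu.-integrable setT (EFin \o f) ->
  is_derive z v (conv K f : VN -> R) (- conv K' f z).
Proof.
move=> mK mK' bK bK' dK fi.
pose F (h : R) (w : V) : R := f w * K ((w : VN) - (h *: v + z)).
have dF (h : R) w : is_derive h 1 (F ^~ w) (- (f w * K' ((w : VN) - (h *: v + z)))).
  have -> : F ^~ w = f w *: (fun h : R => (K : VN -> R) (h *: (- v) + (w - z))).
    apply/funext => r; rewrite /F /=; congr (_ * K _).
    by rewrite scalerN opprD addrCA.
  have dK1 : is_derive (h *: (- v) + ((w : VN) - z)) (- v) (K : VN -> R)
      (- K' ((w : VN) - (h *: v + z))).
    have := dK (h *: (- v) + ((w : VN) - z)).
    have -> : h *: (- v) + ((w : VN) - z) = w - (h *: v + z).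
      by rewrite scalerN opprD addrCA.
    move=> /is_derive_line hK; apply/is_derive_line.
    have -> : (fun r : R => (K : VN -> R) (r *: - v + (w - (h *: v + z)))) =
       (fun r : R => (K : VN -> R) (r *: v + (w - (h *: v + z)))) \o (fun r => - r).
      by apply/funext => r /=; rewrite scaleNr scalerN.
    rewrite -[X in is_derive _ _ _ X]mulrN1; apply: is_derive1_comp.
    by rewrite oppr0.
  apply: (is_derive_eq (is_deriveZ _ (is_derive_along dK1))).
  by rewrite /GRing.scale/= mulrN.
have Fint h : mu.-integrable setT (EFin \o F h) by exact: conv_integrable.
have C'0 : 0 <= C' by apply: le_trans (bK' 0).
have d1 h w : partial1of2 F h w = - (f w * K' ((w : VN) - (h *: v + z))).
  by rewrite partial1of2E; have [_ ->] := dF h w.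
have := @cvg_differentiation_under_integral _ _ _ mu F setT measurableT 0 (-1) 1
  _ (fun h _ => Fint h) (fun h w _ _ => @ex_derive _ _ _ _ _ _ _ (dF h w)) (fun w => C' * `|f w|) _ _ _.
have I0 : `]-1, 1[%classic (0 : R) by rewrite /= in_itv/= ltrN10 ltr01.
move=> /(_ I0) h.
apply/is_derive_line/is_derive_cvg0.
have -> : - conv K' f z = \int[mu]_y partial1of2 F 0 y.
  under eq_Rintegral do rewrite d1 scale0r add0r.
  have := RintegralZl (-1) measurableT (conv_integrable z mK' bK' fi).
  rewrite mulN1r => <-; apply: eq_Rintegral => w _; exact: mulN1r.
apply: h.
- by move=> w; rewrite mulr_ge0.
- have := integrableZl measurableT C' (integrable_norm fi); by [].
- move=> h w _ _; rewrite d1 normrN normrM mulrC ler_wpM2r//.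
Qed.

Lemma measurable_conv K f : measurable_fun setT K -> measurable_fun setT f ->
  measurable_fun setT (conv K f).
Proof.
move=> mK mf; rewrite /conv /Rintegral.
apply: (measurableT_comp (fine_measurable _)) => //.
have m1 : measurable_fun setT (fun p : V * V => p.2 - p.1).
  apply/measurable_fun_pairP; split.
    apply: measurable_fun_rVP => i.
    rewrite (_ : _ \o _ = fun p : V * V => co (Some i) p.2 - co (Some i) p.1).
      by apply: measurable_funB; apply: measurableT_comp (measurable_co _) _; [exact: measurable_snd|exact: measurable_fst].
    by apply/funext => p; rewrite /= /rV_coord !mxE.
  by apply: measurable_funB; apply: measurableT_comp measurable_snd _; [exact: measurable_snd|exact: measurable_fst].
have m2 : measurable_fun setT (fun p : V * V => f p.2 * K (p.2 - p.1)).
  apply: measurable_funM; first exact: (measurableT_comp mf measurable_snd).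
  exact: (measurableT_comp mK m1).
have m3 : measurable_fun setT (fun p : V * V => (f p.2 * K (p.2 - p.1))%:E).
  exact/measurable_EFinP.
exact: (measurable_integral_param lebesgue_st_sf m3).
Qed.

End product_kernels.
Section mollifier.
Context (R : realType) (n : nat).
Local Notation V := (spacetime R n).
Local Notation VN := ('rV[R]_n * R)%type.
Local Notation mu := (lebesgue_st R n).
Implicit Types (o : option 'I_n) (z w : V) (f : V -> R) (e : R).

Definition bumpK e : V -> R := prodK (fun=> bump e).
Definition bumpK1 e o : V -> R := prodK (updK (fun=> bump e) o (bump1 e)).
Definition bumpK2 e o : V -> R := prodK (updK (fun=> bump e) o (bump2 e)).

Lemma measurable_bump_ e : [/\ measurable_fun setT (bump e : R -> R),
  measurable_fun setT (bump1 e : R -> R) & measurable_fun setT (bump2 e : R -> R)].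
Proof.
have mB k : measurable_fun setT (fun s : R => flat k (e - s)).
  apply: continuous_measurable_fun => s.
  exact: is_derive_continuous (is_derive_flatB k e s).
have mD k : measurable_fun setT (fun s : R => flat k (e + s)).
  apply: continuous_measurable_fun => s.
  exact: is_derive_continuous (is_derive_flatD k e s).
split; first exact: measurable_funM.
  by apply: measurable_funB; exact: measurable_funM.
apply: measurable_funD; first apply: measurable_funB.
- apply: measurable_funM => //; apply: measurable_funB => //.
  exact: measurable_funM.
- by apply: measurable_funM => //; exact: measurable_funM.
- apply: measurable_funM => //; apply: measurable_funB => //.
  exact: measurable_funM.
Qed.

Lemma measurable_bumpK e o : [/\ measurable_fun setT (bumpK e),
  measurable_fun setT (bumpK1 e o) & measurable_fun setT (bumpK2 e o)].
Proof.
have [m0 m1 m2] := measurable_bump_ e.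
by split; apply: measurable_prodK => o' //; rewrite /updK; case: ifP.
Qed.

Lemma bumpK_bdd e o : exists C : R, forall z,
  [/\ `|bumpK e z| <= C, `|bumpK1 e o z| <= C & `|bumpK2 e o z| <= C].
Proof.
have [C0 h0] := @prodK_bdd R n (fun=> bump e) (fun=> bdd_bump e).
have [|C1 h1] := @prodK_bdd R n (updK (fun=> bump e) o (bump1 e)).
  by move=> o'; rewrite /updK; case: ifP => _; [exact: bdd_bump1|exact: bdd_bump].
have [|C2 h2] := @prodK_bdd R n (updK (fun=> bump e) o (bump2 e)).
  by move=> o'; rewrite /updK; case: ifP => _; [exact: bdd_bump2|exact: bdd_bump].
exists (Num.max C0 (Num.max C1 C2)) => z.
by split; rewrite !le_max ?h0 ?h1 ?h2 ?orbT.
Qed.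

Lemma bumpK_derive e o (z : VN) :
  is_derive z (dir R o) (bumpK e : VN -> R) (bumpK1 e o z).
Proof. exact: prodK_derive (fun s => is_derive_bump e s). Qed.

Lemma bumpK1_derive e o (z : VN) :
  is_derive z (dir R o) (bumpK1 e o : VN -> R) (bumpK2 e o z).
Proof.
have -> : bumpK2 e o = prodK (updK (updK (fun=> bump e) o (bump1 e)) o (bump2 e)).
  apply/funext => w; rewrite /bumpK2 /prodK; apply: eq_bigr => o' _.
  by rewrite /updK; case: ifP.
apply: prodK_derive => s; rewrite /updK eqxx; exact: is_derive_bump1.
Qed.

Lemma bumpK_ge0 e z : 0 <= bumpK e z.
Proof. by apply: prodr_ge0 => o _; exact: bump_ge0. Qed.

Lemma bumpK_gt0 e z : (forall o, `|co o z| < e) -> 0 < bumpK e z.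
Proof. by move=> h; apply: prodr_gt0 => o _; exact: bump_gt0. Qed.

Lemma bumpK_eq0 e o z : (exists o', e <= `|co o' z|) ->
  bumpK e z = 0 /\ bumpK1 e o z = 0.
Proof.
case=> k h; have [b0 b1] := bump_eq0 h; rewrite /bumpK /bumpK1 /prodK.
rewrite (bigD1 k)//= b0 mul0r; split => //.
by rewrite (bigD1 k)//= /updK; case: ifP; rewrite ?b1 ?b0 mul0r.
Qed.

Definition mass e : R := (\int[mu]_z bumpK e z)%R.

Lemma bumpK_integrable e : 0 < e -> mu.-integrable setT (EFin \o bumpK e).
Proof.
move=> e0; have [C hC] := bumpK_bdd e None.
have [m0 _ _] := measurable_bumpK e None.
apply/integrableP; split; first exact/measurable_EFinP.
apply: (@le_lt_trans _ _ (\int[mu]_z (C * \1_(@box R n e) z)%:E)%E).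
  apply: ae_le_integral => // [z _|].
    by rewrite lee_fin mulr_ge0//; have [h _ _] := hC z; apply: le_trans h.
  apply: aeW => z _; rewrite /= lee_fin.
  have [zB|zB] := pselect (box e z).
    by rewrite (indic1 _ zB) mulr1; have [] := hC z.
  have [->] : bumpK e z = 0 /\ bumpK1 e None z = 0; last by rewrite normr0 (indic0 _ zB) mulr0.
  apply: bumpK_eq0; apply: contrapT => /forallNP h; apply: zB => o /=.
  by rewrite ltNge; apply/negP; exact: h.
under eq_integral do rewrite EFinM.
rewrite ge0_integralZl//; last 2 first.
- by apply/measurable_EFinP; apply: measurable_indic; exact: measurable_box.
- by rewrite lee_fin; have [h _ _] := hC 0; apply: le_trans h.
rewrite integral_indic ?setIT//; last exact: measurable_box.
by rewrite lebesgue_st_box 1?ltW// -EFinM ltry.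
Qed.

(** With mass 0 the bump would vanish almost everywhere, yet it is positive on [box e], a set of
    positive measure. *)
Lemma mass_gt0 e : 0 < e -> 0 < mass e.
Proof.
move=> e0; rewrite lt_neqAle Rintegral_ge0 ?andbT; last by move=> z _; exact: bumpK_ge0.
apply/eqP => /esym m0.
have [mm _ _] := measurable_bumpK e None.
have : (\int[mu]_z `|(bumpK e z)%:E| = 0)%E.
  under eq_integral do rewrite gee0_abs ?lee_fin ?bumpK_ge0//.
  by rewrite -[LHS]fineK ?integrable_fin_num// ?bumpK_integrable// -/(Rintegral _ _ _) -/(mass e) m0.
move=> /ae_eq_integral_abs => /(_ measurableT (proj2 (measurable_EFinP _ _) mm)) [N [mN N0 hN]].
have : (mu (@box R n e) <= mu N)%E.
  apply: le_measure; rewrite ?inE//; first exact: measurable_box.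
  move=> z /= zB; apply: hN => /= /(_ I) h.
  by have := bumpK_gt0 zB; case: h => ->; rewrite ltxx.
rewrite N0 (lebesgue_st_box n (ltW e0)) lee_fin leNgt => /negP; apply.
by rewrite mulr_gt0 ?exprn_gt0 ?addr_gt0 ?mulr_gt0.
Qed.

Definition moll e z : R := (mass e)^-1 * bumpK e z.
Definition moll1 e o z : R := (mass e)^-1 * bumpK1 e o z.
Definition moll2 e o z : R := (mass e)^-1 * bumpK2 e o z.

Lemma measurable_moll e o : [/\ measurable_fun setT (moll e),
  measurable_fun setT (moll1 e o) & measurable_fun setT (moll2 e o)].
Proof. by have [? ? ?] := measurable_bumpK e o; split; exact: measurable_funM. Qed.

Lemma moll_bdd e o : exists C : R, forall z,
  [/\ `|moll e z| <= C, `|moll1 e o z| <= C & `|moll2 e o z| <= C].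
Proof.
have [C hC] := bumpK_bdd e o; exists (`|(mass e)^-1| * C) => z.
by have [? ? ?] := hC z; split; rewrite normrM ler_wpM2l.
Qed.

Lemma moll_derive e o (z : VN) :
  is_derive z (dir R o) (moll e : VN -> R) (moll1 e o z).
Proof.
have := is_deriveZ (mass e)^-1 (bumpK_derive e o z).
by rewrite /moll /moll1.
Qed.

Lemma moll1_derive e o (z : VN) :
  is_derive z (dir R o) (moll1 e o : VN -> R) (moll2 e o z).
Proof.
have := is_deriveZ (mass e)^-1 (bumpK1_derive e o z).
by rewrite /moll1 /moll2.
Qed.

Lemma moll_ge0 e z : 0 < e -> 0 <= moll e z.
Proof. by move=> e0; rewrite mulr_ge0 ?bumpK_ge0// invr_ge0 ltW ?mass_gt0. Qed.

Lemma moll_eq0 e o z : (exists o', e <= `|co o' z|) ->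
  moll e z = 0 /\ moll1 e o z = 0.
Proof. by move=> h; have [h1 h2] := bumpK_eq0 o h; rewrite /moll /moll1 h1 h2 !mulr0. Qed.

Lemma integral_moll e z : 0 < e -> (\int[mu]_w (moll e (w - z))%:E = 1)%E.
Proof.
move=> e0; have [mm _ _] := measurable_moll e None.
have mE : measurable_fun setT (EFin \o moll e) by exact/measurable_EFinP.
have := @ge0_integral_st_shift R n (- z) (EFin \o moll e) mE.
move=> /(_ (fun w => _)) -> => [|w]; last by rewrite lee_fin moll_ge0.
under eq_integral do rewrite /= EFinM.
have mi := bumpK_integrable e0.
rewrite ge0_integralZl//; last 3 first.
- exact: (measurable_int mu).
- by move=> w _; rewrite lee_fin bumpK_ge0.
- by rewrite lee_fin invr_ge0 ltW ?mass_gt0.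
rewrite -[X in (_ * X)%E]fineK ?integrable_fin_num// -/(Rintegral _ _ _) -/(mass e).
by rewrite -EFinM mulVf// gt_eqF ?mass_gt0.
Qed.

End mollifier.
Lemma integrable_EFin_measurable d (T : measurableType d) (R : realType)
    (mu : {measure set T -> \bar R}) (D : set T) (f : T -> R) :
  mu.-integrable D (EFin \o f) -> measurable_fun D f.
Proof. by move=> fi; apply/measurable_EFinP; exact: (measurable_int mu fi). Qed.

Section mollification.
Context (R : realType) (n : nat).
Local Notation V := (spacetime R n).
Local Notation mu := (lebesgue_st R n).
Implicit Types (o : option 'I_n) (z w : V) (f : V -> R) (e : R).

Lemma measurable_st_add : measurable_fun setT (fun p : V * V => p.1 + p.2).
Proof.
apply/measurable_fun_pairP; split.
  apply: measurable_fun_rVP => i.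
  rewrite (_ : _ \o _ = fun p : V * V => co (Some i) p.1 + co (Some i) p.2).
    by apply: measurable_funD; apply: measurableT_comp (measurable_co _) _; [exact: measurable_fst|exact: measurable_snd].
  by apply/funext => p; rewrite /= /rV_coord !mxE.
by apply: measurable_funD; apply: measurableT_comp measurable_snd _; [exact: measurable_fst|exact: measurable_snd].
Qed.

(** The kernel has mass 1, so [c] can be moved under the integral. The choice [c = f z] leads to
    convergence in L^1, the choice [c = 0] to Jensen's inequality. *)
Lemma conv_moll_sub e f (c : R) z : 0 < e -> mu.-integrable setT (EFin \o f) ->
  ((`|conv (moll e) f z - c|)%:E <= \int[mu]_w (`|f w - c| * moll e (w - z))%:E)%E.
Proof.
move=> e0 fi; have [mm _ _] := measurable_moll e (@None 'I_n).
have [C hC] := moll_bdd e (@None 'I_n).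
have bC w : `|moll e w| <= C by have [] := hC w.
have f1 := conv_integrable z mm bC fi.
have mz : mu.-integrable setT (EFin \o (fun w => moll e (w - z))).
  apply/integrableP; split.
    apply/measurable_EFinP; exact: (measurableT_comp mm (measurable_st_sub z)).
  rewrite (eq_integral (fun w => (moll e (w - z))%:E)) ?integral_moll ?ltry// => w _.
  by rewrite /= ger0_norm// moll_ge0.
have cz : mu.-integrable setT (EFin \o (fun w => c * moll e (w - z))).
  by have := integrableZl measurableT c mz.
have -> : conv (moll e) f z - c = \int[mu]_w (f w * moll e (w - z) - c * moll e (w - z)).
  rewrite RintegralB// RintegralZl// /conv; congr (_ - _).
  by rewrite /Rintegral integral_moll//= mulr1.
have d1 : mu.-integrable setT (EFin \o (fun w => f w * moll e (w - z) - c * moll e (w - z))).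
  by have := integrableB measurableT f1 cz.
rewrite /Rintegral -abse_EFin fineK ?integrable_fin_num//.
apply: (le_trans (le_abse_integral mu measurableT (measurable_int mu d1))).
apply: ae_le_integral => // [w _|]; first by rewrite lee_fin mulr_ge0// moll_ge0.
apply: aeW => w _; rewrite /= lee_fin -mulrBl normrM [`|moll _ _|]ger0_norm//.
exact: moll_ge0.
Qed.

Lemma box0 (e : R) : 0 <= e -> box_le e (0 : V).
Proof. by move=> e0; split => [i|] /=; rewrite ?mxE normr0. Qed.

(** By Tonelli the error is at most the average, over the kernel, of the L^1 distance between [f]
    and its shifts; the kernel sees only shifts of size below [e]. *)
Lemma conv_moll_L1 f (de : R) : mu.-integrable setT (EFin \o f) -> 0 < de ->
  exists2 e0 : R, 0 < e0 & forall e, 0 < e <= e0 ->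
    (\int[mu]_z (`|conv (moll e) f z - f z|)%:E <= de%:E)%E.
Proof.
move=> fi de0.
have mf : measurable_fun setT f by exact: (integrable_EFin_measurable (mu := mu)).
have [|e0 e00 he] := shift_cont_integrable _ (@shift_space_st R n) fi de0.
  by exists 0; exact: box0.
exists e0 => // e /andP[epos ele]; have [mm _ _] := measurable_moll e (@None 'I_n).
have m1 : measurable_fun setT (fun p : V * V => (`|f (p.1 + p.2) - f p.1| * moll e p.2)%:E).
  apply/measurable_EFinP; apply: measurable_funM.
    apply: measurableT_comp => //; apply: measurable_funB.
      exact: (measurableT_comp mf measurable_st_add).
    exact: (measurableT_comp mf measurable_fst).
  exact: (measurableT_comp mm measurable_snd).
have p1 (p : V * V) : (0 <= (`|f (p.1 + p.2) - f p.1| * moll e p.2)%:E)%E.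
  by rewrite lee_fin mulr_ge0// moll_ge0.
apply: (@le_trans _ _ (\int[mu]_z \int[mu]_w (`|f (z + w)%R - f z| * moll e w)%:E)%E).
  apply: ae_le_integral => // [z _|]; first by apply: integral_ge0 => w _; exact: (p1 (z, w)).
  apply: aeW => z _; apply: (le_trans (conv_moll_sub (f z) z epos fi)).
  have mg : measurable_fun setT (fun w => (`|f w - f z| * moll e (w - z))%:E).
    apply/measurable_EFinP; apply: measurable_funM.
      by apply: measurableT_comp => //; exact: measurable_funB.
    exact: (measurableT_comp mm (measurable_st_sub z)).
  have := @ge0_integral_st_shift R n z _ mg.
  move=> /(_ (fun w => _)) <- => [|w]; last by rewrite lee_fin mulr_ge0// moll_ge0.
  rewrite le_eqVlt; apply/orP; left; apply/eqP; apply: eq_integral => w _ /=.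
  by rewrite addrK [z + w]addrC.
have := @fubini_tonelli _ _ _ _ R (lebesgue_st_sf R n) (lebesgue_st_sf R n) _ m1 p1.
rewrite /= => ->.
rewrite -[leRHS]mule1 -(integral_moll (0 : V) epos) -ge0_integralZl//; last 3 first.
- by apply/measurable_EFinP; apply: (measurableT_comp mm (measurable_st_sub _)).
- by move=> w _; rewrite lee_fin moll_ge0.
- by rewrite lee_fin ltW.
apply: ae_le_integral => [w _|w _|].
- by apply: integral_ge0 => z _; exact: (p1 (z, w)).
- by rewrite -EFinM lee_fin mulr_ge0 ?moll_ge0// ltW.
apply: aeW => w _; rewrite subr0.
have [wb|wb] := pselect (forall o, `|co o w| < e); last first.
  have [->] : moll e w = 0 /\ moll1 e None w = 0; last first.
    by move=> _; rewrite mule0 integral0_eq// => z _; rewrite mulr0.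
  apply: moll_eq0; apply: contrapT => /forallNP h; apply: wb => o.
  by rewrite ltNge; apply/negP; exact: h.
under eq_integral do rewrite EFinM muleC.
rewrite ge0_integralZl//; last 2 first.
- apply/measurable_EFinP; apply: measurableT_comp => //; apply: measurable_funB => //.
  exact: (measurableT_comp mf (measurable_st_shift _)).
- by rewrite lee_fin moll_ge0.
rewrite muleC lee_wpmul2r ?lee_fin ?moll_ge0//.
apply: he; split => [i|].
- exact: le_trans (ltW (wb (Some i))) ele.
- exact: le_trans (ltW (wb None)) ele.
Qed.

(** Hoelder's inequality for the splitting [|f| * moll = (|f|^s * moll)^(1/s) * moll^(1 - 1/s)], in
    which the second factor has integral 1. *)
Lemma conv_moll_jensen e f (s : R) z : 0 < e -> 1 <= s ->
  mu.-integrable setT (EFin \o f) ->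
  mu.-integrable setT (EFin \o (fun w => `|f w| `^ s)) ->
  `|conv (moll e) f z| `^ s <= conv (moll e) (fun w => `|f w| `^ s) z.
Proof.
move=> e0 s1 fi fsi; have [mm _ _] := measurable_moll e (@None 'I_n).
have [C hC] := moll_bdd e (@None 'I_n).
have bC w : `|moll e w| <= C by have [] := hC w.
have f1 := conv_integrable z mm bC fsi.
have mf : measurable_fun setT f by exact: (integrable_EFin_measurable (mu := mu)).
have mfs : measurable_fun setT (fun w => `|f w| `^ s) by exact: (integrable_EFin_measurable (mu := mu)).
have mmz : measurable_fun setT (fun w => moll e (w - z)).
  exact: (measurableT_comp mm (measurable_st_sub z)).
have := conv_moll_sub 0 z e0 fi; rewrite subr0.
under eq_integral do rewrite subr0.
(* Hoelder's exponent [1/s] must lie strictly below 1. *)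
have [->|s1'] := eqVneq s 1.
  rewrite powRr1// => h; rewrite -lee_fin; apply: (le_trans h).
  rewrite /conv /Rintegral fineK ?integrable_fin_num//; last first.
    have := conv_integrable z mm bC (integrable_norm fi).
    by apply: eq_integrable => // w _; rewrite /= powRr1.
  by under [leRHS]eq_integral do rewrite powRr1//.
have s0 : 0 < s by lra.
have t01 : 0 < s^-1 < 1 by rewrite invr_gt0 s0 invf_lt1// lt_neqAle eq_sym s1'.
have := @hoelder_pow _ _ _ mu (fun w => (`|f w| `^ s * moll e (w - z))%:E)
  (fun w => (moll e (w - z))%:E) s^-1 t01.
rewrite integral_moll// poweR1r mule1.
move=> /(_ _ _ _ _); move=> H h.
have {H}H := H (proj2 (measurable_EFinP _ _) (measurable_funM mfs mmz)) (proj2 (measurable_EFinP _ _) mmz).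
have {H}H : (\int[mu]_w (`|f w| * moll e (w - z))%:E <=
    (\int[mu]_w (`|f w| `^ s * moll e (w - z))%:E) `^ s^-1)%E.
  apply: le_trans (H _ _).
  - rewrite le_eqVlt; apply/orP; left; apply/eqP; apply: eq_integral => w _.
    rewrite !poweR_EFin -EFinM; congr (_%:E).
    rewrite powRM ?powR_ge0 ?moll_ge0// -powRrM mulfV ?gt_eqF// powRr1// -mulrA; congr (_ * _).
    have [->|m0] := eqVneq (moll e (w - z)) 0.
      by rewrite !powR0 ?mulr0// ?gt_eqF//; lra.
    by rewrite -powRD ?subrKC ?powRr1 ?moll_ge0// m0 implybT.
  - by move=> w; rewrite lee_fin mulr_ge0 ?powR_ge0 ?moll_ge0.
  - by move=> w; rewrite lee_fin moll_ge0.
have {h}H := le_trans h H.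
rewrite -lee_fin -poweR_EFin.
apply: (le_trans (le_poweR (ltW s0) _ H)); first by rewrite lee_fin.
rewrite -poweRrM mulVf ?gt_eqF// poweRe1; last first.
  by apply: integral_ge0 => w _; rewrite lee_fin mulr_ge0 ?powR_ge0 ?moll_ge0.
by rewrite /conv /Rintegral fineK ?integrable_fin_num.
Qed.

End mollification.

(** * Convergence in L^1 and almost everywhere along mollified sequences *)

Section integral_convergence.
Context d (T : measurableType d) (R : realType) (mu : {measure set T -> \bar R}).
Implicit Types (F H : nat -> T -> R) (f h : T -> R).

Definition L1cvg F f :=
  (\int[mu]_x (`|F k x - f x|)%:E)%E @[k --> \oo] --> 0%E.

Definition ae_cvg F f := {ae mu, forall x, F k x @[k --> \oo] --> f x}.

Lemma measurable_norm_sub (f g : T -> R) : measurable_fun setT f -> measurable_fun setT g ->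
  measurable_fun setT (fun x => (`|f x - g x|)%:E).
Proof.
move=> mf mg; apply/measurable_EFinP; apply: measurableT_comp => //.
exact: measurable_funB.
Qed.

(* Pratt's generalisation of dominated convergence, with varying majorants. *)
Lemma pratt F f H h : (forall k, measurable_fun setT (F k)) ->
  measurable_fun setT f -> (forall k, measurable_fun setT (H k)) ->
  mu.-integrable setT (EFin \o h) ->
  (forall k x, `|F k x| <= H k x) ->
  ae_cvg F f -> ae_cvg H h -> L1cvg H h -> L1cvg F f.
Proof.
move=> mF mf mH ih FH cF cH c1.
have mh := integrable_EFin_measurable ih.
(* Almost everywhere [|F k - f| <= H k + h <= |H k - h| + 2 * h], so what exceeds [G k] is at most
   [|H k - h|], while [G k] has the fixed majorant [2 * |h|]. *)
pose G k x := Num.min (`|F k x - f x|) (2 * `|h x|).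
have mG k : measurable_fun setT (G k).
  apply: measurable_minr; last by apply: measurable_funM => //; exact: measurableT_comp.
  exact/measurable_EFinP/measurable_norm_sub.
have i2 : mu.-integrable setT (EFin \o (fun x => 2 * `|h x|)).
  by have := integrableZl measurableT 2 (integrable_norm ih).
have G0 k x : 0 <= G k x by rewrite /G le_min normr_ge0 mulr_ge0.
have [|||||_ cG _] := @dominated_convergence _ _ _ mu setT measurableT
    (fun k => EFin \o G k) (cst 0%E) (EFin \o (fun x => 2 * `|h x|)).
- by move=> k; exact/measurable_EFinP.
- exact: measurable_cst.
- apply: filterS cF => x cx _; apply: cvg_EFin; first exact: nearW.
  rewrite /cst/= [X in _ --> X](_ : _ = Num.min (`|f x - f x|) (2 * `|h x|)); last first.
    by rewrite subrr normr0 min_l// mulr_ge0.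
  have c3 : (fun k => `|F k x - f x|) @ \oo --> `|f x - f x|.
    by apply: cvg_norm; apply: cvgB => //; exact: cvg_cst.
  rewrite subrr normr0 in c3 *; rewrite min_l ?mulr_ge0//.
  apply: (squeeze_cvgr _ (cvg_cst 0) c3).
  by near=> k; rewrite G0 /G/= ge_min lexx.
- exact: i2.
- by apply: aeW => x k _ /=; rewrite lee_fin ger0_norm ?G0// /G ge_min lexx orbT.
have key k : (\int[mu]_x (`|F k x - f x|)%:E <=
    \int[mu]_x (`|H k x - h x|)%:E + \int[mu]_x (G k x)%:E)%E.
  rewrite -ge0_integralD//; last 3 first.
  - exact: measurable_norm_sub.
  - by move=> x _; rewrite lee_fin.
  - exact/measurable_EFinP.
  apply: ae_le_integral => [x _|x _|]; first by rewrite lee_fin.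
    by rewrite -EFinD lee_fin addr_ge0.
  apply: filterS2 cF cH => x cFx cHx _; rewrite -EFinD lee_fin.
  have fh : `|f x| <= h x.
    have c3 : (fun k => `|F k x|) @ \oo --> `|f x| by exact: cvg_norm.
    by apply: (ler_cvg_to c3 cHx); apply: nearW => j.
  have := ler_normB (F k x) (f x); have := FH k x; have := ler_norm (H k x - h x).
  have := ler_norm (h x); have := normr_ge0 (H k x - h x).
  move=> h1 h2 h3 h4 h5; rewrite /G minEle; case: ifP => _; lra.
apply: (@squeeze_cvge _ _ _ _ (cst 0%E) _
  (fun k => \int[mu]_x (`|H k x - h x|)%:E + \int[mu]_x (G k x)%:E)%E) => //.
- by apply: nearW => k; rewrite key andbT integral_ge0// => x _; rewrite lee_fin.
- exact: cvg_cst.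
- rewrite -[X in _ --> X]adde0; apply: cvgeD => //.
  apply: cvg_trans cG; apply: near_eq_cvg; apply: nearW => k /=.
  by apply: eq_integral => x _ /=; rewrite subr0 ger0_norm.
Unshelve. all: by end_near. Qed.

(** The integrals of [|F k - f|] are summable, so the sum of these functions is finite almost
    everywhere and its terms tend to 0. *)
Lemma summable_cvg F f : (forall k, measurable_fun setT (F k)) ->
  measurable_fun setT f ->
  (forall k, \int[mu]_x (`|F k x - f x|)%:E <= (1 / (2 ^ k.+1)%:R)%:E)%E ->
  L1cvg F f /\ ae_cvg F f.
Proof.
move=> mF mf hF.
have mFf k := measurable_norm_sub (mF k) mf.
have s1 : (\sum_(0 <= k <oo) \int[mu]_x (`|F k x - f x|)%:E <= 1%:E)%E.
  apply: (@le_trans _ _ (\sum_(0 <= k <oo) (1 / (2 ^ k.+1)%:R)%:E)%E); last first.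
    exact: (@epsilon_trick0 R 1 xpredT ler01).
  by apply: lee_nneseries => // k _ _; apply: integral_ge0 => x _; rewrite lee_fin.
split.
  apply: (@squeeze_cvge _ _ _ _ (cst 0%E) _ (EFin \o harmonic)).
  - apply: nearW => k; rewrite integral_ge0//=.
    apply: (le_trans (hF k)); rewrite lee_fin div1r lef_pV2 ?posrE ?ltr0n ?expn_gt0//.
    by rewrite ler_nat ltnW// ltn_expl.
  - exact: cvg_cst.
  - by apply: cvg_EFin; [exact: nearW|exact: cvg_harmonic].
rewrite -integral_nneseries// in s1.
have iS : mu.-integrable setT (fun x => \sum_(0 <= k <oo) (`|F k x - f x|)%:E)%E.
  apply/integrableP; split.
    by apply: ge0_emeasurable_sum => // k x _; rewrite lee_fin.
  apply: le_lt_trans (ltry 1); apply: le_trans s1.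
  apply: ae_le_integral => // [x _|]; first by apply: nneseries_ge0 => k _ _; rewrite lee_fin.
  by apply: aeW => x _; rewrite gee0_abs// nneseries_ge0// => k _ _; rewrite lee_fin.
have := integrable_ae measurableT iS.
apply: filterS => x /(_ I) fx.
have c : cvgn (series (fun k => `|F k x - f x|)).
  apply: nnseries_is_cvg => //.
  by rewrite -ge0_fin_numE// nneseries_ge0// => k _ _; rewrite lee_fin.
have {}c := cvg_series_cvg_0 c.
by apply/subr_cvg0/norm_cvg0P; exact: c.
Qed.

End integral_convergence.

Section mollified_sequence.
Context (R : realType) (n : nat).
Local Notation V := (spacetime R n).
Local Notation mu := (lebesgue_st R n).

(** The L^1 errors are made at most [2^-(k+1)] for all [i] at once; one sequence of radii thus gives
    convergence almost everywhere for the whole finite family, with no subsequence. *)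
Lemma conv_moll_seq (I : finType) (f : I -> V -> R) (E : R) : 0 < E ->
  (forall i, mu.-integrable setT (EFin \o f i)) ->
  exists2 e : nat -> R, forall k, 0 < e k <= E &
    forall i, L1cvg mu (fun k => conv (moll (e k)) (f i)) (f i) /\
              ae_cvg mu (fun k => conv (moll (e k)) (f i)) (f i).
Proof.
move=> E0 fi.
have /boolp.choice[e he] : forall k : nat, exists e : R, 0 < e <= E /\ forall i,
    (\int[mu]_z (`|conv (moll e) (f i) z - f i z|)%:E <= (1 / (2 ^ k.+1)%:R)%:E)%E.
  move=> k.
  have k0 : 0 < 1 / (2 ^ k.+1)%:R :> R by rewrite divr_gt0// ltr0n expn_gt0.
  have /boolp.choice[e he] : forall i, exists e : R, 0 < e /\ forall e', 0 < e' <= e ->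
      (\int[mu]_z (`|conv (moll e') (f i) z - f i z|)%:E <= (1 / (2 ^ k.+1)%:R)%:E)%E.
    by move=> i; have [e0 e00 h] := conv_moll_L1 (fi i) k0; exists e0.
  exists (\big[Num.min/E]_i e i); split.
    rewrite bigmin_le_id andbT; apply: lt_bigmin => // i _; by have [] := he i.
  move=> i; have [_] := he i; apply; rewrite bigmin_le andbT.
  by apply: lt_bigmin => // j _; have [] := he j.
exists e => [k|i]; first by have [] := he k.
apply: summable_cvg => [k||k].
- apply: measurable_conv; last exact: (integrable_EFin_measurable (fi i)).
  by have [] := measurable_moll (e k) (@None 'I_n).
- exact: (integrable_EFin_measurable (fi i)).
- by have [_] := he k; apply.
Qed.

End mollified_sequence.

(** * The fundamental theorem of calculus on lines *)

Section line_integrals.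
Context (R : realType).
Local Notation mu1 := (@lebesgue_measure R).

Lemma integral_derivative (f f' : R -> R) (a b : R) : a < b ->
  (forall s : R, is_derive s 1 f (f' s)) -> continuous f' ->
  (\int[mu1]_(s in `[a, b]) (f' s)%:E = (f b - f a)%:E)%E.
Proof.
move=> ab df cf; have cF : continuous f by move=> s; exact: is_derive_continuous (df s).
rewrite EFinB; apply: continuous_FTC2 => //.
- by apply: continuous_subspaceT => x; exact: cf.
- split=> [x _||]; first by have [] := df x.
    by apply: cvg_at_right_filter; exact: cF.
  by apply: cvg_at_left_filter; exact: cF.
- by move=> x _; rewrite derive1E; have [_ ->] := df x.
Qed.

Lemma le_integral_derivative (f f' : R -> R) (g : R -> \bar R) (a x : R) : a < x ->
  f a = 0 -> (forall s : R, is_derive s 1 f (f' s)) -> continuous f' ->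
  (forall s, (`|f' s|)%:E <= g s)%E ->
  ((f x)%:E <= \int[mu1]_s g s)%E.
Proof.
move=> ax fa df cf fg; have := integral_derivative ax df cf; rewrite fa subr0 => <-.
apply: (le_trans (lee_abs _)).
have mf' : measurable_fun setT (f' : measurableTypeR R -> R) by exact: continuous_measurable_fun.
apply: (le_trans (le_abse_integral _ _ _)) => //.
  by apply: measurable_funTS; exact/measurable_EFinP.
apply: (@le_trans _ _ (\int[mu1]_s (`|f' s|)%:E)%E).
  apply: ge0_subset_integral => //.
  by apply/measurable_EFinP; exact: measurableT_comp.
apply: ae_le_integral => // [s _|].
  by apply: le_trans (fg s); rewrite lee_fin.
by apply: aeW => s _.
Qed.

End line_integrals.

(** * Sobolev inequality *)

Section sobolev.
Context (R : realType) (k : nat).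
Local Notation n := k.+1.
Local Notation mu1 := (@lebesgue_measure R).
Local Notation mun := (lebesgue_rV R k.+1).

Lemma upd_id n (v : 'rV[R]_n) (i : 'I_n) : upd v i (v 0 i) = v.
Proof. by apply/rowP => j; rewrite mxE; case: eqP => // ->. Qed.

Lemma upd_at n (v : 'rV[R]_n) (i : 'I_n) (s : R) : upd v i s 0 i = s.
Proof. by rewrite mxE eqxx. Qed.

(** Supplies the finiteness needed before a power of the same integral is divided out. *)
Lemma integral_bounded_support (f : 'rV[R]_n -> R) (C L : R) : 0 <= C ->
  (forall v, 0 <= f v <= C) -> (forall v, f v != 0 -> forall i, `|v 0 i| < L) ->
  (\int[mun]_v (f v)%:E < +oo)%E.
Proof.
move=> C0 fC fL.
pose J : set (measurableTypeR R) := `]- L, L[%classic.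
have mJ : measurable J by exact: measurable_itv.
pose B := [set v : 'rV[R]_n | forall i, J (v 0 i)].
have mB : measurable B.
  rewrite (_ : B = \bigcap_(i in setT) (rV_coord i @^-1` J)).
    apply: fin_bigcap_measurable => [|i _]; first exact: finite_finset.
    by rewrite -[X in measurable X]setTI; exact: measurable_rV_coord.
  by apply/seteqP; split => v /= vA i; [move=> _|]; exact: vA.
apply: (@le_lt_trans _ _ (\int[mun]_v (C * \1_B v)%:E)%E).
  apply: ae_le_integral => [v _|v _|].
  - by rewrite lee_fin; have /andP[] := fC v.
  - by rewrite lee_fin mulr_ge0.
  apply: aeW => v _; rewrite lee_fin.
  have [->|fv0] := eqVneq (f v) 0; first by rewrite mulr_ge0.
  rewrite indic1 ?mulr1; first by have /andP[] := fC v.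
  by move=> i; rewrite /J /= in_itv/= -ltr_norml; exact: fL.
under eq_integral do rewrite EFinM.
rewrite ge0_integralZl//; last first.
  by apply/measurable_EFinP; exact: measurable_indic.
have : (\int[mun]_v (\1_B v)%:E = \prod_(i < n) mu1 J)%E.
  apply: etrans (@lebesgue_rV_box R n (fun=> J) _) => //.
  by rewrite integral_indic// setIT.
move=> ->; rewrite lte_mul_pinfty ?lee_fin//.
have : forall l : seq 'I_n, (\prod_(i <- l) mu1 J < +oo)%E.
  elim => [|i l IH]; rewrite ?big_nil ?ltry// big_cons.
  apply: lte_mul_pinfty => //.
  by have := lebesgue_measure_itv `]- L, L[; rewrite ge0_fin_numE// => ->; case: ifP; rewrite ?ltry.
exact.
Qed.

(** The division by [X^(1 - t)] is licit because [X] is finite; [X = 0] is treated apart. *)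
Lemma poweR_absorb (X A : \bar R) (t : R) : 0 < t < 1 ->
  (0 <= X -> X < +oo -> 0 <= A -> X <= A * X `^ (1 - t) -> X `^ t <= A)%E.
Proof.
move=> /andP[t0 t1]; case: X => [x| |]//.
rewrite lee_fin => x0 _ A0 h; have [->|xn0] := eqVneq x 0.
  by rewrite poweR_EFin powR0 ?gt_eqF.
have xp : 0 < x by rewrite lt_neqAle eq_sym xn0.
rewrite !poweR_EFin in h *; have x1 : 0 < x `^ (1 - t) by rewrite powR_gt0.
rewrite -(@lee_pmul2r _ (x `^ (1 - t))%:E)// ?lte_fin//.
by rewrite -EFinM -powRD ?(addrC t) ?subrK ?powRr1// xn0 implybT.
Qed.

(** [sobolev_dual] is applied to [w^sg] and [h = w^2], with [g = sg * w^(sg - 1) * N], which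
    dominates every partial derivative of [w^sg]. Hoelder's inequality bounds the integral of [g] by
    the power [1 - 1/r] of the left-hand side, thanks to [m * (1 - 1/r) = sg - 1]; absorbing it and
    raising to the power [r] ends the proof. *)
Lemma sobolev_slice (w N : 'rV[R]_n -> R) (dw : 'I_n -> 'rV[R]_n -> R)
    (C L sg r m : R) : 0 <= C -> 1 < r -> 2 < sg ->
  m = sg + 2 / n%:R -> m * (1 - r^-1) = sg - 1 ->
  measurable_fun setT w -> measurable_fun setT N ->
  (forall v, 0 <= w v <= C) -> (forall v, 0 <= N v) ->
  (forall v, w v != 0 -> forall i, `|v 0 i| < L) ->
  (forall i v (s : R), is_derive s 1 (fun s => w (upd v i s)) (dw i (upd v i s))) ->
  (forall i v, continuous (fun s : R => dw i (upd v i s))) ->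
  (forall i v, `|dw i v| <= N v) ->
  (\int[mun]_v (w v `^ m)%:E <= (sg `^ r)%:E * \int[mun]_v (N v `^ r)%:E *
     (\int[mun]_v (w v ^+ 2)%:E) `^ (r / n%:R))%E.
Proof.
move=> C0 r1 sg2 mE mr mw mN wC N0 wL dwE cdw dwN.
have w0 v : 0 <= w v by have /andP[] := wC v.
have n0 : 0 < n%:R :> R by [].
set X := (\int[mun]_v _)%E; set D := (\int[mun]_v (N v `^ r)%:E)%E.
set E := (\int[mun]_v _)%E.
have m0 : 0 < m by rewrite mE addr_gt0// ?divr_gt0//; lra.
have Xfin : (X < +oo)%E.
  apply: (@integral_bounded_support _ (C `^ m) L); first exact: powR_ge0.
    move=> v; rewrite powR_ge0 ge0_ler_powR ?nnegrE ?w0//; last by have /andP[] := wC v.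
    exact: ltW.
  by move=> v wv; apply: wL; apply: contra wv => /eqP ->; rewrite powR0// gt_eqF.
have X0 : (0 <= X)%E by apply: integral_ge0 => v _; rewrite lee_fin powR_ge0.
have D0 : (0 <= D)%E by apply: integral_ge0 => v _; rewrite lee_fin powR_ge0.
have E0 : (0 <= E)%E by apply: integral_ge0 => v _; rewrite lee_fin sqr_ge0.
have pospE a v : posp a (w v) = w v `^ a by rewrite posp_gt0.
have mp a : measurable_fun setT (fun v => w v `^ a) by exact: (measurableT_comp (measurable_powR a) mw).
have S1 : (X <= (\int[mun]_v (sg * w v `^ (sg - 1) * N v)%:E) * E `^ n%:R^-1)%E.
  have := @sobolev_dual R k (fun v => (w v `^ sg)%:E) (fun v => (sg * w v `^ (sg - 1) * N v)%:E)
    (fun v => (w v ^+ 2)%:E).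
  move=> /(_ _ _ _ _ _ _ _) H; apply: le_trans (H _ _ _ _ _ _ _).
  - rewrite le_eqVlt; apply/orP; left; apply/eqP; apply: eq_integral => v _.
    rewrite poweR_EFin -EFinM -powR_mulrn// -powRrM mE powRD//.
    by apply/implyP => /eqP h; move: m0; rewrite mE h ltxx.
  - exact/measurable_EFinP.
  - by apply/measurable_EFinP; apply: measurable_funM => //; apply: measurable_funM.
  - by apply/measurable_EFinP; exact: measurable_funX.
  - by move=> v; rewrite lee_fin powR_ge0.
  - by move=> v; rewrite lee_fin !mulr_ge0// ?powR_ge0//; lra.
  - by move=> v; rewrite lee_fin sqr_ge0.
  move=> i v; rewrite -[v in leLHS](upd_id v i).
  (* A point to the left of both the given coordinate and the support, from which the derivative of
     [w^sg] is integrated. *)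
  pose a := Num.min (v 0 i) (- L) - 1.
  have av : a < v 0 i by rewrite ltrBlDr; apply: (@le_lt_trans _ _ (v 0 i)); rewrite ?ge_min ?lexx ?ltrDl.
  have aL : a < - L by rewrite ltrBlDr; apply: (@le_lt_trans _ _ (- L)); rewrite ?ge_min ?lexx ?orbT ?ltrDl.
  apply: (@le_integral_derivative R (fun s => w (upd v i s) `^ sg)
     (fun s => sg * posp (sg - 1) (w (upd v i s)) * dw i (upd v i s)) _ a _ av).
  - have -> : w (upd v i a) = 0; last by rewrite powR0// gt_eqF//; lra.
    apply/eqP; apply: contraTT aL => /wL /(_ i); rewrite upd_at -leNgt => /ltW.
    by rewrite ler_norml => /andP[].
  - move=> s.
    have -> : (fun s => w (upd v i s) `^ sg) = posp sg \o (fun s => w (upd v i s)).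
      by apply/funext => t /=; rewrite pospE.
    by apply: is_derive1_comp; apply: is_derive_posp; lra.
  - move=> s; apply: cvgM; last exact: cdw.
    apply: cvgM; first exact: cvg_cst.
    apply: (@continuous_comp _ _ _ (fun s => w (upd v i s)) (posp (sg - 1))).
      exact: is_derive_continuous (dwE i v s).
    by apply: is_derive_continuous; apply: is_derive_posp; lra.
  - move=> s; rewrite lee_fin normrM pospE ger0_norm ?mulr_ge0 ?powR_ge0//; last lra.
    by rewrite ler_wpM2l// mulr_ge0 ?powR_ge0//; lra.
have r0 : 0 < r by lra.
have t01 : 0 < r^-1 < 1 by rewrite invr_gt0 r0 invf_lt1.
have S2 : (\int[mun]_v (sg * w v `^ (sg - 1) * N v)%:E <= sg%:E * (D `^ r^-1 * X `^ (1 - r^-1)))%E.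
  under eq_integral do rewrite -mulrA EFinM.
  rewrite ge0_integralZl//; last 3 first.
  - by apply/measurable_EFinP; apply: measurable_funM.
  - by move=> v _; rewrite lee_fin mulr_ge0 ?powR_ge0.
  - by rewrite lee_fin; lra.
  apply: lee_wpmul2l; first by rewrite lee_fin; lra.
  have := @hoelder_pow _ _ _ mun (fun v => (N v `^ r)%:E) (fun v => (w v `^ m)%:E) _ t01.
  move=> /(_ _ _ _ _) H; apply: le_trans (H _ _ _ _).
  - rewrite le_eqVlt; apply/orP; left; apply/eqP; apply: eq_integral => v _.
    rewrite !poweR_EFin -EFinM -!powRrM mulfV ?gt_eqF// powRr1// mulrC; congr (_ * _ `^ _)%:E.
    by rewrite mr.
  - by apply/measurable_EFinP; exact: (measurableT_comp (measurable_powR r) mN).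
  - exact/measurable_EFinP.
  - by move=> v; rewrite lee_fin powR_ge0.
  - by move=> v; rewrite lee_fin powR_ge0.
have S3 : (X `^ r^-1 <= sg%:E * D `^ r^-1 * E `^ n%:R^-1)%E.
  move: (X) (D) (E) X0 D0 E0 Xfin S1 S2 => X' D' E' X0' D0' E0' Xfin' S1' S2'.
  apply: poweR_absorb => //.
    by rewrite !mule_ge0 ?poweR_ge0 ?lee_fin//; lra.
  apply: (le_trans S1'); apply: (@le_trans _ _ (sg%:E * (D' `^ r^-1 * X' `^ (1 - r^-1)) * E' `^ n%:R^-1)%E).
    by apply: lee_wpmul2r => //; exact: poweR_ge0.
  by rewrite muleA -[leLHS]muleA -[leRHS]muleA [(E' `^ _ * _)%E]muleC.
clear S1 S2; clearbody X D E.
have := @le_poweR R r _ _ (ltW r0) (poweR_ge0 _ _) S3.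
rewrite -poweRrM mulVf ?gt_eqF// poweRe1// => h; apply: (le_trans h).
rewrite !poweRM ?mule_ge0 ?poweR_ge0//; try by rewrite lee_fin; lra.
by rewrite -!poweRrM mulVf ?gt_eqF// poweRe1// poweR_EFin [n%:R^-1 * _]mulrC.
Qed.

End sobolev.

(** * Bounded measurable functions and integration by parts on space-time *)

Section bounded_measurable.
Context (R : realType) (n : nat).
Local Notation V := (spacetime R n).
Local Notation VN := ('rV[R]_n * R)%type.
Local Notation mu := (lebesgue_st R n).
Implicit Types (f g : V -> R) (z w : V).

Definition bmeas f := measurable_fun setT f /\ exists C : R, forall z, `|f z| <= C.

Definition bsupp (L : R) f := forall z, f z != 0 -> forall o, `|co o z| < L.

Lemma bmeasD f g : bmeas f -> bmeas g -> bmeas (fun z => f z + g z).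
Proof.
move=> [mf [C hC]] [mg [D hD]]; split; first exact: measurable_funD.
by exists (C + D) => z; apply: (le_trans (ler_normD _ _)); exact: lerD.
Qed.

Lemma bmeasM f g : bmeas f -> bmeas g -> bmeas (fun z => f z * g z).
Proof.
move=> [mf [C hC]] [mg [D hD]]; split; first exact: measurable_funM.
by exists (C * D) => z; rewrite normrM ler_pM.
Qed.

Lemma bmeasN f : bmeas f -> bmeas (fun z => - f z).
Proof.
move=> [mf [C hC]]; split; first exact: measurable_funN.
by exists C => z; rewrite normrN.
Qed.

Lemma bmeas_cst (c : R) : bmeas (cst c).
Proof. by split; [exact: measurable_cst|exists `|c|]. Qed.

Lemma bmeas_sum (I : Type) (r : seq I) (F : I -> V -> R) : (forall i, bmeas (F i)) ->
  bmeas (fun z => \sum_(i <- r) F i z).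
Proof.
move=> bF; elim: r => [|i r IH].
  have -> : (fun z => \sum_(i <- [::]) F i z) = cst 0 by apply/funext => z; rewrite big_nil.
  exact: bmeas_cst.
have -> : (fun z => \sum_(j <- i :: r) F j z) = (fun z => F i z + \sum_(j <- r) F j z).
  by apply/funext => z; rewrite big_cons.
exact: bmeasD.
Qed.

Lemma bmeas_indic (A : set V) : measurable A -> bmeas (fun z => \1_A z).
Proof.
move=> mA; split; first exact: measurable_indic.
by exists 1 => z; rewrite indicE; case: (_ \in _); rewrite ?normr1 ?normr0.
Qed.

Lemma bmeas_comp (G : R -> R) f : continuous G -> bmeas f -> bmeas (fun z => G (f z)).
Proof.
move=> cG [mf [C hC]]; split.
  by apply: (measurableT_comp _ mf); exact: continuous_measurable_fun.
have C0 : 0 <= C by apply: le_trans (hC 0).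
have c1 : compact (G @` `[- C, C]).
  apply: continuous_compact; last exact: segment_compact.
  by apply: continuous_subspaceT => x; exact: cG.
have [M [_ hM]] := compact_bounded c1.
exists (M + 1) => z; apply: (hM (M + 1)); first by rewrite ltrDl.
by exists (f z) => //=; rewrite in_itv/= -ler_norml.
Qed.

Lemma integrable_bsupp (L : R) f : bmeas f -> bsupp L f -> mu.-integrable setT (EFin \o f).
Proof.
move=> [mf [C hC]] fL; have C0 : 0 <= C by apply: le_trans (hC 0).
apply/integrableP; split; first exact/measurable_EFinP.
pose L' := Num.max L 0.
have L0 : 0 <= L' by rewrite le_max lexx orbT.
apply: (@le_lt_trans _ _ (\int[mu]_z (C * \1_(@box R n L') z)%:E)%E).
  apply: ae_le_integral => // [z _|]; first by rewrite lee_fin mulr_ge0.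
  apply: aeW => z _; rewrite /= lee_fin.
  have [->|fz] := eqVneq (f z) 0; first by rewrite normr0 mulr_ge0.
  rewrite indic1 ?mulr1// => o /=.
  by apply: (lt_le_trans (fL _ fz o)); rewrite le_max lexx.
under eq_integral do rewrite EFinM.
rewrite ge0_integralZl//; last first.
  by apply/measurable_EFinP; apply: measurable_indic; exact: measurable_box.
rewrite integral_indic ?setIT//; last exact: measurable_box.
by rewrite (lebesgue_st_box n L0) -EFinM ltry.
Qed.

Lemma integral_st_shift w (f : V -> \bar R) : measurable_fun setT f ->
  (\int[mu]_z f (z + w)%R = \int[mu]_z f z)%E.
Proof.
move=> mf; rewrite integralE [RHS]integralE; congr (_ - _)%E.
  rewrite -(@ge0_integral_st_shift R n w (f^\+)%E (measurable_funepos mf))//.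
  by apply: eq_integral => z _; rewrite !funeposE.
rewrite -(@ge0_integral_st_shift R n w (f^\-)%E (measurable_funeneg mf))//.
by apply: eq_integral => z _; rewrite !funenegE.
Qed.

(** By translation invariance the integral of [f (h * dir + z)] does not depend on [h];
    differentiating under the integral at [h = 0] gives the claim. *)
Lemma integral_dir_derivative (L : R) (f f1 : V -> R) o : bmeas f -> bmeas f1 ->
  bsupp L f -> bsupp L f1 ->
  (forall z : VN, is_derive z (dir R o) (f : VN -> R) (f1 z)) ->
  (\int[mu]_z (f1 z)%:E = 0)%E.
Proof.
move=> bf bf1 sf sf1 df; have [mf _] := bf; have [mf1 [C hC]] := bf1.
have C0 : 0 <= C by apply: le_trans (hC 0).
have if1 := integrable_bsupp bf1 sf1.
pose F (h : R) (z : V) : R := f (h *: dir R o + (z : VN)).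
have dF (h : R) z : is_derive h 1 (F ^~ z) (f1 (h *: dir R o + (z : VN))).
  exact: is_derive_along (df _).
have d1 h z : partial1of2 F h z = f1 (h *: dir R o + (z : VN)).
  by rewrite partial1of2E; have [_ ->] := dF h z.
have mF h (g : V -> R) : measurable_fun setT g -> measurable_fun setT (fun z : V => g (h *: dir R o + (z : VN))).
  move=> mg; have := measurableT_comp mg (measurable_st_shift (h *: dir R o)).
  by congr (measurable_fun _ _); apply/funext => z /=; rewrite addrC.
have coF h z o' : `|co o' z| <= `|co o' (h *: dir R o + (z : VN))| + `|h|.
  rewrite co_line.
  rewrite -{1}[co o' z](addrK (h * (o' == o)%:R)).
  apply: (le_trans (ler_normB _ _)); rewrite lerD2l normrM ler_piMr//.
  by case: (_ == _); rewrite ?normr1 ?normr0.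
have Fint h : mu.-integrable setT (EFin \o F h).
  apply: (@integrable_bsupp (L + `|h|)).
    split; first exact: mF.
    by have [_ [D hD]] := bf; exists D => z; exact: hD.
  by move=> z /sf h1 o'; apply: (le_lt_trans (coF h z o')); rewrite ltrD2r.
(* For [|h| < 1] the shifted derivative is supported in the box enlarged by 1. *)
pose G z : R := C * \1_(@box R n (L + 1)) z.
have iG : mu.-integrable setT (EFin \o G).
  apply: (@integrable_bsupp (L + 1)).
    by apply: bmeasM; [exact: bmeas_cst|apply: bmeas_indic; exact: measurable_box].
  move=> z; rewrite /G; have [zB _|zB] := pselect (box (L + 1) z); first exact: zB.
  by rewrite indic0// mulr0 eqxx.
have I0 : `]-1, 1[%classic (0 : R) by rewrite /= in_itv/= ltrN10 ltr01.
have := @cvg_differentiation_under_integral _ _ _ mu F setT measurableT 0 (-1) 1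
  I0 (fun h _ => Fint h) (fun h w _ _ => @ex_derive _ _ _ _ _ _ _ (dF h w)) G _ iG _.
have Fc (h : R) : \int[mu]_y F h y = \int[mu]_y f y.
  rewrite /Rintegral; congr fine.
  have mfE : measurable_fun setT (EFin \o f) by exact/measurable_EFinP.
  rewrite -(integral_st_shift (h *: dir R o) mfE).
  by apply: eq_integral => z _; rewrite /F /= addrC.
move=> H; have {H}H := H _ _.
have e1 : \int[mu]_y partial1of2 F 0 y = 0.
  apply: (cvg_unique _ (H _ _)) => //.
  - by move=> z; rewrite mulr_ge0.
  - move=> h z hI _; rewrite d1 /G.
    have [->|fz] := eqVneq (f1 (h *: dir R o + (z : VN))) 0; first by rewrite normr0 mulr_ge0.
    rewrite indic1 ?mulr1// => o' /=; apply: (le_lt_trans (coF h z o')).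
    apply: ltrD; first exact: sf1.
    by move: hI; rewrite /= in_itv/= -ltr_norml.
  - rewrite (_ : (fun _ => _) = cst 0); first exact: cvg_cst.
    by apply/funext => h; rewrite !Fc subrr scaler0.
have := integrable_fin_num measurableT if1; move=> /fineK <-.
rewrite -[RHS]/(0%R%:E) -e1 /Rintegral; congr (fine _)%:E.
by apply: eq_integral => z _; rewrite /= d1 scale0r add0r.
Qed.

End bounded_measurable.
(** * Energy estimates *)

Section energy.
Context (R : realType) (n : nat).
Local Notation V := (spacetime R n).
Local Notation VN := ('rV[R]_n * R)%type.
Local Notation mu := (lebesgue_st R n).
Implicit Types (z w : V).

Definition before (tau : R) : set V := [set z | z.2 <= tau].

Lemma measurable_before tau : measurable (before tau).
Proof.
rewrite (_ : before tau = co None @^-1` `]-oo, tau]).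
  by rewrite -[X in measurable X]setTI; exact: (@measurable_co R n None).
by apply/seteqP; split => z; rewrite /= in_itv.
Qed.

Lemma indic_before tau z : \1_(before tau) z = ((co None z <= tau)%R)%:R :> R.
Proof.
case: (leP (co None z) tau) => h; first exact: indic1.
by apply: indic0; rewrite /before/= => h'; move: h; rewrite ltNge h'.
Qed.

Lemma line_t (x : 'rV[R]_n) (t : R) : (t *: dir R None + (x, 0) : VN) = (x, t).
Proof. by rewrite /dir; congr pair; [rewrite /= scaler0 add0r|rewrite /= addr0; exact: mulr1]. Qed.

Lemma integral_cut (L tau : R) (f : V -> R) : bmeas f ->
  (forall z, z.2 <= tau -> f z != 0 -> forall o, `|co o z| < L) ->
  mu.-integrable setT (EFin \o (fun z => \1_(before tau) z * f z)).
Proof.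
move=> bf sf; apply: (@integrable_bsupp _ _ L).
  by apply: bmeasM => //; apply: bmeas_indic; exact: measurable_before.
move=> z; have [zB|zB] := pselect (before tau z); last by rewrite indic0// mul0r eqxx.
by rewrite indic1// mul1r; exact: sf.
Qed.

(** The indicator of [t <= tau] cannot be differentiated in time; on each line parallel to the time
    axis the fundamental theorem of calculus turns the integral up to [tau] into the value at
    [t = tau]. *)
Lemma integral_before (L tau : R) (P P1 : V -> R) : bmeas P -> bmeas P1 ->
  (forall z, z.2 <= tau -> P z != 0 -> forall o, `|co o z| < L) ->
  (forall z, z.2 <= tau -> P1 z != 0 -> forall o, `|co o z| < L) ->
  (forall z : VN, is_derive z (dir R None) (P : VN -> R) (P1 z)) ->
  (forall x, continuous (fun t : R => P1 (x, t))) ->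
  (\int[mu]_z (\1_(before tau) z * P1 z)%:E = \int[lebesgue_rV R n]_x (P (x, tau))%:E)%E.
Proof.
move=> bP bP1 sP sP1 dP cP1.
have := integral12_prod_meas1 (integral_cut bP1 sP1) => <-.
apply: eq_integral => x _.
pose a := Num.min tau (- L) - 1.
have aT : a < tau by rewrite ltrBlDr; apply: (@le_lt_trans _ _ tau); rewrite ?ge_min ?lexx ?ltrDl.
have aL : a < - L by rewrite ltrBlDr; apply: (@le_lt_trans _ _ (- L)); rewrite ?ge_min ?lexx ?orbT ?ltrDl.
have d1 (t : R) : is_derive t 1 (fun t => P (x, t)) (P1 (x, t)).
  have := dP (t *: dir R None + (x, 0)) => /is_derive_along.
  rewrite line_t; congr (is_derive _ _ _ _); apply/funext => s.
  by rewrite line_t.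
have Pa : P (x, a) = 0.
  apply/eqP; apply: contraTT aL => h; rewrite -leNgt.
  by have := sP (x, a) (ltW aT) h None => /ltW; rewrite /= ler_norml => /andP[].
have := integral_derivative aT d1 (cP1 x); rewrite Pa subr0 => <-.
rewrite /fubini_F [RHS]integral_mkcond; apply: eq_integral => t _.
rewrite /= patchE; case: ifPn => [|].
  by rewrite inE/= in_itv/= => /andP[_ tT]; rewrite indic1// mul1r.
rewrite notin_setE /= in_itv/= => /negP; rewrite negb_and -!ltNge => /orP[ta|tT]; last first.
  by rewrite indic_before leNgt tT mul0r.
have [tT|tT] := leP t tau; last first.
  by rewrite indic_before leNgt tT mul0r.
have [->|h] := eqVneq (P1 (x, t)) 0; first by rewrite mulr0.
have := sP1 (x, t) tT h None => /ltW; rewrite /= ler_norml => /andP[h1 _].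
by exfalso; have := lt_trans ta aL; rewrite ltNge h1.
Qed.

(* Testing the pointwise inequality U_t <= div A with g(U) eta. *)
Lemma energy_identity (L tau : R) (Phi g g1 : R -> R) (U eta : V -> R)
    (U1 eta1 : option 'I_n -> V -> R) (A A1 : 'I_n -> V -> R) :
  (forall s : R, is_derive s 1 Phi (g s)) -> (forall s : R, is_derive s 1 g (g1 s)) ->
  continuous g1 -> (forall s, 0 <= g s) ->
  bmeas U -> (forall o, bmeas (U1 o)) -> (forall i, bmeas (A i)) ->
  (forall i, bmeas (A1 i)) -> bmeas eta -> (forall o, bmeas (eta1 o)) ->
  (forall o (z : VN), is_derive z (dir R o) (U : VN -> R) (U1 o z)) ->
  (forall o (z : VN), is_derive z (dir R o) (eta : VN -> R) (eta1 o z)) ->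
  (forall i (z : VN), is_derive z (dir R (Some i)) (A i : VN -> R) (A1 i z)) ->
  (forall x, continuous (fun t : R => U1 None (x, t))) ->
  (forall x, continuous (fun t : R => eta1 None (x, t))) ->
  (forall z, 0 <= eta z) -> (forall o z, eta z = 0 -> eta1 o z = 0) ->
  (forall z, z.2 <= tau -> eta z != 0 -> forall o, `|co o z| < L) ->
  (forall z, z.2 <= tau -> eta z != 0 -> U1 None z <= \sum_i A1 i z) ->
  (\int[lebesgue_rV R n]_x (Phi (U (x, tau)) * eta (x, tau))%:E <=
   \int[mu]_z (\1_(before tau) z * (Phi (U z) * eta1 None z -
      \sum_i A i z * (g1 (U z) * U1 (Some i) z * eta z + g (U z) * eta1 (Some i) z)))%:E)%E.
Proof.
move=> dPhi dg cg1 g0 bU bU1 bA bA1 beta beta1 dU deta dA cU1 ceta1 eta0 eta10 seta pde.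
have cPhi : continuous Phi by move=> s; exact: is_derive_continuous (dPhi s).
have cg : continuous g by move=> s; exact: is_derive_continuous (dg s).
have bPhiU := bmeas_comp cPhi bU; have bgU := bmeas_comp cg bU.
have bg1U := bmeas_comp cg1 bU.
(* As [Phi' = g], the function [P1] is the time derivative of [P]; [F1 i] is the derivative of [F i]
   in direction [i]. *)
pose P z := Phi (U z) * eta z.
pose P1 z := Phi (U z) * eta1 None z + eta z * (g (U z) * U1 None z).
pose F i z := g (U z) * eta z * A i z.
pose F1 i z := g (U z) * eta z * A1 i z +
   A i z * (g1 (U z) * U1 (Some i) z * eta z + g (U z) * eta1 (Some i) z).
pose rhs z := Phi (U z) * eta1 None z -
   \sum_i A i z * (g1 (U z) * U1 (Some i) z * eta z + g (U z) * eta1 (Some i) z).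
have supp (f : V -> R) : (forall z, eta z = 0 -> f z = 0) ->
    forall z, z.2 <= tau -> f z != 0 -> forall o, `|co o z| < L.
  by move=> h z zt fz; apply: seta => //; apply: contra fz => /eqP/h ->.
have bG i : bmeas (fun z => A i z * (g1 (U z) * U1 (Some i) z * eta z + g (U z) * eta1 (Some i) z)).
  by apply: bmeasM => //; apply: bmeasD; apply: bmeasM => //; exact: bmeasM.
have bP : bmeas P by exact: bmeasM.
have bP1 : bmeas P1 by apply: bmeasD; apply: bmeasM => //; exact: bmeasM.
have bF i : bmeas (F i) by apply: bmeasM => //; exact: bmeasM.
have bF1 i : bmeas (F1 i) by apply: bmeasD => //; apply: bmeasM => //; exact: bmeasM.
have brhs : bmeas rhs.
  by apply: bmeasD; [exact: bmeasM|apply: bmeasN; apply: bmeas_sum].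
have zP z : eta z = 0 -> P z = 0 by move=> h; rewrite /P h mulr0.
have zP1 z : eta z = 0 -> P1 z = 0 by move=> h; rewrite /P1 h (eta10 _ _ h) mulr0 mul0r addr0.
have zF i z : eta z = 0 -> F i z = 0 by move=> h; rewrite /F h mulr0 mul0r.
have zF1 i z : eta z = 0 -> F1 i z = 0.
  by move=> h; rewrite /F1 h (eta10 _ _ h) !mulr0 mul0r addr0 mulr0 addr0.
have zrhs z : eta z = 0 -> rhs z = 0.
  move=> h; rewrite /rhs (eta10 _ _ h) mulr0 big1 ?subr0// => i _.
  by rewrite h (eta10 _ _ h) !mulr0 addr0 mulr0.
have dP (z : VN) : is_derive z (dir R None) (P : VN -> R) (P1 z).
  have d1 := is_derive_circ (dPhi (U z)) (dU None z).
  exact: (is_deriveM d1 (deta None z)).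
have cU x : continuous (fun t : R => U (x, t)).
  move=> t; apply: (@is_derive_continuous _ _ (U1 None (x, t))).
  have := dU None (t *: dir R None + (x, 0)) => /is_derive_along.
  rewrite line_t; congr (is_derive _ _ _ _); apply/funext => s.
  by rewrite line_t.
have ceta x : continuous (fun t : R => eta (x, t)).
  move=> t; apply: (@is_derive_continuous _ _ (eta1 None (x, t))).
  have := deta None (t *: dir R None + (x, 0)) => /is_derive_along.
  rewrite line_t; congr (is_derive _ _ _ _); apply/funext => s.
  by rewrite line_t.
have cc (h : R -> R) x : continuous h -> continuous (fun t : R => h (U (x, t))).
  by move=> ch t; apply: (@continuous_comp _ _ _ (fun t => U (x, t)) h); [exact: cU|exact: ch].
have cP1 x : continuous (fun t : R => P1 (x, t)).
  move=> t; apply: cvgD; apply: cvgM.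
  - exact: cc.
  - exact: ceta1.
  - exact: ceta.
  - by apply: cvgM; [exact: cc|exact: cU1].
have := integral_before bP bP1 (supp _ zP) (supp _ zP1) dP cP1 => /= <-.
have dF i (z : VN) : is_derive z (dir R (Some i)) (F i : VN -> R) (F1 i z).
  have d1 := is_derive_circ (dg (U z)) (dU (Some i) z).
  have d2 := is_deriveM (is_deriveM d1 (deta (Some i) z)) (dA i z).
  apply: (is_derive_eq d2).
  change (g (U z) * eta z * A1 i z + A i z *
    (g (U z) * eta1 (Some i) z + eta z * (g1 (U z) * U1 (Some i) z)) = F1 i z).
  rewrite /F1; lra.
(* The indicator depends on time only and passes through the spatial derivatives. *)
have F0 i : (\int[mu]_z (\1_(before tau) z * F1 i z)%:E = 0)%E.
  have bi := bmeas_indic (measurable_before tau).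
  apply: (@integral_dir_derivative _ _ L (fun z => \1_(before tau) z * F i z) _ (Some i)).
  - exact: bmeasM.
  - exact: bmeasM.
  - move=> z; have [zB|zB] := pselect (before tau z); last by rewrite indic0// mul0r eqxx.
    rewrite indic1// mul1r; exact: (supp _ (zF i)).
  - move=> z; have [zB|zB] := pselect (before tau z); last by rewrite indic0// mul0r eqxx.
    rewrite indic1// mul1r; exact: (supp _ (zF1 i)).
  - move=> z; apply/is_derive_line.
    have -> : (fun h : R => \1_(before tau) (h *: dir R (Some i) + z) * F i (h *: dir R (Some i) + z)) =
        \1_(before tau) z *: (fun h : R => F i (h *: dir R (Some i) + z)).
      apply/funext => h; congr (_ * _).
      by rewrite !indic_before co_line mulr0 addr0.
    exact: (is_deriveZ _ (proj1 (is_derive_line _ _ _ _) (dF i z))).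
have iF1 i := integral_cut (bF1 i) (supp _ (zF1 i)).
have irhs := integral_cut brhs (supp _ zrhs).
have iP1 := integral_cut bP1 (supp _ zP1).
have iS := integrable_sum measurableT (index_enum 'I_n) (P := xpredT) (fun i _ => iF1 i).
(* Adding the vanishing integrals of the [F1 i] reduces the claim to a pointwise inequality of
   integrands. *)
have E1 : (\int[mu]_z (\1_(before tau) z * rhs z)%:E =
    \int[mu]_z (\sum_i (\1_(before tau) z * F1 i z)%:E + (\1_(before tau) z * rhs z)%:E))%E.
  rewrite (integralD measurableT iS irhs) (integral_sum measurableT iF1) big1 ?add0e// => i _; exact: F0.
apply: (le_trans _ (lexx _)); rewrite [leRHS]E1.
apply: le_integral => //.
  have := integrableD measurableT iS irhs.
  by apply: eq_integrable => // z _ /=; rewrite sumEFin.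
move=> z _; rewrite sumEFin -EFinD lee_fin -mulr_sumr -mulrDr.
have [zB|zB] := pselect (before tau z); last by rewrite indic0// !mul0r.
rewrite indic1// !mul1r /rhs /F1 big_split/= /P1 -mulr_sumr.
have : g (U z) * eta z * U1 None z <= g (U z) * eta z * \sum_i A1 i z.
  have [->|e0] := eqVneq (eta z) 0; first by rewrite mulr0 !mul0r.
  by apply: ler_wpM2l; [exact: mulr_ge0|exact: pde].
lra.
Qed.

End energy.
Section parabolic_sobolev.
Context (R : realType) (k : nat).
Local Notation n := k.+1.
Local Notation V := (spacetime R k.+1).
Local Notation VN := ('rV[R]_k.+1 * R)%type.
Local Notation mu := (lebesgue_st R k.+1).

Lemma line_x (x : 'rV[R]_n) (i : 'I_n) (s t : R) :
  (s *: dir R (Some i) + (upd x i 0, t) : VN) = (upd x i s, t).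
Proof.
rewrite /dir; congr pair; last by rewrite /= [s *: 0]mulr0 add0r.
apply/rowP => j; rewrite !mxE eqxx/= eq_sym; case: eqP => _.
  by rewrite mulr1 addr0.
by rewrite mulr0 add0r.
Qed.

Lemma measurable_slice (f : V -> R) (t : R) : measurable_fun setT f ->
  measurable_fun setT (fun x : 'rV[R]_n => f (x, t)).
Proof. by move=> mf; apply: (measurableT_comp mf); exact: measurable_pair2. Qed.

(** On each slice up to [t1] the L^2 factor is at most [E], uniformly, and leaves the time integral;
    the later slices are cut away. *)
Lemma sobolev_parabolic (w N : V -> R) (dw : 'I_n -> V -> R)
    (C L sg r m t1 E : R) : 0 <= C -> 1 < r -> 2 < sg ->
  m = sg + 2 / n%:R -> m * (1 - r^-1) = sg - 1 ->
  measurable_fun setT w -> measurable_fun setT N ->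
  (forall z, 0 <= w z <= C) -> (forall z, 0 <= N z) ->
  (forall z, z.2 <= t1 -> w z != 0 -> forall o, `|co o z| < L) ->
  (forall i (z : VN), is_derive z (dir R (Some i)) (w : VN -> R) (dw i z)) ->
  (forall i (z : VN), continuous (fun s : R => dw i (s *: dir R (Some i) + z))) ->
  (forall i z, `|dw i z| <= N z) ->
  (forall t, t <= t1 -> (\int[lebesgue_rV R n]_x (w (x, t) ^+ 2)%:E <= E%:E)%E) ->
  (\int[mu]_z (\1_(before t1) z * w z `^ m)%:E <=
   (sg `^ r * E `^ (r / n%:R))%:E * \int[mu]_z (\1_(before t1) z * N z `^ r)%:E)%E.
Proof.
move=> C0 r1 sg2 mE mr mw mN wC N0 wL dwE cdw dwN hE.
have mpow (f : V -> R) a : measurable_fun setT f ->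
    measurable_fun setT (fun z => (\1_(before t1) z * f z `^ a)%:E).
  move=> mf; apply/measurable_EFinP; apply: measurable_funM.
    apply: measurable_indic; exact: measurable_before.
  exact: (measurableT_comp (measurable_powR a) mf).
have p0 (f : V -> R) a z : (0 <= (\1_(before t1) z * f z `^ a)%:E)%E.
  by rewrite lee_fin mulr_ge0 ?powR_ge0.
rewrite (@ge0_integral_st_sym _ _ _ (mpow w m mw) (p0 w m)).
rewrite (@ge0_integral_st_sym _ _ _ (mpow N r mN) (p0 N r)).
rewrite -ge0_integralZl//; last 3 first.
- have := @measurable_integral1 R _ _ _ _ (lebesgue_rV R n) _ (mpow N r mN) (p0 N r); by [].
- by move=> t _; apply: integral_ge0 => x _; exact: p0.
- by rewrite lee_fin mulr_ge0 ?powR_ge0.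
apply: ae_le_integral => [t _|t _|].
- by apply: integral_ge0 => x _; exact: p0.
- by rewrite mule_ge0 ?lee_fin ?mulr_ge0 ?powR_ge0// integral_ge0// => x _; exact: p0.
apply: aeW => t _; have [tt1|tt1] := leP t t1; last first.
  rewrite integral0_eq => [|x _]; last by rewrite indic_before /= leNgt tt1 mul0r.
  rewrite mule_ge0// ?lee_fin ?mulr_ge0 ?powR_ge0//.
  by apply: integral_ge0 => x _; exact: p0.
have e1 (f : V -> R) a : (\int[lebesgue_rV R n]_x (\1_(before t1) (x, t) * f (x, t) `^ a)%:E =
    \int[lebesgue_rV R n]_x (f (x, t) `^ a)%:E)%E.
  by apply: eq_integral => x _; rewrite indic_before /= tt1 mul1r.
rewrite !e1.
have S := @sobolev_slice R k (fun x => w (x, t)) (fun x => N (x, t))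
  (fun i x => dw i (x, t)) C L sg r m C0 r1 sg2 mE mr
  (measurable_slice t mw) (measurable_slice t mN).
apply: le_trans (S _ _ _ _ _ _) _ => //.
- move=> v wv i; exact: (wL (v, t) tt1 wv (Some i)).
- move=> i v s; have := dwE i (s *: dir R (Some i) + (upd v i 0, t)) => /is_derive_along.
  rewrite line_x; congr (is_derive _ _ _ _); apply/funext => h.
  by rewrite line_x.
- move=> i v; have := cdw i (upd v i 0, t).
  by rewrite (_ : (fun s => dw i (_ + _)) = (fun s => dw i (upd v i s, t)))//; apply/funext => h; rewrite line_x.
rewrite EFinM muleAC; apply: lee_wpmul2r.
  by apply: integral_ge0 => x _; rewrite lee_fin powR_ge0.
apply: lee_wpmul2l; first by rewrite lee_fin powR_ge0.
rewrite -poweR_EFin; apply: le_poweR.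
- by rewrite divr_ge0//; lra.
- by apply: integral_ge0 => x _; rewrite lee_fin sqr_ge0.
- exact: hE.
Qed.

End parabolic_sobolev.

(** * Limits of integrals and one-sided comparison *)

Section limits_of_integrals.
Context d (T : measurableType d) (R : realType) (mu : {measure set T -> \bar R}).
Implicit Types (F : nat -> T -> R) (f : T -> R).

(** Fatou's lemma with a bound that holds only from some index on: shifting the sequence past that
    index keeps the limit. *)
Lemma fatou_le F f (b : \bar R) : (forall k, measurable_fun setT (F k)) ->
  (forall k x, 0 <= F k x) -> (forall x, 0 <= f x) -> ae_cvg mu F f ->
  (\forall k \near \oo, (\int[mu]_x (F k x)%:E <= b)%E) ->
  (\int[mu]_x (f x)%:E <= b)%E.
Proof.
move=> mF F0 f0 cF [N _ hN].
pose G j x := (F (j + N)%N x)%:E.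
have mG j : measurable_fun setT (G j) by exact/measurable_EFinP.
have G0 j x : setT x -> (0 <= G j x)%E by move=> _; rewrite lee_fin.
apply: (@le_trans _ _ (\int[mu]_x limn_einf (G^~ x))%E).
  apply: ae_le_integral => [x _|x _|]; first by rewrite lee_fin.
    rewrite limn_einf_lim; apply: lime_ge; first exact: is_cvg_einfs.
    apply: nearW => j; rewrite /einfs; apply: le_ereal_inf_tmp => _ [i _ <-]; exact: G0.
  apply: filterS cF => x cx _.
  have : G^~ x @ \oo --> (f x)%:E.
    apply: cvg_EFin; first exact: nearW.
    by have := cx; rewrite -(cvg_shiftn N).
  by move=> /cvg_limn_einf_sup[-> _].
apply: (le_trans (fatou mu measurableT mG G0)).
rewrite limn_einf_lim; apply: lime_le; first exact: is_cvg_einfs.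
apply: nearW => j; apply: (@le_trans _ _ (\int[mu]_x G j x)%E).
  by apply: ereal_inf_lbound; exists j => /=.
by apply: hN => /=; rewrite leq_addl.
Qed.

Lemma L1cvg_affine F f (g : T -> R) (c : R) : (forall k, measurable_fun setT (F k)) ->
  measurable_fun setT f -> L1cvg mu F f ->
  L1cvg mu (fun k x => g x + c * F k x) (fun x => g x + c * f x).
Proof.
move=> mF mf cF; rewrite /L1cvg.
rewrite (_ : (fun k => _) = (fun k => (`|c|)%:E * \int[mu]_x (`|F k x - f x|)%:E)%E); last first.
  apply/funext => k; rewrite -ge0_integralZl//; last exact: measurable_norm_sub.
  apply: eq_integral => x _; rewrite -EFinM -normrM; congr (`|_|%:E); lra.
by rewrite -[X in _ --> X](mule0 (`|c|)%:E); apply: cvgeZl.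
Qed.

Lemma ae_cvg_comp2 F f (g : T -> R) (c : R) : ae_cvg mu F f ->
  ae_cvg mu (fun k x => g x + c * F k x) (fun x => g x + c * f x).
Proof.
apply: filterS => x cx; apply: cvgD; first exact: cvg_cst.
by apply: cvgM => //; exact: cvg_cst.
Qed.

Lemma L1cvg_near F f (de : R) : L1cvg mu F f -> 0 < de ->
  \forall k \near \oo, (\int[mu]_x (`|F k x - f x|)%:E <= de%:E)%E.
Proof.
move=> cF d0.
have [N _ hN] := cF _ (@nbhs_open_ereal_lt R 0 (fun=> de) d0).
by exists N => // k Nk; apply: ltW; exact: hN.
Qed.

(** Since [g >= 0], it suffices to compare [g] with the positive part of [f]; so [f] may be neither
    measurable nor integrable. *)
Lemma integral_le_ge0 (f g : T -> \bar R) : (forall x, 0 <= g x)%E ->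
  (forall x, f x <= g x)%E -> (\int[mu]_x f x <= \int[mu]_x g x)%E.
Proof.
move=> g0 fg; rewrite integralE.
apply: (@le_trans _ _ (\int[mu]_x f^\+ x)%E).
  by rewrite -[leRHS]sube0; apply: leeB => //; exact: integral_ge0.
apply: ae_le_integral => //; apply: aeW => x _.
by rewrite funeposE ge_max fg g0.
Qed.

Lemma L1cvg_integral_ge0 F f : (forall k, measurable_fun setT (F k)) ->
  mu.-integrable setT (EFin \o f) -> L1cvg mu F f ->
  (forall k, 0 <= \int[mu]_x (F k x)%:E)%E -> (0 <= \int[mu]_x (f x)%:E)%E.
Proof.
move=> mF fi cF F0; apply/lee_addgt0Pr => de d0.
have [N _ hN] := L1cvg_near cF d0; have {}hN := hN N (leqnn N).
have mf := integrable_EFin_measurable fi.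
have di : mu.-integrable setT (EFin \o (fun x => F N x - f x)).
  apply/integrableP; split; first exact/measurable_EFinP/measurable_funB.
  by apply: le_lt_trans (ltry de).
apply: (le_trans (F0 N)); apply: (@le_trans _ _ (\int[mu]_x ((f x)%:E + (F N x - f x)%:E))%E).
  by rewrite le_eqVlt; apply/orP; left; apply/eqP; apply: eq_integral => x _; rewrite -EFinD subrKC.
rewrite integralD//; apply: leeD => //; apply: le_trans hN.
by apply: integral_le_ge0 => x; rewrite lee_fin// ler_norm.
Qed.

End limits_of_integrals.
(** Used in [caccioppoli] with [e] the mollified integrand, [x] its limit, [c] the flux, [a] the
    energy density and [d] the distance of [e] to [x]. *)
Lemma bound_of_excess (R : realFieldType) (a c d e x : R) :
  e - x <= d -> a <= c - x -> 0 <= a -> e <= c + d.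
Proof. lra. Qed.

(** * Energy inequality and Sobolev bound after removing the mollification *)

Section caccioppoli.
Context (R : realType) (k : nat).
Local Notation n := k.+1.
Local Notation V := (spacetime R k.+1).
Local Notation VN := ('rV[R]_k.+1 * R)%type.
Local Notation mu := (lebesgue_st R k.+1).

Lemma bmeas_conv (K f : V -> R) (C : R) : measurable_fun setT K ->
  (forall w, `|K w| <= C) -> mu.-integrable setT (EFin \o f) -> bmeas (conv K f).
Proof.
move=> mK bK fi; split; first exact: (measurable_conv mK (integrable_EFin_measurable fi)).
by exists (C * \int[mu]_w `|f w|) => z; exact: conv_bdd.
Qed.

Lemma conv_moll_le (e : R) (f g : V -> R) z : 0 < e ->
  mu.-integrable setT (EFin \o f) -> mu.-integrable setT (EFin \o g) ->
  (forall w, f w <= g w) -> conv (moll e) f z <= conv (moll e) g z.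
Proof.
move=> e0 fi gi fg; have [mm _ _] := measurable_moll e (@None 'I_n).
have [C hC] := moll_bdd e (@None 'I_n).
have bC (w : V) : `|moll e w| <= C by have [] := hC w.
apply: le_Rintegral => //; [exact: (conv_integrable z mm bC fi)|exact: (conv_integrable z mm bC gi)|].
by move=> w _; rewrite ler_wpM2r// moll_ge0.
Qed.

Lemma powR_le1D (t H : R) : 0 <= t <= 1 -> 0 <= H -> H `^ t <= 1 + H.
Proof.
move=> /andP[t0 t1] H0; have [H1|H1] := leP H 1.
  apply: (@le_trans _ _ (1 `^ t)); first by rewrite ge0_ler_powR ?nnegrE.
  by rewrite powR1 lerDl.
apply: (@le_trans _ _ (H `^ 1)); first by rewrite ler_powR// ltW.
by rewrite powRr1// lerDr.
Qed.

Context (s s' r : R) (Phi g g1 : R -> R).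
Hypotheses (s2 : 2 <= s) (ss' : s^-1 + s'^-1 = 1) (s'0 : 0 < s') (r1 : 1 < r) (rs : r <= s)
  (dPhi : forall x : R, is_derive x 1 Phi (g x)) (dg : forall x : R, is_derive x 1 g (g1 x))
  (cg1 : continuous g1) (g1_01 : forall x, 0 <= g1 x <= 1)
  (g_le : forall x, 0 <= g x <= `|x|) (Phi_le : forall x, g x ^+ 2 <= 2 * Phi x <= x ^+ 2).

(** The integrand on the right of the energy inequality, as a function of the values of [u], [Du],
    [A], the cutoff and its derivatives. The mollified and the limiting integrand are then one
    function of different arguments. *)
Definition excess (x : R) (d a : 'I_n -> R) (e : R) (e1 : option 'I_n -> R) : R :=
  Phi x * e1 None - \sum_i a i * (g1 x * d i * e + g x * e1 (Some i)).

(** A common majorant of the spatial derivatives of [g (u) * eta]. *)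
Definition slope (x : R) (d : 'I_n -> R) (e : R) (e1 : option 'I_n -> R) : R :=
  \sum_i (g1 x * `|d i| * e + g x * `|e1 (Some i)|).

Lemma young_le (x y H : R) : `|x| `^ s' <= H -> `|y| `^ s <= H -> `|x| * `|y| <= 2 * H.
Proof.
move=> h1 h2; have s0 : 0 < s by exact: lt_le_trans s2.
have := conjugate_powR (normr_ge0 x) (normr_ge0 y) s'0 s0; rewrite addrC => /(_ ss').
have i1 : s'^-1 <= 1 by have := invr_gt0 s; rewrite s0 => h; move: (ss'); lra.
have i2 : s^-1 <= 1 by have := invr_gt0 s'; rewrite s'0 => h; move: (ss'); lra.
have : `|x| `^ s' / s' <= `|x| `^ s' by rewrite ler_piMr ?powR_ge0.
have : `|y| `^ s / s <= `|y| `^ s by rewrite ler_piMr ?powR_ge0.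
lra.
Qed.

(** [x^2 <= 1 + H] because [s >= 2], and products with [a i] are split by Young's inequality for [s]
    and [s']. The bound is affine in [H], which will be a mollified majorant converging in L^1, as
    Pratt's theorem requires. *)
Lemma excess_le (x e H Ce : R) (d a : 'I_n -> R) (e1 : option 'I_n -> R) :
  `|x| `^ s <= H -> (forall i, `|d i| `^ s <= H) -> (forall i, `|a i| `^ s' <= H) ->
  0 <= e <= 1 -> 1 <= Ce -> (forall o, `|e1 o| <= Ce) ->
  `|excess x d a e e1| <= Ce * (1 + (1 + 4 * n%:R) * H).
Proof.
move=> xH dH aH /andP[e0 e_1] Ce1 e1C.
have H0 : 0 <= H by apply: le_trans xH; exact: powR_ge0.
have /andP[P1 P2] := Phi_le x; have /andP[gp gx] := g_le x.
have /andP[g10 g11] := g1_01 x.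
have P0 : 0 <= Phi x by have := sqr_ge0 (g x); lra.
have x2 : x ^+ 2 <= 1 + H.
  rewrite -[x ^+ 2]ger0_norm ?sqr_ge0// normrX -powR_mulrn//.
  have [x1|x1] := leP `|x| 1.
    apply: (@le_trans _ _ (1 `^ 2)); first by rewrite ge0_ler_powR ?nnegrE.
    by rewrite powR1 lerDl.
  apply: (@le_trans _ _ (`|x| `^ s)); first by rewrite ler_powR// ltW.
  by apply: (le_trans xH); rewrite lerDr.
have T1 : `|Phi x * e1 None| <= Ce * (1 + H).
  rewrite normrM (ger0_norm P0) mulrC; apply: ler_pM => //.
  have := sqr_ge0 x; lra.
have T2 i : `|a i * (g1 x * d i * e + g x * e1 (Some i))| <= Ce * (4 * H).
  rewrite normrM.
  have b1 : `|g1 x * d i * e + g x * e1 (Some i)| <= Ce * (`|d i| + `|x|).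
    apply: (le_trans (ler_normD _ _)); rewrite mulrDr; apply: lerD.
      rewrite !normrM (ger0_norm g10) (ger0_norm e0).
      have h1 : g1 x * `|d i| <= `|d i| by rewrite ler_piMl.
      have h2 : g1 x * `|d i| * e <= g1 x * `|d i| by rewrite ler_piMr// mulr_ge0.
      have h3 : `|d i| <= Ce * `|d i| by rewrite ler_peMl.
      lra.
    by rewrite normrM (ger0_norm gp) mulrC ler_pM.
  apply: (@le_trans _ _ (`|a i| * (Ce * (`|d i| + `|x|)))); first by rewrite ler_wpM2l.
  have := young_le (aH i) (dH i); have := young_le (aH i) xH => y1 y2.
  rewrite mulrCA mulrDr ler_wpM2l//; lra.
apply: (le_trans (ler_normB _ _)).
apply: (@le_trans _ _ (Ce * (1 + H) + \sum_(i < n) Ce * (4 * H))).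
  apply: lerD => //; apply: (le_trans (ler_norm_sum _ _ _)).
  by apply: ler_sum => i _; exact: T2.
rewrite sumr_const card_ord -[_ *+ _]mulr_natl; lra.
Qed.

Lemma slope_ge0 (x e : R) (d : 'I_n -> R) (e1 : option 'I_n -> R) : 0 <= e ->
  0 <= slope x d e e1.
Proof.
move=> e0; have /andP[? _] := g_le x; have /andP[? _] := g1_01 x.
by apply: sumr_ge0 => i _; rewrite addr_ge0// !mulr_ge0.
Qed.

Lemma slope_le (x e H Ce : R) (d : 'I_n -> R) (e1 : option 'I_n -> R) :
  `|x| `^ s <= H -> (forall i, `|d i| `^ s <= H) ->
  0 <= e <= 1 -> 1 <= Ce -> (forall o, `|e1 o| <= Ce) ->
  slope x d e e1 `^ r <= (2 * n%:R * Ce) `^ r * (1 + H).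
Proof.
move=> xH dH /andP[e0 e_1] Ce1 e1C.
have H0 : 0 <= H by apply: le_trans xH; exact: powR_ge0.
have s0 : 0 < s by exact: lt_le_trans s2.
have /andP[gp gx] := g_le x; have /andP[g10 g11] := g1_01 x.
have root (y : R) : `|y| `^ s <= H -> `|y| <= H `^ s^-1.
  move=> h; rewrite -[`|y|]powRr1// -(mulfV (lt0r_neq0 s0)) powRrM.
  by rewrite ge0_ler_powR ?nnegrE ?powR_ge0// invr_ge0 ltW.
have b : slope x d e e1 <= 2 * n%:R * Ce * H `^ s^-1.
  have -> : 2 * n%:R * Ce * H `^ s^-1 = \sum_(i < n) 2 * Ce * H `^ s^-1.
    rewrite sumr_const card_ord -[RHS]mulr_natl; lra.
  apply: ler_sum => i _.
  have h1 := root _ (dH i); have h2 := root _ xH.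
  have h3 : g1 x * `|d i| <= `|d i| by rewrite ler_piMl.
  have h4 : g1 x * `|d i| * e <= g1 x * `|d i| by rewrite ler_piMr// mulr_ge0.
  have h5 : g x * `|e1 (Some i)| <= H `^ s^-1 * Ce.
    by apply: ler_pM => //; exact: le_trans h2.
  have h6 : H `^ s^-1 <= Ce * H `^ s^-1 by rewrite ler_peMl ?powR_ge0.
  lra.
apply: (@le_trans _ _ ((2 * n%:R * Ce * H `^ s^-1) `^ r)).
  rewrite ge0_ler_powR ?nnegrE ?slope_ge0//; first by move: (r1); lra.
  by rewrite !mulr_ge0 ?powR_ge0//; lra.
rewrite powRM ?powR_ge0//; last by rewrite !mulr_ge0//; lra.
rewrite ler_wpM2l ?powR_ge0// -powRrM powR_le1D//.
by rewrite mulr_ge0 ?invr_ge0 ?(ltW s0)//= ?ler_pdivrMl// ?mulr1//; move: (r1); lra.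
Qed.

Context (u : V -> R) (D A : 'I_n -> V -> R) (eta : V -> R)
  (eta1 : option 'I_n -> V -> R) (L t1 E0 Ce : R).
Hypotheses (iu : mu.-integrable setT (EFin \o u))
  (iD : forall i, mu.-integrable setT (EFin \o D i))
  (iA : forall i, mu.-integrable setT (EFin \o A i))
  (ius : mu.-integrable setT (EFin \o (fun z => `|u z| `^ s)))
  (iDs : forall i, mu.-integrable setT (EFin \o (fun z => `|D i z| `^ s)))
  (iAs : forall i, mu.-integrable setT (EFin \o (fun z => `|A i z| `^ s')))
  (AD0 : forall z, 0 <= \sum_i A i z * D i z)
  (meta : measurable_fun setT eta) (meta1 : forall o, measurable_fun setT (eta1 o))
  (eta01 : forall z, 0 <= eta z <= 1) (Ce1 : 1 <= Ce) (eta1C : forall o z, `|eta1 o z| <= Ce)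
  (deta : forall o (z : VN), is_derive z (dir R o) (eta : VN -> R) (eta1 o z))
  (ceta1 : forall o (z : VN), continuous (fun h : R => eta1 o (h *: dir R o + z)))
  (eta10 : forall o z, eta z = 0 -> eta1 o z = 0)
  (seta : forall z, z.2 <= t1 -> eta z != 0 -> forall o, `|co o z| < L)
  (E00 : 0 < E0)
  (weak : forall e z, 0 < e <= E0 -> z.2 <= t1 -> eta z != 0 ->
     \sum_i conv (moll1 e (Some i)) (A i) z <= conv (moll1 e None) u z)
  (weakD : forall e z i, 0 < e <= E0 -> z.2 <= t1 -> eta z != 0 ->
     conv (moll1 e (Some i)) u z = - conv (moll e) (D i) z).

Definition chi (z : V) : R := \1_(before t1) z.
Definition dominant z := `|u z| `^ s + \sum_i (`|D i z| `^ s + `|A i z| `^ s').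

Lemma integrable_dominant : mu.-integrable setT (EFin \o dominant).
Proof.
have i1 := integrable_sum measurableT (index_enum 'I_n) (P := xpredT)
  (fun i _ => integrableD measurableT (iDs i) (iAs i)).
have := integrableD measurableT ius i1.
by apply: eq_integrable => // z _; rewrite /= /dominant EFinD -sumEFin.
Qed.

Lemma dominant_ge z : [/\ `|u z| `^ s <= dominant z, forall i, `|D i z| `^ s <= dominant z &
  forall i, `|A i z| `^ s' <= dominant z].
Proof.
have p i : 0 <= `|D i z| `^ s + `|A i z| `^ s' by rewrite addr_ge0 ?powR_ge0.
have q i : `|D i z| `^ s + `|A i z| `^ s' <= dominant z.
  rewrite /dominant (bigD1 i)//= addrA.
  have := powR_ge0 (`|u z|) s.
  have : 0 <= \sum_(j | j != i) (`|D j z| `^ s + `|A j z| `^ s') by apply: sumr_ge0.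
  lra.
split=> [|i|i].
- by rewrite /dominant lerDl sumr_ge0.
- by apply: le_trans (q i); rewrite lerDl powR_ge0.
- by apply: le_trans (q i); rewrite lerDr powR_ge0.
Qed.

(** Jensen's inequality for the exponents [s] and [s'], both at least 1: all mollified functions
    share one majorant, the mollification of [dominant] with the same radius. *)
Lemma conv_dominant_ge e z : 0 < e -> [/\ `|conv (moll e) u z| `^ s <= conv (moll e) dominant z,
  forall i, `|conv (moll e) (D i) z| `^ s <= conv (moll e) dominant z &
  forall i, `|conv (moll e) (A i) z| `^ s' <= conv (moll e) dominant z].
Proof.
move=> e0; have s1 : 1 <= s by move: (s2); lra.
have s'1 : 1 <= s'.
  have : 0 < s^-1 by rewrite invr_gt0; exact: lt_le_trans s2.
  rewrite -invf_le1//; move: (ss'); lra.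
split=> [|i|i].
- apply: (le_trans (conv_moll_jensen z e0 s1 iu ius)).
  by apply: conv_moll_le => //; [exact: integrable_dominant|move=> w; have [] := dominant_ge w].
- apply: (le_trans (conv_moll_jensen z e0 s1 (iD i) (iDs i))).
  by apply: conv_moll_le => //; [exact: integrable_dominant|move=> w; have [_ +  _] := dominant_ge w; apply].
- apply: (le_trans (conv_moll_jensen z e0 s'1 (iA i) (iAs i))).
  by apply: conv_moll_le => //; [exact: integrable_dominant|move=> w; have [_ _] := dominant_ge w; apply].
Qed.

Lemma bmeas_majorant (c : R) : bmeas (fun z : V => c * \1_(@box R n L) z).
Proof. by apply: bmeasM; [exact: bmeas_cst|apply: bmeas_indic; exact: measurable_box]. Qed.

Lemma integrable_majorant_fun (c c' : R) :
  mu.-integrable setT (EFin \o (fun z => c * \1_(@box R n L) z + c' * dominant z)).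
Proof.
have i1 : mu.-integrable setT (EFin \o (fun z : V => c * \1_(@box R n L) z)).
  apply: (@integrable_bsupp _ _ L); first exact: bmeas_majorant.
  move=> z; have [zB _|zB] := pselect (@box R n L z); first exact: zB.
  by rewrite indic0// mulr0 eqxx.
have i2 : mu.-integrable setT (EFin \o (fun z => c' * dominant z)).
  by have := integrableZl measurableT c' integrable_dominant.
by have := integrableD measurableT i1 i2.
Qed.

Lemma integrable_majorant (c c' : R) (f : V -> R) : measurable_fun setT f ->
  (forall z, `|f z| <= c * \1_(@box R n L) z + c' * dominant z) ->
  mu.-integrable setT (EFin \o f).
Proof.
move=> mf fb.
apply: (le_integrable measurableT _ _ (integrable_majorant_fun c c')).
  exact/measurable_EFinP.
by move=> z _ /=; rewrite lee_fin; apply: (le_trans (fb z)); exact: ler_norm.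
Qed.

Let cg : continuous g. Proof. by move=> x; exact: is_derive_continuous (dg x). Qed.
Let cPhi : continuous Phi. Proof. by move=> x; exact: is_derive_continuous (dPhi x). Qed.

Lemma excess_eq0 x d a (e1 : option 'I_n -> R) : (forall o, e1 o = 0) ->
  excess x d a 0 e1 = 0.
Proof. by move=> e10; rewrite /excess e10 mulr0 big1 ?subr0// => i _; rewrite e10 !mulr0 addr0 mulr0. Qed.

Lemma slope_eq0 x d (e1 : option 'I_n -> R) : (forall o, e1 o = 0) -> slope x d 0 e1 = 0.
Proof. by move=> e10; rewrite /slope big1// => i _; rewrite e10 !mulr0 normr0 mulr0 addr0. Qed.

Lemma chi01 z : chi z = 0 \/ chi z = 1 /\ z.2 <= t1.
Proof.
have [zt|zt] := pselect (before t1 z); first by right; rewrite /chi indic1.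
by left; rewrite /chi indic0.
Qed.

Lemma cut_le (f c c' H : R) z : 0 <= c -> 0 <= c' -> 0 <= H ->
  (eta z = 0 -> f = 0) -> (eta z != 0 -> `|f| <= c + c' * H) ->
  `|chi z * f| <= c * \1_(@box R n L) z + c' * H.
Proof.
move=> c0 c'0 H0 f0 fc.
have nn : 0 <= c * \1_(@box R n L) z + c' * H by rewrite addr_ge0// ?mulr_ge0.
have [->|[-> zt]] := chi01 z; first by rewrite mul0r normr0.
rewrite mul1r; have [/f0 ->|ez] := eqVneq (eta z) 0; first by rewrite normr0.
have zB : box L z by move=> o; exact: seta.
by rewrite indic1// mulr1; exact: fc.
Qed.

Lemma excess_cut_le x d a H z : `|x| `^ s <= H -> (forall i, `|d i| `^ s <= H) ->
  (forall i, `|a i| `^ s' <= H) ->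
  `|chi z * excess x d a (eta z) (eta1^~ z)| <=
    Ce * \1_(@box R n L) z + Ce * (1 + 4 * n%:R) * H.
Proof.
move=> xH dH aH; have C0 : 0 <= Ce by move: (Ce1); lra.
have H0 : 0 <= H by apply: le_trans xH; exact: powR_ge0.
apply: cut_le => // [|e0|_]; first by rewrite mulr_ge0// addr_ge0// mulr_ge0.
  by rewrite e0 excess_eq0// => o; exact: eta10.
rewrite -mulrA -[X in X + _]mulr1 -mulrDr; apply: excess_le => // o; exact: eta1C.
Qed.

Lemma slope_cut_le x d H z : `|x| `^ s <= H -> (forall i, `|d i| `^ s <= H) ->
  `|chi z * slope x d (eta z) (eta1^~ z) `^ r| <=
    (2 * n%:R * Ce) `^ r * \1_(@box R n L) z + (2 * n%:R * Ce) `^ r * H.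
Proof.
move=> xH dH; have H0 : 0 <= H by apply: le_trans xH; exact: powR_ge0.
apply: cut_le; rewrite ?powR_ge0// => e0.
  rewrite e0 slope_eq0 ?powR0//; last by move=> o; exact: eta10.
  by rewrite gt_eqF//; move: (r1); lra.
rewrite ger0_norm ?powR_ge0// -[X in X + _]mulr1 -mulrDr; apply: slope_le => // o; exact: eta1C.
Qed.

(** What remains of the excess once [<A, Du>] is moved to the left. The absolute values make it
    nonnegative, so its integral up to [t1] bounds the integrals up to all earlier times. *)
Definition flux x (a : 'I_n -> R) (e1 : option 'I_n -> R) : R :=
  Phi x * `|e1 None| + g x * `|\sum_i a i * e1 (Some i)|.

Lemma flux_cut_le x a H z : `|x| `^ s <= H -> (forall i, `|a i| `^ s' <= H) ->
  `|chi z * flux x a (eta1^~ z)| <= Ce * \1_(@box R n L) z + Ce * (1 + 4 * n%:R) * H.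
Proof.
move=> xH aH; have C0 : 0 <= Ce by move: (Ce1); lra.
have H0 : 0 <= H by apply: le_trans xH; exact: powR_ge0.
(* With the gradient set to 0, [a] multiplied by [- sg] and the time derivative in absolute value,
   the flux is an instance of [excess] and inherits its bound. *)
pose sg := Num.sg (\sum_i a i * eta1 (Some i) z).
pose e1 o := if o is Some _ then eta1 o z else `|eta1 None z|.
have -> : flux x a (eta1^~ z) = excess x (fun=> 0) (fun i => - sg * a i) (eta z) e1.
  rewrite /flux /excess -[X in _ + X]opprK; congr (_ - _).
  rewrite normrEsg -/sg !mulr_sumr -sumrN; apply: eq_bigr => i _ /=; lra.
apply: cut_le => // [|e0|_]; first by rewrite mulr_ge0// addr_ge0// mulr_ge0.
  by rewrite e0 excess_eq0// => -[i|] /=; rewrite eta10// normr0.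
rewrite -mulrA -[X in X + _]mulr1 -mulrDr; apply: excess_le => // [i|i|o].
- by rewrite normr0 powR0// gt_eqF//; move: (s2); lra.
- apply: le_trans (aH i); rewrite ge0_ler_powR ?nnegrE//; first exact: ltW.
  by rewrite normrM normrN ler_piMl// /sg normr_sg; case: (_ != _).
- by case: o => [i|] /=; rewrite ?normr_id; exact: eta1C.
Qed.

Lemma measurable_excess (x : V -> R) (d a : 'I_n -> V -> R) : measurable_fun setT x ->
  (forall i, measurable_fun setT (d i)) -> (forall i, measurable_fun setT (a i)) ->
  measurable_fun setT (fun z => chi z * excess (x z) (d^~ z) (a^~ z) (eta z) (eta1^~ z)).
Proof.
move=> mx md ma; have mc (f : R -> R) : continuous f -> measurable_fun setT (fun z => f (x z)).
  by move=> cf; apply: (measurableT_comp _ mx); exact: continuous_measurable_fun.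
apply: measurable_funM; first by apply: measurable_indic; exact: measurable_before.
apply: measurable_funB; first by apply: measurable_funM => //; exact: mc.
apply: measurable_sum => i; apply: measurable_funM => //; apply: measurable_funD.
  by apply: measurable_funM => //; apply: measurable_funM => //; exact: mc.
by apply: measurable_funM => //; exact: mc.
Qed.

Lemma measurable_slope (x : V -> R) (d : 'I_n -> V -> R) : measurable_fun setT x ->
  (forall i, measurable_fun setT (d i)) ->
  measurable_fun setT (fun z => slope (x z) (d^~ z) (eta z) (eta1^~ z)).
Proof.
move=> mx md; have mc (f : R -> R) : continuous f -> measurable_fun setT (fun z => f (x z)).
  by move=> cf; apply: (measurableT_comp _ mx); exact: continuous_measurable_fun.
apply: measurable_sum => i; apply: measurable_funD.
  apply: measurable_funM => //; apply: measurable_funM; first exact: mc.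
  exact: measurableT_comp.
by apply: measurable_funM; [exact: mc|exact: measurableT_comp].
Qed.

Lemma measurable_flux (x : V -> R) (a : 'I_n -> V -> R) : measurable_fun setT x ->
  (forall i, measurable_fun setT (a i)) ->
  measurable_fun setT (fun z => chi z * flux (x z) (a^~ z) (eta1^~ z)).
Proof.
move=> mx ma; have mc (f : R -> R) : continuous f -> measurable_fun setT (fun z => f (x z)).
  by move=> cf; apply: (measurableT_comp _ mx); exact: continuous_measurable_fun.
apply: measurable_funM; first by apply: measurable_indic; exact: measurable_before.
apply: measurable_funD; apply: measurable_funM; try exact: mc.
  exact: measurableT_comp.
by apply: measurableT_comp => //; apply: measurable_sum => i; exact: measurable_funM.
Qed.

(** [weak] supplies the pointwise inequality, and [weakD] replaces the derivative of the mollified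
    [u], which has no evident limit, by the mollification of [D], which has one. *)
Lemma energy_eps (e tau : R) : 0 < e <= E0 -> tau <= t1 ->
  (\int[lebesgue_rV R n]_x (Phi (conv (moll e) u (x, tau)) * eta (x, tau))%:E <=
   \int[mu]_z (\1_(before tau) z * excess (conv (moll e) u z)
      (fun i => conv (moll e) (D i) z) (fun i => conv (moll e) (A i) z) (eta z) (eta1^~ z))%:E)%E.
Proof.
move=> eE tT; have /andP[e0 _] := eE.
pose U1 o z := - conv (moll1 e o) u z.
pose A1 i z := - conv (moll1 e (Some i)) (A i) z.
have mb o : exists C : R, [/\ measurable_fun setT (moll e : V -> R),
    measurable_fun setT (moll1 e o : V -> R), measurable_fun setT (moll2 e o : V -> R) &
    forall w : V, [/\ `|moll e w| <= C, `|moll1 e o w| <= C & `|moll2 e o w| <= C]].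
  by have [? ? ?] := measurable_moll e o; have [C hC] := moll_bdd e o; exists C.
have b0 f : mu.-integrable setT (EFin \o f) -> bmeas (conv (moll e) f).
  by move=> fi; have [C [m0 _ _ hC]] := mb None; apply: (@bmeas_conv _ _ C) => // w; have [] := hC w.
have b1 o f : mu.-integrable setT (EFin \o f) -> bmeas (fun z => - conv (moll1 e o) f z).
  by move=> fi; have [C [_ m1 _ hC]] := mb o; apply: bmeasN; apply: (@bmeas_conv _ _ C) => // w; have [] := hC w.
have d0 o f (z : VN) : mu.-integrable setT (EFin \o f) ->
    is_derive z (dir R o) (conv (moll e) f : VN -> R) (- conv (moll1 e o) f z).
  move=> fi; have [C [m0 m1 _ hC]] := mb o.
  by apply: (@conv_derive _ _ _ _ _ _ _ C C) => // [w|w|w]; [have [] := hC w|have [] := hC w|exact: moll_derive].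
have d1 o f (z : VN) : mu.-integrable setT (EFin \o f) ->
    is_derive z (dir R o) (conv (moll1 e o) f : VN -> R) (- conv (moll2 e o) f z).
  move=> fi; have [C [_ m1 m2 hC]] := mb o.
  by apply: (@conv_derive _ _ _ _ _ _ _ C C) => // [w|w|w]; [have [] := hC w|have [] := hC w|exact: moll1_derive].
have bE o : bmeas (eta1 o) by split=> //; exists Ce => z; exact: eta1C.
have be : bmeas eta by split=> //; exists 1 => z; rewrite ger0_norm; have /andP[] := eta01 z.
have g0 x : 0 <= g x by have /andP[] := g_le x.
have seta' z : z.2 <= tau -> eta z != 0 -> forall o, `|co o z| < L.
  by move=> zt; apply: seta; exact: le_trans tT.
have cU1 x : continuous (fun t : R => U1 None (x, t)).
  move=> t; apply: (@continuousN _ _ _ (fun t => conv (moll1 e None) u (x, t))).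
  apply: (@is_derive_continuous _ _ (- conv (moll2 e None) u (x, t))).
  have := d1 None u (t *: dir R None + (x, 0)) iu => /is_derive_along.
  by rewrite line_t; congr (is_derive _ _ _ _); apply/funext => y; rewrite line_t.
have ce1 x : continuous (fun t : R => eta1 None (x, t)).
  have := @ceta1 None (x, 0).
  by rewrite (_ : (fun t => eta1 _ (_ + _)) = (fun t => eta1 None (x, t)))//; apply/funext => y; rewrite line_t.
have := @energy_identity R n L tau Phi g g1 (conv (moll e) u) eta U1 eta1
  (fun i => conv (moll e) (A i)) A1 dPhi dg cg1 g0 (b0 _ iu) (fun o => b1 o _ iu)
  (fun i => b0 _ (iA i)) (fun i => b1 (Some i) _ (iA i)) be bE
  (fun o z => d0 o _ z iu) deta (fun i z => d0 (Some i) _ z (iA i)) cU1 ce1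
  (fun z => proj1 (andP (eta01 z))) eta10 seta'.
move=> H; apply: (le_trans (H _)).
  move=> z zt ez; rewrite /U1 /A1 sumrN lerN2; apply: weak => //; exact: le_trans tT.
rewrite le_eqVlt; apply/orP; left; apply/eqP; apply: eq_integral => z _; congr (_%:E).
have [zt|zt] := pselect (before tau z); last by rewrite indic0// !mul0r.
congr (_ * _); rewrite -[LHS]/(excess _ (fun i => U1 (Some i) z) _ _ (eta1^~ z)).
have [ez|ez] := eqVneq (eta z) 0; first by rewrite ez !excess_eq0// => o; exact: eta10.
congr (excess _ _ _ _ _); apply/funext => i.
by rewrite /U1 weakD ?opprK//; exact: le_trans tT.
Qed.

Let cvg_fsum (I : Type) (l : seq I) (F : I -> nat -> R) (f : I -> R) :
  (forall i, F i j @[j --> \oo] --> f i) -> \sum_(i <- l) F i j @[j --> \oo] --> \sum_(i <- l) f i.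
Proof. by move=> cF; apply: cvg_big => // ; exact: add_continuous. Qed.

Let cvg_comp_cont (F : nat -> R) (x : R) (f : R -> R) : continuous f ->
  F j @[j --> \oo] --> x -> f (F j) @[j --> \oo] --> f x.
Proof. by move=> cf cF; apply: continuous_cvg => //; exact: cf. Qed.

Lemma cvg_excess (X : nat -> R) (Dj Aj : nat -> 'I_n -> R) (x : R) (d a : 'I_n -> R) e e1 :
  X j @[j --> \oo] --> x -> (forall i, Dj j i @[j --> \oo] --> d i) ->
  (forall i, Aj j i @[j --> \oo] --> a i) ->
  excess (X j) (Dj j) (Aj j) e e1 @[j --> \oo] --> excess x d a e e1.
Proof.
move=> cX cD cA; apply: cvgB.
  by apply: cvgM; [exact: cvg_comp_cont|exact: cvg_cst].
apply: cvg_fsum => i; apply: cvgM => //; apply: cvgD.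
  by apply: cvgM; [apply: cvgM => //; exact: cvg_comp_cont|exact: cvg_cst].
by apply: cvgM; [exact: cvg_comp_cont|exact: cvg_cst].
Qed.

Lemma cvg_slope (X : nat -> R) (Dj : nat -> 'I_n -> R) (x : R) (d : 'I_n -> R) e e1 :
  X j @[j --> \oo] --> x -> (forall i, Dj j i @[j --> \oo] --> d i) ->
  slope (X j) (Dj j) e e1 @[j --> \oo] --> slope x d e e1.
Proof.
move=> cX cD; apply: cvg_fsum => i; apply: cvgD.
  by apply: cvgM; [apply: cvgM; [exact: cvg_comp_cont|exact: cvg_norm]|exact: cvg_cst].
by apply: cvgM; [exact: cvg_comp_cont|exact: cvg_cst].
Qed.

Let cvg_pow (F : nat -> R) (x a : R) : 1 < a -> (forall j, 0 <= F j) -> 0 <= x ->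
  F j @[j --> \oo] --> x -> F j `^ a @[j --> \oo] --> x `^ a.
Proof.
move=> a1 F0 x0 cF.
rewrite (_ : (fun j => F j `^ a) = (fun j => posp a (F j))); last first.
  by apply/funext => j; rewrite posp_gt0.
rewrite -posp_gt0//; apply: cvg_comp_cont => // y.
exact: is_derive_continuous (is_derive_posp _ a1).
Qed.

(** The strict inequality [RA < K] leaves a margin [K - RA] for the L^1 error of the mollified
    integrands. Once the error is below it, the L^2 mass of [g (U j) * eta] is at most [2 * K] on
    every slice and the parabolic Sobolev inequality applies; Fatou's lemma removes the
    mollification. *)
Lemma caccioppoli (sg m : R) (RA := (\int[mu]_z (chi z * flux (u z) (A^~ z) (eta1^~ z))%:E)%E) :
  2 < sg -> m = sg + 2 / n%:R -> m * (1 - r^-1) = sg - 1 ->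
  [/\ (RA < +oo)%E,
    (\int[mu]_z (chi z * (g1 (u z) * eta z * \sum_i A i z * D i z))%:E <= RA)%E &
    forall K : R, (RA < K%:E)%E ->
      (\int[mu]_z (chi z * (g (u z) * eta z) `^ m)%:E <=
       (sg `^ r * (2 * K) `^ (r / n%:R))%:E *
       \int[mu]_z (chi z * slope (u z) (D^~ z) (eta z) (eta1^~ z) `^ r)%:E)%E].
Proof.
move=> sg2 mE mr.
have mu0 := integrable_EFin_measurable iu.
have mD i := integrable_EFin_measurable (iD i).
have mA i := integrable_EFin_measurable (iA i).
have mchi : measurable_fun setT chi by apply: measurable_indic; exact: measurable_before.
have chi0 z : 0 <= chi z by case: (chi01 z) => [->|[-> _]].
have mdom := integrable_EFin_measurable integrable_dominant.
(* One family, so that a single sequence of radii serves [u], [D], [A] and the majorant. *)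
pose fam (i : option (option 'I_n + 'I_n)) : V -> R := match i with
  | None => dominant | Some (inl None) => u | Some (inl (Some i)) => D i | Some (inr i) => A i end.
have ifam i : mu.-integrable setT (EFin \o fam i).
  by move: i => [[[i|]|i]|] /=; [exact: iD|exact: iu|exact: iA|exact: integrable_dominant].
have [e e0 ce] := conv_moll_seq E00 ifam.
have aecv : {ae mu, forall z, forall i, conv (moll (e j)) (fam i) z @[j --> \oo] --> fam i z}.
  by apply: filter_forall => i; have [_] := ce i.
have ep j : 0 < e j by have /andP[] := e0 j.
have mconv j f : mu.-integrable setT (EFin \o f) -> measurable_fun setT (conv (moll (e j)) f).
  move=> fi; have [mm _ _] := measurable_moll (e j) (@None 'I_n).
  exact: (measurable_conv mm (integrable_EFin_measurable fi)).
pose U j z := conv (moll (e j)) u z.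
pose Dj j i z := conv (moll (e j)) (D i) z.
pose Aj j i z := conv (moll (e j)) (A i) z.
pose GE j z := chi z * excess (U j z) ((Dj j)^~ z) ((Aj j)^~ z) (eta z) (eta1^~ z).
pose G z := chi z * excess (u z) (D^~ z) (A^~ z) (eta z) (eta1^~ z).
pose NE j z := chi z * slope (U j z) ((Dj j)^~ z) (eta z) (eta1^~ z) `^ r.
pose N z := chi z * slope (u z) (D^~ z) (eta z) (eta1^~ z) `^ r.
have mGE j : measurable_fun setT (GE j).
  by apply: measurable_excess => [|i|i]; exact: mconv.
have mG : measurable_fun setT G by exact: measurable_excess.
have mslope (x : V -> R) (d : 'I_n -> V -> R) : measurable_fun setT x ->
    (forall i, measurable_fun setT (d i)) ->
    measurable_fun setT (fun z => chi z * slope (x z) (d^~ z) (eta z) (eta1^~ z) `^ r).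
  move=> mx md; apply: measurable_funM => //.
  exact: (measurableT_comp (measurable_powR r) (measurable_slope mx md)).
have mNE j : measurable_fun setT (NE j) by apply: mslope => [|i]; exact: mconv.
have mN : measurable_fun setT N by exact: mslope.
have eta0 z : 0 <= eta z by have /andP[] := eta01 z.
(* Pratt's theorem with majorants affine in the mollified [dominant]; it serves both the excess and
   the slope. *)
have pr (F : nat -> V -> R) f (c c' : R) : (forall j, measurable_fun setT (F j)) -> measurable_fun setT f ->
    (forall j z, `|F j z| <= c * \1_(@box R n L) z + c' * conv (moll (e j)) dominant z) ->
    ae_cvg mu F f -> L1cvg mu F f.
  move=> mF mf bF cF; have [c1 c2] := ce None.
  apply: (pratt mF mf _ _ bF cF (ae_cvg_comp2 _ c' c2) (L1cvg_affine _ c' _ mdom c1)).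
  - move=> j; apply: measurable_funD; last by apply: measurable_funM => //; exact: (mconv _ _ integrable_dominant).
    by have [] := bmeas_majorant c.
  - exact: integrable_majorant_fun.
  - by move=> j; exact: (mconv j _ (ifam None)).
have aeS (F : nat -> V -> R) f : (forall z, (forall i, conv (moll (e j)) (fam i) z @[j --> \oo] --> fam i z) ->
    F j z @[j --> \oo] --> f z) -> ae_cvg mu F f.
  by move=> hF; apply: filterS aecv => z; exact: hF.
have cG : L1cvg mu GE G.
  apply: (pr _ _ Ce (Ce * (1 + 4 * n%:R))) => // [j z|].
    by have [h1 h2 h3] := conv_dominant_ge z (ep j); exact: (@excess_cut_le (U j z) ((Dj j)^~ z) ((Aj j)^~ z) _ z h1 h2 h3).
  apply: aeS => z cz; apply: cvgM; first exact: cvg_cst.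
  apply: cvg_excess => [|i|i]; first exact: (cz (Some (inl None))).
    exact: (cz (Some (inl (Some i)))).
  exact: (cz (Some (inr i))).
have cN : L1cvg mu NE N.
  apply: (pr _ _ ((2 * n%:R * Ce) `^ r) ((2 * n%:R * Ce) `^ r)) => // [j z|].
    by have [h1 h2 h3] := conv_dominant_ge z (ep j); exact: (@slope_cut_le (U j z) ((Dj j)^~ z) _ z h1 h2).
  apply: aeS => z cz; apply: cvgM; first exact: cvg_cst.
  apply: cvg_pow => // [j||]; [exact: slope_ge0|exact: slope_ge0|].
  apply: cvg_slope => [|i]; first exact: (cz (Some (inl None))).
  exact: (cz (Some (inl (Some i)))).
have iG : mu.-integrable setT (EFin \o G).
  apply: (integrable_majorant mG (c := Ce) (c' := Ce * (1 + 4 * n%:R))) => z.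
  by have [h1 h2 h3] := dominant_ge z; exact: excess_cut_le.
pose RF z := chi z * flux (u z) (A^~ z) (eta1^~ z).
have mRF : measurable_fun setT RF by exact: measurable_flux.
have iRF : mu.-integrable setT (EFin \o RF).
  apply: (integrable_majorant mRF (c := Ce) (c' := Ce * (1 + 4 * n%:R))) => z.
  by have [h1 h2 h3] := dominant_ge z; exact: flux_cut_le.
have g0 x : 0 <= g x by have /andP[] := g_le x.
have g10 x : 0 <= g1 x by have /andP[] := g1_01 x.
have Phi0 x : 0 <= Phi x.
  have /andP[h1 _] := Phi_le x; have := le_trans (sqr_ge0 (g x)) h1.
  by rewrite pmulr_rge0.
have RF0 z : 0 <= RF z by rewrite /RF mulr_ge0// addr_ge0// mulr_ge0.
(* In [RF - G] the product [<A, Du>] appears with weight [g1 * eta], and the cutoff terms of [G] are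
   dominated by those of [RF]. *)
have GRF z : chi z * (g1 (u z) * eta z * \sum_i A i z * D i z) <= RF z - G z.
  rewrite /RF /G -mulrBr ler_wpM2l// /flux /excess opprB addrA.
  have -> : \sum_i A i z * (g1 (u z) * D i z * eta z + g (u z) * eta1 (Some i) z) =
      g1 (u z) * eta z * (\sum_i A i z * D i z) + g (u z) * \sum_i A i z * eta1 (Some i) z.
    rewrite !mulr_sumr -big_split/=; apply: eq_bigr => i _; lra.
  have := ler_wpM2l (Phi0 (u z)) (ler_norm (eta1 None z)).
  have := ler_wpM2l (g0 (u z)) (ler_norm (- \sum_i A i z * eta1 (Some i) z)).
  rewrite normrN; lra.
have B0 z : 0 <= chi z * (g1 (u z) * eta z * \sum_i A i z * D i z).
  by rewrite !mulr_ge0.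
(* The energy inequality at [tau = t1], whose left-hand side is nonnegative; its limit bounds the
   integral of [<A, Du>] by [RA]. *)
have GE0 j : (0 <= \int[mu]_z (GE j z)%:E)%E.
  apply: le_trans (energy_eps (e0 j) (lexx t1)).
  by apply: integral_ge0 => x _; rewrite lee_fin mulr_ge0.
have RAfin : (RA < +oo)%E.
  by rewrite -ge0_fin_numE ?(integrable_fin_num measurableT iRF)// integral_ge0// => z _; rewrite lee_fin; exact: RF0.
split=> //.
  have iG0 := L1cvg_integral_ge0 mGE iG cG GE0.
  apply: (@le_trans _ _ (\int[mu]_z (RF z - G z)%:E)%E).
    apply: integral_le_ge0 => z; rewrite lee_fin; last exact: GRF.
    by apply: le_trans (GRF z).
  under eq_integral do rewrite EFinB.
  rewrite integralB// -/RA leeBlDr; last by have := integrable_fin_num measurableT iG.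
  by rewrite leeDl.
move=> K RK.
have RAf : RA \is a fin_num by exact: (integrable_fin_num measurableT iRF).
have RA0 : (0 <= RA)%E by apply: integral_ge0 => z _; rewrite lee_fin; exact: RF0.
have K0 : 0 < K by rewrite -lte_fin; exact: le_lt_trans RK.
have dK : 0 < K - fine RA by rewrite subr_gt0 -lte_fin fineK.
(* Up to any time [t <= t1] the mollified excess is at most [RF] plus the L^1 error, since the
   energy density is nonnegative. The factor 2 comes from [g^2 <= 2 * Phi]. *)
have sup j : (\int[mu]_z (`|GE j z - G z|)%:E <= (K - fine RA)%:E)%E -> forall t, t <= t1 ->
    (\int[lebesgue_rV R n]_x ((g (U j (x, t)) * eta (x, t)) ^+ 2)%:E <= (2 * K)%:E)%E.
  move=> dj t tt1.
  apply: (@le_trans _ _ (\int[lebesgue_rV R n]_x (2%:E * (Phi (U j (x, t)) * eta (x, t))%:E))%E).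
    apply: ae_le_integral => [x _|x _|].
    - by rewrite lee_fin sqr_ge0.
    - by rewrite mule_ge0// lee_fin mulr_ge0.
    apply: aeW => x _; rewrite -EFinM lee_fin exprMn.
    have /andP[h1 _] := Phi_le (U j (x, t)); have /andP[h2 h3] := eta01 (x, t).
    have e2 : eta (x, t) ^+ 2 <= eta (x, t) by rewrite expr2 ler_piMr.
    by rewrite [leRHS]mulrA; apply: ler_pM; rewrite ?sqr_ge0.
  have mPe : measurable_fun setT (fun x : 'rV[R]_n => (Phi (U j (x, t)) * eta (x, t))%:E).
    apply/measurable_EFinP; apply: (measurable_slice t (f := fun z => Phi (U j z) * eta z)).
    apply: measurable_funM => //.
    by apply: (measurableT_comp _ (mconv j u iu)); exact: continuous_measurable_fun.
  rewrite ge0_integralZl//; last by move=> x _; rewrite lee_fin mulr_ge0.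
  rewrite EFinM; apply: lee_wpmul2l; first by rewrite lee_fin.
  apply: (le_trans (energy_eps (e0 j) tt1)).
  apply: (@le_trans _ _ (\int[mu]_z ((RF z)%:E + (`|GE j z - G z|)%:E))%E).
    apply: integral_le_ge0 => z; rewrite -EFinD lee_fin ?addr_ge0//.
    have [zt|zt] := pselect (before t z); last by rewrite indic0// mul0r addr_ge0.
    have zt1 : before t1 z by exact: le_trans tt1.
    have := B0 z; have := GRF z; have := ler_norm (GE j z - G z).
    rewrite (indic1 _ zt) {1}/GE /chi (indic1 _ zt1) !mul1r -/(U j z).
    exact: bound_of_excess.
  rewrite ge0_integralD//; last 3 first.
  - by move=> z _; rewrite lee_fin; exact: RF0.
  - exact/measurable_EFinP.
  - exact: measurable_norm_sub.
  rewrite -/RA; apply: (@le_trans _ _ (RA + (K - fine RA)%:E)%E); first exact: leeD.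
  by rewrite -[in leLHS](fineK RAf) -EFinD subrKC.
have cPos : 0 <= sg `^ r * (2 * K) `^ (r / n%:R) by rewrite mulr_ge0 ?powR_ge0.
have sob j : (\int[mu]_z (`|GE j z - G z|)%:E <= (K - fine RA)%:E)%E ->
    (\int[mu]_z (chi z * (g (U j z) * eta z) `^ m)%:E <=
      (sg `^ r * (2 * K) `^ (r / n%:R))%:E * \int[mu]_z (NE j z)%:E)%E.
  move=> dj; have /andP[ej0 _] := e0 j.
  pose U1 (i : 'I_n) z := - conv (moll1 (e j) (Some i)) u z.
  have [Cg hCg] : exists C : R, 0 <= C /\ forall z, 0 <= g (U j z) * eta z <= C.
    have [_ [C hC]] : bmeas (fun z => g (U j z)).
      apply: bmeas_comp => //; have [mm _ _] := measurable_moll (e j) (@None 'I_n).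
      have [C hC] := moll_bdd (e j) (@None 'I_n).
      by apply: (@bmeas_conv _ _ C) => // w; have [] := hC w.
    have C0 : 0 <= C by exact: le_trans (hC 0).
    exists C; split=> // z; rewrite mulr_ge0//=.
    have := hC z; rewrite ger0_norm// => h1; have /andP[_ h2] := eta01 z.
    by rewrite -[leRHS]mulr1 ler_pM.
  have [Cg0 {}hCg] := hCg.
  have [m0 m1 m2] := measurable_moll (e j) (@None 'I_n).
  have dU i (z : VN) : is_derive z (dir R (Some i)) (U j : VN -> R) (U1 i z).
    have [_ m1' _] := measurable_moll (e j) (Some i).
    have [C hC] := moll_bdd (e j) (Some i).
    by apply: (@conv_derive _ _ _ _ _ _ _ C C) => // [w|w|w]; [have [] := hC w|have [] := hC w|exact: moll_derive].
  have dU1 i (z : VN) : is_derive z (dir R (Some i)) (conv (moll1 (e j) (Some i)) u : VN -> R)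
      (- conv (moll2 (e j) (Some i)) u z).
    have [_ m1' m2'] := measurable_moll (e j) (Some i).
    have [C hC] := moll_bdd (e j) (Some i).
    by apply: (@conv_derive _ _ _ _ _ _ _ C C) => // [w|w|w]; [have [] := hC w|have [] := hC w|exact: moll1_derive].
  have mU1 i : measurable_fun setT (U1 i).
    have [_ m1' _] := measurable_moll (e j) (Some i).
    by apply: measurable_funN; exact: (measurable_conv m1' mu0).
  have mgU : measurable_fun setT (fun z => g (U j z) * eta z).
    apply: measurable_funM => //.
    by apply: (measurableT_comp _ (mconv j u iu)); exact: continuous_measurable_fun.
  have -> : (\int[mu]_z (NE j z)%:E =
      \int[mu]_z (\1_(before t1) z * slope (U j z) (U1^~ z) (eta z) (eta1^~ z) `^ r)%:E)%E.
    apply: eq_integral => z _; rewrite /NE /chi; congr (_%:E).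
    have [zt|zt] := pselect (before t1 z); last by rewrite indic0// !mul0r.
    have [ez|ez] := eqVneq (eta z) 0; first by rewrite ez !slope_eq0// => o; exact: eta10.
    congr (_ * slope _ _ _ _ `^ _); apply/funext => i.
    by rewrite /U1 weakD ?opprK.
  apply: (@sobolev_parabolic _ _ (fun z => g (U j z) * eta z)
    (fun z => slope (U j z) (U1^~ z) (eta z) (eta1^~ z))
    (fun i z => g (U j z) * eta1 (Some i) z + eta z * (g1 (U j z) * U1 i z)) Cg L) => //.
  - exact: measurable_slope (mconv j u iu) mU1.
  - by move=> z; exact: slope_ge0.
  - move=> z zt wz; apply: seta => //; apply: contra wz => /eqP ->; by rewrite mulr0.
  - move=> i z; have d1 := is_derive_circ (dg (U j z)) (dU i z).
    exact: (is_deriveM d1 (deta (Some i) z)).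
  - move=> i z.
    have cl (f f1 : VN -> R) : (forall z, is_derive z (dir R (Some i)) f (f1 z)) ->
        continuous (fun y : R => f (y *: dir R (Some i) + z)).
      by move=> df y; apply: is_derive_continuous; exact: is_derive_along (df _).
    have cU := cl _ _ (dU i).
    have cc (f : R -> R) : continuous f -> continuous (fun y : R => f (U j (y *: dir R (Some i) + z))).
      by move=> cf y; exact: (@continuous_cvg _ _ _ _ _ _ f _ (cf _) (cU y)).
    move=> y; apply: cvgD; apply: cvgM.
    + exact: cc.
    + exact: ceta1.
    + exact: (cl _ _ (deta (Some i))).
    + apply: cvgM; first exact: cc.
      by apply: cvgN; exact: (cl _ _ (dU1 i)).
  - move=> i z; rewrite /slope (bigD1 i)//=.
    apply: (@le_trans _ _ (g1 (U j z) * `|U1 i z| * eta z + g (U j z) * `|eta1 (Some i) z|)); last first.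
      by rewrite lerDl; apply: sumr_ge0 => l _; rewrite addr_ge0// !mulr_ge0.
    apply: (le_trans (ler_normD _ _)).
    by rewrite !normrM (ger0_norm (g0 _)) (ger0_norm (eta0 _)) (ger0_norm (g10 _)) addrC [eta z * _]mulrC.
  - exact: sup.
have m1 : 1 < m by rewrite mE; apply: (lt_le_trans (lt_trans _ sg2)); [rewrite ltr1n|rewrite lerDl divr_ge0].
have key (de : R) : 0 < de -> (\int[mu]_z (chi z * (g (u z) * eta z) `^ m)%:E <=
    (sg `^ r * (2 * K) `^ (r / n%:R))%:E * (\int[mu]_z (N z)%:E + de%:E))%E.
  move=> d0; apply: (@fatou_le _ _ _ _ (fun j z => chi z * (g (U j z) * eta z) `^ m)).
  - move=> j; apply: measurable_funM => //.
    apply: (measurableT_comp (measurable_powR m)); apply: measurable_funM => //.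
    by apply: (measurableT_comp _ (mconv j u iu)); exact: continuous_measurable_fun.
  - by move=> j z; rewrite mulr_ge0 ?powR_ge0.
  - by move=> z; rewrite mulr_ge0 ?powR_ge0.
  - apply: aeS => z cz; apply: cvgM; first exact: cvg_cst.
    apply: cvg_pow => // [j||]; rewrite ?mulr_ge0//.
    apply: cvgM; last exact: cvg_cst.
    by apply: cvg_comp_cont => //; exact: (cz (Some (inl None))).
  near=> j; apply: (le_trans (sob j _)); first by near: j; exact: L1cvg_near.
  apply: lee_wpmul2l; first by rewrite lee_fin.
  apply: (@le_trans _ _ (\int[mu]_z ((N z)%:E + (`|NE j z - N z|)%:E))%E).
    apply: ae_le_integral => [z _|z _|].
    - by rewrite lee_fin mulr_ge0 ?powR_ge0.
    - by rewrite -EFinD lee_fin addr_ge0// mulr_ge0 ?powR_ge0.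
    apply: aeW => z _; rewrite -EFinD lee_fin -lerBlDl; exact: ler_norm.
  rewrite ge0_integralD//; last 3 first.
  - by move=> z _; rewrite lee_fin mulr_ge0 ?powR_ge0.
  - exact/measurable_EFinP.
  - exact: measurable_norm_sub.
  by apply: leeD => //; near: j; exact: L1cvg_near.
(* The error [de] is multiplied by this constant, which must be nonzero before dividing by it. *)
have [c0|cn0] := eqVneq (sg `^ r * (2 * K) `^ (r / n%:R)) 0.
  by have := key 1 ltr01; rewrite c0 !mul0e.
have cp : 0 < sg `^ r * (2 * K) `^ (r / n%:R) by rewrite lt_neqAle eq_sym cn0.
apply/lee_addgt0Pr => de d0.
apply: (le_trans (key (de / (sg `^ r * (2 * K) `^ (r / n%:R))) (divr_gt0 d0 cp))).
rewrite muleDr ?ge0_adde_def ?inE//; last 2 first.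
- by apply: integral_ge0 => z _; rewrite lee_fin mulr_ge0 ?powR_ge0.
- by rewrite lee_fin divr_ge0// ltW.
by rewrite -[X in (_ + X)%E]EFinM mulrCA mulfV// mulr1.
Unshelve. all: by end_near. Qed.

End caccioppoli.
(** * Truncations and cutoffs *)

Section level_functions.
Context (R : realType).
Implicit Types (x s ka de : R).

Lemma pospn (i : nat) s : posp i.+1%:R s = Num.max s 0 ^+ i.+1.
Proof. by rewrite /posp powR_mulrn// le_max lexx orbT. Qed.

Lemma posp1E s : posp 1 s = Num.max s 0.
Proof. by have := pospn 0 s; rewrite expr1. Qed.

Lemma is_derive_posp_shift (a c x : R) : 1 < a ->
  is_derive x 1 (fun x : R => posp a (x - c)) (a * posp (a - 1) (x - c)).
Proof.
move=> a1; have d1 : is_derive x 1 (fun x : R => x - c) (1 - 0).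
  exact: (is_deriveB (is_derive_id _ _) (is_derive_cst _ _ _)).
have := @is_derive1_comp _ (posp a) (fun x => x - c) x _ _ (is_derive_posp (x - c) a1) d1.
by rewrite subr0 mulr1.
Qed.

(* A C^1 convex replacement of (x - ka)_+, with its primitive and its derivative. *)
Definition lev1 ka de x : R := de^-1 * (posp 1 (x - ka) - posp 1 (x - (ka + de))).
Definition lev ka de x : R := (2 * de)^-1 * (posp 2 (x - ka) - posp 2 (x - (ka + de))).
Definition Lev ka de x : R := (6 * de)^-1 * (posp 3 (x - ka) - posp 3 (x - (ka + de))).

Lemma is_derive_lev ka de x : is_derive x 1 (lev ka de) (lev1 ka de x).
Proof.
have h (c : R) : is_derive x 1 (fun x : R => posp 2 (x - c)) (2 * posp 1 (x - c)).
  have := @is_derive_posp_shift 2 c x; have -> : (2 - 1 = 1 :> R)%R by lra.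
  by apply; lra.
apply: (is_derive_eq (is_deriveZ (2 * de)^-1 (is_deriveB (h ka) (h (ka + de))))).
rewrite /lev1 /GRing.scale/= invfM.
rewrite -mulrBr mulrA [2^-1 * _]mulrC -[_ * 2]mulrA mulVf ?mulr1// mulrC; by [].
Qed.

Lemma is_derive_Lev ka de x : is_derive x 1 (Lev ka de) (lev ka de x).
Proof.
have h (c : R) : is_derive x 1 (fun x : R => posp 3 (x - c)) (3 * posp 2 (x - c)).
  have := @is_derive_posp_shift 3 c x; have -> : (3 - 1 = 2 :> R)%R by lra.
  by apply; lra.
apply: (is_derive_eq (is_deriveZ (6 * de)^-1 (is_deriveB (h ka) (h (ka + de))))).
rewrite /lev /GRing.scale/= -mulrBr mulrA; congr (_ * _).
have -> : 6 * de = 3 * (2 * de) by lra.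
by rewrite invfM mulrC mulrA mulfV ?mul1r.
Qed.

Lemma continuous_lev1 ka de : continuous (lev1 ka de).
Proof.
have h (c : R) : continuous (fun x : R => posp 1 (x - c)).
  move=> x; apply: (@continuous_comp _ _ _ (fun x : R => x - c) (posp 1)); last exact: continuous_posp1.
  by apply: cvgB; [exact: cvg_id|exact: cvg_cst].
by move=> x; apply: cvgM; [exact: cvg_cst|apply: cvgB; exact: h].
Qed.

Variant lev_spec ka de x : R -> R -> R -> Prop :=
| LevBelow : x <= ka -> lev_spec ka de x 0 0 0
| LevMid : ka <= x <= ka + de ->
    lev_spec ka de x ((x - ka) / de) ((x - ka) ^+ 2 / (2 * de)) ((x - ka) ^+ 3 / (6 * de))
| LevAbove : ka + de <= x ->
    lev_spec ka de x 1 (x - ka - de / 2) (((x - ka) ^+ 2 - (x - ka) * de + de ^+ 2 / 3) / 2).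

Lemma levP ka de x : 0 < de -> lev_spec ka de x (lev1 ka de x) (lev ka de x) (Lev ka de x).
Proof.
move=> d0; rewrite /lev1 /lev /Lev !posp1E (pospn 1) (pospn 1) (pospn 2) (pospn 2).
have [h1|h1] := leP x ka.
  rewrite !max_r; try lra.
  by rewrite !expr0n/= subrr !mulr0; constructor.
have [h2|h2] := leP x (ka + de).
  rewrite (@max_l _ _ (x - ka)); last lra.
  rewrite max_r; last lra.
  rewrite !expr0n/= !subr0 ![_^-1 * _]mulrC; constructor; lra.
rewrite (@max_l _ _ (x - ka)); last lra.
rewrite max_l; last lra.
have -> : de^-1 * (x - ka - (x - (ka + de))) = 1.
  have -> : x - ka - (x - (ka + de)) = de by lra.
  by rewrite mulVf// gt_eqF.
have -> : (2 * de)^-1 * ((x - ka) ^+ 2 - (x - (ka + de)) ^+ 2) = x - ka - de / 2.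
  have -> : (x - ka) ^+ 2 - (x - (ka + de)) ^+ 2 = (2 * de) * (x - ka - de / 2) by lra.
  by rewrite mulKf// mulf_neq0// gt_eqF.
have -> : (6 * de)^-1 * ((x - ka) ^+ 3 - (x - (ka + de)) ^+ 3) =
    ((x - ka) ^+ 2 - (x - ka) * de + de ^+ 2 / 3) / 2.
  have -> : (x - ka) ^+ 3 - (x - (ka + de)) ^+ 3 =
    (6 * de) * (((x - ka) ^+ 2 - (x - ka) * de + de ^+ 2 / 3) / 2) by lra.
  by rewrite mulKf// mulf_neq0// gt_eqF.
by constructor; lra.
Qed.

(** The bound [lev <= lev1 * max (x - ka) 0] is convexity; through it [young_flux] extracts from
    [lev] the weight [lev1] that [<A, Du>] carries. The lower bound by [max (x - (ka + de)) 0]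
    returns to the sharp truncation at the higher level. *)
Lemma lev_bounds ka de x : 0 < de -> 0 <= ka ->
  [/\ 0 <= lev1 ka de x <= 1, 0 <= lev ka de x <= `|x|,
      lev ka de x ^+ 2 <= 2 * Lev ka de x <= x ^+ 2,
      lev ka de x <= lev1 ka de x * Num.max (x - ka) 0 &
      [/\ lev ka de x <= Num.max (x - ka) 0, 2 * Lev ka de x <= Num.max (x - ka) 0 ^+ 2,
        Num.max (x - (ka + de)) 0 <= lev ka de x & (x <= ka -> Lev ka de x = 0 /\ lev ka de x = 0)]].
Proof.
move=> d0 k0; have dn : de != 0 by rewrite gt_eqF.
have x0 : 0 <= x -> `|x| = x by move=> ?; rewrite ger0_norm.
case: (levP ka x d0) => [h|/andP[h1 h2]|h].
- rewrite !max_r; try lra.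
  by rewrite expr0n/= !mulr0 !lexx ler01 normr_ge0 sqr_ge0.
- pose y := x - ka; pose t := y / de.
  have t0 : 0 <= t by rewrite /t divr_ge0//; rewrite /y; lra.
  have t1 : t <= 1 by rewrite /t ler_pdivrMr// mul1r /y; lra.
  have y0 : 0 <= y by rewrite /y; lra.
  have yE : y = t * de by rewrite /t divfK.
  rewrite max_l -/y//; rewrite max_r; last by lra.
  rewrite x0; last lra.
  have -> : y ^+ 2 / (2 * de) = t * y / 2.
    by rewrite /t invfM; have := erefl (y * y * (2^-1 * de^-1)); lra.
  have -> : y ^+ 3 / (6 * de) = t * (y * y) / 6.
    by rewrite /t invfM; have := erefl (y * y * (2^-1 * de^-1)); lra.
  have ty : t * y <= y by rewrite ler_piMl.
  have ty0 : 0 <= t * y by rewrite mulr_ge0.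
  have yx : y <= x by rewrite /y; lra.
  have tyy : t * (y * y) <= y * y := ler_piMl (mulr_ge0 y0 y0) t1.
  have yyx : y * y <= x * x by apply: ler_pM.
  have ttyy : t * (t * (y * y)) <= t * (y * y) by exact: ler_wpM2l.
  have tyy0 : 0 <= t * (y * y) := mulr_ge0 t0 (mulr_ge0 y0 y0).
  split; rewrite -?/t; try (apply/andP; split); try lra.
  split; try lra; move=> xk.
  have -> : t = 0 by apply/eqP; rewrite eq_le t0 andbT /t ler_pdivrMr// mul0r /y; lra.
  by rewrite !mul0r.
- pose y := x - ka; rewrite -/y.
  have yd : de <= y by rewrite /y; lra.
  rewrite max_l; last lra.
  rewrite max_l; last lra.
  rewrite x0; last lra.
  have yx : y <= x by rewrite /y; lra.
  have yyx : y * y <= x * x by apply: ler_pM => //; lra.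
  have ydd : de * de <= y * de by rewrite ler_wpM2r// ltW.
  have dd0 : 0 < de * de by rewrite mulr_gt0.
  have e1 : x - (ka + de) = y - de by rewrite /y; lra.
  split; try (apply/andP; split); try lra.
  split; try lra.
Qed.

End level_functions.
Section cutoff.
Context (R : realType) (n : nat).
Local Notation V := (spacetime R n).
Local Notation VN := ('rV[R]_n * R)%type.

(** A C^1 step from 0 to 1 over [[0, 2]] with slope at most 1. The factor 2 in [cutX] and [cutT]
    makes these run over [[0, 2]] across the transition. *)
Definition smooth (s : R) : R := lev 0 1 s - lev 1 1 s.
Definition smooth1 (s : R) : R := lev1 0 1 s - lev1 1 1 s.

Lemma is_derive_smooth (s : R) : is_derive s 1 smooth (smooth1 s).
Proof. exact: is_deriveB (is_derive_lev _ _ _) (is_derive_lev _ _ _). Qed.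

Lemma continuous_smooth1 : continuous smooth1.
Proof. by move=> s; apply: cvgB; exact: continuous_lev1. Qed.

Lemma smooth_bounds (s : R) : [/\ 0 <= smooth s <= 1, 0 <= smooth1 s <= 1,
  s <= 0 -> smooth s = 0 /\ smooth1 s = 0 & 2 <= s -> smooth s = 1].
Proof.
rewrite /smooth /smooth1.
case: (levP 0 s (@ltr01 R)) => [h|/andP[h1 h2]|h];
case: (levP 1 s (@ltr01 R)) => [h'|/andP[h1' h2']|h']; rewrite ?subr0 ?divr1; try (exfalso; lra).
- by rewrite lexx ler01; split=> //; lra.
- have := @ler_piMl _ s s; have := sqr_ge0 s; have := sqr_ge0 (1 - s).
  move=> *; split; try (apply/andP; split); try lra.
- have := sqr_ge0 s; have := sqr_ge0 (1 - s).
  have -> : s = 1 by lra.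
  by move=> *; split; try (apply/andP; split); try lra.
- have -> : s = 1 by lra.
  by split; try (apply/andP; split); try lra.
- have := sqr_ge0 (2 - s); have := sqr_ge0 (s - 1).
  have : 0 <= (s - 1) * (2 - s) by rewrite mulr_ge0//; lra.
  move=> *; split; try (apply/andP; split); try lra.
- by split; try (apply/andP; split); try lra.
Qed.

Variables (x0 : 'rV[R]_n) (r1 r2 a1 a2 : R) (N : nat).
Hypotheses (r10 : 0 < r1) (r12 : r1 < r2) (a12 : a1 < a2).

(** The squared distance is a polynomial, so the cutoff is differentiable at the centre too. *)
Definition nsq (z : V) : R := \sum_i (co (Some i) z - x0 0 i) ^+ 2.
Definition nsq1 o (z : V) : R := 2 * \sum_i (co (Some i) z - x0 0 i) * (Some i == o)%:R.
Definition cutX (z : V) : R := 2 * (r2 ^+ 2 - r1 ^+ 2)^-1 * (r2 ^+ 2 - nsq z).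
Definition cutX1 o (z : V) : R := 2 * (r2 ^+ 2 - r1 ^+ 2)^-1 * - nsq1 o z.
Definition cutT (z : V) : R := 2 * (a2 - a1)^-1 * (co None z - a1).
Definition cutT1 (o : option 'I_n) : R := 2 * (a2 - a1)^-1 * (None == o)%:R.
Definition zeta (z : V) : R := smooth (cutX z) * smooth (cutT z).
Definition zeta1 o (z : V) : R :=
  smooth1 (cutX z) * cutX1 o z * smooth (cutT z) + smooth (cutX z) * (smooth1 (cutT z) * cutT1 o).
Definition cut (z : V) : R := zeta z ^+ N.+2.
Definition cut1 o (z : V) : R := N.+2%:R * zeta z ^+ N.+1 * zeta1 o z.

Let r0 : 0 < r2 ^+ 2 - r1 ^+ 2.
Proof. by rewrite subr_sqr mulr_gt0//; move: (r10) (r12); lra. Qed.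

Lemma nsqE z : nsq z = enorm (z.1 - x0) ^+ 2.
Proof.
rewrite /enorm sqr_sqrtr; last by apply: sumr_ge0 => i _; exact: sqr_ge0.
by apply: eq_bigr => i _; rewrite !mxE.
Qed.

Lemma nsq_line (h : R) o (z : VN) :
  nsq (h *: dir R o + z) = nsq z + h * nsq1 o z + h ^+ 2 * \sum_(i < n) (Some i == o)%:R.
Proof.
rewrite /nsq /nsq1 mulrCA !mulr_sumr -!big_split; apply: eq_bigr => i _.
rewrite co_line; case: (Some i == o) => /=; lra.
Qed.

Lemma is_derive_nsq o (z : VN) : is_derive z (dir R o) (nsq : VN -> R) (nsq1 o z).
Proof.
apply/is_derive_line; pose c : R := \sum_(i < n) (Some i == o)%:R.
have -> : (fun h : R => (nsq : VN -> R) (h *: dir R o + z)) =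
    cst (nsq z) + (nsq1 o z \*: id) + c \*: (id ^+ 2).
  by apply/funext => h; rewrite nsq_line -/c /= mulrC [_ * c]mulrC.
apply: (is_derive_eq (is_deriveD (is_deriveD (is_derive_cst _ _ _)
  (is_deriveZ (nsq1 o z) (is_derive_id _ _))) (is_deriveZ c (is_deriveX 2 (is_derive_id _ _))))).
by rewrite /GRing.scale/= expr1; lra.
Qed.

Lemma is_derive_cutX o (z : VN) : is_derive z (dir R o) (cutX : VN -> R) (cutX1 o z).
Proof.
have := is_deriveZ (2 * (r2 ^+ 2 - r1 ^+ 2)^-1) (is_deriveB (is_derive_cst (r2 ^+ 2) z (dir R o)) (is_derive_nsq o z)).
by rewrite sub0r.
Qed.

Lemma is_derive_cutT o (z : VN) : is_derive z (dir R o) (cutT : VN -> R) (cutT1 o).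
Proof.
apply: is_derive_affine => h; rewrite /cutT /cutT1 co_line; lra.
Qed.

Lemma is_derive_zeta o (z : VN) : is_derive z (dir R o) (zeta : VN -> R) (zeta1 o z).
Proof.
have d1 := is_derive_circ (is_derive_smooth (cutX z)) (is_derive_cutX o z).
have d2 := is_derive_circ (is_derive_smooth (cutT z)) (is_derive_cutT o z).
apply: (is_derive_eq (is_deriveM d1 d2)).
change (smooth (cutX z) * (smooth1 (cutT z) * cutT1 o) +
  smooth (cutT z) * (smooth1 (cutX z) * cutX1 o z) = zeta1 o z).
rewrite /zeta1; lra.
Qed.

Lemma is_derive_cut o (z : VN) : is_derive z (dir R o) (cut : VN -> R) (cut1 o z).
Proof.
have -> : (cut : VN -> R) = (zeta : VN -> R) ^+ N.+2 by apply/funext => w; rewrite exprfctE.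
apply: (is_derive_eq (is_deriveX N.+2 (is_derive_zeta o z))).
by rewrite /cut1 /GRing.scale/= mulr_natl.
Qed.

Lemma zeta01 z : 0 <= zeta z <= 1.
Proof.
have [/andP[? ?] _ _ _] := smooth_bounds (cutX z).
have [/andP[? ?] _ _ _] := smooth_bounds (cutT z).
by rewrite /zeta mulr_ge0//= mulr_ile1.
Qed.

Lemma cut_range z : 0 <= cut z <= 1.
Proof. by have /andP[? ?] := zeta01 z; rewrite /cut exprn_ge0//= exprn_ile1. Qed.

Lemma cut_supp z : cut z != 0 -> enorm (z.1 - x0) < r2 /\ a1 < z.2.
Proof.
have r20 : 0 < r2 by exact: lt_trans r12.
move=> c0; have : zeta z != 0 by apply: contra c0 => /eqP h; rewrite /cut h expr0n.
rewrite /zeta mulf_eq0 negb_or => /andP[hX hT]; split.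
  rewrite ltNge; apply: contra hX => h.
  have [_ _ + _] := smooth_bounds (cutX z) => /(_ _)[|-> //].
  rewrite /cutX pmulr_rle0 ?mulr_gt0 ?invr_gt0// subr_le0 nsqE.
  by rewrite ler_sqr ?nnegrE// ?sqrtr_ge0// ltW.
rewrite ltNge; apply: contra hT => h.
have [_ _ + _] := smooth_bounds (cutT z) => /(_ _)[|-> //].
by rewrite /cutT pmulr_rle0 ?mulr_gt0 ?invr_gt0 ?subr_gt0// subr_le0.
Qed.

Lemma cut_eq1 z : enorm (z.1 - x0) <= r1 -> a2 <= z.2 -> cut z = 1.
Proof.
move=> hx ht; rewrite /cut /zeta.
have [_ _ _ ->] := smooth_bounds (cutX z); last first.
  rewrite /cutX -mulrA ler_peMr// mulrC ler_pdivlMr// mul1r nsqE lerD2l lerN2.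
  by rewrite ler_sqr ?nnegrE// ?sqrtr_ge0// ltW.
have [_ _ _ ->] := smooth_bounds (cutT z); last first.
  by rewrite /cutT -mulrA ler_peMr// mulrC ler_pdivlMr ?subr_gt0// mul1r lerD2r.
by rewrite mulr1 expr1n.
Qed.

Lemma cut1_le o z : `|cut1 o z| <=
  N.+2%:R * zeta z ^+ N.+1 * (if o is Some _ then 4 / (r2 - r1) else 2 / (a2 - a1)).
Proof.
have /andP[z0 z1] := zeta01 z.
rewrite /cut1 normrM ger0_norm ?mulr_ge0 ?exprn_ge0// ler_wpM2l ?mulr_ge0 ?exprn_ge0//.
have [/andP[X0 X1] /andP[X10 X11] Xz _] := smooth_bounds (cutX z).
have [/andP[T0 T1] /andP[T10 T11] _ _] := smooth_bounds (cutT z).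
rewrite /zeta1; case: o => [i|].
  rewrite /cutT1 (_ : (None == Some i) = false)// !mulr0 addr0 normrM [`|_ * cutX1 _ _|]normrM.
  rewrite (ger0_norm X10) (ger0_norm T0).
  have [XX|XX] := leP (cutX z) 0.
    have [_ ->] := Xz XX; rewrite !mul0r divr_ge0// subr_ge0 ltW//.
  apply: (@le_trans _ _ (`|cutX1 (Some i) z|)).
    by rewrite mulrAC ler_piMl// mulr_ile1.
  have nn : nsq z < r2 ^+ 2.
    by move: XX; rewrite /cutX pmulr_rgt0 ?subr_gt0// mulr_gt0 ?invr_gt0.
  rewrite /cutX1 normrM normrN /nsq1 (bigD1 i)//= eqxx mulr1 big1 ?addr0; last first.
    move=> j ji; rewrite (_ : (Some j == Some i) = false) ?mulr0//.
    by apply/negbTE; apply: contra ji => /eqP[->].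
  have xr : `|z.1 0 i - x0 0 i| <= r2.
    have r20 : 0 < r2 by exact: lt_trans r12.
    rewrite -ler_sqr ?nnegrE ?(ltW r20)// real_normK ?num_real//.
    apply: le_trans (ltW nn); rewrite /nsq (bigD1 i)//= lerDl.
    by apply: sumr_ge0 => j _; exact: sqr_ge0.
  rewrite [`|2 / _|]ger0_norm ?divr_ge0 ?(ltW r0)// [`|2 * _|]normrM (ger0_norm (_ : 0 <= 2))//.
  (* A derivative of the squared distance is at most [2 * r2], and [4 * r2 / ((r2 - r1) * (r2 + r1))
     <= 4 / (r2 - r1)]. *)
  rewrite subr_sqr invfM mulrACA; apply: (@le_trans _ _ (2 * 2 * ((r2 - r1)^-1 * (r2 + r1)^-1 * r2))).
    by rewrite ler_wpM2l// ler_wpM2l// mulr_ge0 ?invr_ge0 ?subr_ge0 ?addr_ge0 ?(ltW r12) ?(ltW r10) ?(ltW (lt_trans r10 r12)).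
  apply: (@le_trans _ _ (4 * ((r2 - r1)^-1 * ((r2 + r1)^-1 * r2)))); first lra.
  rewrite ler_wpM2l// ler_piMr// ?invr_ge0; first by rewrite subr_ge0 ltW.
  have r20 := lt_trans r10 r12; by rewrite mulrC ler_pdivrMr ?addr_gt0// mul1r lerDl ltW.
rewrite /cutX1 /nsq1 big1 ?mulr0 ?oppr0 ?mulr0 ?mul0r ?add0r; last first.
  by move=> j _; rewrite (_ : (Some j == None) = false)// mulr0.
rewrite /cutT1 eqxx mulr1 !normrM (ger0_norm X0) (ger0_norm T10).
have i0 : 0 <= (a2 - a1)^-1 by rewrite invr_ge0 subr_ge0 ltW.
rewrite (ger0_norm i0) (ger0_norm (_ : 0 <= 2))//.
have h : 0 <= 2 / (a2 - a1) by rewrite divr_ge0// subr_ge0 ltW.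
by rewrite mulrA ler_piMl// mulr_ile1.
Qed.

Lemma cut1_eq0 o z : cut z = 0 -> cut1 o z = 0.
Proof.
move=> c0; have z0 : zeta z = 0 by move/eqP : c0; rewrite /cut expf_eq0 => /andP[_ /eqP].
by rewrite /cut1 z0 expr0n/= mulr0 mul0r.
Qed.

Lemma measurable_cut : measurable_fun setT cut /\ forall o, measurable_fun setT (cut1 o).
Proof.
have mc o : measurable_fun setT (co o : V -> R) by exact: measurable_co.
have mn : measurable_fun setT nsq.
  by apply: measurable_sum => i; apply: measurable_funX; exact: measurable_funB.
have mX : measurable_fun setT cutX by apply: measurable_funM => //; exact: measurable_funB.
have mT : measurable_fun setT cutT by apply: measurable_funM => //; exact: measurable_funB.
have ms (f : V -> R) : measurable_fun setT f -> measurable_fun setT (fun z => smooth (f z)).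
  move=> mf; apply: (measurableT_comp _ mf); apply: continuous_measurable_fun => s.
  exact: is_derive_continuous (is_derive_smooth s).
have ms1 (f : V -> R) : measurable_fun setT f -> measurable_fun setT (fun z => smooth1 (f z)).
  move=> mf; apply: (measurableT_comp _ mf); apply: continuous_measurable_fun.
  exact: continuous_smooth1.
have mz : measurable_fun setT zeta by apply: measurable_funM; exact: ms.
split; first exact: measurable_funX.
move=> o; apply: measurable_funM.
  by apply: measurable_funM => //; exact: measurable_funX.
apply: measurable_funD; apply: measurable_funM.
- apply: measurable_funM; first exact: ms1.
  apply: measurable_funM => //; apply: measurable_funN; apply: measurable_funM => //.
  by apply: measurable_sum => i; apply: measurable_funM => //; exact: measurable_funB.
- exact: ms.
- exact: ms.
- by apply: measurable_funM => //; exact: ms1.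
Qed.

Lemma continuous_cut1 o (z : VN) : continuous (fun h : R => cut1 o (h *: dir R o + z)).
Proof.
have cl (f f1 : VN -> R) : (forall z, is_derive z (dir R o) f (f1 z)) ->
    continuous (fun y : R => f (y *: dir R o + z)).
  by move=> df y; apply: is_derive_continuous; exact: is_derive_along (df _).
have cX := cl _ _ (is_derive_cutX o); have cT := cl _ _ (is_derive_cutT o).
have cZ := cl _ _ (is_derive_zeta o).
have cc (f : R -> R) (g : VN -> R) : continuous f ->
    continuous (fun y : R => g (y *: dir R o + z)) -> continuous (fun y : R => f (g (y *: dir R o + z))).
  by move=> cf cg y; exact: (@continuous_cvg _ _ _ _ _ _ f _ (cf _) (cg y)).
have cs : continuous smooth by move=> s; exact: is_derive_continuous (is_derive_smooth s).
have cX1 : continuous (fun y : R => cutX1 o (y *: dir R o + z)).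
  apply: (cl _ (fun=> 2 * (r2 ^+ 2 - r1 ^+ 2)^-1 * - (2 * \sum_(i < n) (Some i == o)%:R))).
  move=> w; apply: is_derive_affine => h; rewrite /cutX1 /nsq1.
  have -> : \sum_i (co (Some i) (h *: dir R o + w) - x0 0 i) * (Some i == o)%:R =
      \sum_i (co (Some i) w - x0 0 i) * (Some i == o)%:R + h * \sum_(i < n) (Some i == o)%:R.
    rewrite mulr_sumr -big_split; apply: eq_bigr => i _; rewrite co_line.
    by case: (Some i == o) => /=; lra.
  lra.
move=> y; apply: cvgM; first apply: cvgM.
- exact: cvg_cst.
- apply: (cc (fun s => s ^+ N.+1) zeta _ cZ); exact: exprn_continuous.
- apply: cvgD; apply: cvgM.
  + by apply: cvgM; [exact: (cc _ _ continuous_smooth1 cX)|exact: cX1].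
  + exact: (cc _ _ cs cT).
  + exact: (cc _ _ cs cX).
  + by apply: cvgM; [exact: (cc _ _ continuous_smooth1 cT)|exact: cvg_cst].
Qed.

End cutoff.

(** * Pointwise inequalities for powers *)

Section pointwise_young.
Context (R : realType).
Implicit Types (x y : R).

Lemma powR_ge1 (x a : R) : 1 <= x -> 0 <= a -> 1 <= x `^ a.
Proof. by move=> x1 a0; rewrite -(powRr0 x) ler_powR. Qed.

Lemma powR_le1 (x a b : R) : 0 <= x <= 1 -> 0 < b -> b <= a -> x `^ a <= x `^ b.
Proof.
move=> /andP[x0 x1] b0 ba; have [->|xn] := eqVneq x 0; first by rewrite !powR0 ?gt_eqF//; lra.
have xp : 0 < x by rewrite lt_neqAle eq_sym xn.
by rewrite -(subrKC b a) powRD ?xn ?implybT// ler_piMr ?powR_ge0// -(powRr0 x) ger_powR ?xp ?x1//; lra.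
Qed.

Lemma young_eps (th e x y : R) : 0 < th < 1 -> 0 < e -> 0 <= x -> 0 <= y ->
  x `^ th * y <= e * x + e `^ (- (th / (1 - th))) * y `^ (1 - th)^-1.
Proof.
move=> /andP[th0 th1] e0 x0 y0; have t1 : 0 < 1 - th by lra.
have := @conjugate_powR R ((e * x) `^ th) (e `^ (- th) * y) th^-1 (1 - th)^-1.
rewrite !invrK !invr_gt0 => /(_ (powR_ge0 _ _) (mulr_ge0 (powR_ge0 _ _) y0) th0 t1 (subrKC _ _)).
rewrite -powRrM mulfV ?gt_eqF// powRr1 ?mulr_ge0 ?(ltW e0)// powRM ?(ltW e0)//.
rewrite [(e `^ (- th) * y) `^ _]powRM ?powR_ge0// -powRrM mulNr.
have -> : e `^ th * x `^ th * (e `^ (- th) * y) = x `^ th * y.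
  by rewrite mulrACA -powRD ?subrr ?powRr0 ?mul1r// (gt_eqF e0) implybT.
have h1 : e * x * th <= e * x by rewrite ler_piMr ?mulr_ge0 ?(ltW e0)//; lra.
have h2 : e `^ (- (th / (1 - th))) * y `^ (1 - th)^-1 * (1 - th) <=
    e `^ (- (th / (1 - th))) * y `^ (1 - th)^-1.
  by rewrite ler_piMr ?mulr_ge0 ?powR_ge0//; lra.
lra.
Qed.

(** The energy carries [P] with weight [g1 * ze^(N+2)], the flux only has [g * ze^(N+1)]. From
    [g <= g1 * s], [g1 <= 1] and [N + 2 >= 1/(1 - th)] the latter is at most
    [(g1 * ze^(N+2))^th * s], so [P^th] comes with just the weight that Young's inequality can
    absorb. *)
Lemma young_flux (N : nat) (th e P ai b s g g1 ze Lx e1 A : R) (lam0 := (1 - th)^-1) :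
  0 < th < 1 -> 0 < e -> lam0 <= N.+2%:R ->
  0 <= P -> 0 <= ai -> 0 <= b -> 0 <= s -> 0 <= Lx ->
  0 <= g1 <= 1 -> 0 <= g -> g <= g1 * s -> 0 <= ze <= 1 ->
  `|e1| <= N.+2%:R * ze ^+ N.+1 * Lx -> `|A| <= b * (1 + (ai * P) `^ th) ->
  g * (`|A| * `|e1|) <= e * (g1 * ze ^+ N.+2 * P) +
    (N.+2%:R + e `^ (- (th / (1 - th))) * N.+2%:R `^ lam0) *
    (b * (s * Lx) + ai `^ (th * lam0) * b `^ lam0 * (s * Lx) `^ lam0).
Proof.
move=> th01 e0 lN P0 ai0 b0 s0 Lx0 /andP[g10 g11] g0 gs /andP[z0 z1] e1le Ale.
have /andP[th0 th1] := th01; have t1 : 0 < 1 - th by lra.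
have N0 : 0 <= N.+2%:R :> R by [].
have l0 : 0 < lam0 by rewrite invr_gt0.
have ex0 : 0 <= ze ^+ N.+1 by rewrite exprn_ge0.
have F : g * (`|A| * `|e1|) <= g * ((b * (1 + (ai * P) `^ th)) * (N.+2%:R * ze ^+ N.+1 * Lx)).
  by rewrite ler_wpM2l// ler_pM.
apply: (le_trans F).
have gz : g * ze ^+ N.+1 <= (g1 * ze ^+ N.+2) `^ th * s.
  rewrite powRM ?exprn_ge0//.
  have h1 : g <= g1 `^ th * s.
    apply: (le_trans gs); rewrite ler_wpM2r//.
    by rewrite -[leLHS]powRr1//; apply: powR_le1; rewrite ?g10 ?g11//; lra.
  have h2 : ze ^+ N.+1 <= (ze ^+ N.+2) `^ th.
    rewrite -!powR_mulrn// -powRrM; apply: powR_le1; rewrite ?z0 ?z1 ?mulr_gt0//.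
    have : 1 <= N.+2%:R * (1 - th) by rewrite -ler_pdivrMr// mul1r.
    by rewrite -(natr1 N.+1); lra.
  by rewrite mulrAC [leRHS]mulrC mulrC; apply: ler_pM => //; rewrite mulr_ge0 ?powR_ge0.
have T1 : g * b * (N.+2%:R * ze ^+ N.+1 * Lx) <= N.+2%:R * (b * (s * Lx)).
  have gs' : g <= s by apply: (le_trans gs); rewrite ler_piMl.
  have zz : ze ^+ N.+1 <= 1 by rewrite exprn_ile1.
  have -> : N.+2%:R * (b * (s * Lx)) = s * b * (N.+2%:R * 1 * Lx) by lra.
  apply: ler_pM; rewrite ?mulr_ge0 ?ler_wpM2r// ler_wpM2l//.
pose y := N.+2%:R * b * ai `^ th * (s * Lx).
have y0 : 0 <= y by rewrite !mulr_ge0 ?powR_ge0.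
have x0 : 0 <= g1 * ze ^+ N.+2 * P by rewrite !mulr_ge0 ?exprn_ge0.
have T2 : g * (b * (ai * P) `^ th) * (N.+2%:R * ze ^+ N.+1 * Lx) <= (g1 * ze ^+ N.+2 * P) `^ th * y.
  rewrite (powRM _ ai0 P0) [X in _ <= X * _]powRM ?mulr_ge0 ?exprn_ge0//.
  have -> : g * (b * (ai `^ th * P `^ th)) * (N.+2%:R * ze ^+ N.+1 * Lx) =
     (g * ze ^+ N.+1) * (N.+2%:R * b * ai `^ th * P `^ th * Lx) by lra.
  have -> : (g1 * ze ^+ N.+2) `^ th * P `^ th * y =
     ((g1 * ze ^+ N.+2) `^ th * s) * (N.+2%:R * b * ai `^ th * P `^ th * Lx) by rewrite /y; lra.
  by rewrite ler_wpM2r// !mulr_ge0 ?powR_ge0.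
have := young_eps th01 e0 x0 y0; rewrite -/lam0.
have -> : y `^ lam0 = N.+2%:R `^ lam0 * (ai `^ (th * lam0) * b `^ lam0 * (s * Lx) `^ lam0).
  rewrite /y !powRM ?mulr_ge0 ?powR_ge0// -powRrM; lra.
set E := e `^ _; set B1 := b * (s * Lx); set B2 := ai `^ _ * _ * _.
rewrite -/B1 in T1; have B10 : 0 <= B1 by rewrite !mulr_ge0.
have B20 : 0 <= B2 by rewrite !mulr_ge0 ?powR_ge0.
have c1 : 0 <= E * N.+2%:R `^ lam0 * B1 by rewrite !mulr_ge0 ?powR_ge0.
have c2 : 0 <= N.+2%:R * B2 by rewrite mulr_ge0.
lra.
Qed.

(** Where [u > ka], the excess over the lower level [k0] is at least [ka - k0 >= k / H]. This gap
    lets a power [e <= m] of the excess be bounded by the power [m], at the cost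
    [H^(m - e) <= H^m]. *)
Lemma level_power (e m k k0 ka H u Y : R) : 0 < e <= m -> 0 < k -> k0 < ka ->
  1 <= H -> k <= H * (ka - k0) -> 0 <= Y ->
  Num.max (u - k0) 0 `^ m <= k `^ m * Y ->
  Num.max (u - ka) 0 `^ e <= k `^ e * (H `^ m * Y).
Proof.
move=> /andP[e0 em] kp kk H1 kH Y0 hY.
have [uk|uk] := leP u ka.
  by rewrite max_r ?powR0 ?gt_eqF ?mulr_ge0 ?powR_ge0//; lra.
rewrite max_l ?subr_ge0 ?(ltW uk)//.
rewrite max_l in hY; last lra.
have w0 : 0 < u - k0 by lra.
have Hp : 0 < H by lra.
pose w := (u - k0) / k.
have wp : 0 < w by rewrite divr_gt0.
have wH : H^-1 <= w.
  rewrite /w ler_pdivlMr// mulrC ler_pdivrMr//; apply: (le_trans kH).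
  by rewrite mulrC ler_wpM2r//; lra.
have wm : w `^ m <= Y.
  rewrite /w powRM ?invr_ge0 ?(ltW kp) ?(ltW w0)// -[k^-1]powR_inv1 ?(ltW kp)// -powRrM mulN1r powRN.
  by rewrite ler_pdivrMr ?powR_gt0// mulrC.
have s1 : (u - ka) `^ e <= k `^ e * w `^ e.
  rewrite -powRM ?(ltW kp) ?(ltW wp)//; apply: ge0_ler_powR; rewrite ?nnegrE ?(ltW e0)//.
  - lra.
  - by rewrite mulr_ge0 ?(ltW kp) ?(ltW wp).
  - by rewrite /w mulrC divfK ?gt_eqF//; lra.
apply: (le_trans s1); rewrite ler_wpM2l ?powR_ge0//.
have -> : w `^ e = w^-1 `^ (m - e) * w `^ m.
  rewrite -[w^-1]powR_inv1 ?(ltW wp)// -powRrM mulN1r opprB -powRD ?subrK//.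
  by rewrite (gt_eqF wp) implybT.
apply: ler_pM; rewrite ?powR_ge0//.
apply: (@le_trans _ _ (H `^ (m - e))).
  apply: ge0_ler_powR; rewrite ?nnegrE ?invr_ge0 ?(ltW wp) ?(ltW Hp)//; first lra.
  by rewrite -[H]invrK lef_pV2 ?posrE ?invr_gt0.
by rewrite ler_powR//; lra.
Qed.

End pointwise_young.
(** * Iteration step *)

Section step_integral.
Context d (T : measurableType d) (R : realType) (mu : {measure set T -> \bar R}).
Implicit Types (F G H : T -> R).

Let mpow F a : measurable_fun setT F -> measurable_fun setT (fun x => F x `^ a).
Proof. by move=> mF; exact: (measurableT_comp (measurable_powR a) mF). Qed.

Lemma hoelder2_bound F G (t f g : R) : 0 < t < 1 ->
  measurable_fun setT F -> measurable_fun setT G -> (forall x, 0 <= F x) -> (forall x, 0 <= G x) ->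
  (\int[mu]_x (F x)%:E <= f%:E)%E -> (\int[mu]_x (G x)%:E <= g%:E)%E ->
  (\int[mu]_x (F x `^ t * G x `^ (1 - t))%:E <= (f `^ t * g `^ (1 - t))%:E)%E.
Proof.
move=> t01 mF mG F0 G0 Ff Gg; have /andP[t0 t1] := t01.
have := @hoelder_pow _ _ _ mu (EFin \o F) (EFin \o G) t t01.
move=> /(_ (proj2 (measurable_EFinP _ _) mF) (proj2 (measurable_EFinP _ _) mG)) H.
apply: (@le_trans _ _ (\int[mu]_x ((EFin \o F) x `^ t * (EFin \o G) x `^ (1 - t)))%E).
  by rewrite le_eqVlt; apply/orP; left; apply/eqP; apply: eq_integral => x _; rewrite /= ?poweR_EFin.
apply: (le_trans (H _ _)) => [x|x|]; rewrite ?lee_fin//.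
rewrite EFinM -!poweR_EFin; apply: lee_pmul; rewrite ?poweR_ge0//.
  by apply: le_poweR => //; [exact: ltW|apply: integral_ge0 => x _; rewrite lee_fin].
by apply: le_poweR => //; [lra|apply: integral_ge0 => x _; rewrite lee_fin].
Qed.

Lemma hoelder3_bound (F G H : T -> R) (a b c f g h : R) : 0 < a -> 0 < b -> 0 < c -> a + b + c = 1 ->
  measurable_fun setT F -> measurable_fun setT G -> measurable_fun setT H ->
  (forall x, 0 <= F x) -> (forall x, 0 <= G x) -> (forall x, 0 <= H x) -> 0 <= g -> 0 <= h ->
  (\int[mu]_x (F x)%:E <= f%:E)%E -> (\int[mu]_x (G x)%:E <= g%:E)%E ->
  (\int[mu]_x (H x)%:E <= h%:E)%E ->
  (\int[mu]_x (F x `^ a * G x `^ b * H x `^ c)%:E <= (f `^ a * g `^ b * h `^ c)%:E)%E.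
Proof.
move=> a0 b0 c0 abc mF mG mH F0 G0 H0 g0 h0 Ff Gg Hh.
have a1 : 0 < 1 - a by lra.
have c1 : c / (1 - a) = 1 - b / (1 - a).
  have -> : c = (1 - a) - b by lra.
  by rewrite mulrBl mulfV// gt_eqF.
have t01 : 0 < b / (1 - a) < 1 by rewrite divr_gt0//= ltr_pdivrMr// mul1r; lra.
have GH := hoelder2_bound t01 mG mH G0 H0 Gg Hh; rewrite -c1 in GH.
have a01 : 0 < a < 1 by rewrite a0; lra.
have := @hoelder2_bound F (fun x => G x `^ (b / (1 - a)) * H x `^ (c / (1 - a))) a f _ a01 mF _ F0 _ Ff GH.
have e (x y : R) : 0 <= x -> 0 <= y ->
    (x `^ (b / (1 - a)) * y `^ (c / (1 - a))) `^ (1 - a) = x `^ b * y `^ c.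
  by move=> x0 y0; rewrite powRM ?powR_ge0// -!powRrM !divfK ?gt_eqF.
under eq_integral do rewrite e// mulrA.
rewrite e// mulrA; apply.
  by apply: measurable_funM; exact: mpow.
by move=> x; rewrite mulr_ge0 ?powR_ge0.
Qed.

(** The integral of [XF] is at most that of [RF], which is finite, so half of it is absorbed and
    [RF] has integral below [K]. The same [K] then serves twice: for the L^2 mass in the Sobolev
    inequality and for the energy in the slope. [F1] and [F2] stand for [a^-alpha] and [b^beta], [Y]
    for the normalised excess. *)
Lemma step_integral (RF XF W SL F1 F2 Y : T -> R)
    (al be x1 x2 x3 c1 c2 c3 c4 c5 c6 A B Q y nu K : R) :
  measurable_fun setT XF -> measurable_fun setT F1 -> measurable_fun setT F2 ->
  measurable_fun setT Y -> (forall x, 0 <= RF x) -> (forall x, 0 <= XF x) ->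
  (forall x, 0 <= SL x) -> (forall x, 0 <= F1 x) -> (forall x, 0 <= F2 x) -> (forall x, 0 <= Y x) ->
  1 < be -> 0 < al -> 0 < x1 -> 0 < x2 -> 0 < x3 -> x1 + x2 + x3 = 1 ->
  0 <= c1 -> 0 <= c2 -> 0 <= c3 -> 0 <= c4 -> 0 <= c5 -> 0 <= c6 -> 0 <= B -> 0 <= Q -> 0 <= y ->
  (forall x, RF x <= 2^-1 * XF x + (c1 * Y x + c2 * (F2 x `^ be^-1 * Y x `^ (1 - be^-1)) +
     c3 * (F1 x `^ x1 * F2 x `^ x2 * Y x `^ x3))) ->
  (forall x, SL x <= c4 * (F1 x `^ (al + 1)^-1 * XF x `^ (1 - (al + 1)^-1)) + c5 * Y x) ->
  (\int[mu]_x (F1 x)%:E <= (A * Q)%:E)%E -> (\int[mu]_x (F2 x)%:E <= (B * Q)%:E)%E ->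
  (\int[mu]_x (Y x)%:E <= (Q * y)%:E)%E ->
  (\int[mu]_x (RF x)%:E < +oo)%E -> (\int[mu]_x (XF x)%:E <= \int[mu]_x (RF x)%:E)%E ->
  (forall K : R, (\int[mu]_x (RF x)%:E < K%:E)%E ->
     (\int[mu]_x (W x)%:E <= (c6 * K `^ nu)%:E * \int[mu]_x (SL x)%:E)%E) ->
  2 * (c1 * (Q * y) + c2 * ((B * Q) `^ be^-1 * (Q * y) `^ (1 - be^-1)) +
    c3 * ((A * Q) `^ x1 * (B * Q) `^ x2 * (Q * y) `^ x3)) < K ->
  (\int[mu]_x (W x)%:E <= (c6 * K `^ nu * (c4 * ((A * Q) `^ (al + 1)^-1 * K `^ (1 - (al + 1)^-1)) +
     c5 * (Q * y)))%:E)%E.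
Proof.
move=> mX m1 m2 mY R0 X0 S0 F10 F20 Y0 be1 al0 x10 x20 x30 x123 c10 c20 c30 c40 c50 c60 B0 Q0 y0.
move=> RFle SLle i1 i2 iY Rfin XR hW hK.
have be0 := invf_itv01 be1.
have al1 : 0 < (al + 1)^-1 < 1 by rewrite invf_itv01// ltrDr.
have BQ0 : 0 <= B * Q by rewrite mulr_ge0.
have Qy0 : 0 <= Q * y by rewrite mulr_ge0.
set k1 := (X in 2 * X < _) in hK.
pose I := (\int[mu]_x (RF x)%:E)%E.
have If : I \is a fin_num by rewrite ge0_fin_numE// integral_ge0// => x _; rewrite lee_fin.
have mYE : measurable_fun setT (EFin \o Y) by exact/measurable_EFinP.
have H2 := hoelder2_bound be0 m2 mY F20 Y0 i2 iY.
have H3 := hoelder3_bound x10 x20 x30 x123 m1 m2 mY F10 F20 Y0 BQ0 Qy0 i1 i2 iY.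
have mF2 : measurable_fun setT (EFin \o (fun x => F2 x `^ be^-1 * Y x `^ (1 - be^-1))).
  by apply/measurable_EFinP; apply: measurable_funM; exact: mpow.
have mF3 : measurable_fun setT (EFin \o (fun x => F1 x `^ x1 * F2 x `^ x2 * Y x `^ x3)).
  by apply/measurable_EFinP; apply: measurable_funM; [apply: measurable_funM|]; exact: mpow.
have scale (c : R) (f : T -> R) (b : R) : 0 <= c -> measurable_fun setT (EFin \o f) -> (forall x, 0 <= f x) ->
    (\int[mu]_x (f x)%:E <= b%:E)%E -> (\int[mu]_x (c * f x)%:E <= (c * b)%:E)%E.
  move=> c0 mf f0 fb; under eq_integral do rewrite EFinM.
  rewrite ge0_integralZl//; last by move=> x _; rewrite lee_fin.
  by rewrite EFinM; apply: lee_wpmul2l; rewrite ?lee_fin.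
have addI (f g : T -> R) (b c : \bar R) : measurable_fun setT (EFin \o f) -> measurable_fun setT (EFin \o g) ->
    (forall x, 0 <= f x) -> (forall x, 0 <= g x) ->
    (\int[mu]_x (f x)%:E <= b -> \int[mu]_x (g x)%:E <= c -> \int[mu]_x (f x + g x)%:E <= b + c)%E.
  move=> mf mg f0 g0 fb gc; under eq_integral do rewrite EFinD.
  rewrite ge0_integralD//; try by move=> x _; rewrite lee_fin.
  exact: leeD.
have mZ (c : R) (f : T -> R) : measurable_fun setT (EFin \o f) -> measurable_fun setT (EFin \o (fun x => c * f x)).
  by move=> /measurable_EFinP mf; apply/measurable_EFinP; exact: measurable_funM.
have mA (f g : T -> R) : measurable_fun setT (EFin \o f) -> measurable_fun setT (EFin \o g) ->
    measurable_fun setT (EFin \o (fun x => f x + g x)).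
  by move=> /measurable_EFinP mf /measurable_EFinP mg; apply/measurable_EFinP; exact: measurable_funD.
have Rk : (I <= (2^-1)%:E * I + k1%:E)%E.
  apply: (@le_trans _ _ (\int[mu]_x (2^-1 * XF x + (c1 * Y x + c2 * (F2 x `^ be^-1 * Y x `^ (1 - be^-1)) +
     c3 * (F1 x `^ x1 * F2 x `^ x2 * Y x `^ x3)))%:E)%E).
    by apply: integral_le_ge0 => x; rewrite lee_fin//; exact: le_trans (RFle x).
  have p2 x : 0 <= F2 x `^ be^-1 * Y x `^ (1 - be^-1) by rewrite mulr_ge0 ?powR_ge0.
  have p3 x : 0 <= F1 x `^ x1 * F2 x `^ x2 * Y x `^ x3 by rewrite !mulr_ge0 ?powR_ge0.
  apply: (addI _ _) => [||x|x||].
  - by apply: mZ; exact/measurable_EFinP.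
  - by apply: (mA (fun x => _ + _)); [apply: mA|]; exact: mZ.
  - by rewrite mulr_ge0.
  - by rewrite !addr_ge0// mulr_ge0.
  - have mXE : measurable_fun setT (EFin \o XF) by exact/measurable_EFinP.
    under eq_integral do rewrite EFinM.
    rewrite ge0_integralZl//; last by move=> x _; rewrite lee_fin.
    by apply: lee_wpmul2l; rewrite ?lee_fin.
  rewrite /k1 EFinD.
  pose G1 x := c1 * Y x; pose G2 x := c2 * (F2 x `^ be^-1 * Y x `^ (1 - be^-1)).
  pose G3 x := c3 * (F1 x `^ x1 * F2 x `^ x2 * Y x `^ x3).
  have g1 x : 0 <= G1 x by rewrite mulr_ge0.
  have g2 x : 0 <= G2 x by rewrite mulr_ge0.
  have g3 x : 0 <= G3 x by rewrite mulr_ge0.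
  have h12 := addI G1 G2 _ _ (mZ _ _ mYE) (mZ _ _ mF2) g1 g2 (scale _ _ _ c10 mYE Y0 iY) (scale _ _ _ c20 mF2 p2 H2).
  have m12 := mA G1 G2 (mZ _ _ mYE) (mZ _ _ mF2).
  exact: (addI _ G3 _ _ m12 (mZ _ _ mF3) (fun x => addr_ge0 (g1 x) (g2 x)) g3 h12 (scale _ _ _ c30 mF3 p3 H3)).
have Ik : (I <= (2 * k1)%:E)%E.
  move: Rk; rewrite -(fineK If) -EFinM -EFinD !lee_fin; lra.
have IK : (I < K%:E)%E by apply: (le_lt_trans Ik); rewrite lte_fin.
apply: (le_trans (hW K IK)); rewrite [leRHS]EFinM; apply: lee_wpmul2l.
  by rewrite lee_fin mulr_ge0 ?powR_ge0.
have XK : (\int[mu]_x (XF x)%:E <= K%:E)%E by apply: (le_trans XR); exact: ltW.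
have H4 := hoelder2_bound al1 m1 mX F10 X0 i1 XK.
apply: (@le_trans _ _ (\int[mu]_x (c4 * (F1 x `^ (al + 1)^-1 * XF x `^ (1 - (al + 1)^-1)) + c5 * Y x)%:E)%E).
  by apply: integral_le_ge0 => x; rewrite lee_fin//; exact: le_trans (SLle x).
have mF4 : measurable_fun setT (EFin \o (fun x => F1 x `^ (al + 1)^-1 * XF x `^ (1 - (al + 1)^-1))).
  by apply/measurable_EFinP; apply: measurable_funM; exact: mpow.
rewrite EFinD; apply: (addI _ _) => [||x|x||]; try exact: mZ.
- by rewrite !mulr_ge0 ?powR_ge0.
- by rewrite mulr_ge0.
- by apply: scale => // x; rewrite mulr_ge0 ?powR_ge0.
- exact: scale.
Qed.

End step_integral.

(** * Arithmetic of the exponents *)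

Section exponents.
Context (R : realType) (nn p q al be : R).
(* [expr] is p_alpha, [expm] is m and [exps] is q_beta. [explam] is the exponent
   to which Young's inequality raises b; [exp1], [exp2] and [exp3] are the Hoelder
   exponents left for a^-alpha, b^beta and the excess. *)
Definition expA : R := al / (al + 1).
Definition expr : R := p * al / (al + 1).
Definition expm : R := expr * (nn + 2) / nn.
Definition exps : R := q * be / (be - 1).
Definition expth : R := (q - 1) / p.
Definition explam : R := (1 - expth)^-1.
Definition exp1 : R := expth * explam / al.
Definition exp2 : R := explam / be.
Definition exp3 : R := 1 - exp1 - exp2.

Hypotheses (n0 : 0 < nn) (p2 : 2 <= p) (al1 : 1 < al) (be1 : 1 < be)
  (pq : p <= q < p * (al / (al + 1)) * ((be - 1) / be) + 2 / (nn + 2)).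

Local Notation A := expA.
Definition expB : R := (be - 1) / be.
Local Notation B := expB.

Lemma expA_bounds : 0 < A < 1.
Proof. by move: (al1) => h; rewrite /expA divr_gt0 ?ltr_pdivrMr ?mul1r//=; lra. Qed.

Let B_bounds : 0 < B < 1.
Proof. by move: (be1) => h; rewrite /expB divr_gt0 ?ltr_pdivrMr ?mul1r//=; lra. Qed.

Lemma exprE : expr = p * A. Proof. by rewrite /expr -mulrA. Qed.

Let frac : 0 < 2 / (nn + 2) < 1.
Proof. by move: (n0) => h; rewrite divr_gt0 ?ltr_pdivrMr ?mul1r//=; lra. Qed.

Let AB : 0 < A * B < 1.
Proof.
have /andP[? ?] := expA_bounds; have /andP[? ?] := B_bounds.
by rewrite mulr_gt0//= mulr_ilt1// ltW.
Qed.

Let qlt : q < p * (A * B) + 2 / (nn + 2).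
Proof. by rewrite mulrA; have /andP[_ h] := pq; exact: h. Qed.

(** Both [A * B] and [2 / (nn + 2)] are below 1, so the condition on [q] keeps [q - p] below 1;
    [th < 1] and the finiteness of [lam] rest on this. *)
Lemma q_lt : 0 < p + 1 - q <= 1.
Proof.
have /andP[h1 h2] := AB; have /andP[h3 h4] := frac; have /andP[h5 _] := pq.
have : p * (A * B) <= p by rewrite ler_piMr//; [move: (p2); lra|exact: ltW].
move: (qlt); lra.
Qed.

Lemma th_bounds : 0 < expth < 1.
Proof.
have /andP[h1 h2] := q_lt; move: (p2) => h; have /andP[h5 _] := pq.
by rewrite /expth divr_gt0 ?ltr_pdivrMr ?mul1r//=; lra.
Qed.

Lemma lamE : explam = p / (p + 1 - q).
Proof.
have p0 : p != 0 by rewrite gt_eqF//; move: (p2); lra.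
rewrite /explam /expth -{1}(mulfV p0) -mulrBl invfM invrK mulrC; congr (_ * _^-1); lra.
Qed.

Lemma lam_ge : p <= explam.
Proof.
have /andP[h1 h2] := q_lt; rewrite lamE ler_peMr//; first by move: (p2); lra.
by rewrite invf_ge1.
Qed.

(** The numerator of [exp3] over [p + 1 - q]. The upper bound on [q] says exactly that
    [X > nn / ((nn + 2) * A)]. *)
Definition expX : R := (1 + p * (A * B) - q) / A.
Local Notation X := expX.

Let exp3E : exp3 = X / (p + 1 - q).
Proof.
have /andP[h1 _] := q_lt; have /andP[h3 _] := expA_bounds.
have p0 : p != 0 by rewrite gt_eqF//; move: (p2); lra.
have q0 : p + 1 - q != 0 by rewrite gt_eqF.
apply: (mulIf q0); rewrite divfK//.
have e1 : explam * (p + 1 - q) = p by rewrite lamE divfK.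
have e2 : expth * p = q - 1 by rewrite /expth divfK.
have e3 : exp1 * (p + 1 - q) = (q - 1) / al.
  have -> : exp1 * (p + 1 - q) = expth * (explam * (p + 1 - q)) / al by rewrite /exp1; lra.
  by rewrite e1 e2.
have e4 : exp2 * (p + 1 - q) = p / be.
  have -> : exp2 * (p + 1 - q) = (explam * (p + 1 - q)) / be by rewrite /exp2; lra.
  by rewrite e1.
have -> : exp3 * (p + 1 - q) = (p + 1 - q) - (q - 1) / al - p / be.
  by rewrite -e3 -e4 /exp3; lra.
have a0 : al != 0 by rewrite gt_eqF//; move: (al1); lra.
have b0 : be != 0 by rewrite gt_eqF//; move: (be1); lra.
have ai : al^-1 = A^-1 - 1.
  by rewrite /expA invfM invrK mulrDr mulVf// mulr1; lra.
have bi : be^-1 = 1 - B by rewrite /expB mulrBl mulfV// mul1r; lra.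
have aa : A^-1 * A = 1 by rewrite mulVf// gt_eqF.
rewrite /expX ai bi.
have -> : (1 + p * (A * B) - q) / A = A^-1 - q / A + p * B * (A^-1 * A) by lra.
rewrite aa; lra.
Qed.

Let Xgt : nn / ((nn + 2) * A) < X.
Proof.
have /andP[h3 _] := expA_bounds.
have -> : nn / ((nn + 2) * A) = nn / (nn + 2) / A by rewrite invfM mulrA.
rewrite /expX ltr_pM2r ?invr_gt0//.
have -> : nn / (nn + 2) = 1 - 2 / (nn + 2).
  have h : nn + 2 != 0 by rewrite gt_eqF// addr_gt0.
  by rewrite -[X in X - _](mulfV h) -mulrBl addrK.
move: (qlt); lra.
Qed.

Let Xp : 0 < X.
Proof.
have /andP[h3 _] := expA_bounds.
apply: lt_trans Xgt; apply: divr_gt0 => //; apply: mulr_gt0 => //; exact: addr_gt0.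
Qed.

Lemma exp3_gt0 : 0 < exp3.
Proof. by have /andP[h _] := q_lt; rewrite exp3E; apply: divr_gt0. Qed.

(** Equivalent to the upper bound on [q]. It is the room that lets [level_power] trade the power
    [lam / exp3] of the excess for the power [m], and it makes [expD] positive. *)
Lemma lam1_lt : explam / exp3 < expm.
Proof.
have /andP[h1 _] := q_lt; have /andP[h3 _] := expA_bounds.
have q0 : p + 1 - q != 0 by rewrite gt_eqF.
rewrite lamE exp3E invfM invrK mulrACA mulVf// mulr1 /expm exprE.
have pp : 0 < p by move: (p2); lra.
have -> : p * A * (nn + 2) / nn = p * (nn / ((nn + 2) * A))^-1.
  by rewrite invf_div; lra.
rewrite ltr_pM2l// ltf_pV2 ?posrE ?Xp//.
by rewrite divr_gt0// mulr_gt0// addr_gt0.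
Qed.

Lemma exp12_gt0 : 0 < exp1 /\ 0 < exp2.
Proof.
have /andP[h1 h2] := th_bounds; have l0 : 0 < explam by have := lam_ge; move: (p2); lra.
have a0 : 0 < al by move: (al1); lra.
have b0 : 0 < be by move: (be1); lra.
split; last exact: divr_gt0.
by apply: divr_gt0 => //; exact: mulr_gt0.
Qed.

Lemma exp3_le : exp3 <= 1 - be^-1.
Proof.
have [h1 h2] := exp12_gt0; have l1 : 1 <= explam by have := lam_ge; move: (p2); lra.
have : be^-1 <= exp2 by rewrite /exp2 ler_peMl// invr_ge0; move: (be1); lra.
rewrite /exp3; lra.
Qed.

Lemma expr_gt : 2 - 2 / (nn + 2) < expr.
Proof.
have /andP[h1 h2] := expA_bounds; have /andP[h5 _] := pq; have /andP[? ?] := B_bounds.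
have : p * (A * B) <= p * A.
  rewrite mulrA ler_piMr//; last exact: ltW.
  by rewrite mulr_ge0 ?(ltW h1)//; move: (p2); lra.
rewrite exprE; move: (qlt) (p2); lra.
Qed.

(** This is the condition [sg > 2] of the Sobolev inequality for [sg = m - 2 / nn]. *)
Lemma expm_gt : 2 + 2 / nn < expm.
Proof.
have h : 0 < nn + 2 by rewrite addr_gt0.
have -> : 2 + 2 / nn = (2 - 2 / (nn + 2)) * (nn + 2) / nn.
  have -> : (2 - 2 / (nn + 2)) * (nn + 2) = 2 * nn + 2.
    by rewrite mulrBl divfK ?gt_eqF//; lra.
  by rewrite [RHS]mulrDl mulfK// gt_eqF.
by rewrite /expm ltr_pM2r ?invr_gt0// ltr_pM2r//; exact: expr_gt.
Qed.

(** The compatibility of exponents in the Sobolev inequality with [sg = m - 2 / nn]; it holds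
    because [m / r = 1 + 2 / nn]. *)
Lemma sobolev_exponent : expm * (1 - expr^-1) = expm - 2 / nn - 1.
Proof.
have r0 : expr != 0 by rewrite gt_eqF//; have := expr_gt; have /andP[] := frac; lra.
rewrite mulrBr mulr1 /expm -addrA; congr (_ + _).
have -> : expr * (nn + 2) / nn / expr = (nn + 2) / nn * (expr / expr) by lra.
rewrite mulfV// mulr1 mulrDl mulfV ?gt_eqF//; lra.
Qed.

Lemma expr_le : expr <= p.
Proof.
have /andP[h1 h2] := expA_bounds; rewrite exprE ler_piMr//; [move: (p2); lra|exact: ltW].
Qed.

Lemma exps_ge : q <= exps.
Proof.
have /andP[h5 _] := pq.
rewrite /exps -mulrA ler_peMr//; first by move: (p2); lra.
by rewrite ler_pdivlMr ?mul1r; move: (be1); lra.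
Qed.

(** The bound [K] of the flux is proportional to [y^exp3]. It enters the new excess with the power
    [expr / nn] through the supremum in time and with the power [A] through the energy, so the new
    excess is of order [y^(1 + expka)]. *)
Definition expka : R := exp3 * (expr / nn + A) - 1.

(** The condition on [q] gives [X * A > nn / (nn + 2)]; as [p + 1 - q <= 1] and [p >= 2], the
    product exceeds [(p + nn) / (nn + 2) >= 1]. *)
Lemma expka_gt0 : 0 < expka.
Proof.
have /andP[h1 h2] := q_lt; have /andP[h3 _] := expA_bounds.
rewrite /expka subr_gt0 exp3E exprE.
have XA : nn / (nn + 2) < X * A.
  by rewrite -ltr_pdivrMr//; move: Xgt; rewrite invfM mulrA.
have -> : X / (p + 1 - q) * (p * A / nn + A) = (X * A) * ((p / nn + 1) / (p + 1 - q)) by lra.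
have e1 : 0 < p / nn + 1 by rewrite addr_gt0// divr_gt0//; move: (p2); lra.
apply: (@lt_le_trans _ _ (X * A * (p / nn + 1))); last first.
  rewrite [leRHS]mulrA ler_peMr ?invf_ge1//.
  by apply: mulr_ge0; [apply: mulr_ge0; exact: ltW|exact: ltW].
apply: (@le_lt_trans _ _ (nn / (nn + 2) * (p / nn + 1))); last by rewrite ltr_pM2r.
have -> : nn / (nn + 2) * (p / nn + 1) = (nn / nn * p + nn) / (nn + 2) by lra.
rewrite mulfV ?gt_eqF// mul1r ler_pdivlMr ?addr_gt0// mul1r; move: (p2); lra.
Qed.

(** By the third identity [b * |Du|^(q - 1)], with [b] in L^beta and [Du] in L^s, lies in the dual
    L^s'. This explains the integrability exponent [q_beta]. *)
Lemma conj_exps : [/\ 0 < (1 - exps^-1)^-1, exps^-1 + ((1 - exps^-1)^-1)^-1 = 1 &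
  be^-1 + (q - 1) / exps = 1 - exps^-1].
Proof.
have /andP[h5 _] := pq; have h := exps_ge; have h2 := p2.
have s0 : 0 < exps by lra.
have b0 : 0 < be by move: (be1); lra.
split.
- by rewrite invr_gt0 subr_gt0 invf_lt1//; lra.
- by rewrite invrK; lra.
have q0 : q != 0 by rewrite gt_eqF//; lra.
have b1 : be - 1 != 0 by rewrite gt_eqF//; move: (be1); lra.
have si : exps^-1 = q^-1 * (1 - be^-1).
  rewrite /exps !invfM invrK; have -> : 1 - be^-1 = (be - 1) / be by rewrite mulrBl mulfV ?gt_eqF//; lra.
  lra.
rewrite si; have : q / q = 1 by rewrite mulfV.
have -> : (q - 1) * (q^-1 * (1 - be^-1)) = (q / q) * (1 - be^-1) - q^-1 * (1 - be^-1) by lra.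
move=> ->; lra.
Qed.

End exponents.
Lemma midpointE (R : realType) (a b : R) :
  (a + b) / 2 + (b - a) / 2 = b /\ (a + b) / 2 - a = (b - a) / 2.
Proof. by split; lra. Qed.

(** * The excess on two nested cylinders *)

Section iteration_step.
Context (R : realType) (k : nat) (p q al be Ab Bb : R).
Local Notation n := k.+1.
Local Notation nn := (k.+1%:R : R).
Local Notation V := (spacetime R k.+1).
Local Notation VN := ('rV[R]_k.+1 * R)%type.
Local Notation mu := (lebesgue_st R k.+1).
Local Notation A0 := (expA al).
Local Notation r := (expr p al).
Local Notation m := (expm nn p al).
Local Notation s := (exps q be).
Local Notation s' := (1 - s^-1)^-1.
Local Notation th := (expth p q).
Local Notation lam := (explam p q).
Local Notation x1 := (exp1 p q al).
Local Notation x2 := (exp2 p q be).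
Local Notation x3 := (exp3 p q al be).

(* The cutoff enters to the power [Ncut.+2] > [lam], so that Young's inequality
   does not divide by it. *)
Definition Ncut : nat := Num.Def.archi_bound lam.
(** Each of the [nn] components of the flux leaves [eps0 * <A, Du>]; together they make one half,
    which is absorbed. *)
Definition eps0 : R := (2 * nn)^-1.
Definition Cyoung : R := Ncut.+2%:R + eps0 `^ (- (th / (1 - th))) * Ncut.+2%:R `^ lam.
(** [stepM1] gathers the constants of the flux, [stepM2] those of the slope, [stepC] those of a
    whole step. The powers of [Ab] and [Bb] from Hoelder's inequality are rounded up to the first,
    both being at least 1. *)
Definition stepM1 : R := Ncut.+2%:R + 2 * nn * Cyoung * Ab * Bb.
Definition stepM2 : R := (2 * nn) `^ r * nn * (3 * Ab * stepM1 + Ncut.+2%:R `^ r).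
Definition stepC : R := (m - 2 / nn) `^ r * 2 `^ (r / nn) * (3 * stepM1) `^ (r / nn) * stepM2.
(** The power [lam + m] of [H] occurs once directly and once, through [K], to the power [r / nn]. *)
Definition stepc : R := (lam + m) * (r / nn + 1).

Hypotheses (p2 : 2 <= p) (al1 : 1 < al) (be1 : 1 < be) (Ab1 : 1 <= Ab) (Bb1 : 1 <= Bb)
  (pq : p <= q < p * (al / (al + 1)) * ((be - 1) / be) + 2 / (nn + 2)).

Let n0 : 0 < nn. Proof. by []. Qed.

Let frac2 : 0 <= 2 / (nn + 2) <= 1.
Proof.
have h : 0 < nn + 2 by exact: addr_gt0.
by apply/andP; split; [exact: divr_ge0 (ltW h)|rewrite ler_pdivrMr// mul1r lerDr].
Qed.

Lemma m_gt2 : 2 < m.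
Proof.
have h : 2 <= 2 + 2 / nn by rewrite lerDl; apply: divr_ge0.
exact: le_lt_trans h (expm_gt n0 p2 al1 be1 pq).
Qed.

Lemma one_subA : 1 - (al + 1)^-1 = A0.
Proof.
have h : al + 1 != 0 by rewrite gt_eqF//; move: (al1); lra.
by apply: (mulIf h); rewrite mulrBl mul1r mulVf// addrK /expA divfK.
Qed.

Lemma sobolev_exp_gt1 : 1 < r.
Proof. by have := frac2; have := expr_gt p2 al1 be1 pq; lra. Qed.

Lemma lam_ge1 : 1 <= lam.
Proof. by have := lam_ge n0 p2 al1 be1 pq; move: (p2); lra. Qed.

Lemma lam_Ncut : lam <= Ncut.+2%:R.
Proof.
have l1 := lam_ge1; have := @archi_boundP R lam (le_trans ler01 l1); rewrite -/Ncut => h.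
by apply: (le_trans (ltW h)); rewrite ler_nat -addn2 leq_addr.
Qed.

Lemma eps0_nn : nn * eps0 = 2^-1.
Proof. by rewrite /eps0 invfM mulrCA mulfV ?mulr1// gt_eqF. Qed.

Lemma Cyoung_ge0 : 0 <= Cyoung.
Proof. by rewrite addr_ge0// mulr_ge0 ?powR_ge0. Qed.

Lemma stepM1_ge1 : 1 <= stepM1.
Proof.
rewrite /stepM1; apply: (@le_trans _ _ Ncut.+2%:R); first by rewrite ler1n.
have := Cyoung_ge0 => h; rewrite lerDl !mulr_ge0//; move: (Ab1) (Bb1); lra.
Qed.

(** [level_power] with exponent [1/e], raised to the power [e]: the form in which Hoelder's
    inequality takes the excess. *)
Lemma step_pointwise (H kk k0 ka uz e Y : R) : 0 < kk -> k0 < ka -> 1 <= H ->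
  kk <= H * (ka - k0) -> 0 <= Y -> Num.max (uz - k0) 0 `^ m <= kk `^ m * Y ->
  0 < e -> e^-1 <= m -> Num.max (uz - ka) 0 <= kk * (H `^ m * Y) `^ e.
Proof.
move=> kp kk0 H1 kH Y0 hY e0 em.
have s0 : 0 <= Num.max (uz - ka) 0 by rewrite le_max lexx orbT.
have ei : 0 < e^-1 <= m by rewrite invr_gt0 e0.
have := level_power ei kp kk0 H1 kH Y0 hY.
have H0 : 0 <= H `^ m * Y by rewrite mulr_ge0 ?powR_ge0.
have L0 : 0 <= kk `^ e^-1 * (H `^ m * Y) by rewrite mulr_ge0 ?powR_ge0.
move=> h; have : (Num.max (uz - ka) 0 `^ e^-1) `^ e <= (kk `^ e^-1 * (H `^ m * Y)) `^ e.
  by apply: ge0_ler_powR; rewrite ?nnegrE ?powR_ge0// ltW.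
rewrite powRM ?powR_ge0// -!powRrM mulVf ?gt_eqF// !powRr1//; exact: ltW.
Qed.

Tactic Notation "slra" hyp_list(h) := clear -p2 al1 be1 Ab1 Bb1 pq n0 frac2 h; lra.

(** As [y <= 1] and [exp3] is the smallest exponent of [y] in the flux terms, all of them are
    bounded with [y^exp3]; the powers of [Q] in each Hoelder product add up to 1. The factor 3 in
    [K], against 2 on the left, makes the first inequality strict. *)
Lemma step_numeric (H Z Q y kk w : R) (HH := H `^ (lam + m)) (nu := r / nn)
    (K := 3 * HH * Z * Q * y `^ x3 * stepM1) :
  0 < Q -> 0 < y <= 1 -> 1 <= H -> 1 <= w -> Z = w `^ lam ->
  2 * (Ncut.+2%:R * HH * Z * (Q * y) +
    nn * Cyoung * HH * Z * ((Bb * Q) `^ be^-1 * (Q * y) `^ (1 - be^-1)) +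
    nn * Cyoung * HH * Z * ((Ab * Q) `^ x1 * (Bb * Q) `^ x2 * (Q * y) `^ x3)) < K /\
  kk `^ (- m) * ((m - 2 / nn) `^ r * 2 `^ nu * K `^ nu *
    ((2 * nn) `^ r * nn * ((Ab * Q) `^ (al + 1)^-1 * K `^ (1 - (al + 1)^-1)) +
     (2 * nn) `^ r * nn * Ncut.+2%:R `^ r * ((H * w) `^ r * H `^ m) * (Q * y))) <=
  Q * (stepC * H `^ stepc * (kk `^ (- m) * Q `^ nu * Z `^ (nu + A0)) *
     y `^ (1 + expka nn p q al be)).
Proof.
move=> Q0 /andP[y0 y1] H1 w1 ZE.
have l1 := lam_ge1; have lamp := lam_ge n0 p2 al1 be1 pq.
have [x10 x20] := exp12_gt0 n0 p2 al1 be1 pq; have x30 := exp3_gt0 n0 p2 al1 be1 pq.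
have x3le := exp3_le n0 p2 al1 be1 pq.
have /andP[A00 A01] := expA_bounds al1.
have rp := expr_le p2 al1; have rgt := expr_gt p2 al1 be1 pq.
have m2 := m_gt2.
have nn22 : 0 <= 2 / (nn + 2) <= 1 by exact: frac2.
have nn2 : 0 <= 2 / nn by rewrite divr_ge0.
have r0 : 0 < r by slra rgt nn22.
have nu0 : 0 < nu by rewrite divr_gt0.
have C0 := Cyoung_ge0; have M1 := stepM1_ge1.
have H0 : 0 < H by exact: lt_le_trans H1.
have w0 : 0 < w by exact: lt_le_trans w1.
have Z0 : 0 < Z by rewrite ZE powR_gt0.
have HH0 : 0 < HH by rewrite powR_gt0.
have HH1 : 1 <= HH by apply: powR_ge1 => //; slra l1 m2.
have bi := invf_itv01 be1.
have ai1 : 0 < (al + 1)^-1 < 1 by rewrite invf_itv01// ltrDr (lt_trans ltr01).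
have [A0w A1w] := (ltW A00, ltW A01).
have M31 : 1 <= 3 * stepM1 by apply: mulr_ege1 => //; rewrite ler1n.
have A0E := one_subA.
have Ab0 : 0 <= Ab by exact: le_trans Ab1.
have Bb0 : 0 <= Bb by exact: le_trans Bb1.
have ple (x a : R) : 1 <= x -> 0 <= a -> a <= 1 -> x `^ a <= x.
  by move=> h1 a0 a1; rewrite -[leRHS]powRr1 ?ler_powR// (le_trans ler01).
set yx := y `^ x3.
have yx0 : 0 < yx by rewrite powR_gt0.
have y01 : 0 <= y <= 1 by rewrite (ltW y0).
have yyx : y <= yx by rewrite -[leLHS]powRr1 ?(ltW y0)//; apply: powR_le1 => //; slra x3le bi.
have QQ a b : a + b = 1 -> Q `^ a * Q `^ b = Q.
  by move=> ab; rewrite -powRD ?ab ?powRr1 ?(ltW Q0)// (gt_eqF Q0) implybT.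
have F2 : (Bb * Q) `^ be^-1 * (Q * y) `^ (1 - be^-1) <= Bb * Q * yx.
  rewrite !powRM ?(ltW Q0) ?(ltW y0)//.
  have -> : Bb `^ be^-1 * Q `^ be^-1 * (Q `^ (1 - be^-1) * y `^ (1 - be^-1)) =
    Bb `^ be^-1 * (Q `^ be^-1 * Q `^ (1 - be^-1)) * y `^ (1 - be^-1) by slra.
  rewrite QQ; last exact: subrKC.
  apply: ler_pM; rewrite ?mulr_ge0 ?powR_ge0 ?(ltW Q0)//.
    by rewrite ler_wpM2r ?(ltW Q0)// ple//; case/andP: bi => /ltW h /ltW.
  by apply: powR_le1.
have F3 : (Ab * Q) `^ x1 * (Bb * Q) `^ x2 * (Q * y) `^ x3 <= Ab * Bb * Q * yx.
  have x123 : x1 + x2 + x3 = 1 by rewrite /exp3 -addrA subrKC addrC subrK.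
  have [x1le x2le] : x1 <= 1 /\ x2 <= 1 by split; slra x123 x10 x20 x30.
  rewrite !powRM ?(ltW Q0) ?(ltW y0)//.
  have -> : Ab `^ x1 * Q `^ x1 * (Bb `^ x2 * Q `^ x2) * (Q `^ x3 * y `^ x3) =
    Ab `^ x1 * Bb `^ x2 * (Q `^ x1 * Q `^ x2 * Q `^ x3) * y `^ x3 by slra.
  rewrite -powRD ?(gt_eqF Q0) ?implybT// QQ// -/yx.
  apply: ler_wpM2r; first exact: ltW.
  apply: ler_wpM2r; first exact: ltW.
  by apply: ler_pM; [exact: powR_ge0|exact: powR_ge0|exact: ple (ltW x10) x1le|exact: ple (ltW x20) x2le].
have hz : 0 < HH * Z by exact: mulr_gt0.
have big : 0 < HH * Z * (Q * yx) by rewrite mulr_gt0// mulr_gt0.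
have K0 : 0 < K by rewrite /K !mulr_gt0//; exact: lt_le_trans M1.
split.
  have e1 : Ncut.+2%:R * HH * Z * (Q * y) <= HH * Z * (Q * yx) * Ncut.+2%:R.
    have -> : HH * Z * (Q * yx) * Ncut.+2%:R = Ncut.+2%:R * HH * Z * (Q * yx) by slra.
    by rewrite ler_wpM2l ?mulr_ge0 ?(ltW HH0) ?(ltW Z0)// ler_wpM2l// ltW.
  have nC : 0 <= nn * Cyoung * HH * Z by rewrite !mulr_ge0 ?(ltW HH0) ?(ltW Z0).
  have e2 := ler_wpM2l nC F2; have e3 := ler_wpM2l nC F3.
  have e4 : nn * Cyoung * HH * Z * (Bb * Q * yx) <= nn * Cyoung * HH * Z * (Ab * Bb * Q * yx).
    rewrite ler_wpM2l// ler_wpM2r ?(ltW yx0)// ler_wpM2r ?(ltW Q0)// ler_peMl//.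
  have -> : K = 3 * (HH * Z * (Q * yx) * Ncut.+2%:R + 2 * (nn * Cyoung * HH * Z * (Ab * Bb * Q * yx))).
    by rewrite /K /stepM1 -/yx; slra.
  have big2 : 0 < HH * Z * (Q * yx) * Ncut.+2%:R by exact: mulr_gt0.
  have big3 : 0 <= nn * Cyoung * HH * Z * (Ab * Bb * Q * yx).
    by rewrite mulr_ge0// !mulr_ge0 ?(ltW Q0) ?(ltW yx0).
  slra e1 e2 e3 e4 big2 big3.
have M10 : 0 <= stepM1 by exact: le_trans M1.
have KE a : K `^ a = (3 * stepM1) `^ a * HH `^ a * Z `^ a * Q `^ a * y `^ (x3 * a).
  have -> : K = (3 * stepM1) * HH * Z * Q * yx by rewrite /K -/yx; slra.
  have q1 : 0 <= 3 * stepM1 by exact: mulr_ge0.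
  have q2 : 0 <= 3 * stepM1 * HH by exact: mulr_ge0 (ltW HH0).
  have q3 : 0 <= 3 * stepM1 * HH * Z by exact: mulr_ge0 (ltW Z0).
  have q4 : 0 <= 3 * stepM1 * HH * Z * Q by exact: mulr_ge0 (ltW Q0).
  by rewrite (powRM a q4 (ltW yx0)) (powRM a q3 (ltW Q0)) (powRM a q2 (ltW Z0)) (powRM a q1 (ltW HH0)) [y `^ (x3 * a)]powRrM.
rewrite A0E.
have I1 : (Ab * Q) `^ (al + 1)^-1 * K `^ A0 <= 3 * Ab * stepM1 * (HH * Z `^ A0 * Q * y `^ (x3 * A0)).
  rewrite KE powRM ?(ltW Q0)//.
  have -> : Ab `^ (al + 1)^-1 * Q `^ (al + 1)^-1 *
     ((3 * stepM1) `^ A0 * HH `^ A0 * Z `^ A0 * Q `^ A0 * y `^ (x3 * A0)) =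
    (Ab `^ (al + 1)^-1 * (3 * stepM1) `^ A0) * (HH `^ A0 * Z `^ A0 * (Q `^ (al + 1)^-1 * Q `^ A0) * y `^ (x3 * A0)) by slra.
  rewrite QQ; last by rewrite -A0E subrKC.
  have -> : 3 * Ab * stepM1 = Ab * (3 * stepM1) by slra.
  apply: ler_pM; rewrite ?mulr_ge0 ?powR_ge0 ?(ltW Q0)//.
    apply: ler_pM; [exact: powR_ge0|exact: powR_ge0| |exact: ple].
      by apply: ple => //; [case/andP: ai1 => /ltW|case/andP: ai1 => _ /ltW].
  apply: ler_wpM2r; first exact: powR_ge0.
  apply: ler_wpM2r; first exact: ltW.
  by apply: ler_wpM2r; [exact: powR_ge0|exact: ple].
have I2 : Ncut.+2%:R `^ r * ((H * w) `^ r * H `^ m) * (Q * y) <= Ncut.+2%:R `^ r * (HH * Z `^ A0 * Q * y `^ (x3 * A0)).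
  rewrite -mulrA ler_wpM2l ?powR_ge0// powRM ?(ltW H0) ?(ltW w0)//.
  have -> : H `^ r * w `^ r * H `^ m * (Q * y) = (H `^ r * H `^ m) * w `^ r * Q * y by slra.
  apply: ler_pM; rewrite ?mulr_ge0 ?powR_ge0 ?(ltW Q0) ?(ltW y0)//.
    apply: ler_wpM2r; first exact: ltW.
    apply: ler_pM; rewrite ?mulr_ge0 ?powR_ge0//.
      by rewrite -powRD ?(gt_eqF H0) ?implybT// /HH ler_powR// lerD2r; exact: le_trans lamp.
    rewrite ZE -powRrM ler_powR// exprE ler_wpM2r//; exact: ltW.
  have xA : 0 < x3 * A0 by exact: mulr_gt0.
  rewrite -[leLHS]powRr1 ?(ltW y0)//; apply: powR_le1; rewrite ?y01//.
  apply: mulr_ile1; [exact: ltW|exact: ltW| |exact: ltW].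
  slra x3le bi.
pose big2 := HH * Z `^ A0 * Q * y `^ (x3 * A0).
have big20 : 0 <= big2 by rewrite !mulr_ge0 ?powR_ge0 ?(ltW Q0) ?(ltW HH0).
rewrite -/big2 in I1 I2.
have nr : 0 <= (2 * nn) `^ r * nn by rewrite mulr_ge0 ?powR_ge0.
set E := _ * _ + _ * (Q * y).
have EM : E <= stepM2 * big2.
  have -> : stepM2 * big2 = (2 * nn) `^ r * nn * (3 * Ab * stepM1 * big2) + (2 * nn) `^ r * nn * (Ncut.+2%:R `^ r * big2).
    by rewrite /stepM2; slra.
  have -> : E = (2 * nn) `^ r * nn * ((Ab * Q) `^ (al + 1)^-1 * K `^ A0) +
      (2 * nn) `^ r * nn * (Ncut.+2%:R `^ r * ((H * w) `^ r * H `^ m) * (Q * y)) by rewrite /E; slra.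
  by apply: lerD; apply: ler_wpM2l.
have c60 : 0 <= (m - 2 / nn) `^ r * 2 `^ nu by rewrite mulr_ge0 ?powR_ge0.
have G : kk `^ (- m) * ((m - 2 / nn) `^ r * 2 `^ nu * K `^ nu * E) <=
   kk `^ (- m) * ((m - 2 / nn) `^ r * 2 `^ nu * K `^ nu * (stepM2 * big2)).
  by rewrite ler_wpM2l ?powR_ge0// ler_wpM2l// mulr_ge0 ?powR_ge0.
apply: (le_trans G); rewrite le_eqVlt; apply/orP; left; apply/eqP.
have Hc : H `^ stepc = HH `^ nu * HH.
  have -> : H `^ stepc = HH `^ (nu + 1) by exact: powRrM.
  by rewrite powRD ?(gt_eqF HH0) ?implybT// (powRr1 (ltW HH0)).
have Zc : Z `^ (nu + A0) = Z `^ nu * Z `^ A0 by rewrite powRD ?(gt_eqF Z0) ?implybT.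
have yc : y `^ (1 + expka nn p q al be) = y `^ (x3 * nu) * y `^ (x3 * A0).
  by rewrite -powRD ?(gt_eqF y0) ?implybT// /expka -mulrDr subrKC.
by rewrite KE Hc Zc yc /stepC /big2 -/nu; slra.
Qed.

(** Each of the [2 * nn] terms is at most the power [1/r0] of the sum [S] on the right. *)
Lemma powR_sum_le (r0 : R) (x y : 'I_n -> R) : 1 <= r0 -> (forall i, 0 <= x i) -> (forall i, 0 <= y i) ->
  (\sum_i (x i + y i)) `^ r0 <= (2 * nn) `^ r0 * \sum_i (x i `^ r0 + y i `^ r0).
Proof.
move=> r1 x0 y0; have rp : 0 < r0 by lra.
set S := \sum_i (_ `^ _ + _); have t0 i : 0 <= x i `^ r0 + y i `^ r0 by rewrite addr_ge0 ?powR_ge0.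
have S0 : 0 <= S by rewrite sumr_ge0.
have le1 (t : R) : 0 <= t -> t `^ r0 <= S -> t <= S `^ r0^-1.
  move=> tt ts; rewrite -[leLHS]powRr1// -(mulfV (lt0r_neq0 rp)) powRrM.
  by apply: ge0_ler_powR; rewrite ?nnegrE ?powR_ge0 ?invr_ge0 ?(ltW rp).
have leS i : x i `^ r0 + y i `^ r0 <= S.
  by rewrite /S (bigD1 i)//= lerDl sumr_ge0.
have : \sum_i (x i + y i) <= 2 * nn * S `^ r0^-1.
  have -> : 2 * nn * S `^ r0^-1 = \sum_(i < n) 2 * S `^ r0^-1.
    by rewrite sumr_const card_ord -mulr_natl; lra.
  apply: ler_sum => i _.
  have h1 := le1 _ (x0 i) (le_trans (_ : _ <= x i `^ r0 + y i `^ r0) (leS i)).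
  have h2 := le1 _ (y0 i) (le_trans (_ : _ <= x i `^ r0 + y i `^ r0) (leS i)).
  by have := h1 _; have := h2 _; rewrite lerDl lerDr !powR_ge0 => /(_ isT) + /(_ isT); lra.
move=> h; apply: (@le_trans _ _ ((2 * nn * S `^ r0^-1) `^ r0)).
  by apply: ge0_ler_powR; rewrite ?nnegrE ?(ltW rp) ?mulr_ge0 ?powR_ge0 ?sumr_ge0// => i _; rewrite addr_ge0.
by rewrite powRM ?powR_ge0// -powRrM mulVf ?gt_eqF// powRr1.
Qed.

Section pointwise.
Variables (H kk rho Lx Lt k0 ka x ze P g g1 Phi Y ai b : R) (e0 : R) (e a d : 'I_n -> R).
Local Notation w := (kk / rho).
Local Notation Z := (w `^ lam).
Local Notation HH := (H `^ (lam + m)).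
Local Notation eta := (ze ^+ Ncut.+2).
Hypotheses (rho0 : 0 < rho) (rk : rho <= kk) (H1 : 1 <= H) (Lx0 : 0 <= Lx) (Lt0 : 0 <= Lt)
  (hLx : Lx <= H / rho) (hLt : Lt * kk ^+ 2 <= H * Z) (k0a : k0 < ka) (hk : kk <= H * (ka - k0))
  (Y0 : 0 <= Y) (hY : Num.max (x - k0) 0 `^ m <= kk `^ m * Y)
  (ze01 : 0 <= ze <= 1) (P0 : 0 <= P) (ai0 : 0 <= ai) (b0 : 0 <= b)
  (g101 : 0 <= g1 <= 1) (g0 : 0 <= g) (gs : g <= g1 * Num.max (x - ka) 0)
  (Phi0 : 0 <= Phi) (Phis : 2 * Phi <= Num.max (x - ka) 0 ^+ 2).

Let s_ := Num.max (x - ka) 0.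
Let s0 : 0 <= s_. Proof. by rewrite /s_ le_max lexx orbT. Qed.
Let kk0 : 0 < kk. Proof. exact: lt_le_trans rk. Qed.
Let H0 : 0 < H. Proof. by move: (H1); lra. Qed.
Let w1 : 1 <= w. Proof. by rewrite ler_pdivlMr// mul1r. Qed.
Let w0 : 0 < w. Proof. by exact: lt_le_trans w1. Qed.
Let wZ : w <= Z. Proof. by rewrite -[leLHS]powRr1 ?(ltW w0)// ler_powR// lam_ge1. Qed.
Let kLx : kk * Lx <= H * w.
Proof. 
have -> : H * w = kk * (H / rho) by lra.
by rewrite ler_wpM2l// ltW. Qed.
Let kLx0 : 0 <= kk * Lx. Proof. by rewrite mulr_ge0 ?(ltW kk0). Qed.
Let m2 := m_gt2.
Let HHle c : 0 <= c <= lam -> H `^ c * H `^ m <= HH.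
Proof. by move=> h; rewrite -powRD ?(gt_eqF H0) ?implybT// ler_powR//; lra. Qed.
Let Hmle c : 0 <= c <= 1 -> (H `^ m) `^ c <= H `^ m.
Proof.
move=> h; rewrite -[leRHS]powRr1 ?powR_ge0// ler_powR//; last lra.
by apply: powR_ge1 => //; move: m2; lra.
Qed.

(** The three terms in parentheses come from the time derivative of the cutoff, from the constant 1
    in the growth bound and from the remainder in Young's inequality. Powers of [kk / rho >= 1] are
    all raised to [lam]. *)
Lemma step_flux : (forall i, `|e i| <= Ncut.+2%:R * ze ^+ Ncut.+1 * Lx) ->
  `|e0| <= Ncut.+2%:R * ze ^+ Ncut.+1 * Lt -> (forall i, `|a i| <= b * (1 + (ai * P) `^ th)) ->
  Phi * `|e0| + g * `|\sum_i a i * e i| <= 2^-1 * (g1 * eta * P) +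
    (Ncut.+2%:R * HH * Z * Y +
     nn * Cyoung * HH * Z * ((b `^ be) `^ be^-1 * Y `^ (1 - be^-1)) +
     nn * Cyoung * HH * Z * ((ai `^ al) `^ x1 * (b `^ be) `^ x2 * Y `^ x3)).
Proof.
move=> ee e0e ha.
have l1 := lam_ge1; have x30 := exp3_gt0 n0 p2 al1 be1 pq.
have [x10 x20] := exp12_gt0 n0 p2 al1 be1 pq.
have x3le := exp3_le n0 p2 al1 be1 pq; have lam1 := lam1_lt n0 p2 al1 be1 pq.
have bi := invf_itv01 be1.
have /andP[z0 z1] := ze01.
have zN : 0 <= ze ^+ Ncut.+1 <= 1 by rewrite exprn_ge0//= exprn_ile1.
have Z0 : 0 < Z by rewrite powR_gt0.
have C0 := Cyoung_ge0.
(* The square of the excess is traded for its power [m > 2], and [hLt] compares the time cutoff with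
   [Z]. *)
have T1 : Phi * `|e0| <= Ncut.+2%:R * HH * Z * Y.
  have h1 : s_ `^ 2 <= kk `^ 2 * (H `^ m * Y).
    by apply: (@level_power _ 2 m kk k0 ka H x Y) => //; rewrite ltr0n/= ltW.
  rewrite !powR_mulrn ?(ltW kk0)// in h1.
  have h2 : `|e0| <= Ncut.+2%:R * Lt.
    apply: (le_trans e0e); rewrite ler_wpM2r// ler_piMr//; by case/andP: zN.
  apply: (@le_trans _ _ (s_ ^+ 2 * (Ncut.+2%:R * Lt))).
    apply: ler_pM => //; move: Phis; rewrite -/s_; move: (Phi0); lra.
  apply: (@le_trans _ _ (kk ^+ 2 * (H `^ m * Y) * (Ncut.+2%:R * Lt))).
    by rewrite ler_wpM2r// mulr_ge0.
  have -> : kk ^+ 2 * (H `^ m * Y) * (Ncut.+2%:R * Lt) = Ncut.+2%:R * (H `^ m * (Lt * kk ^+ 2)) * Y by lra.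
  rewrite ler_wpM2r// -!mulrA ler_wpM2l//.
  apply: (@le_trans _ _ (H `^ m * (H * Z))); first by rewrite ler_wpM2l ?powR_ge0.
  have -> : H `^ m * (H * Z) = (H * H `^ m) * Z by lra.
  rewrite ler_wpM2r ?(ltW Z0)//; have := @HHle 1; rewrite powRr1 ?(ltW H0)//; apply; lra.
(* The power [1 / (1 - 1/be)] of the excess is admissible: it is at most
   [1 / exp3 <= lam / exp3 < m]. *)
have T2 : b * (s_ * Lx) <= HH * Z * ((b `^ be) `^ be^-1 * Y `^ (1 - be^-1)).
  have em : (1 - be^-1)^-1 <= m.
    apply: (le_trans _ (ltW lam1)); apply: (@le_trans _ _ x3^-1).
      by rewrite lef_pV2 ?posrE//; lra.
    by rewrite ler_peMl// invr_ge0 ltW.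
  have h := step_pointwise kk0 k0a H1 hk Y0 hY (_ : 0 < 1 - be^-1) em.
  have {h} := h _; rewrite -/s_ => /(_ ltac:(lra)) h.
  rewrite -powRrM mulfV ?powRr1//; last by rewrite gt_eqF// (lt_trans ltr01).
  apply: (@le_trans _ _ (b * (kk * (H `^ m * Y) `^ (1 - be^-1) * Lx))).
    by rewrite ler_wpM2l// ler_wpM2r.
  rewrite powRM ?powR_ge0//.
  have -> : b * (kk * ((H `^ m) `^ (1 - be^-1) * Y `^ (1 - be^-1)) * Lx) =
    ((kk * Lx) * (H `^ m) `^ (1 - be^-1)) * (b * Y `^ (1 - be^-1)) by lra.
  rewrite ler_wpM2r ?mulr_ge0 ?powR_ge0//.
  apply: (@le_trans _ _ ((H * w) * H `^ m)).
    apply: ler_pM; rewrite ?powR_ge0//; apply: Hmle; lra.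
  have -> : H * w * H `^ m = (H * H `^ m) * w by lra.
  apply: ler_pM => //; [by rewrite mulr_ge0 ?powR_ge0 ?(ltW H0)|exact: ltW|].
  by have := @HHle 1; rewrite powRr1 ?(ltW H0)//; apply; lra.
(* Here the power of the excess is [lam / exp3], below [m] by [lam1_lt]. *)
have T3 : ai `^ (th * lam) * b `^ lam * (s_ * Lx) `^ lam <= HH * Z * ((ai `^ al) `^ x1 * (b `^ be) `^ x2 * Y `^ x3).
  have e0' : 0 < x3 / lam by rewrite divr_gt0// (lt_le_trans ltr01).
  have em : (x3 / lam)^-1 <= m by rewrite invf_div ltW.
  have := step_pointwise kk0 k0a H1 hk Y0 hY e0' em; rewrite -/s_ => h.
  rewrite -!powRrM.
  have -> : al * x1 = th * lam by rewrite /exp1 mulrC divfK// gt_eqF// (lt_trans ltr01).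
  have -> : be * x2 = lam by rewrite /exp2 mulrC divfK// gt_eqF// (lt_trans ltr01).
  have -> : HH * Z * (ai `^ (th * lam) * b `^ lam * Y `^ x3) = ai `^ (th * lam) * b `^ lam * (HH * Z * Y `^ x3) by lra.
  rewrite ler_wpM2l ?mulr_ge0 ?powR_ge0//.
  apply: (@le_trans _ _ ((kk * Lx * (H `^ m * Y) `^ (x3 / lam)) `^ lam)).
    apply: ge0_ler_powR; rewrite ?nnegrE ?mulr_ge0 ?powR_ge0 ?(ltW kk0)//; first exact: le_trans ler01 l1.
    have -> : kk * Lx * (H `^ m * Y) `^ (x3 / lam) = kk * (H `^ m * Y) `^ (x3 / lam) * Lx by lra.
    by rewrite ler_wpM2r.
  rewrite powRM ?powR_ge0// -powRrM divfK; last by rewrite gt_eqF// (lt_le_trans ltr01).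
  rewrite [(H `^ m * Y) `^ _]powRM ?powR_ge0//.
  apply: (@le_trans _ _ ((H * w) `^ lam * (H `^ m * Y `^ x3))).
    apply: ler_pM; rewrite ?mulr_ge0 ?powR_ge0//.
      apply: ge0_ler_powR; [exact: le_trans ler01 l1|by rewrite nnegrE|by rewrite nnegrE; exact: le_trans kLx|exact: kLx].
    by rewrite ler_wpM2r ?powR_ge0//; apply: Hmle; lra.
  rewrite powRM ?(ltW H0) ?(ltW w0)//.
  have -> : H `^ lam * Z * (H `^ m * Y `^ x3) = (H `^ lam * H `^ m) * (Z * Y `^ x3) by lra.
  rewrite -[leRHS]mulrA ler_wpM2r ?mulr_ge0 ?powR_ge0//; apply: HHle; lra.
have eps0p : 0 < eps0 by rewrite /eps0 invr_gt0 mulr_gt0.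
have Y1 i := young_flux (th_bounds n0 p2 al1 be1 pq) eps0p lam_Ncut P0 ai0 b0 s0 Lx0 g101 g0 gs ze01 (ee i) (ha i).
have S : g * `|\sum_i a i * e i| <= \sum_(i < n) (eps0 * (g1 * eta * P) +
    Cyoung * (b * (s_ * Lx) + ai `^ (th * lam) * b `^ lam * (s_ * Lx) `^ lam)).
  apply: (@le_trans _ _ (\sum_i g * (`|a i| * `|e i|))).
    rewrite -mulr_sumr ler_wpM2l//; apply: (le_trans (ler_norm_sum _ _ _)).
    by apply: ler_sum => i _; rewrite normrM.
  by apply: ler_sum => i _; exact: Y1.
rewrite sumr_const card_ord -mulr_natl mulrDr in S.
have E1 : nn * (eps0 * (g1 * eta * P)) = 2^-1 * (g1 * eta * P) by rewrite mulrA eps0_nn.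
rewrite E1 in S.
have nC : 0 <= nn * Cyoung by rewrite mulr_ge0.
have e2 : nn * Cyoung * (b * (s_ * Lx)) <= nn * Cyoung * HH * Z * ((b `^ be) `^ be^-1 * Y `^ (1 - be^-1)).
  by apply: (le_trans (ler_wpM2l nC T2)); rewrite !mulrA.
have e3 : nn * Cyoung * (ai `^ (th * lam) * b `^ lam * (s_ * Lx) `^ lam) <=
    nn * Cyoung * HH * Z * ((ai `^ al) `^ x1 * (b `^ be) `^ x2 * Y `^ x3).
  by apply: (le_trans (ler_wpM2l nC T3)); rewrite !mulrA.
apply: (le_trans (lerD T1 S)); rewrite addrCA lerD2l -[leRHS]addrA lerD2l mulrA mulrDr.
exact: lerD.
Qed.

(** Since [r = p * A0], coercivity to the power [A0] bounds [|d i|^r] by [(ai * P)^A0], and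
    [(g1 * eta)^r <= (g1 * eta)^A0] as the base is at most 1. Writing [ai^A0] as
    [(ai^al)^(1/(al + 1))] prepares Hoelder's inequality. *)
Lemma step_slope : (forall i, `|e i| <= Ncut.+2%:R * ze ^+ Ncut.+1 * Lx) ->
  (forall i, `|d i| `^ p <= ai * P) ->
  (\sum_i (g1 * `|d i| * eta + g * `|e i|)) `^ r <=
  (2 * nn) `^ r * nn * ((ai `^ al) `^ (al + 1)^-1 * (g1 * eta * P) `^ (1 - (al + 1)^-1)) +
  (2 * nn) `^ r * nn * Ncut.+2%:R `^ r * ((H * w) `^ r * H `^ m) * Y.
Proof.
move=> ee hd.
have /andP[A00 A01] := expA_bounds al1.
have nn22 := frac2; have rgt := expr_gt p2 al1 be1 pq; have rp := expr_le p2 al1.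
have r1 : 1 < r by lra.
have /andP[z0 z1] := ze01; have /andP[g10 g11] := g101.
have et : 0 <= eta <= 1 by rewrite exprn_ge0//= exprn_ile1.
have /andP[et0 et1] := et.
have A0E := one_subA.
have := @powR_sum_le r (fun i => g1 * `|d i| * eta) (fun i => g * `|e i|) (ltW r1)
  (fun i => mulr_ge0 (mulr_ge0 g10 (normr_ge0 _)) et0) (fun i => mulr_ge0 g0 (normr_ge0 _)) => h.
apply: (le_trans h) => {h}.
set X1 := (ai `^ al) `^ _ * _; set X2 := (H * w) `^ r * _.
have -> : (2 * nn) `^ r * nn * X1 + (2 * nn) `^ r * nn * Ncut.+2%:R `^ r * X2 * Y =
  (2 * nn) `^ r * (nn * (X1 + Ncut.+2%:R `^ r * X2 * Y)) by lra.
rewrite ler_wpM2l ?powR_ge0//.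
have -> : nn * (X1 + Ncut.+2%:R `^ r * X2 * Y) = \sum_(i < n) (X1 + Ncut.+2%:R `^ r * X2 * Y).
  by rewrite sumr_const card_ord -[RHS]mulr_natl.
apply: ler_sum => i _; apply: lerD.
  have -> : g1 * `|d i| * eta = `|d i| * (g1 * eta) by lra.
  have ge01 : 0 <= g1 * eta <= 1 by rewrite mulr_ge0//= mulr_ile1.
  have [ge0 ge1] : 0 <= g1 * eta /\ g1 * eta <= 1 by case/andP: ge01.
  rewrite (powRM r (normr_ge0 (d i)) ge0) /X1 -[(ai `^ al) `^ _]powRrM A0E.
  have -> : al * (al + 1)^-1 = A0 by [].
  have -> : g1 * eta * P = P * (g1 * eta) by lra.
  rewrite (powRM A0 P0 ge0) mulrA -(powRM A0 ai0 P0).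
  apply: ler_pM; rewrite ?powR_ge0//.
    rewrite exprE powRrM; apply: ge0_ler_powR; [exact: ltW|rewrite nnegrE powR_ge0//|rewrite nnegrE mulr_ge0//|exact: hd].
  apply: powR_le1 => //; lra.
have rm : r <= m.
  rewrite /expm -mulrA ler_peMr//; first by lra.
  by rewrite ler_pdivlMr// mul1r lerDl.
have h := @level_power R r m kk k0 ka H x Y; have {h} := h _ kk0 k0a H1 hk Y0 hY.
rewrite (_ : 0 < r <= m) -/s_; last by rewrite rm andbT; lra.
move=> /(_ isT) h.
have gs' : g <= s_ by apply: (le_trans gs); rewrite ler_piMl.
have h2 : `|e i| <= Ncut.+2%:R * Lx.
  apply: (le_trans (ee i)); rewrite ler_wpM2r// ler_piMr//; exact: exprn_ile1.
apply: (@le_trans _ _ ((s_ * (Ncut.+2%:R * Lx)) `^ r)).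
  have nL : 0 <= Ncut.+2%:R * Lx by exact: mulr_ge0.
  apply: ge0_ler_powR; [lra|rewrite nnegrE; exact: mulr_ge0|rewrite nnegrE; exact: mulr_ge0|].
  by apply: ler_pM.
have nL : 0 <= Ncut.+2%:R * Lx by exact: mulr_ge0.
rewrite (powRM r s0 nL) (powRM r _ Lx0)//.
have -> : s_ `^ r * (Ncut.+2%:R `^ r * Lx `^ r) = Ncut.+2%:R `^ r * (s_ `^ r * Lx `^ r) by lra.
rewrite -[leRHS]mulrA ler_wpM2l ?powR_ge0//.
apply: (@le_trans _ _ (kk `^ r * (H `^ m * Y) * Lx `^ r)); first by rewrite ler_wpM2r ?powR_ge0.
have -> : kk `^ r * (H `^ m * Y) * Lx `^ r = (kk `^ r * Lx `^ r) * H `^ m * Y by lra.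
rewrite /X2; apply: ler_wpM2r => //; apply: ler_wpM2r; first exact: powR_ge0.
rewrite -(powRM r (ltW kk0) Lx0).
apply: ge0_ler_powR; [exact: ltW (lt_trans ltr01 r1)|by rewrite nnegrE|by rewrite nnegrE; exact: le_trans kLx|exact: kLx].
Qed.

End pointwise.

Context (u : V -> R) (D A : 'I_n -> V -> R) (ai b : V -> R) (Q L t1 E0 : R) (x0 : 'rV[R]_n).
Hypotheses (Q0 : 0 < Q)
  (iu : mu.-integrable setT (EFin \o u))
  (iD : forall i, mu.-integrable setT (EFin \o D i))
  (iA : forall i, mu.-integrable setT (EFin \o A i))
  (ius : mu.-integrable setT (EFin \o (fun z => `|u z| `^ s)))
  (iDs : forall i, mu.-integrable setT (EFin \o (fun z => `|D i z| `^ s)))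
  (iAs : forall i, mu.-integrable setT (EFin \o (fun z => `|A i z| `^ s')))
  (AD0 : forall z, 0 <= \sum_i A i z * D i z)
  (mai : measurable_fun setT ai) (mb : measurable_fun setT b)
  (ai0 : forall z, 0 <= ai z) (b0 : forall z, 0 <= b z)
  (growth : forall i z, `|A i z| <= b z * (1 + (ai z * \sum_i A i z * D i z) `^ th))
  (coerc : forall i z, `|D i z| `^ p <= ai z * \sum_i A i z * D i z)
  (aiL : (\int[mu]_z (ai z `^ al)%:E <= (Ab * Q)%:E)%E)
  (bL : (\int[mu]_z (b z `^ be)%:E <= (Bb * Q)%:E)%E)
  (E00 : 0 < E0).

(** [caccioppoli] for a truncation between the two levels and a cutoff between the two cylinders,
    with [step_flux] and [step_slope] inserted in [step_integral]. [H] collects the losses due to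
    the gaps in space, time and level. *)
Lemma iteration_step (r1 r2 a1 a2 k0 k1 kk rho H y : R) (Y Y' : V -> R) :
  0 < r1 -> r1 < r2 -> a1 < a2 -> 0 <= k0 -> k0 < k1 -> 0 < rho -> rho <= kk -> 1 <= H ->
  0 < y <= 1 ->
  (forall z, z.2 <= t1 -> enorm (z.1 - x0) < r2 -> a1 < z.2 ->
     [/\ forall o, `|co o z| < L,
         forall e, 0 < e <= E0 -> \sum_i conv (moll1 e (Some i)) (A i) z <= conv (moll1 e None) u z &
         forall e i, 0 < e <= E0 -> conv (moll1 e (Some i)) u z = - conv (moll e) (D i) z]) ->
  4 / (r2 - r1) <= H / rho -> 2 / (a2 - a1) * kk ^+ 2 <= H * (kk / rho) `^ lam ->
  kk <= H * ((k1 - k0) / 2) ->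
  measurable_fun setT Y -> (forall z, 0 <= Y z) ->
  (forall z, z.2 <= t1 -> enorm (z.1 - x0) < r2 -> a1 < z.2 -> Num.max (u z - k0) 0 `^ m <= kk `^ m * Y z) ->
  (\int[mu]_z (Y z)%:E <= (Q * y)%:E)%E ->
  (forall z, 0 <= Y' z) ->
  (forall z, Y' z != 0 -> [/\ z.2 <= t1, enorm (z.1 - x0) <= r1, a2 <= z.2 &
     kk `^ m * Y' z <= Num.max (u z - k1) 0 `^ m]) ->
  (\int[mu]_z (Y' z)%:E <=
    (Q * (stepC * H `^ stepc * (kk `^ (- m) * Q `^ (r / nn) * ((kk / rho) `^ lam) `^ (r / nn + A0)) *
     y `^ (1 + expka nn p q al be)))%:E)%E.
Proof.
move=> r10 r12 a12 k00 k01 rho0 rk H1 /andP[y0 y1] region hr ha hk mY Y0 Yu iY Y'0 Y'u.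
have kk0 : 0 < kk by exact: lt_le_trans rk.
have l1 := lam_ge1.
have /andP[A00 A01] := expA_bounds al1.
have m2 := m_gt2.
have nn2 : 0 <= 2 / nn by rewrite divr_ge0.
have thb := th_bounds n0 p2 al1 be1 pq.
have x30 := exp3_gt0 n0 p2 al1 be1 pq.
have [x10 x20] := exp12_gt0 n0 p2 al1 be1 pq.
have x3le := exp3_le n0 p2 al1 be1 pq.
have lam1 := lam1_lt n0 p2 al1 be1 pq.
have rgt := expr_gt p2 al1 be1 pq.
have rp := expr_le p2 al1.
have sge := exps_ge p2 be1 pq.
have [s'0 ss' _] := conj_exps p2 be1 pq.
have lamp := lam_ge n0 p2 al1 be1 pq.
have /andP[pleq _] := pq.
have nn22 : 0 <= 2 / (nn + 2) <= 1 by exact: frac2.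
have rgt1 := sobolev_exp_gt1.
have s2 : 2 <= s by exact: le_trans p2 (le_trans pleq sge).
have rs : r <= s by exact: le_trans rp (le_trans pleq sge).
(* The truncation acts between the midpoint [ka] and [k1]: below [ka] there remains the gap that
   [level_power] needs, and [lev] is still at least the excess over [k1]. *)
pose ka := (k0 + k1) / 2; pose de := (k1 - k0) / 2.
have de0 : 0 < de by rewrite /de divr_gt0// subr_gt0.
have ka0 : 0 <= ka by apply: divr_ge0 => //; apply: addr_ge0 => //; exact: le_trans (ltW k01).
have [kde kak0] : ka + de = k1 /\ ka - k0 = de := midpointE k0 k1.
have k0ka : k0 < ka by rewrite -subr_gt0 kak0.
have kkH : kk <= H * (ka - k0) by rewrite kak0.
pose eta := @cut R n x0 r1 r2 a1 a2 Ncut; pose eta1 := @cut1 R n x0 r1 r2 a1 a2 Ncut.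
pose ze := @zeta R n x0 r1 r2 a1 a2.
pose g := lev ka de; pose g1 := lev1 ka de; pose Phi := Lev ka de.
have lb x := lev_bounds x de0 ka0.
have [meta meta1] := @measurable_cut R n x0 r1 r2 a1 a2 Ncut.
pose Lx := 4 / (r2 - r1); pose Lt := 2 / (a2 - a1).
have Lx0 : 0 <= Lx by rewrite divr_ge0// subr_ge0 ltW.
have Lt0 : 0 <= Lt by rewrite divr_ge0// subr_ge0 ltW.
have ze01 z : 0 <= ze z <= 1 by exact: zeta01.
have e1S i z : `|eta1 (Some i) z| <= Ncut.+2%:R * ze z ^+ Ncut.+1 * Lx.
  exact: (@cut1_le R n x0 r1 r2 a1 a2 Ncut r10 r12 a12 (Some i) z).
have e1N z : `|eta1 None z| <= Ncut.+2%:R * ze z ^+ Ncut.+1 * Lt.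
  exact: (@cut1_le R n x0 r1 r2 a1 a2 Ncut r10 r12 a12 None z).
have zeN z : 0 <= ze z ^+ Ncut.+1 <= 1.
  by have /andP[h1 h2] := ze01 z; rewrite exprn_ge0//= exprn_ile1.
pose Ce := 1 + Ncut.+2%:R * (Lx + Lt).
have Ce1 : 1 <= Ce by rewrite lerDl mulr_ge0// addr_ge0.
have eta1C o z : `|eta1 o z| <= Ce.
  have /andP[h1 h2] := zeN z.
  have hL (x : R) : 0 <= x -> Ncut.+2%:R * ze z ^+ Ncut.+1 * x <= Ncut.+2%:R * x.
    by move=> x_0; rewrite ler_wpM2r// ler_piMr.
  have hLx := hL _ Lx0; have hLt := hL _ Lt0.
  have LxN : 0 <= Ncut.+2%:R * Lx by rewrite mulr_ge0.
  have LtN : 0 <= Ncut.+2%:R * Lt by rewrite mulr_ge0.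
  have CL : Ce = 1 + Ncut.+2%:R * Lx + Ncut.+2%:R * Lt by rewrite /Ce mulrDr addrA.
  case: o => [i|].
    apply: (le_trans (e1S i z)); apply: (le_trans hLx); rewrite CL -addrA addrCA lerDl addr_ge0//.
  apply: (le_trans (e1N z)); apply: (le_trans hLt); rewrite CL lerDr addr_ge0//.
have supp z : z.2 <= t1 -> eta z != 0 -> [/\ z.2 <= t1, enorm (z.1 - x0) < r2 & a1 < z.2].
  by move=> zt ez; have [] := @cut_supp R n x0 r1 r2 a1 a2 Ncut r10 r12 a12 z ez.
have ccut o z := @continuous_cut1 R n x0 r1 r2 a1 a2 Ncut o z.
have cac := @caccioppoli R k s s' r Phi g g1 s2 ss' s'0 rgt1 rs (is_derive_Lev ka de)
  (is_derive_lev ka de) (@continuous_lev1 R ka de) (fun x => let: And5 h _ _ _ _ := lb x in h)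
  (fun x => let: And5 _ h _ _ _ := lb x in h) (fun x => let: And5 _ _ h _ _ := lb x in h)
  u D A eta eta1 L t1 E0 Ce iu iD iA ius iDs iAs AD0 meta meta1 (@cut_range R n x0 r1 r2 a1 a2 Ncut)
  Ce1 eta1C (@is_derive_cut R n x0 r1 r2 a1 a2 Ncut) ccut
  (fun o z => @cut1_eq0 R n x0 r1 r2 a1 a2 Ncut o z).
have m2n : 2 < m - 2 / nn.
  by rewrite ltrBrDr; exact: expm_gt n0 p2 al1 be1 pq.
have [|||//||Rfin XR hW] := cac _ E00 _ _ (m - 2 / nn) m m2n.
- by move=> z zt ez; have [h1 h2 h3] := supp z zt ez; have [] := region z h1 h2 h3.
- by move=> e z e0 zt ez; have [h1 h2 h3] := supp z zt ez; have [_ + _] := region z h1 h2 h3; apply.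
- by move=> e z i e0 zt ez; have [h1 h2 h3] := supp z zt ez; have [_ _] := region z h1 h2 h3; apply.
- by rewrite subrK.
- exact: sobolev_exponent n0 p2 al1 be1 pq.
pose P z := \sum_i A i z * D i z.
pose RF z := chi t1 z * flux Phi g (u z) (A^~ z) (eta1^~ z).
pose XF z := chi t1 z * (g1 (u z) * eta z * P z).
pose W z := chi t1 z * (g (u z) * eta z) `^ m.
pose SL z := chi t1 z * slope g g1 (u z) (D^~ z) (eta z) (eta1^~ z) `^ r.
pose HH := H `^ (lam + m); pose Z := (kk / rho) `^ lam.
have w1 : 1 <= kk / rho by rewrite ler_pdivlMr// mul1r.
have y01 : 0 < y <= 1 by rewrite y0.
have [num1 num2] := @step_numeric H Z Q y kk (kk / rho) Q0 y01 H1 w1 erefl.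
have mu_ := integrable_EFin_measurable iu.
have mD i := integrable_EFin_measurable (iD i).
have mA i := integrable_EFin_measurable (iA i).
have Cy := Cyoung_ge0.
have Z0 : 0 <= Z by exact: powR_ge0.
have HH0 : 0 <= HH by exact: powR_ge0.
have chi0 z : 0 <= chi t1 z by case: (chi01 t1 z) => [->|[-> _]].
have mchi : measurable_fun setT (chi t1 : V -> R) by apply: measurable_indic; exact: measurable_before.
have g10 x : 0 <= g1 x <= 1 by have [] := lb x.
have g_0 x : 0 <= g x <= Num.max (x - ka) 0.
  by have [_ /andP[-> _] _ _ [-> _ _ _]] := lb x.
have et01 z : 0 <= eta z <= 1 by exact: cut_range.
have Phi_0 x : 0 <= Phi x.
  have [_ _ /andP[h2 _] _ _] := lb x; have := le_trans (sqr_ge0 _) h2.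
  by rewrite pmulr_rge0.
have flat0 z : ze z = 0 -> (forall o, eta1 o z = 0).
  move=> zz o; apply/eqP; rewrite -normr_le0.
  by case: o => [i|]; [have := e1S i z|have := e1N z]; rewrite zz expr0n/= mulr0 mul0r.
have reg z : z.2 <= t1 -> ze z != 0 -> Num.max (u z - k0) 0 `^ m <= kk `^ m * Y z.
  move=> zt zz; have [|h1 h2 h3] := supp z zt; first by rewrite expf_neq0.
  exact: Yu.
have PhiS x : 2 * Phi x <= Num.max (x - ka) 0 ^+ 2 by have [_ _ _ _ []] := lb x.
have gsS x : g x <= g1 x * Num.max (x - ka) 0 by have [] := lb x.
(* Where [Y'] is nonzero the cutoff equals 1, and [lev] is at least the excess over
   [k1 = ka + de]. *)
apply: (@le_trans _ _ (\int[mu]_z (kk `^ (- m) * W z)%:E)%E).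
  have W0 z : 0 <= W z by rewrite mulr_ge0 ?powR_ge0.
  apply: integral_le_ge0 => z; rewrite lee_fin//; first exact: mulr_ge0 (powR_ge0 _ _) (W0 z).
  have [->|Yn] := eqVneq (Y' z) 0; first exact: mulr_ge0 (powR_ge0 _ _) (W0 z).
  have [zt zr za hY'] := Y'u z Yn.
  have cz : chi t1 z = 1 by rewrite /chi indicE mem_set.
  have ez : eta z = 1 by apply: (@cut_eq1 R n x0 r1 r2 a1 a2 Ncut).
  rewrite /W cz mul1r ez mulr1 powRN mulrC ler_pdivlMr ?powR_gt0// mulrC.
  apply: (le_trans hY'); have [_ /andP[gp _] _ _ [_ _ h _]] := lb (u z).
  rewrite kde in h.
  apply: ge0_ler_powR => //; [exact: le_trans (ltW m2)|by rewrite nnegrE le_max lexx orbT].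
have mgu (f : R -> R) : continuous f -> measurable_fun setT (fun z => f (u z)).
  by move=> cf; apply: (measurableT_comp _ mu_); exact: continuous_measurable_fun.
have cg : continuous g.
  by move=> x; apply: differentiable_continuous; apply/derivable1_diffP; have [] := is_derive_lev ka de x.
have mW : measurable_fun setT W.
  apply: measurable_funM => //; apply: (measurableT_comp (measurable_powR m)).
  by apply: measurable_funM => //; exact: mgu.
under eq_integral do rewrite EFinM.
have W0 z : 0 <= W z by rewrite mulr_ge0 ?powR_ge0.
rewrite ge0_integralZl//; first last.
- by rewrite lee_fin powR_ge0.
- by move=> z _; rewrite lee_fin.
- exact/measurable_EFinP.
have nr : 0 <= (2 * nn) `^ r * nn by rewrite mulr_ge0 ?powR_ge0.
have RF0 z : 0 <= RF z by rewrite mulr_ge0// addr_ge0// mulr_ge0//; case/andP: (g_0 (u z)).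
have XF0 z : 0 <= XF z.
  apply: mulr_ge0; [exact: chi0|apply: mulr_ge0; last exact: AD0].
  by apply: mulr_ge0; [case/andP: (g10 (u z))|case/andP: (et01 z)].
have SL0 z : 0 <= SL z by rewrite mulr_ge0// powR_ge0.
have mXF : measurable_fun setT XF.
  apply: measurable_funM => //; apply: measurable_funM.
    by apply: measurable_funM => //; apply: mgu; exact: continuous_lev1.
  by apply: measurable_sum => i; apply: measurable_funM.
have al0 : 0 < al by exact: lt_trans al1.
have x123 : x1 + x2 + x3 = 1 by rewrite /exp3 -addrA subrKC addrC subrK.
have N20 : 0 <= Ncut.+2%:R :> R by [].
have c10 : 0 <= Ncut.+2%:R * HH * Z by apply: mulr_ge0 => //; exact: mulr_ge0.
have c20 : 0 <= nn * Cyoung * HH * Z by apply: mulr_ge0 => //; apply: mulr_ge0 => //; exact: mulr_ge0.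
have c50 : 0 <= (2 * nn) `^ r * nn * Ncut.+2%:R `^ r * ((H * (kk / rho)) `^ r * H `^ m).
  by apply: mulr_ge0; [apply: mulr_ge0 => //; exact: powR_ge0|apply: mulr_ge0; exact: powR_ge0].
have c60 : 0 <= (m - 2 / nn) `^ r * 2 `^ (r / nn) by apply: mulr_ge0; exact: powR_ge0.
have Bb0 : 0 <= Bb by exact: le_trans ler01 Bb1.
have pRF z : RF z <= 2^-1 * XF z + (Ncut.+2%:R * HH * Z * Y z +
    nn * Cyoung * HH * Z * ((b z `^ be) `^ be^-1 * Y z `^ (1 - be^-1)) +
    nn * Cyoung * HH * Z * ((ai z `^ al) `^ x1 * (b z `^ be) `^ x2 * Y z `^ x3)).
  have T0 : 0 <= Ncut.+2%:R * HH * Z * Y z +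
    nn * Cyoung * HH * Z * ((b z `^ be) `^ be^-1 * Y z `^ (1 - be^-1)) +
    nn * Cyoung * HH * Z * ((ai z `^ al) `^ x1 * (b z `^ be) `^ x2 * Y z `^ x3).
    apply: addr_ge0; [apply: addr_ge0; [exact: mulr_ge0|]|]; apply: (mulr_ge0 c20).
      by apply: mulr_ge0; exact: powR_ge0.
    by apply: mulr_ge0; [apply: mulr_ge0|]; exact: powR_ge0.
  have R0 : 0 <= 2^-1 * XF z by exact: mulr_ge0.
  have [->|zn] := eqVneq (RF z) 0; first exact: addr_ge0.
  have [cz|[cz zt]] := chi01 t1 z; first by move: zn; rewrite /RF cz mul0r eqxx.
  have [zz|zz] := eqVneq (ze z) 0.
    move: zn; rewrite /RF /flux !(flat0 z zz) normr0 mulr0 big1 ?normr0 ?mulr0 ?addr0 ?mulr0 ?eqxx//.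
    by move=> i _; rewrite (flat0 z zz) mulr0.
  have gz : 0 <= g (u z) by case/andP: (g_0 (u z)).
  have := @step_flux H kk rho Lx Lt k0 ka (u z) (ze z) (P z) (g (u z)) (g1 (u z)) (Phi (u z)) (Y z) (ai z) (b z)
    (eta1 None z) (fun i => eta1 (Some i) z) (A^~ z) rho0 rk H1 Lx0 Lt0 hr ha k0ka kkH (Y0 z) (reg z zt zz) (ze01 z) (AD0 z)
    (ai0 z) (b0 z) (g10 (u z)) gz (gsS (u z)) (Phi_0 (u z)) (PhiS (u z)) (e1S^~ z) (e1N z) (growth^~ z).
  by rewrite /RF /XF cz !mul1r.
have pSL z : SL z <= (2 * nn) `^ r * nn * ((ai z `^ al) `^ (al + 1)^-1 * XF z `^ (1 - (al + 1)^-1)) +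
    (2 * nn) `^ r * nn * Ncut.+2%:R `^ r * ((H * (kk / rho)) `^ r * H `^ m) * Y z.
  have T0 : 0 <= (2 * nn) `^ r * nn * ((ai z `^ al) `^ (al + 1)^-1 * XF z `^ (1 - (al + 1)^-1)) +
    (2 * nn) `^ r * nn * Ncut.+2%:R `^ r * ((H * (kk / rho)) `^ r * H `^ m) * Y z.
    by apply: addr_ge0; [apply: mulr_ge0 => //; apply: mulr_ge0; exact: powR_ge0|exact: mulr_ge0].
  have [cz|[cz zt]] := chi01 t1 z; first by rewrite /SL cz mul0r.
  have [zz|zz] := eqVneq (ze z) 0.
    rewrite /SL cz mul1r /slope big1 ?powR0 ?gt_eqF//; first exact: lt_trans rgt1.
    by move=> i _; rewrite (flat0 z zz) normr0 mulr0 addr0 /eta /cut -/ze zz expr0n mulr0.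
  have gz : 0 <= g (u z) by case/andP: (g_0 (u z)).
  have := @step_slope H kk rho Lx k0 ka (u z) (ze z) (P z) (g (u z)) (g1 (u z)) (Y z) (ai z)
    (fun i => eta1 (Some i) z) (D^~ z) rho0 rk H1 Lx0 hr k0ka kkH (Y0 z) (reg z zt zz) (ze01 z) (AD0 z)
    (ai0 z) (g10 (u z)) gz (gsS (u z)) (e1S^~ z) (coerc^~ z).
  by rewrite /SL /XF cz !mul1r.
have hW' (K : R) : (\int[mu]_z (RF z)%:E < K%:E)%E ->
    (\int[mu]_z (W z)%:E <= ((m - 2 / nn) `^ r * 2 `^ (r / nn) * K `^ (r / nn))%:E * \int[mu]_z (SL z)%:E)%E.
  move=> RK; have K0 : 0 <= K.
    rewrite -lee_fin; apply: le_trans (ltW RK); apply: integral_ge0 => z _; rewrite lee_fin; exact: RF0.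
  by have := hW K RK; rewrite (powRM (r / nn) _ K0)// mulrA.
have step := @step_integral _ _ R mu RF XF W SL (fun z => ai z `^ al) (fun z => b z `^ be) Y
  al be x1 x2 x3 _ _ _ _ _ ((m - 2 / nn) `^ r * 2 `^ (r / nn)) Ab Bb Q y (r / nn) (3 * HH * Z * Q * y `^ x3 * stepM1)
  mXF (measurableT_comp (measurable_powR al) mai) (measurableT_comp (measurable_powR be) mb) mY RF0 XF0 SL0
  (fun z => powR_ge0 _ _) (fun z => powR_ge0 _ _) Y0 be1 al0 x10 x20 x30 x123
  c10 c20 c20 nr c50 c60 Bb0 (ltW Q0) (ltW y0) pRF pSL aiL bL iY Rfin XR hW' num1.
apply: (le_trans (lee_wpmul2l _ step)); first by rewrite lee_fin powR_ge0.
by rewrite -EFinM lee_fin.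
Qed.

End iteration_step.
(** The identities behind the gap in space, the gap in time (two of them), the gap of levels and the
    product of constants in [degiorgi]. *)
Lemma degiorgi_arith (R : realType) (a x y K t c d B e : R) :
  [/\ 4 * (a^-1 * 4 * x) = 16 * x / a, 2 * (a^-1 * 4 * x) * K ^+ 2 = 8 * x * (K ^+ 2 / a),
      t - c - (t - d) = d - c,
      16 * y * ((K * (1 - 2^-1 * x) - K * (1 - x)) / 2) = 4 * K * (x * y) &
      c * (d * B) * a * (y * (e / B)) = y * (c * d * a * e) * (B / B)].
Proof. by split; lra. Qed.

(** The ratio [B^(-1/ka)] is chosen so that its power [ka] cancels the growth [B^j] of the
    constants. *)
Lemma powR_geometric (R : realType) (B ka : R) (j : nat) : 0 < B -> 0 < ka ->
  ((B `^ (- ka^-1)) ^+ j) `^ ka = (B ^+ j)^-1.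
Proof.
move=> B0 ka0; rewrite -powR_mulrn ?powR_ge0// -!powRrM.
rewrite -[RHS]powR_inv1 ?exprn_ge0 ?(ltW B0)// -powR_mulrn ?(ltW B0)// -powRrM.
by congr (_ `^ _); rewrite mulrN1 mulrCA mulNr mulVf ?gt_eqF// mulrN1.
Qed.

Lemma powR_expn (R : realType) (b c : R) (j : nat) : 0 <= b -> (b ^+ j) `^ c = (b `^ c) ^+ j.
Proof.
move=> b0; elim: j => [|j IH]; first by rewrite !expr0 powR1.
by rewrite !exprS powRM ?exprn_ge0// IH.
Qed.

Lemma measurable_enorm (R : realType) (n : nat) (x0 : 'rV[R]_n) :
  measurable_fun setT (fun z : spacetime R n => enorm (z.1 - x0)).
Proof.
apply: (measurableT_comp (continuous_measurable_fun (@sqrt_continuous R))).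
apply: measurable_sum => i; apply: measurable_funX.
rewrite [X in measurable_fun _ X](_ : _ = (fun z : spacetime R n => rV_coord i z.1 - x0 0 i)); last first.
  by apply/funext => z; rewrite !mxE.
apply: measurable_funB => //; apply: (measurableT_comp (measurable_rV_coord i)); exact: measurable_fst.
Qed.

(** * Geometric decay *)

Section degiorgi.
Context (R : realType) (k : nat) (p q al be Ab Bb : R).
Local Notation n := k.+1.
Local Notation nn := (k.+1%:R : R).
Local Notation V := (spacetime R k.+1).
Local Notation mu := (lebesgue_st R k.+1).
Local Notation A0 := (expA al).
Local Notation r := (expr p al).
Local Notation m := (expm nn p al).
Local Notation s := (exps q be).
Local Notation s' := (1 - s^-1)^-1.
Local Notation th := (expth p q).
Local Notation lam := (explam p q).
Local Notation ka := (expka nn p q al be).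
Local Notation C0 := (stepC k p q al Ab Bb).
Local Notation c0 := (stepc k p q al).
Hypotheses (p2 : 2 <= p) (al1 : 1 < al) (be1 : 1 < be) (Ab1 : 1 <= Ab) (Bb1 : 1 <= Bb)
  (pq : p <= q < p * (al / (al + 1)) * ((be - 1) / be) + 2 / (nn + 2)).

Context (u : V -> R) (D A : 'I_n -> V -> R) (ai b : V -> R) (Q L t1 t0 E0 : R) (x0 : 'rV[R]_n).
Hypotheses (Q0 : 0 < Q)
  (iu : mu.-integrable setT (EFin \o u))
  (iD : forall i, mu.-integrable setT (EFin \o D i))
  (iA : forall i, mu.-integrable setT (EFin \o A i))
  (ius : mu.-integrable setT (EFin \o (fun z => `|u z| `^ s)))
  (iDs : forall i, mu.-integrable setT (EFin \o (fun z => `|D i z| `^ s)))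
  (iAs : forall i, mu.-integrable setT (EFin \o (fun z => `|A i z| `^ s')))
  (AD0 : forall z, 0 <= \sum_i A i z * D i z)
  (mai : measurable_fun setT ai) (mb : measurable_fun setT b)
  (ai0 : forall z, 0 <= ai z) (b0 : forall z, 0 <= b z)
  (growth : forall i z, `|A i z| <= b z * (1 + (ai z * \sum_i A i z * D i z) `^ th))
  (coerc : forall i z, `|D i z| `^ p <= ai z * \sum_i A i z * D i z)
  (aiL : (\int[mu]_z (ai z `^ al)%:E <= (Ab * Q)%:E)%E)
  (bL : (\int[mu]_z (b z `^ be)%:E <= (Bb * Q)%:E)%E)
  (E00 : 0 < E0).

(** The sizes run from [3/2 * rho] down to [rho]. Starting below [2 * rho] leaves a margin inside
    [Q] for the mollification. *)
Definition dg (rho : R) (j : nat) : R := rho * (1 + 2^-1 * 2^-1 ^+ j).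

Lemma dgS rho j : dg rho j - dg rho j.+1 = rho / 4 * 2^-1 ^+ j.
Proof. by rewrite /dg exprS; lra. Qed.

Lemma dg_gt rho j : 0 < rho -> rho < dg rho j.
Proof. by move=> h; rewrite /dg ltr_pMr// ltrDl mulr_gt0// exprn_gt0. Qed.

Lemma dg_le rho j : 0 < rho -> dg rho j <= dg rho 0.
Proof.
move=> h; rewrite /dg ler_pM2l// lerD2l ler_pM2l// expr0 exprn_ile1// ?invr_ge0// invf_le1//; lra.
Qed.

(** All layers share the final time [t1], since the energy estimates hold up to any time; only the
    radius and the initial time vary. *)
Definition layer (rho sigma : R) (j : nat) : set V :=
  [set z | enorm (z.1 - x0) < dg rho j /\ t0 - dg sigma j < z.2 <= t1].

Lemma measurable_layer rho sigma j : measurable (layer rho sigma j).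
Proof.
have -> : layer rho sigma j = ((fun z : V => enorm (z.1 - x0)) @^-1` `]-oo, dg rho j[%classic) `&`
    (snd @^-1` `]t0 - dg sigma j, t1]%classic).
  by apply/seteqP; split => z; rewrite /layer/= !in_itv/=.
apply: measurableI; rewrite -[X in measurable X]setTI.
  exact: (measurable_enorm x0 measurableT).
by apply: (@measurable_snd _ _ _ _) => //; exact: measurable_itv.
Qed.

Definition lvl (K : R) (j : nat) : R := K * (1 - 2^-1 ^+ j).

Definition layer_excess rho sigma K j (z : V) : R :=
  \1_(layer rho sigma j) z * (K `^ (- m) * Num.max (u z - lvl K j) 0 `^ m).

(** Step [j] has [H = 16 * 2^j], so [H^c0] splits into [16^c0] and the geometric growth [B^j]. *)
Definition degiorgi_C : R := C0 * 16 `^ c0.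

(** Induction keeps the integral of the excess below [Q * y0 * th'^j] with [th' = B^(-1/ka)]. The
    gain [(th'^j)^ka] of a superlinear step cancels the growth [B^j], and the hypothesis on [y0^ka]
    leaves one factor [th']. *)
Lemma degiorgi (rho sigma K y0 : R) (B := 2 `^ c0) :
  0 < rho -> 0 < sigma -> rho <= K -> K ^+ 2 / sigma <= (K / rho) `^ lam -> 0 < y0 <= 1 ->
  (forall z, layer rho sigma 0 z ->
     [/\ forall o, `|co o z| < L,
         forall e, 0 < e <= E0 -> \sum_i conv (moll1 e (Some i)) (A i) z <= conv (moll1 e None) u z &
         forall e i, 0 < e <= E0 -> conv (moll1 e (Some i)) u z = - conv (moll e) (D i) z]) ->
  (\int[mu]_z (layer_excess rho sigma K 0 z)%:E <= (Q * y0)%:E)%E ->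
  degiorgi_C * (K `^ (- m) * Q `^ (r / nn) * ((K / rho) `^ lam) `^ (r / nn + A0)) * y0 `^ ka <=
    B `^ (- ka^-1) ->
  {ae mu, forall z, enorm (z.1 - x0) <= rho -> t0 - sigma <= z.2 -> z.2 <= t1 -> u z <= K}.
Proof.
move=> rho0 sigma0 rK KZ /andP[y00 y01] region iY hG.
have K0 : 0 < K by exact: lt_le_trans rK.
have ka0 := expka_gt0 (ltr0Sn R k) p2 al1 be1 pq.
have m2 := m_gt2 p2 al1 be1 pq.
have m0 : 0 < m by exact: lt_trans m2.
have B0 : 0 < B by exact: powR_gt0.
have lam1 := lam_ge1 p2 al1 be1 pq.
have c00 : 0 < c0.
  apply: mulr_gt0; first by apply: addr_gt0 => //; exact: lt_le_trans ltr01 lam1.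
  have r0 : 0 < r by exact: (lt_trans ltr01 (@sobolev_exp_gt1 R k p q al be p2 al1 be1 pq)).
  exact: (addr_gt0 (divr_gt0 r0 (ltr0Sn R k)) ltr01).
have pow1 (x a : R) : 1 < x -> 0 < a -> 1 < x `^ a.
  move=> x1 a0; have x0' : x \is Num.nneg by rewrite nnegrE; exact: le_trans (ltW x1).
  have one0 : (1 : R) \is Num.nneg by rewrite nnegrE.
  by have := gt0_ltr_powR a0 one0 x0' x1; rewrite powR1.
have B1 : 1 < B by apply: pow1; rewrite ?ltr1n.
pose th' := B `^ (- ka^-1).
have th0 : 0 < th' by exact: powR_gt0.
have th1' : th' < 1.
  by rewrite /th' powRN invf_lt1 ?powR_gt0//; apply: pow1; rewrite ?invr_gt0.
have th1 := ltW th1'.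
pose Y := layer_excess rho sigma K.
have Y0 j z : 0 <= Y j z by rewrite mulr_ge0// mulr_ge0 ?powR_ge0.
have mu_ := integrable_EFin_measurable iu.
have mY j : measurable_fun setT (Y j).
  apply: measurable_funM; first by apply: measurable_indic; exact: measurable_layer.
  apply: measurable_funM => //; apply: (measurableT_comp (measurable_powR m)).
  by apply: measurable_maxr => //; apply: measurable_funB.
have h0 j : 0 < 2^-1 ^+ j :> R by rewrite exprn_gt0.
have h1 j : 2^-1 ^+ j <= 1 :> R by rewrite exprn_ile1 ?invr_ge0// invf_le1// ler1n.
have hj j : 2^-1 ^+ j * 2 ^+ j = 1 :> R by rewrite -exprMn mulVf// expr1n.
have main j : (\int[mu]_z (Y j z)%:E <= (Q * (y0 * th' ^+ j))%:E)%E.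
  elim: j => [|j IH]; first by rewrite expr0 mulr1.
  have yj : 0 < y0 * th' ^+ j <= 1.
    by rewrite mulr_gt0 ?exprn_gt0//= mulr_ile1 ?exprn_ge0 ?exprn_ile1// ltW.
  (* The space cutoff asks for [16 * 2^j], the time cutoff for [8 * 2^j] and the gap of levels for
     [4 * 2^j]. *)
  pose H : R := 16 * 2 ^+ j.
  have H1 : 1 <= H by rewrite /H mulr_ege1 ?exprn_ege1 ?ler1n.
  have := @iteration_step R k p q al be Ab Bb p2 al1 be1 Ab1 Bb1 pq u D A ai b Q L t1 E0 x0 Q0 iu iD iA ius iDs iAs
    AD0 mai mb ai0 b0 growth coerc aiL bL E00 (dg rho j.+1) (dg rho j) (t0 - dg sigma j) (t0 - dg sigma j.+1)
    (lvl K j) (lvl K j.+1) K rho H (y0 * th' ^+ j) (Y j) (Y j.+1).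
  have lay z : layer rho sigma j z -> layer rho sigma 0 z.
    move=> [h2 /andP[h3 h4]]; split; first exact: lt_le_trans (dg_le j rho0).
    by rewrite h4 andbT; apply: le_lt_trans h3; rewrite lerD2l lerN2; exact: dg_le.
  have layS z : layer rho sigma j.+1 z -> layer rho sigma j z.
    move=> [h2 /andP[h3 h4]]; split; first by apply: (lt_trans h2); rewrite -subr_gt0 dgS mulr_gt0// divr_gt0.
    rewrite h4 andbT; apply: lt_trans h3; rewrite ltrD2l ltrN2 -subr_gt0 dgS mulr_gt0// divr_gt0//.
  move=> step; apply: (le_trans (step _ _ _ _ _ rho0 rK H1 yj _ _ _ _ (mY j) (Y0 j) _ IH (Y0 j.+1) _)) => {step}.
  - exact: lt_trans (dg_gt _ rho0).
  - by rewrite -subr_gt0 dgS mulr_gt0// divr_gt0.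
  - by rewrite ltrD2l ltrN2 -subr_gt0 dgS mulr_gt0// divr_gt0.
  - by rewrite /lvl mulr_ge0 ?(ltW K0)// subr_ge0.
  - by rewrite /lvl ltr_pM2l// ltrD2l ltrN2 exprS gtr_pMl// invf_lt1 ?ltr1n.
  - by move=> z zt zr za; apply: region; apply: lay; split => //; rewrite za.
  - rewrite dgS !invfM invrK.
    have -> : 4 * (rho^-1 * 4 * (2^-1 ^+ j)^-1) = 16 * (2^-1 ^+ j)^-1 / rho by case: (degiorgi_arith rho (2^-1 ^+ j)^-1 0 0 0 0 0 0 0).
    by rewrite -exprVn invrK.
  - have -> : t0 - dg sigma j.+1 - (t0 - dg sigma j) = dg sigma j - dg sigma j.+1 by case: (degiorgi_arith 0 0 0 0 t0 (dg sigma j.+1) (dg sigma j) 0 0).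
    rewrite dgS !invfM invrK -exprVn invrK.
    have -> : 2 * (sigma^-1 * 4 * 2 ^+ j) * K ^+ 2 = 8 * 2 ^+ j * (K ^+ 2 / sigma) by case: (degiorgi_arith sigma (2 ^+ j) 0 K 0 0 0 0 0).
    have q1 : 0 <= 8 * 2 ^+ j :> R by apply: mulr_ge0 => //; exact: exprn_ge0.
    have q2 : 0 <= K ^+ 2 / sigma by apply: divr_ge0; [exact: sqr_ge0|exact: ltW].
    by apply: (ler_pM q1 q2 _ KZ); rewrite ler_pM2r ?exprn_gt0// ler_nat.
  - rewrite /lvl exprS.
    have -> : H * ((K * (1 - 2^-1 * 2^-1 ^+ j) - K * (1 - 2^-1 ^+ j)) / 2) = 4 * K * (2^-1 ^+ j * 2 ^+ j).
      by case: (degiorgi_arith 0 (2^-1 ^+ j) (2 ^+ j) K 0 0 0 0 0).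
    by rewrite hj mulr1 ler_peMl ?(ltW K0)// ler1n.
  - move=> z zt zr za; rewrite /Y /layer_excess indicE mem_set ?mul1r; last by split => //; rewrite za.
    by rewrite mulrA -powRD ?(gt_eqF K0) ?implybT// subrr powRr0 mul1r.
  - move=> z; rewrite /Y /layer_excess indicE; case: (boolP (z \in _)); last by rewrite mul0r eqxx.
    rewrite inE => -[h2 /andP[h3 h4]] _; split => //; [exact: ltW|exact: ltW|].
    by rewrite mul1r mulrA -powRD ?(gt_eqF K0) ?implybT// subrr powRr0 mul1r.
  rewrite lee_fin ler_pM2l//.
  have y0' : 0 < y0 * th' ^+ j by case/andP: yj.
  have -> : (y0 * th' ^+ j) `^ (1 + ka) = (y0 * th' ^+ j) * (y0 `^ ka * (B ^+ j)^-1).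
    rewrite powRD ?(gt_eqF y0') ?implybT// powRr1 ?(ltW y0')// powRM ?exprn_ge0 ?(ltW y00) ?(ltW th0)//.
    by congr (_ * (_ * _)); exact: (powR_geometric j B0 ka0).
  have -> : H `^ c0 = 16 `^ c0 * B ^+ j.
    by rewrite /H powRM ?exprn_ge0//; congr (_ * _); exact: powR_expn.
  rewrite exprSr [leRHS]mulrA.
  set G := K `^ (- m) * _ * _ in hG *.
  have -> : C0 * (16 `^ c0 * B ^+ j) * G * (y0 * th' ^+ j * (y0 `^ ka / B ^+ j)) =
      (y0 * th' ^+ j) * (degiorgi_C * G * y0 `^ ka) * (B ^+ j / B ^+ j).
    by case: (degiorgi_arith G 0 (y0 * th' ^+ j) 0 0 C0 (16 `^ c0) (B ^+ j) (y0 `^ ka)).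
  by rewrite mulfV ?gt_eqF ?exprn_gt0// mulr1 ler_pM2l.
(* [F] lies below every [Y j], since the levels stay below [K] and every layer contains the
   intersection; its integral is therefore 0. *)
pose F z := \1_(\bigcap_j layer rho sigma j) z * (K `^ (- m) * Num.max (u z - K) 0 `^ m).
have F0 z : 0 <= F z by rewrite mulr_ge0// mulr_ge0 ?powR_ge0.
have mF : measurable_fun setT F.
  apply: measurable_funM; first by apply: measurable_indic; apply: bigcapT_measurable => j; exact: measurable_layer.
  apply: measurable_funM => //; apply: (measurableT_comp (measurable_powR m)).
  by apply: measurable_maxr => //; apply: measurable_funB.
have FY j z : F z <= Y j z.
  rewrite /F /Y /layer_excess !indicE; case: (boolP (z \in \bigcap_j _)); last first.
    by move=> _; rewrite mul0r; exact: Y0.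
  rewrite inE => zj; rewrite mem_set; last exact: zj.
  rewrite !mul1r ler_wpM2l ?powR_ge0//; apply: ge0_ler_powR; [exact: ltW|by rewrite nnegrE le_max lexx orbT|by rewrite nnegrE le_max lexx orbT|].
  rewrite ge_max !le_max lexx orbT andbT; apply/orP; left; rewrite lerD2l lerN2 /lvl ler_piMr ?(ltW K0)//.
have Fi : (\int[mu]_z (F z)%:E = 0)%E.
  apply/eqP; rewrite eq_le; apply/andP; split; last by apply: integral_ge0 => z _; rewrite lee_fin.
  have le_j j : (\int[mu]_z (F z)%:E <= (Q * (y0 * th' ^+ j))%:E)%E.
    by apply: (le_trans _ (main j)); apply: integral_le_ge0 => z; rewrite lee_fin.
  have cv : (Q * (y0 * th' ^+ j))%:E @[j --> \oo] --> 0%:E.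
    apply: cvg_EFin; first exact: nearW.
    rewrite (_ : _ \o _ = geometric (Q * y0) th'); last by apply/funext => j /=; rewrite mulrA.
    by apply: cvg_geometric; rewrite ger0_norm ?(ltW th0).
  by apply: (cvge_to_ge cv); apply: nearW => j; exact: le_j.
have mFE : measurable_fun setT (EFin \o F) by exact/measurable_EFinP.
have : (\int[mu]_z `|(EFin \o F) z| = 0)%E.
  by rewrite -[RHS]Fi; apply: eq_integral => z _; rewrite /= ger0_norm.
move/(ae_eq_integral_abs mu measurableT mFE); apply: filterS => z /(_ I) [Fz] zr za zt.
have zl j : layer rho sigma j z.
  split; first exact: le_lt_trans zr (dg_gt j rho0).
  by rewrite zt andbT; apply: lt_le_trans za; rewrite ltrD2l ltrN2 dg_gt.
move: Fz; rewrite /F indicE mem_set ?mul1r; last by move=> j _; exact: zl.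
move/eqP; rewrite mulf_eq0 gt_eqF ?powR_gt0//= powR_eq0 => /andP[/eqP h _].
by rewrite -subr_le0 -h le_max lexx.
Qed.

End degiorgi.

(** * Choice of the level and exponents of the estimate *)

Section level_choice.
Context (R : realType) (nn p q al be : R).
Local Notation A0 := (expA al).
Local Notation r := (expr p al).
Local Notation m := (expm nn p al).
Local Notation lam := (explam p q).
Local Notation x3 := (exp3 p q al be).
Local Notation ka := (expka nn p q al be).
Hypotheses (n0 : 0 < nn) (p2 : 2 <= p) (al1 : 1 < al) (be1 : 1 < be)
  (pq : p <= q < p * (al / (al + 1)) * ((be - 1) / be) + 2 / (nn + 2)).

(** The power of [1 / K] in the smallness condition: [K^(-m)] is explicit, [y0 = M / K^m]
    contributes [K^(-m * ka)], and [(K / rho)^lam] works against them with the power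
    [r / nn + A0]. *)
Definition expD : R := (1 + ka) * m - lam * (r / nn + A0).
(** The three exponents are the powers of [sigma / tau], of [rho^(-(q - p))] and of [M] in the
    smallness condition, divided by [expD] on solving for [K]. *)
Definition theta1 : R := r / nn / expD.
Definition theta2 : R := r / (p + 1 - q) / expD.
Definition theta3 : R := ka / expD.

(** [1 + ka = exp3 * (r / nn + A0)], so [expD = (1 + ka) * (m - lam / exp3)] and [lam1_lt]
    applies. *)
Lemma expD_gt0 : 0 < expD.
Proof.
have x30 := exp3_gt0 n0 p2 al1 be1 pq; have ka0 := expka_gt0 n0 p2 al1 be1 pq.
have h := lam1_lt n0 p2 al1 be1 pq.
have e : lam * (r / nn + A0) = (1 + ka) * (lam / x3).
  by rewrite /expka subrKC [RHS]mulrC mulrA divfK ?gt_eqF.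
rewrite /expD e -mulrBr; apply: mulr_gt0; [exact: addr_gt0|by rewrite subr_gt0].
Qed.

Let r0 : 0 < r.
Proof. by rewrite exprE mulr_gt0//; [move: (p2); lra|case/andP: (expA_bounds al1)]. Qed.

Lemma theta_gt0 : [/\ 0 < theta1, 0 < theta2 & 0 < theta3].
Proof.
have D0 := expD_gt0; have /andP[q0 _] := q_lt n0 p2 al1 be1 pq.
have ka0 := expka_gt0 n0 p2 al1 be1 pq.
by split; [exact: divr_gt0 (divr_gt0 r0 n0) D0|exact: divr_gt0 (divr_gt0 r0 q0) D0|exact: divr_gt0].
Qed.

(** The total power of [rho]: [r] comes from the volume of [Q] to the power [r / nn], the rest from
    [K / rho]. On the right, the first part turns [sigma] into [sigma / tau] and the second is the
    power of [rho] left over when [p < q]. *)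
Lemma expD_exponent : r - lam * (r / nn + A0) = - lam * (r / nn) - (q - p) * (r / (p + 1 - q)).
Proof.
have /andP[q0 _] := q_lt n0 p2 al1 be1 pq.
rewrite (lamE q p2) exprE.
have : (p + 1 - q) / (p + 1 - q) = 1 by rewrite divff ?gt_eqF.
set i := (p + 1 - q)^-1; move=> h.
have -> : p * A0 - p * i * (p * A0 / nn + A0) = p * A0 * 1 - p * i * (p * A0 / nn) - p * i * A0 by lra.
rewrite -h; lra.
Qed.

(** The last condition reads [X * y0^ka <= 1], and [y0] has to be at least [M / K^m]. Inserting this
    and the volume bound turns it into [c * S^expD <= K^expD]. *)
Lemma level_choice (B C1 CQ rho sigma Q M K : R) (tau := rho `^ lam)
    (c := C1 * B `^ ka^-1 * CQ `^ (r / nn))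
    (S := (sigma / tau) `^ theta1 / rho `^ ((q - p) * theta2) * M `^ theta3) :
  0 < B -> 0 < C1 -> 0 < CQ -> 0 < rho -> 0 < sigma -> 0 <= M -> 0 < Q ->
  Q <= CQ * (rho `^ nn * sigma) -> rho <= K -> M `^ m^-1 <= K -> c `^ expD^-1 * S <= K ->
  exists y0, [/\ 0 < y0 <= 1, M <= y0 * K `^ m &
   C1 * (K `^ (- m) * Q `^ (r / nn) * ((K / rho) `^ lam) `^ (r / nn + A0)) * y0 `^ ka <= B `^ (- ka^-1)].
Proof.
move=> B0 C10 CQ0 rho0 sigma0 M0 Q0 hQ rK MK SK.
have ka0 := expka_gt0 n0 p2 al1 be1 pq; have D0 := expD_gt0.
have K0 : 0 < K by exact: lt_le_trans rK.
have m0 : 0 < m by apply: lt_trans (expm_gt n0 p2 al1 be1 pq); rewrite addr_gt0// divr_gt0.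
have tau0 : 0 < tau by exact: powR_gt0.
have A00 : 0 < A0 by case/andP: (expA_bounds al1).
pose e := lam * (r / nn + A0).
pose G := K `^ (- m) * Q `^ (r / nn) * ((K / rho) `^ lam) `^ (r / nn + A0).
have G0 : 0 < G by rewrite /G !mulr_gt0// ?powR_gt0// divr_gt0.
have S0 : 0 <= S by rewrite !mulr_ge0 ?invr_ge0 ?powR_ge0.
pose X := C1 * G * B `^ ka^-1.
have X0 : 0 < X by exact: mulr_gt0 (mulr_gt0 C10 G0) (powR_gt0 _ B0).
have c0 : 0 < c by exact: mulr_gt0 (mulr_gt0 C10 (powR_gt0 _ B0)) (powR_gt0 _ CQ0).
have MKm : M <= K `^ m.
  rewrite -[leLHS]powRr1// -(mulVf (lt0r_neq0 m0)) powRrM.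
  by apply: ge0_ler_powR; rewrite ?nnegrE ?powR_ge0 ?(ltW m0) ?(ltW K0).
have SD : S `^ expD = (sigma / tau) `^ (r / nn) * rho `^ (- ((q - p) * (r / (p + 1 - q)))) * M `^ ka.
  have h1 : 0 <= (rho `^ ((q - p) * theta2))^-1 by rewrite invr_ge0 powR_ge0.
  have h2 := mulr_ge0 (powR_ge0 (sigma / tau) theta1) h1.
  rewrite /S (powRM _ h2 (powR_ge0 _ _)) (powRM _ (powR_ge0 _ _) h1) -powRN -!powRrM.
  rewrite mulNr -[(q - p) * _ * expD]mulrA /theta1 /theta2 /theta3 !divfK// gt_eqF//.
have key : X * M `^ ka <= K `^ (m * ka).
  have hQ' : Q `^ (r / nn) <= CQ `^ (r / nn) * (rho `^ r * sigma `^ (r / nn)).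
    apply: (@le_trans _ _ ((CQ * (rho `^ nn * sigma)) `^ (r / nn))).
      apply: ge0_ler_powR; [exact: divr_ge0 (ltW r0) (ltW n0)|by rewrite nnegrE ltW| |exact: hQ].
      by rewrite nnegrE; exact: le_trans (ltW Q0) hQ.
    rewrite (powRM _ (ltW CQ0) (mulr_ge0 (powR_ge0 _ _) (ltW sigma0))) (powRM _ (powR_ge0 _ _) (ltW sigma0)).
    by rewrite -powRrM [nn * _]mulrC divfK// gt_eqF.
  have Ke : ((K / rho) `^ lam) `^ (r / nn + A0) = K `^ e * rho `^ (- e).
    have ri : 0 <= rho^-1 by rewrite invr_ge0 ltW.
    by rewrite -powRrM -/e (powRM _ (ltW K0) ri) -(powR_inv1 (ltW rho0)) -powRrM mulN1r.
  have W : rho `^ r * sigma `^ (r / nn) * rho `^ (- e) =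
      (sigma / tau) `^ (r / nn) * rho `^ (- ((q - p) * (r / (p + 1 - q)))).
    rewrite mulrAC -powRD ?(gt_eqF rho0) ?implybT// /e expD_exponent powRD ?(gt_eqF rho0) ?implybT//.
    have ti : 0 <= tau^-1 by rewrite invr_ge0 ltW.
    by rewrite (powRM _ (ltW sigma0) ti) /tau -powRN -powRrM [LHS]mulrC [LHS]mulrA.
  have le1 : X * M `^ ka <= K `^ (e - m) * (c * S `^ expD).
    rewrite SD -W.
    have -> : K `^ (e - m) * (c * (rho `^ r * sigma `^ (r / nn) * rho `^ (- e) * M `^ ka)) =
        C1 * (K `^ (- m) * (CQ `^ (r / nn) * (rho `^ r * sigma `^ (r / nn))) * (K `^ e * rho `^ (- e))) * B `^ ka^-1 * M `^ ka.
      rewrite addrC powRD ?(gt_eqF K0) ?implybT// /c; clear; lra.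
    rewrite /X /G Ke; apply: ler_wpM2r; first exact: powR_ge0.
    apply: ler_wpM2r; first exact: powR_ge0.
    apply: ler_wpM2l; first exact: ltW.
    apply: ler_wpM2r; first by rewrite mulr_ge0 ?powR_ge0.
    by apply: ler_wpM2l; first exact: powR_ge0.
  apply: (le_trans le1).
  have -> : K `^ (m * ka) = K `^ (e - m) * K `^ expD.
    by rewrite -powRD ?(gt_eqF K0) ?implybT//; congr (_ `^ _); rewrite /expD -/e [RHS]addrC addrA subrK mulrDl mul1r addrAC subrr add0r mulrC.
  apply: ler_wpM2l; first exact: powR_ge0.
  have -> : c * S `^ expD = (c `^ expD^-1 * S) `^ expD.
    by rewrite powRM ?powR_ge0// -powRrM mulVf ?gt_eqF// powRr1// ltW.
  apply: ge0_ler_powR; rewrite ?nnegrE ?(ltW D0) ?(ltW K0)//.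
  by rewrite mulr_ge0 ?powR_ge0.
(* The largest value allowed by both upper bounds; [MKm] and [key] say that [M / K^m] is below
   either. *)
pose y0 := Num.min 1 (X `^ (- ka^-1)).
have y00 : 0 < y0 by rewrite lt_min ltr01 powR_gt0.
exists y0; split.
- by rewrite y00 ge_min lexx.
- rewrite /y0 minEle; case: ifP => _; first by rewrite mul1r.
  rewrite powRN mulrC ler_pdivlMr ?powR_gt0//.
  rewrite -[leLHS]powRr1 ?mulr_ge0 ?powR_ge0// -[X in _ `^ X](mulfV (lt0r_neq0 ka0)) powRrM.
  have -> : K `^ m = (K `^ (m * ka)) `^ ka^-1 by rewrite -powRrM mulfK ?gt_eqF.
  apply: ge0_ler_powR; rewrite ?nnegrE ?powR_ge0 ?invr_ge0 ?(ltW ka0)//.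
  by rewrite powRM ?powR_ge0// -powRrM mulVf ?gt_eqF// powRr1 ?(ltW X0)// mulrC.
rewrite -/G powRN -[leLHS]mulrA.
have yX : y0 `^ ka <= X^-1.
  apply: (@le_trans _ _ ((X `^ (- ka^-1)) `^ ka)).
    by apply: ge0_ler_powR; rewrite ?nnegrE ?powR_ge0 ?(ltW ka0) ?(ltW y00)// ge_min lexx orbT.
  by rewrite -powRrM mulNr mulVf ?gt_eqF// powR_inv1// ltW.
apply: (@le_trans _ _ (C1 * (G * X^-1))).
  by apply: ler_wpM2l; [exact: ltW|apply: ler_wpM2l => //; exact: ltW].
by rewrite /X invfM mulrA mulrA divff ?mul1r// gt_eqF// mulr_gt0.
Qed.

End level_choice.
(** * From the weak formulation to mollified inequalities *)

Section euclidean.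
Context (R : realType) (n : nat).
Implicit Types (x y : 'rV[R]_n).

Lemma enorm_sqr x : enorm x ^+ 2 = \sum_i x 0 i ^+ 2.
Proof. by rewrite /enorm sqr_sqrtr// sumr_ge0// => i _; exact: sqr_ge0. Qed.

Lemma enorm_ge0 x : 0 <= enorm x. Proof. exact: sqrtr_ge0. Qed.

Lemma normr_le_enorm x i : `|x 0 i| <= enorm x.
Proof.
rewrite -ler_sqr ?nnegrE ?enorm_ge0// enorm_sqr (bigD1 i)//= real_normK ?num_real// lerDl.
by apply: sumr_ge0 => j _; exact: sqr_ge0.
Qed.

Lemma enorm_sqr_le x (e : R) : (forall i, `|x 0 i| <= e) -> enorm x ^+ 2 <= n%:R * e ^+ 2.
Proof.
move=> h; rewrite enorm_sqr; apply: (@le_trans _ _ (\sum_(i < n) e ^+ 2)).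
  by apply: ler_sum => i _; rewrite -real_normK ?num_real// ler_sqr ?nnegrE//; exact: le_trans (h i).
by rewrite sumr_const card_ord -[leLHS]mulr_natl.
Qed.

(* [(a + b)^2 <= (5/4) a^2 + 5 b^2]. *)
Lemma enorm_perturb x y (r e : R) : 0 < r -> enorm x < r * (3 / 2) -> (forall i, `|y 0 i| <= e) ->
  5 * n%:R * e ^+ 2 <= r ^+ 2 -> enorm (x + y) < 2 * r.
Proof.
move=> r0 xr ye er; rewrite -ltr_sqr ?nnegrE ?enorm_ge0// ?mulr_ge0 ?(ltW r0)//.
have h1 : enorm (x + y) ^+ 2 <= 5 / 4 * enorm x ^+ 2 + 5 * enorm y ^+ 2.
  rewrite !enorm_sqr !mulr_sumr -big_split/=; apply: ler_sum => i _; rewrite mxE.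
  have := sqr_ge0 (x 0 i - 4 * y 0 i); nra.
have h2 := enorm_sqr_le ye.
(* In units of [r^2] the bound becomes [5/4 * 9/4 + 1 = 61/16 < 4]. *)
have h3 : enorm x ^+ 2 < (r * (3 / 2)) ^+ 2.
  by rewrite ltr_sqr ?nnegrE ?enorm_ge0// mulr_ge0 ?(ltW r0).
rewrite exprMn in h3; have r20 : 0 < r ^+ 2 by rewrite exprn_gt0.
have e1 : (3 / 2) ^+ 2 = 9 / 4 :> R by rewrite expr2; lra.
have e2 : 2 ^+ 2 = 4 :> R by rewrite expr2; lra.
by rewrite e1 in h3; rewrite [ltRHS]exprMn e2; lra.
Qed.

End euclidean.

Section test_functions_bump.
Context (R : realType).

(** The points of nonzero value lie in the set [|l i| <= e], which is closed and contained in the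
    compact [K]; smoothness is [Ck_flat] for the affine [e - l i] and [e + l i]. *)
Lemma test_fun_bump (V : normedModType R) (I : finType) (l l0 : I -> V -> R) (c e : R) (K D : set V) :
  (forall i, continuous (l i)) -> (forall i z v h, l i (h *: v + z) = l i z + h * l0 i v) ->
  compact K -> K `<=` D -> (forall x, (forall i, `|l i x| <= e) -> K x) ->
  test_fun D (fun x => c * \prod_i bump e (l i x)).
Proof.
move=> cl hl cK KD hK; split.
  move=> k; apply: Ck_mul; first exact: Ck_cst.
  apply: Ck_prod => i; apply: Ck_mul.
    apply: (@Ck_flat _ _ k 0 (fun z => e - l i z) (fun v => - l0 i v)).
      by move=> x; apply: continuousB; [exact: cst_continuous|exact: cl].
    by move=> z v h; rewrite hl; lra.
  apply: (@Ck_flat _ _ k 0 (fun z => e + l i z) (fun v => l0 i v)).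
    by move=> x; apply: continuousD; [exact: cst_continuous|exact: cl].
  by move=> z v h; rewrite hl; lra.
pose F := \bigcap_(i in [set: I]) (l i @^-1` `[- e, e]%classic).
have cF : closed F.
  apply: closed_bigI => i _; apply: preimage_closed; last exact: interval_closed.
  by move=> x _; exact: cl.
have SF : closure [set x | c * \prod_i bump e (l i x) != 0] `<=` F.
  rewrite [X in _ `<=` X]((closure_id F).1 cF); apply: closureS => x /= hx i _.
  rewrite /= in_itv/= -ler_norml leNgt; apply/negP => h.
  move/eqP: hx; apply; rewrite (bigD1 i)//= (proj1 (bump_eq0 (ltW h))) mul0r mulr0//.
have FK : F `<=` K.
  by move=> x hx; apply: hK => i; have := hx i Logic.I; rewrite /= in_itv/= -ler_norml.
split; last by move=> x /SF /FK /KD.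
by apply: subclosed_compact SF => //; [exact: closed_closure|exact: subclosed_compact FK].
Qed.

Context (n : nat).
Local Notation V := (spacetime R n).
Local Notation VN := ('rV[R]_n * R)%type.

Definition cube (z : 'rV[R]_n) (e : R) : set 'rV[R]_n := [set x | forall i, `|x 0 i - z 0 i| <= e].

Lemma compact_cube z e : compact (cube z e).
Proof.
have -> : cube z e = [set v : 'rV[R]_n | forall i, (`[z 0 i - e, z 0 i + e]%classic : set R) (v ord0 i)].
  by apply/seteqP; split => v h i; have := h i; rewrite /= in_itv/= ler_distl.
by apply: (@rV_compact R n (fun i => `[z 0 i - e, z 0 i + e]%classic)) => i; exact: segment_compact.
Qed.

Lemma continuous_coord i : continuous (fun x : 'rV[R]_n => x 0 i).
Proof. exact: coord_continuous. Qed.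

Lemma test_fun_moll (D : set VN) (e : R) (z : VN) :
  (forall w : VN, (forall o, `|co o w - co o z| <= e) -> D w) ->
  test_fun D (fun w : VN => moll e (w - z)).
Proof.
move=> hD.
pose K : set VN := cube z.1 e `*` `[z.2 - e, z.2 + e]%classic.
have := @test_fun_bump VN (option 'I_n) (fun o w => co o w - co o z) (fun o v => co o v) (mass n e)^-1 e K D.
rewrite (_ : (fun x => _) = (fun w : VN => moll e (w - z))); last first.
  by apply/funext => w; rewrite /moll /bumpK /prodK; congr (_ * _); apply: eq_bigr => o _; rewrite coB.
apply.
- by move=> o x; apply: continuousB; [exact: continuous_co|exact: cst_continuous].
- by move=> [i|] w v h; rewrite /= ?mxE /GRing.scale /=; lra.
- by apply: compact_setX; [exact: compact_cube|exact: segment_compact].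
- move=> w [h1 h2]; apply: hD => -[i|] /=; first exact: h1.
  by move: h2; rewrite /= in_itv/= ler_distl.
- move=> w h; split => [i|]; first exact: (h (Some i)).
  by have := h None; rewrite /= in_itv/= ler_distl.
Qed.

Lemma prod_option_neq_none (I : finType) (F : option I -> R) :
  \prod_(o | o != None) F o = \prod_i F (Some i).
Proof.
rewrite big_mkcond (eq_bigr (oapp (fun i => F (Some i)) 1)); last by case.
rewrite -(big_pmap id); apply: perm_big; apply: uniq_perm.
- by apply: (@pmap_uniq _ _ id Some) => //; [case|exact: index_enum_uniq].
- exact: index_enum_uniq.
- by move=> i; rewrite mem_pmap map_id !mem_index_enum.
Qed.

Lemma test_fun_moll_slice (D : set 'rV[R]_n) (e t : R) (z : VN) : 0 < e ->
  (forall x, cube z.1 e x -> `|t - z.2| <= e -> D x) ->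
  test_fun D (fun x : 'rV[R]_n => moll e ((x, t) - z : VN)).
Proof.
move=> e0 hD.
have fE : (fun x : 'rV[R]_n => moll e ((x, t) - z : VN)) =
    (fun x => (mass n e)^-1 * bump e (t - z.2) * \prod_(i < n) bump e (x 0 i - z.1 0 i)).
  apply/funext => x; rewrite /moll /bumpK /prodK -mulrA; congr (_ * _).
  rewrite (bigD1 None)//=; congr (_ * _).
  by rewrite prod_option_neq_none; apply: eq_bigr => i _; rewrite /= !mxE.
(* For [t] farther than [e] from [z.2] the slice vanishes identically, and [hD] gives no information
   there. *)
have [h|h] := leP `|t - z.2| e; last first.
  rewrite fE (proj1 (bump_eq0 (ltW h))).
  have -> : (fun x : 'rV[R]_n => (mass n e)^-1 * 0 * \prod_(i < n) bump e (x 0 i - z.1 0 i)) = cst 0.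
    by apply/funext => x; rewrite mulr0 mul0r.
  split; first by move=> j; exact: Ck_cst.
  have -> : [set x : 'rV[R]_n | (cst 0 x : R) != 0] = set0 by rewrite -subset0 => x /=; rewrite eqxx.
  by rewrite closure0; split => //; exact: compact0.
rewrite fE.
apply: (@test_fun_bump 'rV[R]_n 'I_n (fun i x => x 0 i - z.1 0 i) (fun i v => v 0 i) _ e (cube z.1 e) D).
- by move=> i x; apply: continuousB; [exact: continuous_coord|exact: cst_continuous].
- by move=> i w v s /=; rewrite !mxE; lra.
- exact: compact_cube.
- by move=> x hx; exact: hD.
- by move=> x hx i; exact: hx.
Qed.

Lemma derive_moll_sub (e : R) (z w : VN) o :
  'D_(dir R o) (fun w : VN => moll e (w - z)) w = moll1 e o (w - z).
Proof.
suff [_ ->//] : is_derive w (dir R o) (fun w : VN => moll e (w - z)) (moll1 e o (w - z)).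
apply/is_derive_line; under eq_fun do rewrite -addrA.
exact: (proj1 (@is_derive_line R VN (moll e) (w - z) (dir R o) _) (moll_derive e o (w - z))).
Qed.

Lemma derive_moll_slice (e t : R) (z : VN) (x : 'rV[R]_n) i :
  'D_(delta_mx 0 i) (fun x : 'rV[R]_n => moll e ((x, t) - z : VN)) x = moll1 e (Some i) ((x, t) - z).
Proof.
suff [_ ->//] : is_derive x (delta_mx 0 i) (fun x : 'rV[R]_n => moll e ((x, t) - z : VN))
  (moll1 e (Some i) ((x, t) - z)).
apply/is_derive_line.
have -> : (fun h : R => moll e ((h *: delta_mx 0 i + x, t) - z : VN)) =
    (fun h : R => moll e (h *: dir R (Some i) + ((x, t) - z) : VN)).
  apply/funext => h; congr (moll e _); rewrite addrA; congr (_ - _).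
  by congr pair; rewrite /= scaler0 add0r.
exact: (proj1 (@is_derive_line R VN (moll e) ((x, t) - z) (dir R (Some i)) _) (moll_derive e (Some i) ((x, t) - z))).
Qed.

End test_functions_bump.

(** * Measurability and volume of cylinders *)

Section cylinders.
Context (R : realType) (k : nat).
Local Notation n := k.+1.
Local Notation V := (spacetime R n).
Local Notation mu := (lebesgue_st R n).

(** The sigma-algebra is generated by the coordinates, so an open set is exhibited as a countable
    union of cubes with rational centres and half-sides [1 / (j + 1)]. *)
Lemma open_measurable_rV (A : set 'rV[R]_n) : open A -> measurable A.
Proof.
move=> oA.
pose C (q : 'rV[rat]_n) (j : nat) : set 'rV[R]_n :=
  [set x | forall i, `|x 0 i - ratr (q 0 i)| < j.+1%:R^-1].
have mC q j : measurable (C q j).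
  rewrite (_ : C q j = \bigcap_(i in setT) (rV_coord i @^-1` `]ratr (q 0 i) - j.+1%:R^-1, ratr (q 0 i) + j.+1%:R^-1[%classic)).
    apply: fin_bigcap_measurable => [|i _]; first exact: finite_finset.
    by rewrite -[X in measurable X]setTI; exact: measurable_rV_coord.
  apply/seteqP; split => x hx i; [move=> _|]; have := hx i; first by rewrite /= in_itv/= ltr_distl.
  by move=> /(_ I); rewrite /= in_itv/= ltr_distl.
pose F (w : 'rV[rat]_n * nat) := if pselect (C w.1 w.2 `<=` A) then C w.1 w.2 else set0.
have -> : A = \bigcup_w F w.
  apply/seteqP; split => x; last by move=> [w _]; rewrite /F; case: pselect => // h; exact: h.
  move=> Ax; have := open_nbhs_nbhs (conj oA Ax); rewrite -nbhs_ballE => -[e /= e0 he].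
  have [j] : exists j : nat, j.+1%:R^-1 < e / 2.
    exists (Num.Def.archi_bound (e / 2)^-1).
    have e2 : 0 < e / 2 by rewrite divr_gt0.
    have := archi_boundP (ltW (_ : 0 < (e / 2)^-1)); rewrite invr_gt0 => /(_ e2) h.
    rewrite -[ltRHS]invrK ltf_pV2 ?posrE ?invr_gt0//; apply: (lt_trans h).
    by rewrite ltr_nat.
  move=> hj; have j0 : 0 < j.+1%:R^-1 :> R by rewrite invr_gt0.
  have /boolp.choice[q hq] : forall i : 'I_n, exists q : rat, `|x 0 i - ratr q| < j.+1%:R^-1.
    move=> i; have : x 0 i - j.+1%:R^-1 < x 0 i + j.+1%:R^-1 by rewrite ltrBlDr -addrA ltrDl addr_gt0.
    move=> /rat_in_itvoo[q]; rewrite in_itv/= => /andP[h1 h2]; exists q.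
    by rewrite distrC ltr_distl h1 h2.
  have CA : C (\row_i q i) j `<=` A.
    move=> y hy; apply: he; split => // i0 i; rewrite (ord1 i0) /ball/=.
    have := hy i; rewrite mxE => h; have h' := hq i.
    have := ler_distD (ratr (q i)) (x 0 i) (y 0 i); rewrite [`|ratr (q i) - _|]distrC.
    move=> h3; apply: (le_lt_trans h3); have -> : e = e / 2 + e / 2 by lra.
    by apply: ltrD; [exact: lt_trans hj|exact: lt_trans hj].
  exists (\row_i q i, j) => //; rewrite /F/=; case: pselect => [h|//] i; rewrite mxE; exact: hq.
apply: countable_bigcupT_measurable => [|w]; first exact: countableP.
by rewrite /F; case: pselect => [h|h]; [exact: mC|exact: measurable0].
Qed.

Lemma measurable_cylT (Om : set 'rV[R]_n) (T : R) : open Om -> measurable (cylT Om T : set V).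
Proof. by move=> oO; apply: measurableX; [exact: open_measurable_rV|exact: measurable_itv]. Qed.

Lemma measurable_cylinder (z0 : V) (r s : R) : measurable (cylinder z0 r s).
Proof.
have -> : cylinder z0 r s = ((fun z : V => enorm (z.1 - z0.1)) @^-1` `]-oo, r[%classic) `&`
    (snd @^-1` `]z0.2 - s, z0.2[%classic).
  by apply/seteqP; split => z; rewrite /cylinder/= !in_itv/=.
apply: measurableI; rewrite -[X in measurable X]setTI.
  exact: (measurable_enorm z0.1 measurableT).
by apply: (@measurable_snd _ _ _ _) => //; exact: measurable_itv.
Qed.

Lemma lebesgue_cylinder (z0 : V) (r s : R) : 0 < r -> 0 < s ->
  (0 < mu (cylinder z0 r s))%E /\ (mu (cylinder z0 r s) <= ((2 * r) ^+ n * s)%:E)%E.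
Proof.
move=> r0 s0; have ts : z0.2 - s <= z0.2 by rewrite gerBl ltW.
have inc (e : R) : measurable [set z : V | (forall i, `|z.1 0 i - z0.1 0 i| < e) /\ z0.2 - s < z.2 < z0.2].
  rewrite (_ : mkset _ = (\bigcap_(i in [set: 'I_n]) ((fun z : V => rV_coord i z.1) @^-1` `]z0.1 0 i - e, z0.1 0 i + e[%classic))
     `&` (snd @^-1` `]z0.2 - s, z0.2[%classic)).
    apply: measurableI.
      apply: fin_bigcap_measurable => [|i _]; first exact: finite_finset.
      rewrite -[X in measurable X]setTI; by apply: measurableT_comp => //; exact: measurable_rV_coord.
    by rewrite -[X in measurable X]setTI; apply: (@measurable_snd _ _ _ _) => //; exact: measurable_itv.
  apply/seteqP; split => z /= [h1 h2]; split; rewrite ?in_itv//=.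
    by move=> i _; rewrite /= in_itv/= -ltr_distl; exact: h1.
  by move=> i; have := h1 i I; rewrite /= in_itv/= -ltr_distl.
split; last first.
  have := @st_box R n z0.1 r _ _ (ltW r0) ts; rewrite opprB subrKC => <-.
  apply: le_measure; rewrite ?inE//; first exact: measurable_cylinder.
  move=> z [h1 h2]; split => // i; apply: le_lt_trans h1.
  by have := normr_le_enorm (z.1 - z0.1) i; rewrite !mxE.
(* The cube with this half-side fits in the ball: its points have squared distance at most
   [n * e^2 < r^2] from the centre. *)
pose e := r / n.+1%:R.
have e0 : 0 < e by rewrite divr_gt0.
apply: (@lt_le_trans _ _ ((2 * e) ^+ n * s)%:E).
  by rewrite lte_fin mulr_gt0// exprn_gt0// mulr_gt0.
have := @st_box R n z0.1 e _ _ (ltW e0) ts; rewrite opprB subrKC => <-.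
apply: le_measure; rewrite ?inE//; first exact: measurable_cylinder.
move=> z [h1 h2]; split => //.
have h3 : forall i, `|(z.1 - z0.1) 0 i| <= e by move=> i; rewrite !mxE; exact: ltW (h1 i).
rewrite -ltr_sqr ?nnegrE ?enorm_ge0 ?(ltW r0)//; apply: (le_lt_trans (enorm_sqr_le h3)).
rewrite /e expr_div_n mulrA mulrAC gtr_pMl ?exprn_gt0// ltr_pdivrMr ?exprn_gt0// mul1r.
by rewrite -natrX ltr_nat (leq_trans (ltnSn _))// leq_pmulr.
Qed.

End cylinders.

(** * Measurability of a Caratheodory function along a measurable field *)

Section caratheodory_composition.
Context (R : realType) (k : nat).
Local Notation n := k.+1.
Local Notation V := (spacetime R n).
Local Notation mu := (lebesgue_st R n).

Lemma ae_forall_countable (I : countType) (P : I -> V -> Prop) :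
  (forall i, {ae mu, forall z, P i z}) -> {ae mu, forall z, forall i, P i z}.
Proof.
move=> h; pose P' N z := if @unpickle I N is Some i then P i z else True.
have : {ae mu, forall z, forall N, P' N z}.
  by apply: ae_foralln => N; rewrite /P'; case: (unpickle N) => [i|]; [exact: h|exact: aeW].
by apply: filterS => z hz i; have := hz (pickle i); rewrite /P' pickleK.
Qed.

(** [Dg] is rounded down to a lattice of mesh [1 / (j + 1)], so it takes countably many values. For
    each of them [A] is measurable up to a null set, and countably many null sets are discarded;
    continuity of [A z] passes to the limit. *)
Lemma caratheodory_comp (Om : set 'rV[R]_n) (T : R) (A : V -> 'rV[R]_n -> 'rV[R]_n) (Dg : V -> 'rV[R]_n) :
  measurable (cylT Om T : set V) -> caratheodory Om T A -> measurable_fun setT Dg ->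
  exists B : 'I_n -> V -> R, (forall i, measurable_fun (cylT Om T) (B i)) /\
    {ae mu, forall z, cylT Om T z -> forall i, B i z = A z (Dg z) 0 i}.
Proof.
move=> mO [cA ccA] mD.
have /boolp.choice[G hG] : forall xi, exists g : V -> 'rV[R]_n, measurable_fun (cylT Om T) g /\
    {ae mu, forall z, cylT Om T z -> A z xi = g z} by [].
pose xi (v : 'rV[int]_n) (j : nat) : 'rV[R]_n := \row_i ((v 0 i)%:~R / j.+1%:R).
pose q (j : nat) (z : V) : 'rV[int]_n := \row_i Num.floor (j.+1%:R * Dg z 0 i).
have mDi i : measurable_fun setT (fun z => Dg z 0 i).
  exact: (measurableT_comp (@measurable_rV_coord R n i) mD).
have mq j v : measurable (q j @^-1` [set v]).
  have -> : q j @^-1` [set v] = \bigcap_(i in [set: 'I_n])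
      ((fun z => j.+1%:R * Dg z 0 i) @^-1` `[(v 0 i)%:~R, (v 0 i + 1)%:~R[%classic).
    apply/seteqP; split => z /=.
      move=> <- i _; rewrite /= in_itv/= mxE; exact: floor_itv.
    move=> hz; apply/rowP => i; rewrite mxE; apply/floor_def.
    by have := hz i Logic.I; rewrite /= in_itv.
  apply: fin_bigcap_measurable => [|i _]; first exact: finite_finset.
  rewrite -[X in measurable X]setTI.
  by apply: (@measurable_funM _ _ _ setT (cst j.+1%:R) (fun z => Dg z 0 i)) => //; exact: measurable_itv.
pose B j i z : R := G (xi (q j z) j) z 0 i.
have mB j i : measurable_fun (cylT Om T) (B j i).
  move=> _ Y mY.
  have -> : cylT Om T `&` B j i @^-1` Y = \bigcup_v (q j @^-1` [set v] `&`
      (cylT Om T `&` (fun z => G (xi v j) z 0 i) @^-1` Y)).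
    apply/seteqP; split => z /=; first by move=> [h1 h2]; exists (q j z).
    by move=> [v _ [/= <- [h1 h2]]].
  apply: countable_bigcupT_measurable => [|v]; first exact: countableP.
  apply: measurableI => //.
  exact: (measurableT_comp (@measurable_rV_coord R n i) (proj1 (hG (xi v j))) mO mY).
(* The upper limit is defined and measurable on the whole domain, and equals the limit wherever the
   latter exists. *)
exists (fun i z => fine (limn_esup (fun j => (B j i z)%:E))); split.
  move=> i; apply: (measurableT_comp (f := fine)); first exact: fine_measurable.
  by apply: measurable_fun_limn_esup => j; exact/measurable_EFinP.
have aeG : {ae mu, forall z, forall w : 'rV[int]_n * nat, cylT Om T z -> A z (xi w.1 w.2) = G (xi w.1 w.2) z}.
  by apply: ae_forall_countable => w; exact: (proj2 (hG _)).
apply: filterS2 aeG ccA => z hz cz zO i.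
have cxi : xi (q j z) j @[j --> \oo] --> Dg z.
  apply/cvgrPdist_le => e e0.
  near=> j.
  have j0 : 0 < j.+1%:R :> R by [].
  rewrite /Num.norm/= mx_normrE; apply/bigmax_leP; split; first exact: ltW.
  move=> [i0 i'] _ /=; rewrite (ord1 i0) !mxE.
  have /andP[h1 h2] := floor_itv (j.+1%:R * Dg z 0 i').
  set f := Num.floor _ in h1 h2 *.
  have -> : Dg z 0 i' - f%:~R / j.+1%:R = (j.+1%:R * Dg z 0 i' - f%:~R) / j.+1%:R.
    by rewrite mulrBl mulrAC mulfV ?mul1r// gt_eqF.
  rewrite normrM ger0_norm ?subr_ge0// ger0_norm ?invr_ge0//.
  apply: (@le_trans _ _ (1 / j.+1%:R)).
    by rewrite ler_wpM2r ?invr_ge0// lerBlDl; apply: ltW; rewrite intrD in h2.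
  rewrite mul1r; apply: ltW; near: j; exact: near_infty_natSinv_lt (PosNum e0).
have cB : B j i z @[j --> \oo] --> A z (Dg z) 0 i.
  rewrite (_ : (fun j => B j i z) = (fun j => (A z (xi (q j z) j)) 0 i)); last first.
    by apply/funext => j; rewrite (hz (q j z, j) zO).
  apply: (@continuous_cvg _ _ _ _ _ _ (fun x : 'rV[R]_n => x 0 i)); first exact: coord_continuous.
  by apply: (@continuous_cvg _ _ _ _ _ _ (A z)); first exact: cz.
have cE : (B j i z)%:E @[j --> \oo] --> (A z (Dg z) 0 i)%:E by apply: cvg_EFin => //; exact: nearW.
by rewrite is_cvg_limn_esupE; [rewrite (cvg_lim _ cE)|apply/cvg_ex; eexists; exact: cE].
Unshelve. all: end_near.
Qed.

End caratheodory_composition.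
Lemma integralN_fin_num d (T : measurableType d) (R : realType) (mu : {measure set T -> \bar R})
    (f : T -> \bar R) : (\int[mu]_x f x)%E \is a fin_num ->
  (\int[mu]_x - f x = - \int[mu]_x f x)%E.
Proof.
move=> h; apply: integralN; move: h; rewrite integralE fin_numB => /andP[h1 _].
exact: fin_num_adde_defr.
Qed.

(** * Time slices and mollification of the weak formulation *)

Section slices.
Context (R : realType) (k : nat).
Local Notation n := k.+1.
Local Notation V := (spacetime R n).
Local Notation VN := ('rV[R]_n * R)%type.
Local Notation mu := (lebesgue_st R n).
Local Notation mx := (lebesgue_rV R n).
Local Notation mt := (@lebesgue_measure R).

(** Tonelli for the indicator of a measurable null set that contains the exceptions. *)
Lemma ae_slices (P : V -> Prop) : {ae mu, forall z, P z} ->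
  {ae mt, forall t, {ae mx, forall x, P (x, t)}}.
Proof.
move=> [N [mN N0 hN]].
have mI : measurable_fun setT (fun z : V => (\1_N z : R)%:E) by apply/measurable_EFinP; exact: measurable_indic.
have I0 : forall z : V, (0 <= (\1_N z : R)%:E)%E by move=> z; rewrite lee_fin.
have : (\int[mt]_t \int[mx]_x (\1_N (x, t) : R)%:E = 0)%E.
  rewrite -(ge0_integral_st_sym mI I0) integral_indic// setIT; exact: N0.
have mG := measurable_integral1 mx mI I0.
have G0 t : (0 <= \int[mx]_x (\1_N (x, t) : R)%:E)%E by apply: integral_ge0 => x _; rewrite lee_fin.
move=> h; have : (\int[mt]_t `|\int[mx]_x (\1_N (x, t) : R)%:E| = 0)%E.
  by rewrite -[RHS]h; apply: eq_integral => t _; rewrite gee0_abs.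
move/(ae_eq_integral_abs mt measurableT mG); apply: filterS => t /(_ Logic.I) /= Nt.
have mNt : measurable [set x : 'rV[R]_n | N (x, t)].
  rewrite -[X in measurable X]setTI.
  exact: (measurable_pair2 t measurableT mN).
exists [set x | N (x, t)]; split => //; last by move=> x hx; exact: hN.
by rewrite -[RHS]Nt -[X in mx X]setIT -integral_indic.
Qed.

(** On each slice [W1norm] is a sum of two norms and dominates either; its power [s], integrated in
    time, bounds the space-time integral. [F] is a measurable stand-in for [|f|^s], which makes
    Tonelli applicable. *)
Lemma parabolic_Lp (Om : set 'rV[R]_n) (T s : R) (u : V -> R) (Du : V -> 'rV[R]_n) (f : V -> R) (F : V -> \bar R) :
  0 < s -> parabolic_W1 Om T s u Du -> f = u \/ f = (fun z => enorm (Du z)) ->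
  measurable_fun setT F -> (forall z, 0 <= F z)%E -> (forall z, ~ cylT Om T z -> F z = 0%E) ->
  {ae mu, forall z, cylT Om T z -> F z = (`|f z| `^ s)%:E} -> (\int[mu]_z F z < +oo)%E.
Proof.
move=> s0 [_ [_ [_ [_ bL]]]] hf mF F0 Fout Fae.
rewrite ge0_integral_st_sym//.
pose U t := (fun x => u (x, t), fun x => Du (x, t)).
pose N t := W1norm Om s (U t).
have N0 t : (0 <= N t)%E by apply: adde_ge0; exact: Lnorm_ge0.
have fN t : (Lnorm mx s%:E ((fun x => (f (x, t))%:E) \_ Om) <= N t)%E.
  by case: hf => ->; [apply: leeDl|apply: leeDr]; exact: Lnorm_ge0.
have sn0 : s != 0 by rewrite gt_eqF.
apply: (@le_lt_trans _ _ (\int[mt]_t `|(N \_ (`]0%R, T[ : set R)) t| `^ s)%E); last first.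
  rewrite -poweR_Lnorm//; apply: poweR_lty; exact: bL.
apply: ae_le_integral => [t _|t _|]; [exact: integral_ge0|exact: poweR_ge0|].
have := ae_slices Fae; apply: filterS => t ht _.
rewrite /patch; case: ifPn => [/set_mem tT|/negP tT]; last first.
  rewrite (eq_integral (fun=> 0%E)) ?integral0 ?poweR_ge0// => x _.
  by apply: Fout => -[_ /= h]; apply: tT; exact/mem_set.
rewrite gee0_abs//.
have -> : (\int[mx]_x F (x, t) = \int[mx]_x `|((fun x => (f (x, t))%:E) \_ Om) x| `^ s)%E.
  apply: ae_eq_integral_nm; apply: filterS ht => x hx _.
  rewrite /patch; case: ifPn => [/set_mem Ox|/negP Ox]; first by rewrite hx// poweR_EFin.
  by rewrite Fout ?abse0 ?poweR0r// => -[/= h _]; apply: Ox; exact/mem_set.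
by rewrite -poweR_Lnorm//; apply: le_poweR; [exact: ltW|exact: Lnorm_ge0|exact: fN].
Qed.

Lemma integral_st_slices (f : V -> R) : mu.-integrable setT (EFin \o f) ->
  (\int[mu]_z (f z)%:E = \int[mt]_t \int[mx]_x (f (x, t))%:E)%E.
Proof. by move=> fi; rewrite -(integral21_prod_meas1 fi). Qed.

(** For almost every relevant time the slice of the kernel is a test function on [Om], and the weak
    gradient identity of that slice is integrated over time. [hin] keeps the support of the kernel
    inside the domain. *)
Lemma conv_weak_gradient (Om : set 'rV[R]_n) (T s e : R) (u : V -> R) (Du : V -> 'rV[R]_n)
    (U d : V -> R) (z : VN) i :
  0 < e -> parabolic_W1 Om T s u Du -> mu.-integrable setT (EFin \o U) -> mu.-integrable setT (EFin \o d) ->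
  (forall w : VN, (forall o, `|co o w - co o z| <= e) -> cylT Om T w) ->
  {ae mu, forall w : V, (forall o, `|co o w - co o z| <= e) -> U w = u w /\ d w = Du w 0 i} ->
  conv (moll1 e (Some i)) U z = - conv (moll e) d z.
Proof.
move=> e0 [_ [_ [_ [bW _]]]] iU id hin hae.
have [mm mm1 _] := @measurable_moll R n e (Some i).
have [C hC] := @moll_bdd R n e (Some i).
have i1 := conv_integrable z mm1 (fun w => let: And3 _ h _ := hC w in h) iU.
have i2 := conv_integrable z mm (fun w => let: And3 h _ _ := hC w in h) id.
have small (w : VN) : ~ (forall o, `|co o w - co o z| <= e) ->
    moll e (w - z) = 0 /\ moll1 e (Some i) (w - z) = 0.
  move=> /existsNP -[j /negP]; rewrite -ltNge => h; apply: moll_eq0; exists j.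
  by rewrite coB; exact: ltW.
rewrite /conv /Rintegral (integral_st_slices i1) (integral_st_slices i2).
have fin2 : (\int[mt]_t \int[mx]_x (d (x, t) * moll e ((x, t) - z : VN))%:E)%E \is a fin_num.
  by rewrite -(integral_st_slices i2); exact: integrable_fin_num.
rewrite -fineN -(integralN_fin_num fin2).
congr fine; apply: ae_eq_integral_nm.
apply: filterS2 (ae_slices hae) bW => t ht bt _.
have [tz|tz] := pselect (`|t - z.2| <= e); last first.
  have sm x : moll e ((x, t) - z : VN) = 0 /\ moll1 e (Some i) ((x, t) - z : VN) = 0.
    by apply: small => /(_ None).
  rewrite (eq_integral (fun=> 0%E)) ?integral0; last by move=> x _; rewrite (proj2 (sm x)) mulr0.
  rewrite (eq_integral (fun=> 0%E)) ?integral0 ?oppe0// => x _; by rewrite (proj1 (sm x)) mulr0.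
have hx x : cube z.1 e x -> Om x.
  by move=> xz; have [] : cylT Om T (x, t) by apply: hin => -[j|] //=; exact: xz.
have tT : t \in `]0, T[.
  have [_] : cylT Om T (z.1, t) by apply: hin => -[j|] //=; rewrite subrr normr0 ltW.
  by [].
have [_ [_ wg]] := bt tT.
have := wg _ (@test_fun_moll_slice R n Om e t z e0 (fun x h _ => hx x h)) i.
have cubeo x : Om x \/ ~ cube z.1 e x by have [h|h] := pselect (cube z.1 e x); [left; exact: hx|right].
have sm x : ~ cube z.1 e x -> moll e ((x, t) - z : VN) = 0 /\ moll1 e (Some i) ((x, t) - z : VN) = 0.
  by move=> xz; apply: small => h; apply: xz => j; exact: (h (Some j)).
have toT (g : 'rV[R]_n -> \bar R) (f : 'rV[R]_n -> R) :
    {ae mx, forall x, cube z.1 e x -> g x = (f x)%:E} -> (forall x, ~ cube z.1 e x -> g x = 0%E /\ f x = 0) ->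
    (\int[mx]_(x in Om) g x = \int[mx]_x (f x)%:E)%E.
  move=> gf out; rewrite integral_mkcond; apply: ae_eq_integral_nm; apply: filterS gf => x gfx _.
  rewrite /patch; have [cx|cx] := pselect (cube z.1 e x); first by rewrite mem_set ?gfx//; exact: hx.
  by have [-> ->] := out x cx; case: ifP.
have hx' : {ae mx, forall x, cube z.1 e x -> U (x, t) = u (x, t) /\ d (x, t) = Du (x, t) 0 i}.
  by apply: filterS ht => x h xz; apply: h => -[j|] //=; exact: xz.
rewrite (toT _ (fun x => U (x, t) * moll1 e (Some i) ((x, t) - z))); last 2 first.
- by apply: filterS hx' => x h /h [-> _]; rewrite derive_moll_slice.
- by move=> x /sm[h1 h2]; rewrite derive_moll_slice h2 !mulr0.
rewrite (toT _ (fun x => d (x, t) * moll e ((x, t) - z)))//; last 2 first.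
- by apply: filterS hx' => x h /h [_ ->].
- by move=> x /sm[h1 h2]; rewrite h1 !mulr0.
Qed.

(** The kernel [w |-> moll e (w - z)] is nonnegative and, by [hin], a test function on the domain;
    the claim is the weak inequality for it, sorted into convolutions. *)
Lemma conv_weak_subsolution (Om : set 'rV[R]_n) (T e : R) (u : V -> R) (Du : V -> 'rV[R]_n)
    (A : V -> 'rV[R]_n -> 'rV[R]_n) (U : V -> R) (B : 'I_n -> V -> R) (z : VN) :
  0 < e -> (forall phi : VN -> R, test_fun (cylT Om T) phi -> (forall z, 0 <= phi z) ->
      (\int[mu]_(z in cylT Om T) (- (u z * dt phi z) + dotp (A z (Du z)) (dx phi z))%:E <= 0)%E) ->
  mu.-integrable setT (EFin \o U) -> (forall i, mu.-integrable setT (EFin \o B i)) ->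
  (forall w : VN, (forall o, `|co o w - co o z| <= e) -> cylT Om T w) ->
  {ae mu, forall w : V, (forall o, `|co o w - co o z| <= e) -> U w = u w /\ forall i, B i w = A w (Du w) 0 i} ->
  \sum_i conv (moll1 e (Some i)) (B i) z <= conv (moll1 e None) U z.
Proof.
move=> e0 weak iU iB hin hae.
have icv o f : mu.-integrable setT (EFin \o f) ->
    mu.-integrable setT (EFin \o (fun w => f w * moll1 e o (w - z))).
  move=> fi; have [_ mm1 _] := @measurable_moll R n e o; have [C hC] := @moll_bdd R n e o.
  exact: (conv_integrable z mm1 (fun w => let: And3 _ h _ := hC w in h) fi).
have small (w : VN) o : ~ (forall o, `|co o w - co o z| <= e) -> moll1 e o (w - z) = 0.
  move=> /existsNP -[j /negP]; rewrite -ltNge => h; apply: (proj2 (moll_eq0 o _)); exists j.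
  by rewrite coB; exact: ltW.
have := weak _ (@test_fun_moll R n (cylT Om T) e z hin) (fun w => moll_ge0 (w - z) e0).
pose F0 (w : V) := U w * moll1 e None (w - z).
pose Fi i (w : V) := B i w * moll1 e (Some i) (w - z).
have i0 : mu.-integrable setT (EFin \o F0) by exact: icv.
have ii i : mu.-integrable setT (EFin \o Fi i) by exact: icv.
have dtE (w : VN) : dt (fun w : VN => moll e (w - z)) w = moll1 e None (w - z) by exact: (derive_moll_sub e z w None).
have dxE (w : VN) : dx (fun w : VN => moll e (w - z)) w = \row_i moll1 e (Some i) (w - z).
  by apply/rowP => i; rewrite !mxE; exact: (derive_moll_sub e z w (Some i)).
have -> : (\int[mu]_(w in cylT Om T) (- (u w * dt (fun w : VN => moll e (w - z)) w) +
    dotp (A w (Du w)) (dx (fun w : VN => moll e (w - z)) w))%:E =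
    \int[mu]_w ((\sum_i (EFin \o Fi i) w) - (EFin \o F0) w))%E.
  rewrite integral_mkcond; apply: ae_eq_integral_nm; apply: filterS hae => w hw _.
  rewrite /patch dtE dxE /dotp /=.
  have [cw|cw] := pselect (forall o, `|co o w - co o z| <= e).
    rewrite mem_set; last exact: hin.
    have [h1 h2] := hw cw; rewrite sumEFin -EFinB /F0 h1 addrC; congr (_%:E); congr (_ + _).
    by apply: eq_bigr => i _; rewrite /Fi h2 mxE.
  rewrite sumEFin -EFinB /F0 (small w None cw) !mulr0 oppr0 add0r addr0.
  rewrite [X in _ = X%:E]big1; last by move=> i _; rewrite /Fi small// mulr0.
  case: ifP => // _; congr (_%:E); apply: big1 => i _; by rewrite mxE small// mulr0.
have isum : mu.-integrable setT (fun w => \sum_i (EFin \o Fi i) w)%E by exact: integrable_sum.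
rewrite integralB// integral_sum//.
have fE f : mu.-integrable setT (EFin \o f) -> (\int[mu]_w (EFin \o f) w = (\int[mu]_w f w)%R%:E)%E.
  by move=> fi; rewrite /Rintegral fineK//; exact: integrable_fin_num.
rewrite fE// (eq_bigr (fun i => (\int[mu]_w Fi i w)%R%:E)); last by move=> i _; exact: fE.
by rewrite sumEFin -EFinB lee_fin subr_le0.
Qed.

End slices.
(** * Structure conditions *)

Section structure_conditions.
Context (R : realType).

(** As [p >= 2], dropping [mu0] only decreases the weight. *)
Lemma coercivity_power (x a mu0 p P : R) : 0 <= x -> 2 <= p -> 0 < a ->
  a * (mu0 ^+ 2 + x ^+ 2) `^ ((p - 2) / 2) * x ^+ 2 <= P -> x `^ p <= a^-1 * P.
Proof.
move=> x0 p2 a0 h; rewrite -ler_pdivrMl ?invr_gt0// invrK.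
apply: le_trans h; rewrite -mulrA ler_wpM2l ?(ltW a0)//.
have [->|xn] := eqVneq x 0; first by rewrite powR0 ?mulr_ge0 ?powR_ge0 ?sqr_ge0// gt_eqF//; lra.
have xp : 0 < x by rewrite lt_neqAle eq_sym xn.
have -> : x `^ p = x `^ (p - 2) * x ^+ 2.
  by rewrite -powR_mulrn// -powRD ?subrK// xn implybT.
rewrite ler_wpM2r ?sqr_ge0//.
have -> : x `^ (p - 2) = (x ^+ 2) `^ ((p - 2) / 2).
  by rewrite -powR_mulrn// -powRrM mulrC divfK.
by apply: ge0_ler_powR; rewrite ?nnegrE ?addr_ge0 ?sqr_ge0 ?divr_ge0//; [lra|rewrite lerDr sqr_ge0].
Qed.

(** Both [mu0] and [x] are at most the maximum of 1 and [x]; the factor 2 is the origin of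
    [growth_c]. *)
Lemma growth_power (x mu0 q : R) : 0 <= x -> 0 <= mu0 <= 1 -> 1 <= q ->
  (mu0 ^+ 2 + x ^+ 2) `^ ((q - 1) / 2) <= 2 `^ ((q - 1) / 2) * Num.max 1 x `^ (q - 1).
Proof.
move=> x0 /andP[m0 m1] q1.
have M0 : 0 <= Num.max 1 x by rewrite le_max ler01.
have -> : Num.max 1 x `^ (q - 1) = (Num.max 1 x ^+ 2) `^ ((q - 1) / 2).
  by rewrite -powR_mulrn// -powRrM mulrC divfK.
rewrite -powRM ?sqr_ge0//; apply: ge0_ler_powR; rewrite ?nnegrE ?addr_ge0 ?mulr_ge0 ?sqr_ge0 ?invr_ge0//; first lra.
have h1 : mu0 ^+ 2 <= Num.max 1 x ^+ 2.
  by rewrite ler_sqr ?nnegrE// le_max m1.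
have h2 : x ^+ 2 <= Num.max 1 x ^+ 2 by rewrite ler_sqr ?nnegrE// le_max lexx orbT.
lra.
Qed.

Lemma max1_power_le (x t : R) : 0 <= x -> 0 <= t -> Num.max 1 x `^ t <= 1 + x `^ t.
Proof.
move=> x0 t0; have [h|h] := leP 1 x; first by rewrite lerDr.
by rewrite powR1 lerDl powR_ge0.
Qed.

(* [(b w^(q-1))^s' <= b^be + w^s], by weighted AM-GM with weights [s'/be] and [(q-1)s'/s]. *)
Lemma dual_power (b w q be s s' : R) : 0 <= b -> 0 <= w -> 1 < q -> 0 < be -> 0 < s -> 0 < s' ->
  be^-1 + (q - 1) / s = s'^-1 -> (b * w `^ (q - 1)) `^ s' <= b `^ be + w `^ s.
Proof.
move=> b0 w0 q1 be0 s0 s'0 h.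
have h1 : s' * (be^-1 + (q - 1) / s) = 1 by rewrite h mulfV// gt_eqF.
have t1 : 0 < s' / be by exact: divr_gt0.
have t2 : 0 < s' * ((q - 1) / s) by apply: mulr_gt0 => //; apply: divr_gt0 => //; lra.
have t01 : 0 < s' / be < 1 by rewrite t1/=; lra.
have -> : (b * w `^ (q - 1)) `^ s' = (b `^ be) `^ (s' / be) * (w `^ s) `^ (1 - s' / be).
  rewrite (powRM _ b0 (powR_ge0 _ _)) -[(b `^ be) `^ _]powRrM -[(w `^ s) `^ _]powRrM -[(w `^ (q - 1)) `^ _]powRrM.
  congr (_ `^ _ * _ `^ _).
    by rewrite mulrC divfK// gt_eqF.
  have -> : 1 - s' / be = s' * ((q - 1) / s) by lra.
  by rewrite mulrCA [s * _]mulrC divfK ?gt_eqF// mulrC.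
have := young_eps t01 ltr01 (powR_ge0 b be) (powR_ge0 (w `^ s) (1 - s' / be)).
have n1 : 1 - s' / be != 0 by rewrite gt_eqF//; case/andP: t01; lra.
by rewrite powR1 !mul1r -[((w `^ s) `^ _) `^ _]powRrM mulfV// powRr1 ?powR_ge0.
Qed.

End structure_conditions.

Section representatives.
Context d (X : measurableType d) (R : realType) (mu : {measure set X -> \bar R}).

Lemma in_Lp_rep (D : set X) (r : R) (f : X -> \bar R) : measurable D -> 0 < r -> in_Lp mu D r%:E f ->
  [/\ exists g : X -> \bar R, measurable_fun D g /\ {ae mu, forall x, D x -> f x = g x},
     (\int[mu]_(x in D) `|f x| `^ r < +oo)%E & {ae mu, forall x, D x -> f x \is a fin_num}].
Proof.
move=> mD r0 [[g [mg fg]] fL].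
have rn : r != 0 by rewrite gt_eqF.
have If : (\int[mu]_(x in D) `|f x| `^ r < +oo)%E.
  have -> : (\int[mu]_(x in D) `|f x| `^ r = \int[mu]_x `|(f \_ D) x| `^ r)%E.
    rewrite integral_mkcond; apply: eq_integral => x _; rewrite /patch; case: ifP => // _.
    by rewrite abse0 poweR0r.
  by rewrite -poweR_Lnorm//; exact: poweR_lty.
split => //; first by exists g.
have ig : mu.-integrable D (fun x => `|g x| `^ r)%E.
  apply/integrableP; split.
    by apply: (measurableT_comp (measurable_poweR r)); exact: measurableT_comp.
  rewrite (_ : (\int[mu]_(x in D) abse (poweR (abse (g x)) r))%E = (\int[mu]_(x in D) `|f x| `^ r)%E)//.
  apply: ae_eq_integral_nm; apply: filterS fg => x fgx Dx.
  by rewrite fgx// gee0_abs// poweR_ge0.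
apply: filterS2 fg (integrable_ae mD ig) => x fgx igx Dx.
by move: (igx Dx); rewrite fgx//; case: (g x) => [s| |]//=; rewrite (negbTE rn).
Qed.

End representatives.

Lemma mean_bound (R : realType) (n : nat) (Q : set (spacetime R n)) (Qv : R) (I : \bar R) (f : spacetime R n -> \bar R) :
  0 < Qv -> lebesgue_st R n Q = Qv%:E -> (forall z, Q z -> 0 <= f z)%E ->
  (\int[lebesgue_st R n]_(z in Q) f z < +oo)%E -> (I <= \int[lebesgue_st R n]_(z in Q) f z)%E ->
  (I <= ((1 + `|fine (mean Q f)|) * Qv)%:E)%E.
Proof.
move=> Q0 QE f0 ff; have I0 : (0 <= \int[lebesgue_st R n]_(z in Q) f z)%E by exact: integral_ge0.
have If : (\int[lebesgue_st R n]_(z in Q) f z)%E \is a fin_num by rewrite ge0_fin_numE.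
move=> /le_trans; apply; rewrite /mean QE -(fineK If) inver (gt_eqF Q0) -EFinM lee_fin/=.
have i0 : 0 <= fine (\int[lebesgue_st R n]_(z in Q) f z)%E by exact: fine_ge0.
by rewrite ger0_norm ?divr_ge0 ?(ltW Q0)// mulrDl divfK ?gt_eqF// mul1r lerDr ltW.
Qed.

(** * Everywhere defined data on the cylinder *)

Section data.
Context (R : realType) (k : nat) (p q al be : R).
Local Notation n := k.+1.
Local Notation nn := (k.+1%:R : R).
Local Notation V := (spacetime R n).
Local Notation mu := (lebesgue_st R n).
Local Notation s := (exps q be).
Local Notation s' := (1 - s^-1)^-1.
Hypotheses (p2 : 2 <= p) (al1 : 1 < al) (be1 : 1 < be)
  (pq : p <= q < p * (al / (al + 1)) * ((be - 1) / be) + 2 / (nn + 2)).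

Definition growth_c : R := 2 `^ ((q - 1) / 2).
(** The added 1 makes the constant at least 1, and [fine] with the absolute value makes it a total
    function of an extended mean. In [mean_b] the factor accounts for [growth_c]. *)
Definition mean_a (t : \bar R) : R := 1 + `|fine t|.
Definition mean_b (t : \bar R) : R := 1 + growth_c `^ be * (1 + `|fine t|).

(** All functions are restricted to [Q] minus one null set and extended by 0. The structure
    conditions then hold at every point of space-time, without [mu0] and in terms of [<A, Du>],
    which is the form the iteration uses. *)
Lemma structure_data (Om : set 'rV[R]_n) (T mu0 : R) (a b : V -> R) (A : V -> 'rV[R]_n -> 'rV[R]_n)
    (u : V -> R) (Du : V -> 'rV[R]_n) (Q : set V) (Qv : R) :
  open Om -> 0 <= mu0 <= 1 -> (forall z, cylT Om T z -> 0 <= a z /\ 0 <= b z) ->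
  in_Lp mu (cylT Om T) al%:E (fun z => (a z)%:E^-1%E) ->
  in_Lp mu (cylT Om T) be%:E (fun z => (b z)%:E) -> caratheodory Om T A ->
  {ae mu, forall z, cylT Om T z -> forall xi,
     enorm (A z xi) <= b z * (mu0 ^+ 2 + enorm xi ^+ 2) `^ ((q - 1) / 2) /\
     a z * (mu0 ^+ 2 + enorm xi ^+ 2) `^ ((p - 2) / 2) * enorm xi ^+ 2 <= dotp (A z xi) xi} ->
  parabolic_W1 Om T s u Du -> measurable Q -> Q `<=` cylT Om T -> 0 < Qv -> mu Q = Qv%:E ->
  exists (U : V -> R) (D B : 'I_n -> V -> R) (ai bb : V -> R),
  [/\ [/\ mu.-integrable setT (EFin \o U), forall i, mu.-integrable setT (EFin \o D i) &
        forall i, mu.-integrable setT (EFin \o B i)],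
      [/\ mu.-integrable setT (EFin \o (fun z => `|U z| `^ s)),
        forall i, mu.-integrable setT (EFin \o (fun z => `|D i z| `^ s)) &
        forall i, mu.-integrable setT (EFin \o (fun z => `|B i z| `^ s'))],
      [/\ forall z, 0 <= \sum_i B i z * D i z, measurable_fun setT ai, measurable_fun setT bb,
        forall z, 0 <= ai z & forall z, 0 <= bb z],
      [/\ forall i z, `|B i z| <= bb z * (1 + (ai z * \sum_i B i z * D i z) `^ expth p q),
        forall i z, `|D i z| `^ p <= ai z * \sum_i B i z * D i z,
        (\int[mu]_z (ai z `^ al)%:E <= (mean_a (mean Q (fun z => poweR (a z)%:E^-1 al)) * Qv)%:E)%E &
        (\int[mu]_z (bb z `^ be)%:E <= (mean_b (mean Q (fun z => (b z `^ be)%:E)) * Qv)%:E)%E] &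
      {ae mu, forall z, Q z -> U z = u z /\ forall i, D i z = Du z 0 i /\ B i z = A z (Du z) 0 i}].
Proof.
move=> oO mu01 ab0 ia ib cA struct pW mQ QO Q0 QE.
have mO : measurable (cylT Om T : set V) by exact: measurable_cylT.
have al0 : 0 < al by exact: lt_trans al1.
have be0 : 0 < be by exact: lt_trans be1.
have sge := exps_ge p2 be1 pq; have /andP[plq _] := pq.
have q1 : 1 < q by apply: lt_le_trans plq; apply: lt_le_trans p2; rewrite ltr1n.
have s1 : 1 < s by exact: lt_le_trans sge.
have s0 : 0 < s by exact: lt_trans s1.
have [s'0 ss' bes] := conj_exps p2 be1 pq.
have s'1 : 1 <= s' by rewrite invf_ge1 ?subr_gt0 ?invf_lt1// gerBl invr_ge0 ltW.
have [[ga [mga aga]] IA afin] := in_Lp_rep mO al0 ia.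
have [[gb [mgb agb]] IB _] := in_Lp_rep mO be0 ib.
have [[gu [mgu agu]] [[gD [mgD agD]] _]] := pW.
have mDg : measurable_fun setT (fun z => if z \in cylT Om T then gD z else 0).
  apply: measurable_fun_rVP => i.
  rewrite (_ : _ \o _ = (fun z => gD z 0 i) \_ (cylT Om T)); last first.
    by apply/funext => z; rewrite /= /patch /rV_coord; case: ifP; rewrite ?mxE.
  by apply/(measurable_restrictT _ mO); exact: (measurableT_comp (@measurable_rV_coord R n i) mgD).
have [Bc [mBc aBc]] := caratheodory_comp mO cA mDg.
pose good z := [/\ gu z = u z, gD z = Du z, forall i, Bc i z = A z (Du z) 0 i,
  [/\ ga z = (a z)%:E^-1%E, gb z = (b z)%:E & ga z \is a fin_num] &
  enorm (A z (Du z)) <= b z * (mu0 ^+ 2 + enorm (Du z) ^+ 2) `^ ((q - 1) / 2) /\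
  a z * (mu0 ^+ 2 + enorm (Du z) ^+ 2) `^ ((p - 2) / 2) * enorm (Du z) ^+ 2 <= dotp (A z (Du z)) (Du z)].
have [N [mN N0 hN]] : {ae mu, forall z, cylT Om T z -> good z}.
  apply: filterS2 (filterI aga (filterI agb afin)) (filterI agu (filterI agD (filterI aBc struct))).
  move=> z [h1 [h2 h3]] [h4 [h5 [h6 h7]]] zO.
  split; [by rewrite -h4|by rewrite -h5| |split; [by rewrite -h1|by rewrite -h2|by rewrite -h1//; exact: h3]|exact: h7].
  by move=> i; rewrite h6// mem_set// h5.
pose G := Q `\` N.
have mG : measurable G by exact: measurableD.
have GO : G `<=` cylT Om T by move=> z [/QO].
have Gg z : G z -> good z.
  by move=> [Qz Nz]; apply: contrapT => h; apply: Nz; apply: hN => /(_ (QO _ Qz)).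
have rest (f : V -> R) : measurable_fun (cylT Om T) f -> measurable_fun setT (f \_ G).
  by move=> mf; apply/(measurable_restrictT _ mG); exact: measurable_funS mf.
have restin (f : V -> R) z : G z -> (f \_ G) z = f z by move=> h; rewrite /patch mem_set.
have restout (f : V -> R) z : ~ G z -> (f \_ G) z = 0 by move=> h; rewrite /patch memNset.
pose U := gu \_ G; pose D (i : 'I_n) := (fun z => gD z 0 i) \_ G; pose B i := Bc i \_ G.
pose ai := (fun z => fine (ga z)) \_ G; pose bb := (fun z => growth_c * fine (gb z)) \_ G.
have mU : measurable_fun setT U by exact: rest.
have mD i : measurable_fun setT (D i).
  by apply: rest; exact: (measurableT_comp (@measurable_rV_coord R n i) mgD).
have mB i : measurable_fun setT (B i) by exact: rest.
have mfine (g : V -> \bar R) : measurable_fun (cylT Om T) g -> measurable_fun (cylT Om T) (fun z => fine (g z)).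
  by move=> mg; apply: (measurableT_comp (f := fine)) => //; exact: fine_measurable.
have mai : measurable_fun setT ai by apply: rest; exact: mfine.
have mbb : measurable_fun setT bb by apply: rest; apply: measurable_funM => //; exact: mfine.
have gc0 : 0 <= growth_c by exact: powR_ge0.
(* Integrability of [a^-alpha] excludes [a = 0] almost everywhere, since the extended inverse of 0
   is infinite. *)
have aG z : G z -> 0 < a z /\ ai z = (a z)^-1.
  move=> Gz; have [_ _ _ [h1 _ h3] _] := Gg z Gz; have [az _] := ab0 z (GO _ Gz).
  rewrite /ai restin// h1 inver; move: h3; rewrite h1 inver; case: eqVneq => // an _.
  by split => //; rewrite lt_neqAle eq_sym an.
have bG z : G z -> 0 <= b z /\ bb z = growth_c * b z.
  move=> Gz; have [_ _ _ [_ h2 _] _] := Gg z Gz; have [_ bz] := ab0 z (GO _ Gz).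
  by rewrite /bb restin// h2.
have ai0 z : 0 <= ai z.
  by have [/aG[h ->]|/restout h] := pselect (G z); [rewrite invr_ge0 ltW|rewrite /ai h].
have bb0 z : 0 <= bb z.
  by have [/bG[h ->]|/restout h] := pselect (G z); [rewrite mulr_ge0|rewrite /bb h].
have Pin z : G z -> \sum_i B i z * D i z = dotp (A z (Du z)) (Du z).
  move=> Gz; have [_ h2 h3 _ _] := Gg z Gz; apply: eq_bigr => i _.
  by rewrite /B /D !restin// h3 h2.
have Pout z : ~ G z -> \sum_i B i z * D i z = 0.
  by move=> Gz; apply: big1 => i _; rewrite /B restout// mul0r.
have Din i z : G z -> `|D i z| <= enorm (Du z).
  by move=> Gz; have [_ h2 _ _ _] := Gg z Gz; rewrite /D restin// h2 normr_le_enorm.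
have p0 : 0 < p by exact: lt_le_trans p2.
have co_ z : G z -> enorm (Du z) `^ p <= ai z * \sum_i B i z * D i z.
  move=> Gz; have [_ _ _ _ [_ h]] := Gg z Gz; have [az ->] := aG z Gz.
  by rewrite Pin//; exact: (coercivity_power (enorm_ge0 _) p2 az h).
have coerc i z : `|D i z| `^ p <= ai z * \sum_i B i z * D i z.
  have [Gz|Gz] := pselect (G z); last by rewrite Pout// mulr0 /D restout// normr0 powR0// gt_eqF.
  apply: le_trans (co_ z Gz); apply: ge0_ler_powR; rewrite ?nnegrE ?enorm_ge0 ?(ltW p0)//; exact: Din.
have AD0 z : 0 <= \sum_i B i z * D i z.
  have [Gz|Gz] := pselect (G z); last by rewrite Pout.
  have [az aiE] := aG z Gz; have := le_trans (powR_ge0 _ _) (co_ z Gz).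
  by rewrite aiE pmulr_rge0// invr_gt0.
have Bin i z : G z -> `|B i z| <= bb z * Num.max 1 (enorm (Du z)) `^ (q - 1).
  move=> Gz; have [_ _ h3 _ [h _]] := Gg z Gz; have [bz ->] := bG z Gz.
  rewrite /B restin// h3; apply: (le_trans (normr_le_enorm _ _)); apply: (le_trans h).
  rewrite [growth_c * _]mulrC -mulrA ler_wpM2l//; exact: growth_power (enorm_ge0 _) mu01 (ltW q1).
(* Coercivity replaces [|Du|] by [<A, Du>] in the growth bound, so that the flux can be absorbed by
   the energy. *)
have grow i z : `|B i z| <= bb z * (1 + (ai z * \sum_i B i z * D i z) `^ expth p q).
  have [Gz|Gz] := pselect (G z); last first.
    by rewrite /B restout// normr0 mulr_ge0// addr_ge0// powR_ge0.
  apply: (le_trans (Bin i z Gz)); rewrite ler_wpM2l//.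
  have q10 : 0 <= q - 1 by rewrite subr_ge0 ltW.
  apply: (le_trans (max1_power_le (enorm_ge0 _) q10)); rewrite lerD2l.
  have -> : enorm (Du z) `^ (q - 1) = (enorm (Du z) `^ p) `^ expth p q.
    by rewrite -powRrM /expth mulrC divfK// gt_eqF.
  apply: ge0_ler_powR; rewrite ?nnegrE ?powR_ge0//; [exact: divr_ge0 (ltW p0)|exact: mulr_ge0|exact: co_].
have mpow (f : V -> R) t : measurable_fun setT f -> measurable_fun setT (EFin \o (fun z => f z `^ t)).
  by move=> mf; apply/measurable_EFinP; exact: (measurableT_comp (measurable_powR t) mf).
have mnormr (f : V -> R) : measurable_fun setT f -> measurable_fun setT (fun z => `|f z|).
  by move=> mf; exact: measurableT_comp.
have intg (f g : V -> R) : measurable_fun setT (EFin \o f) -> mu.-integrable setT (EFin \o g) ->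
    (forall z, 0 <= f z <= g z) -> mu.-integrable setT (EFin \o f).
  move=> mf ig fg; apply: (le_integrable measurableT mf _ ig) => z _.
  have /andP[h1 h2] := fg z; rewrite /= lee_fin !ger0_norm//; exact: le_trans h2.
have intge (f : V -> R) : measurable_fun setT (EFin \o f) -> (forall z, 0 <= f z) ->
    (\int[mu]_z (f z)%:E < +oo)%E -> mu.-integrable setT (EFin \o f).
  move=> mf f0 fi; apply/integrableP; split => //; under eq_integral do rewrite /= ger0_norm//.
  exact: fi.
(* The Bochner norm is taken over all of [cylT Om T], so integrability is established there; the
   functions restricted to [G] are dominated by these two. *)
pose hu : V -> R := gu \_ (cylT Om T); pose hd : V -> R := (fun z => enorm (gD z)) \_ (cylT Om T).
have mhu : measurable_fun setT hu by apply/(measurable_restrictT _ mO).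
have mhd : measurable_fun setT hd.
  apply/(measurable_restrictT _ mO); apply: (measurableT_comp (continuous_measurable_fun (@sqrt_continuous R))).
  apply: measurable_sum => i; apply: measurable_funX.
  exact: (measurableT_comp (@measurable_rV_coord R n i) mgD).
have hd0 z : 0 <= hd z by rewrite /hd /patch; case: ifP => // _; exact: enorm_ge0.
have sn0 : s != 0 by rewrite gt_eqF.
have ihu : mu.-integrable setT (EFin \o (fun z => `|hu z| `^ s)).
  apply: intge; [by apply: mpow; exact: mnormr|by move=> z; exact: powR_ge0|].
  apply: (parabolic_Lp s0 pW (or_introl erefl)) => [|z|z zO|].
  - by apply: mpow; exact: mnormr.
  - by rewrite lee_fin powR_ge0.
  - by rewrite /hu /patch memNset// normr0 powR0.
  - by apply: filterS agu => z h zO; rewrite /hu /patch mem_set// h.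
have ihd : mu.-integrable setT (EFin \o (fun z => hd z `^ s)).
  apply: intge; [exact: mpow|by move=> z; exact: powR_ge0|].
  apply: (parabolic_Lp s0 pW (or_intror erefl)) => [|z|z zO|].
  - exact: mpow.
  - by rewrite lee_fin powR_ge0.
  - by rewrite /hd /patch memNset// powR0.
  - by apply: filterS agD => z h zO; rewrite /hd /patch mem_set// h// ger0_norm// enorm_ge0.
have Uhu z : `|U z| <= `|hu z|.
  have [Gz|Gz] := pselect (G z); last by rewrite /U restout// normr0.
  by rewrite /U restin// /hu /patch mem_set//; exact: GO.
have Dhd i z : `|D i z| <= hd z.
  have [Gz|Gz] := pselect (G z); last by rewrite /D restout// normr0.
  by rewrite /D restin// /hd /patch mem_set//; [exact: normr_le_enorm|exact: GO].
have pwle (x y t : R) : 0 <= t -> 0 <= x -> x <= y -> 0 <= x `^ t <= y `^ t.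
  move=> t0 x0 xy; rewrite powR_ge0/=; apply: ge0_ler_powR; rewrite ?nnegrE//; exact: le_trans xy.
have iUs : mu.-integrable setT (EFin \o (fun z => `|U z| `^ s)).
  by apply: (intg _ _ _ ihu) => [|z]; [apply: mpow; exact: mnormr|exact: pwle (ltW s0) (normr_ge0 _) (Uhu z)].
have iDs i : mu.-integrable setT (EFin \o (fun z => `|D i z| `^ s)).
  by apply: (intg _ _ _ ihd) => [|z]; [apply: mpow; exact: mnormr|exact: pwle (ltW s0) (normr_ge0 _) (Dhd i z)].
have QO_int (f : V -> \bar R) : (forall z, Q z -> 0 <= f z)%E ->
    (\int[mu]_(z in cylT Om T) `|f z| < +oo)%E -> (\int[mu]_(z in Q) f z < +oo)%E.
  move=> f0; apply: le_lt_trans; rewrite integral_mkcond [leRHS]integral_mkcond.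
  apply: integral_le_ge0 => z; rewrite /patch; first by case: ifP.
  case: ifPn => [/set_mem Qz|_]; last by case: ifP => [_|//]; exact: abse_ge0.
  by rewrite mem_set; [rewrite gee0_abs//; exact: f0|exact: QO].
have G_int (f : V -> R) (g : V -> \bar R) : (forall z, Q z -> 0 <= g z)%E -> (forall z, ~ G z -> f z = 0) ->
    (forall z, G z -> ((f z)%:E <= g z)%E) -> (\int[mu]_z (f z)%:E <= \int[mu]_(z in Q) g z)%E.
  move=> g0 fout fg; rewrite [leRHS]integral_mkcond; apply: integral_le_ge0 => z; rewrite /patch.
    by case: ifPn => [/set_mem|_] //; exact: g0.
  have [Gz|Gz] := pselect (G z); first by rewrite mem_set; [exact: fg|case: Gz].
  by rewrite fout//; case: ifPn => [/set_mem|_] //; exact: g0.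
have ainv0 z : cylT Om T z -> (0 <= (a z)%:E^-1)%E.
  by move=> /ab0[h _]; rewrite inver; case: eqVneq => // _; rewrite lee_fin invr_ge0.
have aiL : (\int[mu]_z (ai z `^ al)%:E <= (mean_a (mean Q (fun z => poweR (a z)%:E^-1 al)) * Qv)%:E)%E.
  apply: (@mean_bound R n Q Qv _ (fun z => poweR (a z)%:E^-1 al) Q0 QE) => [z _| |]; first exact: poweR_ge0.
    apply: QO_int => [z _|]; first exact: poweR_ge0.
    rewrite (_ : (\int[mu]_(z in cylT Om T) _)%E = (\int[mu]_(z in cylT Om T) `|(a z)%:E^-1| `^ al)%E)//.
    by apply: eq_integral => z /set_mem zO; rewrite gee0_abs ?poweR_ge0// gee0_abs//; exact: ainv0.
  apply: G_int => [z _|z Gz|z Gz]; first exact: poweR_ge0.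
    by rewrite /ai restout// powR0// gt_eqF.
  by have [az ->] := aG z Gz; rewrite inver gt_eqF// poweR_EFin.
pose F2 := (fun z => fine (gb z)) \_ G.
have F2in z : G z -> F2 z = b z.
  by move=> Gz; have [_ _ _ [_ h2 _] _] := Gg z Gz; rewrite /F2 restin// h2.
have F20 z : 0 <= F2 z.
  have [Gz|Gz] := pselect (G z); last by rewrite /F2 restout.
  by rewrite F2in//; case: (bG z Gz).
have mF2 : measurable_fun setT F2 by apply: rest; exact: mfine.
have F2L : (\int[mu]_z (F2 z `^ be)%:E <= ((1 + `|fine (mean Q (fun z => (b z `^ be)%:E))|) * Qv)%:E)%E.
  apply: (@mean_bound R n Q Qv _ (fun z => (b z `^ be)%:E) Q0 QE) => [z _| |]; first by rewrite lee_fin powR_ge0.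
    apply: QO_int => [z _|]; first by rewrite lee_fin powR_ge0.
    rewrite (_ : (\int[mu]_(z in cylT Om T) _)%E = (\int[mu]_(z in cylT Om T) `|(b z)%:E| `^ be)%E)//.
    apply: eq_integral => z /set_mem /ab0[_ bz].
    by rewrite gee0_abs ?lee_fin ?powR_ge0// gee0_abs ?lee_fin// poweR_EFin.
  apply: G_int => [z _|z Gz|z Gz]; first by rewrite lee_fin powR_ge0.
    by rewrite /F2 restout// powR0// gt_eqF.
  by rewrite F2in.
have bbE z : bb z = growth_c * F2 z.
  have [Gz|Gz] := pselect (G z); last by rewrite /bb /F2 !restout// mulr0.
  by rewrite F2in//; case: (bG z Gz).
have bL : (\int[mu]_z (bb z `^ be)%:E <= (mean_b (mean Q (fun z => (b z `^ be)%:E)) * Qv)%:E)%E.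
  under eq_integral do rewrite bbE powRM// EFinM.
  rewrite ge0_integralZl//; first last.
  - by rewrite lee_fin powR_ge0.
  - by move=> z _; rewrite lee_fin powR_ge0.
  - exact: mpow.
  apply: (le_trans (lee_wpmul2l _ F2L)); first by rewrite lee_fin powR_ge0.
  rewrite -EFinM lee_fin /mean_b mulrA; apply: ler_wpM2r; first exact: ltW.
  by rewrite lerDr.
have ibb : mu.-integrable setT (EFin \o (fun z => bb z `^ be)).
  apply: intge; [exact: mpow|by move=> z; exact: powR_ge0|exact: le_lt_trans bL (ltry _)].
have iG : mu.-integrable setT (EFin \o (\1_G : V -> R)).
  apply: intge; [by apply/measurable_EFinP; exact: measurable_indic|by move=> z|].
  rewrite integral_indic// setIT (@le_lt_trans _ _ (mu Q))//; last by rewrite QE ltry.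
  by apply: le_measure; rewrite ?inE//; move=> z [].
(* [dual_power] with [w] the maximum of 1 and [|Du|] gives the majorant; the 1 contributes the
   indicator of [G], which has finite measure. *)
have iBs i : mu.-integrable setT (EFin \o (fun z => `|B i z| `^ s')).
  have i3 := integrableD measurableT (integrableD measurableT ibb iG) ihd.
  apply: (intg _ (fun z => bb z `^ be + \1_G z + hd z `^ s) _ i3) => [|z]; first by apply: mpow; exact: mnormr.
  rewrite powR_ge0/=.
  have [Gz|Gz] := pselect (G z); last first.
    by rewrite /B restout// normr0 powR0 ?gt_eqF// !addr_ge0// powR_ge0.
  have h0 : 0 <= enorm (Du z) by exact: enorm_ge0.
  have hdE : hd z = enorm (Du z).
    by have [_ h2 _ _ _] := Gg z Gz; rewrite /hd /patch mem_set ?h2//; exact: GO.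
  have w0 : 0 <= Num.max 1 (enorm (Du z)) by rewrite le_max ler01.
  apply: (@le_trans _ _ ((bb z * Num.max 1 (enorm (Du z)) `^ (q - 1)) `^ s')).
    apply: ge0_ler_powR; rewrite ?nnegrE ?mulr_ge0 ?powR_ge0// ?(ltW s'0)//; exact: Bin.
  apply: (le_trans (dual_power (bb0 z) w0 q1 be0 s0 s'0 _)); first by rewrite invrK.
  rewrite -addrA lerD2l indicE mem_set// hdE; exact: max1_power_le (ltW s0).
(* On a set of finite measure L^t is contained in L^1, from [|f| <= 1 + |f|^t]. *)
have lin (f : V -> R) t : measurable_fun setT f -> 1 <= t -> (forall z, ~ G z -> f z = 0) ->
    mu.-integrable setT (EFin \o (fun z => `|f z| `^ t)) -> mu.-integrable setT (EFin \o f).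
  move=> mf t1 fout ift.
  have i3 := integrableD measurableT iG ift.
  apply: (le_integrable measurableT _ _ i3) => [|z _]; first exact/measurable_EFinP.
  rewrite /= lee_fin [leRHS]ger0_norm; last by rewrite addr_ge0// powR_ge0.
  have [Gz|Gz] := pselect (G z); last by rewrite fout// normr0 addr_ge0// powR_ge0.
  rewrite indicE mem_set//; have [h|h] := leP `|f z| 1; first by rewrite (le_trans h)// lerDl powR_ge0.
  apply: (@le_trans _ _ (`|f z| `^ t)); last by rewrite lerDr.
  by rewrite -[leLHS]powRr1// ler_powR// ltW.
exists U, D, B, ai, bb; split => //.
- split.
  + by apply: (lin _ s mU (ltW s1) _ iUs) => z Gz; rewrite /U restout.
  + by move=> i; apply: (lin _ s (mD i) (ltW s1) _ (iDs i)) => z Gz; rewrite /D restout.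
  + by move=> i; apply: (lin _ s' (mB i) s'1 _ (iBs i)) => z Gz; rewrite /B restout.
exists N; split => // z hz; apply: contrapT => Nz; apply: hz => Qz.
have Gz : G z by [].
have [h1 h2 h3 _ _] := Gg z Gz; rewrite /U restin//; split => // i.
by rewrite /D /B !restin// h2 h3.
Qed.

End data.
(** * Local boundedness *)

Section local_bound.
Context (R : realType) (k : nat) (p q al be : R).
Local Notation n := k.+1.
Local Notation nn := (k.+1%:R : R).
Local Notation V := (spacetime R n).
Local Notation VN := ('rV[R]_n * R)%type.
Local Notation mu := (lebesgue_st R n).
Local Notation m := (expm nn p al).
Local Notation lam := (explam p q).
Hypotheses (p2 : 2 <= p) (al1 : 1 < al) (be1 : 1 < be)
  (pq : p <= q < p * (al / (al + 1)) * ((be - 1) / be) + 2 / (nn + 2)).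

Lemma degiorgi_C_gt0 Ab Bb : 1 <= Ab -> 1 <= Bb -> 0 < degiorgi_C k p q al Ab Bb.
Proof.
move=> Ab1 Bb1.
have M1 : 0 < stepM1 k p q Ab Bb := lt_le_trans ltr01 (stepM1_ge1 k p q Ab1 Bb1).
have n0 : 0 < nn by [].
have h := expm_gt n0 p2 al1 be1 pq.
have m2 : 0 < m - 2 / nn by rewrite subr_gt0; apply: lt_trans h; rewrite ltrDr.
have M2 : 0 < stepM2 k p q al Ab Bb.
  apply: mulr_gt0; first by apply: mulr_gt0 => //; apply: powR_gt0; exact: mulr_gt0.
  apply: addr_gt0; last exact: powR_gt0.
  by apply: mulr_gt0 M1; apply: mulr_gt0 => //; exact: lt_le_trans Ab1.
apply: mulr_gt0; last exact: powR_gt0.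
apply: mulr_gt0 M2; apply: mulr_gt0; last by apply: powR_gt0; exact: mulr_gt0.
by apply: mulr_gt0; exact: powR_gt0.
Qed.

(** The first layer has size factor [3/2] and final time [t1 < z0.2], so a box of half-side [e]
    around any of its points stays in the cylinder; [rho / (5 * nn)] is what [enorm_perturb] asks
    for. *)
Lemma layer_nbhd (z0 : V) (rho sigma t1 e : R) (z w : V) : 0 < rho -> 0 < e ->
  layer t1 z0.2 z0.1 rho sigma 0 z ->
  e <= rho / (5 * nn) -> e <= sigma / 2 -> e <= (z0.2 - t1) / 2 -> t1 < z0.2 ->
  (forall j, `|co j w - co j z| <= e) -> cylinder z0 (2 * rho) (2 * sigma) w.
Proof.
move=> rho0 e0 [h1 /andP[h2 h3]] e1 e2 e3 t10 hw.
have n0 : 0 < 5 * nn by exact: mulr_gt0.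
split.
  have -> : w.1 - z0.1 = (z.1 - z0.1) + (w.1 - z.1) by rewrite [RHS]addrC addrA subrK.
  apply: (@enorm_perturb R n _ _ rho e) => //.
  - by move: h1; rewrite /dg expr0 mulr1; have -> : 1 + 2^-1 = 3 / 2 :> R by lra.
  - by move=> i; have := hw (Some i); rewrite /= !mxE.
  - have e4 : e * (5 * nn) <= rho by rewrite -ler_pdivlMr.
    have e5 : e <= rho.
      apply: (le_trans e1); rewrite ler_pdivrMr// ler_peMr ?(ltW rho0)//.
      by rewrite mulr_ege1 ?ler1n.
    rewrite expr2 mulrA [5 * nn * e]mulrC expr2.
    by apply: ler_pM => //; [apply: mulr_ge0; exact: ltW|exact: ltW].
have := hw None; rewrite /= ler_norml => /andP[h4 h5].
move: h2; rewrite /dg expr0 mulr1 => h2.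
clear -h2 h3 h4 h5 e2 e3 t10; apply/andP; split; lra.
Qed.

Lemma mean_integral (Q : set V) (f : V -> \bar R) (Qv Mv : R) : 0 < Qv -> mu Q = Qv%:E ->
  mean Q f = Mv%:E -> (\int[mu]_(z in Q) f z = (Mv * Qv)%:E)%E.
Proof.
move=> Q0 QE; rewrite /mean QE inver gt_eqF// => h.
by rewrite EFinM -h -muleA -EFinM mulVf ?gt_eqF// mule1.
Qed.

Lemma mean_a_ge1 t : 1 <= mean_a t :> R. Proof. by rewrite /mean_a lerDl. Qed.

Lemma mean_b_ge1 t : 1 <= mean_b q be t :> R.
Proof. by rewrite /mean_b lerDl; apply: mulr_ge0; [exact: powR_ge0|exact: addr_ge0]. Qed.

(** The constant [c] of [level_choice] for [C1 = degiorgi_C], [B = 2^stepc] and [CQ = 4^n * 2]. *)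
Definition local_C (Ab Bb : R) : R := degiorgi_C k p q al Ab Bb *
  (2 `^ stepc k p q al) `^ (expka nn p q al be)^-1 * (4 ^+ n * 2) `^ (expr p al / nn).

(** [K] is any number that meets the four demands; the theorem inserts [Cab] times the maximum. *)
Lemma local_bound (Om : set 'rV[R]_n) (T mu0 : R) (a b : V -> R) (A : V -> 'rV[R]_n -> 'rV[R]_n)
    (u : V -> R) (Du : V -> 'rV[R]_n) (z0 : V) (rho sigma Mv K : R)
    (Q := cylinder z0 (2 * rho) (2 * sigma))
    (Ab := mean_a (mean Q (fun z => poweR (a z)%:E^-1 al)))
    (Bb := mean_b q be (mean Q (fun z => (b z `^ be)%:E)))
    (tau := rho `^ lam)
    (S := (sigma / tau) `^ theta1 nn p q al be / rho `^ ((q - p) * theta2 nn p q al be) *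
       Mv `^ theta3 nn p q al be) :
  open Om -> 0 <= mu0 <= 1 -> (forall z, cylT Om T z -> 0 <= a z /\ 0 <= b z) ->
  in_Lp mu (cylT Om T) al%:E (fun z => (a z)%:E^-1%E) ->
  in_Lp mu (cylT Om T) be%:E (fun z => (b z)%:E) -> caratheodory Om T A ->
  {ae mu, forall z, cylT Om T z -> forall xi,
     enorm (A z xi) <= b z * (mu0 ^+ 2 + enorm xi ^+ 2) `^ ((q - 1) / 2) /\
     a z * (mu0 ^+ 2 + enorm xi ^+ 2) `^ ((p - 2) / 2) * enorm xi ^+ 2 <= dotp (A z xi) xi} ->
  parabolic_W1 Om T (exps q be) u Du ->
  (forall phi : VN -> R, test_fun (cylT Om T) phi -> (forall z, 0 <= phi z) ->
      (\int[mu]_(z in cylT Om T) (- (u z * dt phi z) + dotp (A z (Du z)) (dx phi z))%:E <= 0)%E) ->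
  0 < rho -> 0 < sigma -> Q `<=` cylT Om T -> 0 <= Mv ->
  mean Q (fun z => (Num.max (u z) 0 `^ m)%:E) = Mv%:E ->
  rho <= K -> K ^+ 2 / sigma <= (K / rho) `^ lam -> Mv `^ m^-1 <= K ->
  local_C Ab Bb `^ (expD nn p q al be)^-1 * S <= K ->
  {ae mu, forall z, cylinder z0 rho sigma z -> u z <= K}.
Proof.
move=> oO mu01 ab0 ia ib cA struct pW weak rho0 sigma0 QO M0 ME rK KZ MK SK.
have n0 : 0 < nn by [].
have rho20 : 0 < 2 * rho by exact: mulr_gt0.
have sigma20 : 0 < 2 * sigma by exact: mulr_gt0.
have [muQ0 muQle] := lebesgue_cylinder z0 rho20 sigma20.
have QE : mu Q = (fine (mu Q))%:E by rewrite fineK// ge0_fin_numE ?(le_lt_trans muQle) ?ltry.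
set Qv := fine (mu Q) in QE.
have Q0 : 0 < Qv by rewrite -lte_fin -QE.
(* A ball of radius [2 * rho] lies in a cube of side [4 * rho], and the height is [2 * sigma]. *)
have Qle : Qv <= 4 ^+ n * 2 * (rho `^ nn * sigma).
  rewrite -lee_fin -QE; apply: (le_trans muQle); rewrite lee_fin powR_mulrn ?(ltW rho0)//.
  have -> : 2 * (2 * rho) = 4 * rho by lra.
  by rewrite exprMn !mulrA [_ * rho ^+ n * 2]mulrAC.
have mQ : measurable Q by exact: measurable_cylinder.
have Ab1 : 1 <= Ab by exact: mean_a_ge1.
have Bb1 : 1 <= Bb by exact: mean_b_ge1.
have [U [D [B [ai [bb [[iU iD iB] [iUs iDs iBs] [BD0 mai mbb ai0 bb0] [grow coerc aiL bL] ae]]]]]] :=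
  structure_data p2 al1 be1 pq oO mu01 ab0 ia ib cA struct pW mQ QO Q0 QE.
have K0 : 0 < K by exact: lt_le_trans rK.
have CQ0 : 0 < 4 ^+ n * 2 :> R by rewrite mulr_gt0// exprn_gt0.
have [y0 [y0r My0 hG]] := level_choice n0 p2 al1 be1 pq (powR_gt0 (stepc k p q al) (ltr0Sn R 1))
  (degiorgi_C_gt0 Ab1 Bb1) CQ0 rho0 sigma0 M0 Q0 Qle rK MK SK.
have mU := integrable_EFin_measurable iU.
have m0 : 0 < m by apply: lt_trans (m_gt2 p2 al1 be1 pq).
pose G z := \1_Q z * Num.max (U z) 0 `^ m.
have G0 z : 0 <= G z by rewrite mulr_ge0 ?powR_ge0.
have mG : measurable_fun setT G.
  apply: measurable_funM; first exact: measurable_indic.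
  by apply: (measurableT_comp (measurable_powR m)); exact: measurable_maxr.
have GE : (\int[mu]_z (G z)%:E = (Mv * Qv)%:E)%E.
  rewrite -(mean_integral Q0 QE ME) [RHS]integral_mkcond; apply: ae_eq_integral_nm.
  apply: filterS ae => z hz _; rewrite /G indicE /patch; case: ifPn => [/set_mem Qz|_].
    by have [-> _] := hz Qz; rewrite mul1r.
  by rewrite mul0r.
(* The cylinder is exhausted in time, as mollification at its top would leave it. *)
pose t1 (j : nat) := z0.2 - j.+1%:R^-1.
suff main j : {ae mu, forall z, enorm (z.1 - z0.1) <= rho -> z0.2 - sigma <= z.2 -> z.2 <= t1 j -> U z <= K}.
  apply: filterS2 (ae_foralln main) ae => z hz haz [z1 /andP[z2 z3]].
  have Qz : Q z.
    split; first by apply: (lt_trans z1); rewrite ltr_pMl// ltr1n.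
    by rewrite z3 andbT; apply: lt_trans z2; rewrite ltrD2l ltrN2 ltr_pMl// ltr1n.
  have [<- _] := haz Qz.
  have d0 : 0 < z0.2 - z.2 by rewrite subr_gt0.
  pose j := Num.Def.archi_bound (z0.2 - z.2)^-1.
  apply: (hz j (ltW z1) (ltW z2)); rewrite /t1 lerBrDr -lerBrDl.
  rewrite -[leRHS]invrK lef_pV2 ?posrE ?invr_gt0//.
  have i0 : 0 <= (z0.2 - z.2)^-1 by rewrite invr_ge0 ltW.
  by apply/ltW/(lt_trans (archi_boundP i0)); rewrite ltr_nat.
have t10 : t1 j < z0.2 by rewrite /t1 gtrBl invr_gt0.
pose E0 := Num.min (rho / (5 * nn)) (Num.min (sigma / 2) ((z0.2 - t1 j) / 2)).
have E00 : 0 < E0.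
  by rewrite !lt_min !divr_gt0 ?mulr_gt0// subr_gt0.
have nbhd e z w : layer (t1 j) z0.2 z0.1 rho sigma 0 z -> 0 < e <= E0 ->
    (forall i, `|co i w - co i z| <= e) -> Q w.
  move=> zl /andP[e0]; rewrite !le_min => /and3P[e1 e2 e3].
  exact: (layer_nbhd rho0 e0 zl e1 e2 e3 t10).
have layQ z : layer (t1 j) z0.2 z0.1 rho sigma 0 z -> Q z.
  by move=> zl; apply: (nbhd E0 z) => //; [rewrite E00 lexx|move=> i; rewrite subrr normr0 ltW].
pose L := enorm z0.1 + 2 * rho + `|z0.2| + 2 * sigma.
apply: (degiorgi p2 al1 be1 Ab1 Bb1 pq Q0 iU iD iB iUs iDs iBs BD0 mai mbb ai0 bb0 grow coerc aiL bL E00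
  (L := L) rho0 sigma0 rK KZ y0r _ _ hG).
- move=> z zl; have [zx /andP[zt1 zt2]] := layQ z zl; split.
  + move=> [i|] /=.
      have := normr_le_enorm (z.1 - z0.1) i; have := normr_le_enorm z0.1 i; rewrite !mxE.
      have := ler_normB (z.1 0 i - z0.1 0 i) (- z0.1 0 i); rewrite opprK subrK normrN => h1 h2 h3.
      have h4 := normr_ge0 z0.2.
      clear -zx h1 h2 h3 h4 sigma0; rewrite /L; lra.
    have := ler_norm z0.2; have := ler_norm (- z0.2); rewrite normrN => h1 h2.
    have h3 := enorm_ge0 z0.1.
    clear -zt1 zt2 h1 h2 h3 rho0 sigma0; rewrite /L ltr_norml; apply/andP; split; lra.
  + move=> e eE; have /andP[e0 _] := eE.
    apply: (conv_weak_subsolution e0 weak iU iB) => [w hw|]; first exact: QO (nbhd e z w zl eE hw).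
    apply: filterS ae => w h hw; have [h1 h2] := h (nbhd e z w zl eE hw).
    by split => // i; case: (h2 i).
  + move=> e i eE; have /andP[e0 _] := eE.
    apply: (conv_weak_gradient e0 pW iU (iD i)) => [w hw|]; first exact: QO (nbhd e z w zl eE hw).
    apply: filterS ae => w h hw; have [h1 h2] := h (nbhd e z w zl eE hw).
    by split => //; case: (h2 i).
(* The iteration starts at the level 0, so the first excess is at most the integral of [u_+^m] over
   [Q], divided by [K^m]. *)
apply: (@le_trans _ _ (\int[mu]_z (K `^ (- m) * G z)%:E)%E).
  apply: integral_le_ge0 => z; first by rewrite lee_fin mulr_ge0 ?powR_ge0.
  rewrite lee_fin /layer_excess /lvl expr0 subrr mulr0 subr0 mulrCA; apply: ler_wpM2l; first exact: powR_ge0.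
  rewrite /G; apply: ler_wpM2r; first exact: powR_ge0.
  rewrite !indicE; case: (boolP (z \in layer _ _ _ _ _ _)) => [|_]; last exact: ler0n.
  by rewrite inE => /layQ Qz; rewrite mem_set.
under eq_integral do rewrite EFinM.
rewrite ge0_integralZl//; first last.
- by rewrite lee_fin powR_ge0.
- by move=> z _; rewrite lee_fin.
- exact/measurable_EFinP.
rewrite GE -EFinM lee_fin mulrA [leRHS]mulrC; apply: ler_wpM2r; first exact: ltW.
apply: (@le_trans _ _ (K `^ (- m) * (y0 * K `^ m))); first by apply: ler_wpM2l; first exact: powR_ge0.
by rewrite mulrCA -powRD ?(gt_eqF K0) ?implybT// addNr powRr0 mulr1.
Qed.

(** The claim amounts to [rho^lam / sigma <= K^(lam - 2)], and [lam - 2 = (p - 2 + 2 * (q - p)) / (p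
    + 1 - q)] is the reciprocal of the exponent in the theorem. *)
Lemma level_time (rho sigma K : R) : 0 < rho -> 0 < sigma -> 0 < K ->
  (pow_quot (rho `^ lam / sigma) (p + 1 - q) (p - 2 + 2 * (q - p)) <= K%:E)%E ->
  K ^+ 2 / sigma <= (K / rho) `^ lam.
Proof.
move=> rho0 sigma0 K0 h.
have /andP[q0 _] := q_lt (ltr0Sn R k) p2 al1 be1 pq.
have /andP[plq _] := pq.
set x := rho `^ lam / sigma in h.
have x0 : 0 < x by apply: divr_gt0 => //; exact: powR_gt0.
have -> : K ^+ 2 / sigma = K ^+ 2 * x / rho `^ lam.
  by rewrite /x -[RHS]mulrA -[_ / sigma / _]mulrA [_^-1 / _]mulrC mulVKf ?gt_eqF ?powR_gt0.
have ri : 0 <= rho^-1 by rewrite invr_ge0 ltW.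
have -> : (K / rho) `^ lam = K `^ lam / rho `^ lam.
  by rewrite (powRM _ (ltW K0) ri) -(powR_inv1 (ltW rho0)) -powRrM mulN1r powRN.
apply: ler_wpM2r; first by rewrite invr_ge0 powR_ge0.
rewrite -[K ^+ 2]powR_mulrn ?(ltW K0)//.
have lam2 : lam - 2 = (p - 2 + 2 * (q - p)) / (p + 1 - q).
  rewrite (lamE q p2); have e : (p + 1 - q) / (p + 1 - q) = 1 by rewrite divff ?gt_eqF.
  rewrite -[X in _ - X]mulr1 -[X in _ - _ * X]e mulrA -mulrBl; congr (_ / _); lra.
have -> : K `^ lam = K `^ 2 * K `^ (lam - 2).
  by rewrite -powRD ?(gt_eqF K0) ?implybT// [2 + _]addrC subrK.
apply: ler_wpM2l; first exact: powR_ge0.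
(* For [p = q = 2] the exponent [lam - 2] is 0 and [K] drops out; [pow_quot] is then infinite unless
   [rho^lam <= sigma]. *)
move: h; rewrite /pow_quot lam2; case: eqVneq => [->|d0].
  rewrite mul0r powRr0; case: ifPn => [/ltW//|_]; case: eqVneq => [->//|_].
  by rewrite leye_eq.
have d1 : 0 < p - 2 + 2 * (q - p).
  rewrite lt_neqAle eq_sym d0/= addr_ge0 ?subr_ge0// mulr_ge0// subr_ge0//.
set l := (p - 2 + _) / _; have l0 : 0 < l by exact: divr_gt0.
have -> : (p + 1 - q) / (p - 2 + 2 * (q - p)) = l^-1 by rewrite /l invf_div.
rewrite lee_fin => h; rewrite -[leLHS]powRr1 ?(ltW x0)// -(mulVf (lt0r_neq0 l0)) powRrM.
by apply: ge0_ler_powR; rewrite ?nnegrE ?powR_ge0 ?(ltW l0) ?(ltW K0).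
Qed.

End local_bound.
(* 1/a is taken in the extended reals, where 0^-1 = +oo. *)
Theorem theorem1p2 (R : realType) (n : nat) (p q alpha beta : R)
    (p_alpha := p * alpha / (alpha + 1))
    (q_beta := q * beta / (beta - 1))
    (m := p_alpha * (n%:R + 2) / n%:R) :
  (2 <= n)%N -> 2 <= p -> 1 < alpha -> 1 < beta ->
  p <= q < p * (alpha / (alpha + 1)) * ((beta - 1) / beta) + 2 / (n%:R + 2) ->
  exists (theta1 theta2 theta3 : R) (Cab : \bar R -> \bar R -> R),
    [/\ 0 < theta1, 0 < theta2, 0 < theta3 & forall s t, 0 < Cab s t] /\
    forall (Om : set 'rV[R]_n) (T mu : R) (a b : spacetime R n -> R)
      (A : spacetime R n -> 'rV[R]_n -> 'rV[R]_n) (u : spacetime R n -> R),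
    open Om -> bounded_set Om -> 0 < T -> 0 <= mu <= 1 ->
    (forall z, cylT Om T z -> 0 <= a z /\ 0 <= b z) ->
    in_Lp (lebesgue_st R n) (cylT Om T) alpha%:E (fun z => (a z)%:E^-1%E) ->
    in_Lp (lebesgue_st R n) (cylT Om T) beta%:E (fun z => (b z)%:E) ->
    caratheodory Om T A ->
    {ae (lebesgue_st R n), forall z, cylT Om T z -> forall xi,
       enorm (A z xi) <= b z * (mu ^+ 2 + enorm xi ^+ 2) `^ ((q - 1) / 2) /\
       a z * (mu ^+ 2 + enorm xi ^+ 2) `^ ((p - 2) / 2) * enorm xi ^+ 2
         <= dotp (A z xi) xi} ->
    weak_subsolution Om T q_beta A u ->
    forall (z0 : spacetime R n) (rho sigma : R), 0 < rho -> 0 < sigma ->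
    let Q := cylinder z0 (2 * rho) (2 * sigma) in
    let halfQ := cylinder z0 rho sigma in
    let M := mean Q (fun z => (Num.max (u z) 0 `^ m)%:E) in
    let tau := rho `^ (p / (p + 1 - q)) in
    Q `<=` cylT Om T -> (0 < st_dist Q (par_boundary Om T))%E ->
    (ess_sup_on halfQ u <=
       (Cab (mean Q (fun z => poweR (a z)%:E^-1 alpha))
            (mean Q (fun z => (b z `^ beta)%:E)))%:E *
       maxe (maxe (maxe
         (((sigma / tau) `^ theta1 / rho `^ ((q - p) * theta2))%:E
            * poweR M theta3)
         (poweR M m^-1))
         (pow_quot (tau / sigma) (p + 1 - q) (p - 2 + 2 * (q - p))))
         rho%:E)%E.
Proof.
case: n @p_alpha @q_beta @m => [//|k] p_alpha q_beta m n2 p2 al1 be1 pq.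
have n0 : 0 < k.+1%:R :> R by [].
have [t10 t20 t30] := theta_gt0 n0 p2 al1 be1 pq.
(* A factor of at least 1 in front of the maximum preserves the other three demands; the power
   [1 / expD] comes from solving the smallness condition for [K]. *)
pose Cab (s t : \bar R) : R := Num.max 1
  (local_C k p q alpha beta (mean_a s) (mean_b q beta t) `^ (expD k.+1%:R p q alpha beta)^-1).
have Cab1 s t : 1 <= Cab s t by rewrite /Cab le_max lexx.
have Cab0 s t : 0 < Cab s t by exact: lt_le_trans (Cab1 s t).
exists (theta1 k.+1%:R p q alpha beta), (theta2 k.+1%:R p q alpha beta), (theta3 k.+1%:R p q alpha beta), Cab.
split; first by split.
move=> Om T mu a b A u oO _ _ mu01 ab0 ia ib cA struct [Du [pW [_ weak]]] z0 rho sigma rho0 sigma0.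
move=> Q halfQ M tau QO _.
set Ca := Cab _ _; have C0 : 0 < Ca by exact: Cab0.
set X := maxe _ _.
have XK (x : \bar R) : (x <= X)%E -> (forall Xv, X = Xv%:E -> rho <= Xv -> (x <= (Ca * Xv)%:E)%E).
  move=> xX Xv XE rX; apply: (le_trans xX); rewrite XE lee_fin ler_peMl ?Cab1//.
  exact: le_trans (ltW rho0) rX.
have rX : (rho%:E <= X)%E by rewrite /X !le_max lexx !orbT.
have pX : (pow_quot (tau / sigma) (p + 1 - q) (p - 2 + 2 * (q - p)) <= X)%E by rewrite /X !le_max lexx !orbT.
have MX : (poweR M m^-1 <= X)%E by rewrite /X !le_max lexx !orbT.
have SX : (((sigma / tau) `^ theta1 k.+1%:R p q alpha beta / rho `^ ((q - p) * theta2 k.+1%:R p q alpha beta))%:E *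
    poweR M (theta3 k.+1%:R p q alpha beta) <= X)%E by rewrite /X !le_max lexx.
(* An infinite maximum makes the estimate trivial; a finite one forces the mean of [u_+^m] to be
   finite, as its power [1/m] is one of the terms. *)
have [XE|[Xv XE]] : X = +oo%E \/ exists Xv, X = Xv%:E.
- by case: X rX {XK pX MX SX} => [x|//|//] _; [right; exists x|left].
- by rewrite XE mulry gtr0_sg// mul1e leey.
have rXv : rho <= Xv by rewrite -lee_fin -XE.
have Xv0 : 0 < Xv by exact: lt_le_trans rXv.
have M0 : (0 <= M)%E.
  rewrite /M /mean; apply: mule_ge0; last by rewrite inve_ge0 measure_ge0.
  by apply: integral_ge0 => z _; rewrite lee_fin powR_ge0.
have m0 : 0 < m by apply: lt_trans (m_gt2 p2 al1 be1 pq).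
have mi0 : m^-1 != 0 by rewrite gt_eqF// invr_gt0.
have [Mv ME] : exists Mv, M = Mv%:E.
  exists (fine M); rewrite fineK// ge0_fin_numE//; apply: (lty_poweRy mi0).
  by apply: (le_lt_trans MX); rewrite XE ltry.
have Mv0 : 0 <= Mv by rewrite -lee_fin -ME.
rewrite XE -EFinM; apply/ess_supP.
have tauE : tau = rho `^ explam p q by rewrite /tau (lamE q p2).
have := local_bound p2 al1 be1 pq oO mu01 ab0 ia ib cA struct pW weak rho0 sigma0 QO Mv0 ME (K := Ca * Xv).
move=> /(_ _ _ _ _) bound; apply: filterS (bound _ _ _ _).
- move=> z hz; case: ifPn => [/set_mem zQ|_]; last exact: leNye.
  by rewrite lee_fin; exact: hz.
- by apply: (le_trans rXv); rewrite ler_peMl ?Cab1// ltW.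
- apply: (level_time p2 al1 be1 pq rho0 sigma0 (mulr_gt0 C0 Xv0)).
  by rewrite -tauE; exact: XK.
- by rewrite -lee_fin; apply: (XK _ _ _ XE rXv); move: MX; rewrite ME poweR_EFin.
rewrite -tauE; apply: ler_pM; rewrite ?powR_ge0//.
- by rewrite !mulr_ge0 ?invr_ge0 ?powR_ge0.
- by rewrite /Ca /Cab le_max lexx orbT.
- by rewrite -lee_fin -XE; move: SX; rewrite ME poweR_EFin -EFinM.
Qed.
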